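(* Let $M\in\mathfrak R$, where $\mathfrak R$ is the renormalisation group defined in the context, let $r>0$ be such that the kernel $K$ annihilates polynomials of degree $r$, and let $(\Pi,\Gamma)$ be an admissible model for $\mathscr T_F^{(r)}$, with associated $f$. Define $\Pi_x^M$ on $\mathcal H_0$ and $f_x^M$ on $\mathcal H_0^+$ by $$\Pi_x^M\tau=(\Pi_x\otimes f_x)\Delta^M\tau,\qquad f_x^M\tau=f_x\hat M\tau,$$ and define $\Gamma^M$ by $\Gamma^M_{xy}=(F_x^M)^{-1}\circ F_y^M$, where $F_x^M=\Gamma_{f_x^M}$. Then $(\Pi^M,\Gamma^M)$ is an admissible model for $\mathscr T_F$ on $\mathcal H_0$. Furthermore, it extends uniquely to an admissible model for all of $\mathscr T_F^{(r)}$.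
   Context: Regularity structure: a triple $(A,T,G)$ where $A\subset\mathbb R$ contains $0$, is bounded from below and locally finite; $T=\bigoplus_{\alpha\in A}T_\alpha$ with Banach spaces $T_\alpha$, $T_0\simeq\mathbb R$ with unit vector $\mathbf 1$; $G$ is a group of linear operators on $T$ with $\Gamma\mathbf 1=\mathbf 1$ and $\Gamma a-a\in\bigoplus_{\beta<\alpha}T_\beta$ for $a\in T_\alpha$. Scaling $\mathfrak s\in\mathbb N^d$ (strictly positive relatively prime integers), $|\mathfrak s|=\sum\mathfrak s_i$, $|k|_{\mathfrak s}=\sum\mathfrak s_ik_i$, $\|x-y\|_{\mathfrak s}=\sum|x_i-y_i|^{1/\mathfrak s_i}$, $(\mathcal S^\delta_{\mathfrak s,x}\phi)(y)=\delta^{-|\mathfrak s|}\phi(\delta^{-\mathfrak s_1}(y_1-x_1),\dots)$. A model $(\Pi,\Gamma)$ on a sector $V$ ($G$-invariant graded subspace) consists of $\Gamma:\mathbb R^d\times\mathbb R^d\to G$ with $\Gamma_{xx}=1$, $\Gamma_{xy}\Gamma_{yz}=\Gamma_{xz}$ and linear $\Pi_x:V\to\mathcal S'(\mathbb R^d)$ with $\Pi_y=\Pi_x\Gamma_{xy}$, such that for each $\gamma>0$ and compact $\mathfrak K$, $|(\Pi_xa)(\mathcal S^\delta_{\mathfrak s,x}\phi)|\lesssim\|a\|\delta^\ell$ and the component of $\Gamma_{xy}a$ of degree $m$ has norm $\lesssim\|a\|\|x-y\|_{\mathfrak s}^{\ell-m}$, uniformly over $x,y\in\mathfrak K$, $\delta\in(0,1]$,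 $\phi$ smooth supported in the $\|\cdot\|_{\mathfrak s}$-unit ball with $\|\phi\|_{\mathcal C^{r_0}}\le1$ ($r_0$ the smallest integer $>-\min A$), $m<\ell<\gamma$, $a\in V$ homogeneous of degree $\ell$. Data: $\beta>0$, $\alpha<0$, a smooth function $F=F(u,\nabla u,\xi)$, affine in $\xi$, which is locally subcritical: in the expression of $F$, replace $\xi$ by a dummy variable $\Xi$; for each $i$ with $\beta+\alpha\le\mathfrak s_i$ replace $\partial_iu$ by $P_i$; if $\beta+\alpha\le0$ replace $u$ by $U$; the result is assumed polynomial in the dummy variables; with homogeneities $\alpha$, $\beta+\alpha$, $\beta+\alpha-\mathfrak s_i$ for $\Xi,U,P_i$, terms containing $\Xi$ contain no other dummy variable and all remaining monomials have homogeneity $>\alpha$. Formal expressions: $\mathcal F$ is generated from $\mathbf 1,\Xi,X_1,\dots,X_d$ by a commutative associative product with unit $\mathbf 1$ and by maps $\tau\mapsto\mathcal I_k(\tau)$, $k\in\mathbb N^d$, with expressions containing $\mathcal I_k(X^\ell)$ excluded (set $\mathcal I_k(X^\ell)=0=\mathcal J_k(X^\ell)$). $\mathcal I=\mathcal I_0$, $\mathcal I_i=\mathcal I_{e_i}$. Weights: $|\mathbf 1|_{\mathfrak s}=0$, $|\Xi|_{\mathfrak s}=\alpha$, $|X_i|_{\mathfrak s}=\mathfrak s_i$, additive under products, $|\mathcal I_k\tau|_{\mathfrak s}=|\tau|_{\mathfrak s}+\beta-|k|_{\mathfrak s}$. $\mathfrak M_F$ is the set of monomials $\Xi^mU^nP^k$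 such that $F$ contains a term $\xi^{\bar m}u^{\bar n}(Du)^{\bar k}$ with $\bar m\ge m$, $\bar n\ge n$, $\bar k\ge k$ (non-polynomial functions count as infinite powers). $\mathcal W_0=\mathcal U_0=\mathcal P_0^i=\emptyset$, $\mathcal W_n=\mathcal W_{n-1}\cup\bigcup_{\mathcal Q\in\mathfrak M_F}\mathcal Q(\mathcal U_{n-1},\mathcal P_{n-1},\Xi)$ (substituting each occurrence of $U$, $P_i$ in $\mathcal Q$ by elements of $\mathcal U_{n-1}$, $\mathcal P^i_{n-1}$), $\mathcal U_n=\{X^k\}\cup\{\mathcal I(\tau):\tau\in\mathcal W_n\}$, $\mathcal P_n^i=\{X^k\}\cup\{\mathcal I_i(\tau):\tau\in\mathcal W_n\}$, $\mathcal F_F=\bigcup_n(\mathcal W_n\cup\mathcal U_n)$. No element of $\mathcal F_F$ other than the $X^k$ has weight in $\mathbb N$. $\mathcal F_+$ (resp. $\mathcal F_F^+$) is the set of expressions $X^k\prod_j\mathcal J_{k_j}\tau_j$ with $\tau_j\in\mathcal F$ (resp. $\mathcal F_F$) and $|\mathcal J_{k_j}\tau_j|_{\mathfrak s}:=|\tau_j|_{\mathfrak s}+\beta-|k_j|_{\mathfrak s}>0$; $\mathcal J_k\tau:=0$ if $|\tau|_{\mathfrak s}+\beta-|k|_{\mathfrak s}\le0$. $\mathcal H,\mathcal H_F,\mathcal H_+,\mathcal H_F^+$ are the linear spans; the weight of an element of $\mathcal F_+$ is $|k|_{\mathfrak s}+\sum_j|\mathcal J_{k_j}\tau_j|_{\mathfrak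 s}$. $\Delta:\mathcal H\to\mathcal H\otimes\mathcal H_+$, $\Delta^+:\mathcal H_+\to\mathcal H_+\otimes\mathcal H_+$ are multiplicative with $\Delta\mathbf 1=\mathbf 1\otimes\mathbf 1$, $\Delta X_i=X_i\otimes\mathbf 1+\mathbf 1\otimes X_i$ (same for $\Delta^+$), $\Delta\Xi=\Xi\otimes\mathbf 1$, $$\Delta(\mathcal I_k\tau)=(\mathcal I_k\otimes I)\Delta\tau+\sum_{\ell,m}\frac{X^\ell}{\ell!}\otimes\frac{X^m}{m!}\mathcal J_{k+\ell+m}\tau,\quad\Delta^+(\mathcal J_k\tau)=\sum_\ell\Bigl(\mathcal J_{k+\ell}\otimes\frac{(-X)^\ell}{\ell!}\Bigr)\Delta\tau+\mathbf 1\otimes\mathcal J_k\tau .$$ $\mathcal H_+$ is a Hopf algebra for $\Delta^+$; $\mathcal A$ is its antipode and $\mathcal M$ denotes multiplication in $\mathcal H_+$. For a multiplicative functional $g$ on $\mathcal H_F^+$, $\Gamma_g\tau=(I\otimes g)\Delta\tau$. $\mathscr T_F$ is the regularity structure with $T=\mathcal H_F$ graded by $|\cdot|_{\mathfrak s}$ and structure group the operators $\Gamma_g$; $\mathscr T_F^{(r)}$ is the same with $T_\gamma=\{0\}$ for $\gamma>r$. Kernel: $K(x,y)=K(x-y)$, $K=\sum_{n\ge0}K_n$ with $K_n$ smooth, supported in $\{\|x\|_{\mathfrak s}\le2^{-n}\}$, $|D^kK_n|\le C_k2^{(|\mathfrak s|-\beta+|k|_{\mathfrak s})n}$, and $\int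 K_n(x-y)P(y)\,dy=0$ for polynomials $P$ of scaled degree $\le r$. Admissible model: a model such that there are multiplicative functionals $f_x$ on $\mathcal H_F^+$ with $\Gamma_{xy}=F_x^{-1}\circ F_y$, $F_x=\Gamma_{f_x}$, $f_x(X_i)=-x_i$, $f_x(\mathcal J_\ell\tau)=-\int D_1^\ell K(x,z)(\Pi_x\tau)(dz)$, $(\Pi_xX^k)(y)=(y-x)^k$ and $(\Pi_x\mathcal I_k\tau)(y)=\int D_1^kK(y,z)(\Pi_x\tau)(dz)+\sum_\ell\frac{(y-x)^\ell}{\ell!}f_x(\mathcal J_{k+\ell}\tau)$ (in the sense of distributions). On $\mathcal H_0$ (below) the same conditions are imposed with $\mathcal F_F,\mathcal F_F^+$ replaced by $\mathcal F_0,\mathcal F_0^+$. Renormalisation: for $\mathcal C\subset\mathcal F_F$, $\mathrm{Alg}(\mathcal C)\subset\mathcal F_F^+$ is the set of elements $X^k\prod_i\mathcal J_{\ell_i}\tau_i$ with $\tau_i\in\mathcal C$, $|\mathcal J_{\ell_i}\tau_i|_{\mathfrak s}>0$. Fix $\mathcal F_\star\subset\mathcal F_0\subset\mathcal F_F$ such that $\mathcal F_0$ contains every $\tau\in\mathcal F_F$ with $|\tau|_{\mathfrak s}\le0$ and $\Delta\tau\in\langle\mathcal F_0\rangle\otimes\langle\mathrm{Alg}(\mathcal F_\star)\rangle$ for $\tau\in\mathcal F_0$ ($\langle\cdot\rangle$: linear span); $\mathcal H_0=\langle\mathcal F_0\rangle$, $\mathcal F_0^+=\mathrm{Alg}(\mathcal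 F_\star)$, $\mathcal H_0^+=\langle\mathcal F_0^+\rangle$; $r$ is such that $\mathcal H_0\subset\mathscr T_F^{(r)}$. Given a linear $M:\mathcal H_0\to\mathcal H_0$ with $M\mathcal I_k\tau=\mathcal I_kM\tau$ whenever $\tau,\mathcal I_k\tau\in\mathcal F_0$, there are unique linear maps $\Delta^M:\mathcal H_0\to\mathcal H_0\otimes\mathcal H_0^+$ and $\hat M:\mathcal H_0^+\to\mathcal H_0^+$ such that $\hat M\mathcal J_k=\mathcal M(\mathcal J_k\otimes I)\Delta^M$ (on $\mathcal F_\star$), $(I\otimes\mathcal M)(\Delta\otimes I)\Delta^M=(M\otimes\hat M)\Delta$, $\hat M$ is multiplicative and $\hat MX^k=X^k$; and a unique $\hat\Delta^M:\mathcal H_0^+\to\mathcal H_0^+\otimes\mathcal H_0^+$ with $(\mathcal A\hat M\mathcal A\otimes\hat M)\Delta^+=(I\otimes\mathcal M)(\Delta^+\otimes I)\hat\Delta^M$. $\mathfrak R$ is the set of all such $M$ with moreover $MX^k=X^k$ and such that for every $\tau\in\mathcal F_0$, $\bar\tau\in\mathcal F_0^+$ one can write $\Delta^M\tau=\tau\otimes\mathbf 1+\sum\tau^{(1)}\otimes\tau^{(2)}$, $\hat\Delta^M\bar\tau=\bar\tau\otimes\mathbf 1+\sum\bar\tau^{(1)}\otimes\bar\tau^{(2)}$ with each $\tau^{(1)}\in\mathcal F_0$, $\bar\tau^{(1)}\in\mathcal F_0^+$ satisfying $|\tau^{(1)}|_{\mathfrak s}>|\tau|_{\mathfrak s}$,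 $|\bar\tau^{(1)}|_{\mathfrak s}>|\bar\tau|_{\mathfrak s}$. *)

(* Defs.v *)
(* [monalg] is loaded without its notations, which clash with those of
   [all_analysis]: [malg K R] is the free R-module on the basis K, with the
   monoid-algebra product when K is a monoid. *)
From HB Require Import structures.
From mathcomp Require Import all_boot all_order all_algebra generic_quotient finmap.
From mathcomp Require Import all_classical all_reals all_analysis.
From mathcomp Require Export -(notations) monalg.

Set Implicit Arguments.
Unset Strict Implicit.
Unset Printing Implicit Defensive.

Import Order.TTheory GRing.Theory Num.Theory.
Import numFieldNormedType.Exports.

Local Open Scope classical_set_scope.
Local Open Scope ring_scope.

Notation mindex n := {ffun 'I_n -> nat}.

Section Analysis.
Context {R : realType} {n : nat}.
Implicit Types (k : mindex n) (f phi : 'rV[R]_n -> R) (x y : 'rV[R]_n).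

Definition mfact k : nat := (\prod_(i < n) (k i)`!)%N.
Definition mdeg k : nat := (\sum_(i < n) k i)%N.
Definition munit (i : 'I_n) : mindex n := [ffun j => (j == i) : nat].

Definition monomial k x : R := \prod_(i < n) x ord0 i ^+ k i.

Definition partial (i : 'I_n) f : 'rV[R]_n -> R :=
  fun x => 'D_(delta_mx ord0 i) f x.

Definition Dpart k f : 'rV[R]_n -> R :=
  foldr (fun i g => iter (k i) (partial i) g) f (enum 'I_n).

Definition smooth f : Prop :=
  forall (l : seq 'I_n) x, differentiable (foldr partial f l) x.

Definition supported_in (A : set 'rV[R]_n) f : Prop :=
  forall x, f x != 0 -> A x.

Definition test_function phi : Prop :=
  smooth phi /\ exists2 A, compact A & supported_in A phi.

(* Distributions are the continuous linear functionals on compactly supported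
   smooth functions; only their values on test functions are meaningful. *)
Definition distribution (T : ('rV[R]_n -> R) -> R) : Prop :=
  (forall (c : R) phi psi, test_function phi -> test_function psi ->
     T (fun x => c * phi x + psi x) = c * T phi + T psi) /\
  (forall A : set 'rV[R]_n, compact A ->
     exists (N : nat) (C : R), forall phi (b : R),
       test_function phi -> supported_in A phi ->
       (forall k, (mdeg k <= N)%N -> forall x, `|Dpart k phi x| <= b) ->
       `|T phi| <= C * b).

End Analysis.

(* Lebesgue integral over R^n as an iterated integral; it is only applied to
   continuous functions with compact support. *)
Fixpoint integral_rV {R : realType} {n : nat} : ('rV[R]_n -> R) -> R :=
  match n return ('rV[R]_n -> R) -> R with
  | 0 => fun f => f 0
  | m.+1 => fun f =>
      \int[lebesgue_measure]_t
        integral_rV (fun v : 'rV[R]_m => f (row_mx (scalar_mx t : 'rV[R]_1) v))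
  end.

Section Scaling.
Context {R : realType} {d : nat}.
Variable s : 'I_d -> nat.

Definition is_scaling : Prop :=
  (forall i, (0 < s i)%N) /\ \big[gcdn/0%N]_(i < d) s i = 1%N.

Definition sdeg (k : mindex d) : nat := (\sum_(i < d) s i * k i)%N.

Definition snorm (x : 'rV[R]_d) : R :=
  \sum_(i < d) `|x ord0 i| `^ (s i)%:R^-1.

Definition rescale (delta : R) (x : 'rV[R]_d) (phi : 'rV[R]_d -> R) :
    'rV[R]_d -> R :=
  fun y => delta ^- (\sum_(i < d) s i)%N *
           phi (\row_i (delta ^- s i * (y ord0 i - x ord0 i))).

(* The kernel K enters only through its decomposition K = \sum_n K_n, which is
   what gives a meaning to the pairing of K with a distribution. *)
Definition kernel_decomposition (beta r : R) (K : nat -> 'rV[R]_d -> R) : Prop :=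
  [/\ forall n, smooth (K n),
      forall n, supported_in [set x | snorm x <= 2 ^- n] (K n),
      forall k, exists C : R, forall n x,
        `|Dpart k (K n) x| <=
          C * 2 `^ (((\sum_(i < d) s i)%:R - beta + (sdeg k)%:R) * n%:R)
    & forall n x (p : seq (R * mindex d)),
        (forall q, q \in p -> (sdeg q.2)%:R <= r) ->
        integral_rV (fun y =>
          K n (x - y) * \sum_(q <- p) q.1 * monomial q.2 y) = 0].

End Scaling.

Inductive term (d : nat) : Type :=
| TOne
| TXi
| TX of 'I_d
| TMul of term d & term d
| TI of mindex d & term d.
Arguments TOne {d}.
Arguments TXi {d}.

Inductive term_eqv (d : nat) : term d -> term d -> Prop :=
| eqv_refl a : term_eqv a a
| eqv_sym a b : term_eqv a b -> term_eqv b a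
| eqv_trans a b c : term_eqv a b -> term_eqv b c -> term_eqv a c
| eqv_mulC a b : term_eqv (TMul a b) (TMul b a)
| eqv_mulA a b c : term_eqv (TMul a (TMul b c)) (TMul (TMul a b) c)
| eqv_mul1 a : term_eqv (TMul TOne a) a
| eqv_mul a a' b b' :
    term_eqv a a' -> term_eqv b b' -> term_eqv (TMul a b) (TMul a' b')
| eqv_I k a a' : term_eqv a a' -> term_eqv (TI k a) (TI k a').

HB.instance Definition _ (d : nat) := gen_eqMixin (term d).
HB.instance Definition _ (d : nat) := gen_choiceMixin (term d).

Section Expr.
Context {d : nat}.

Definition term_eqb (a b : term d) : bool := `[< term_eqv a b >].

Lemma term_eqb_refl : reflexive term_eqb.
Proof. by move=> a; apply/asboolP; exact: eqv_refl. Qed.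

Lemma term_eqb_sym : symmetric term_eqb.
Proof. by move=> a b; apply/asboolP/asboolP; exact: eqv_sym. Qed.

Lemma term_eqb_trans : transitive term_eqb.
Proof.
by move=> b a c /asboolP ab /asboolP bc; apply/asboolP; exact: eqv_trans ab bc.
Qed.

Canonical term_equiv :=
  EquivRel term_eqb term_eqb_refl term_eqb_sym term_eqb_trans.

Definition expr : Type := {eq_quot term_equiv}%qT.
HB.instance Definition _ := Choice.on expr.
HB.instance Definition _ := EqQuotient.on expr.

Definition pi_expr (a : term d) : expr := (\pi_expr a)%qT.

Lemma pi_exprP a b : pi_expr a = pi_expr b <-> term_eqv a b.
Proof. by split=> [/eqmodP/asboolP //|h]; apply/eqmodP/asboolP. Qed.

Lemma pi_reprK (x : expr) : pi_expr (repr x) = x.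
Proof. exact: reprK. Qed.

Lemma repr_pi a : term_eqv (repr (pi_expr a)) a.
Proof. by apply/pi_exprP; rewrite pi_reprK. Qed.

Definition emul (x y : expr) : expr := pi_expr (TMul (repr x) (repr y)).

Lemma emul_pi a b : emul (pi_expr a) (pi_expr b) = pi_expr (TMul a b).
Proof. by apply/pi_exprP/eqv_mul; exact: repr_pi. Qed.

Lemma emulC : commutative emul.
Proof. by move=> x y; apply/pi_exprP; exact: eqv_mulC. Qed.

Lemma emulA : associative emul.
Proof.
move=> x y z; rewrite -(pi_reprK x) -(pi_reprK y) -(pi_reprK z) !emul_pi.
by apply/pi_exprP; exact: eqv_mulA.
Qed.

Lemma emul1 : left_id (pi_expr TOne) emul.
Proof.
by move=> x; rewrite -(pi_reprK x) emul_pi; apply/pi_exprP; exact: eqv_mul1.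
Qed.

Lemma emulx1 : right_id (pi_expr TOne) emul.
Proof. by move=> x; rewrite emulC emul1. Qed.

Fixpoint term_trivial (a : term d) : bool :=
  match a with
  | TOne => true
  | TMul b c => term_trivial b && term_trivial c
  | _ => false
  end.

Lemma term_trivial_eqv a b : term_eqv a b -> term_trivial a = term_trivial b.
Proof.
elim=> //= [? ? ? _ -> _ -> //|? ?|? ? ?|? ? ? ? _ -> _ -> //].
- by rewrite andbC.
- by rewrite andbA.
Qed.

Lemma term_trivialP a : term_trivial a -> pi_expr a = pi_expr TOne.
Proof.
elim: a => //= a iha b ihb /andP[/iha ea /ihb eb].
by rewrite -emul_pi ea eb emul1.
Qed.

Lemma emul_eq1 x y : emul x y = pi_expr TOne ->
  x = pi_expr TOne /\ y = pi_expr TOne.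
Proof.
move=> /pi_exprP/term_trivial_eqv /= /andP[tx ty].
by split; rewrite -[LHS]pi_reprK; exact: term_trivialP.
Qed.

HB.instance Definition _ :=
  Choice_isMonomialDef.Build expr emulA emul1 emulx1 emul_eq1.
HB.instance Definition _ := MonomialDef_isConomialDef.Build expr emulC.

End Expr.
Arguments expr d : clear implicits.

(* The componentwise product on K * L, so that malg (K * L) R is the algebra
   (malg K R) (x) (malg L R). *)
Section PairMonomial.
Variables K L : conomType.
Definition pmul (x y : K * L) : K * L := (mul x.1 y.1, mul x.2 y.2).
Lemma pmulA : associative pmul.
Proof. by move=> x y z; rewrite /pmul !mulmA. Qed.
Lemma pmul1 : left_id (one, one) pmul.
Proof. by move=> [x y]; rewrite /pmul !mul1m. Qed.
Lemma pmulx1 : right_id (one, one) pmul.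
Proof. by move=> [x y]; rewrite /pmul !mulm1. Qed.
Lemma pmulC : commutative pmul.
Proof.
by move=> x y; rewrite /pmul (mulmC x.1) (mulmC x.2).
Qed.
Lemma pmul_eq1 x y : pmul x y = (one, one) -> x = (one, one) /\ y = (one, one).
Proof.
by case: x y => [x x'] [y y'] [] /= /unitm[-> ->] /unitm[-> ->].
Qed.
HB.instance Definition _ :=
  Choice_isMonomialDef.Build (K * L)%type pmulA pmul1 pmulx1 pmul_eq1.
HB.instance Definition _ := MonomialDef_isConomialDef.Build (K * L)%type pmulC.
End PairMonomial.

Section ExprConstructors.
Context {d : nat}.
Implicit Types (t : expr d) (k : mindex d).

Definition Xi : expr d := pi_expr TXi.
Definition Xvar (i : 'I_d) : expr d := pi_expr (TX i).
Definition II k t : expr d := pi_expr (TI k (repr t)).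

Definition Xpow k : expr d :=
  \big[emul/one]_(i < d) iter (k i) (emul (Xvar i)) one.

Definition is_Xpow : set (expr d) := [set t | exists k, t = Xpow k].

(* The set F of formal expressions: I_k(X^l) is excluded.  The type [expr]
   itself still contains such symbols. *)
Inductive formal : expr d -> Prop :=
| formal_one : formal one
| formal_Xi : formal Xi
| formal_X i : formal (Xvar i)
| formal_mul t u : formal t -> formal u -> formal (emul t u)
| formal_I k t : formal t -> ~ is_Xpow t -> formal (II k t).

End ExprConstructors.

Section FreeModule.
Context {R : realType}.

Definition bas {K : choiceType} (k : K) : malg K R := mkmalgU k 1.

Definition lspan {K : choiceType} (B : set K) : set (malg K R) :=
  [set a | forall k, mcoeff k a != 0 -> B k].

Definition lext {K : choiceType} {V : lmodType R} (f : K -> V)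
  (a : malg K R) : V := \sum_(k <- msupp a) mcoeff k a *: f k.

Definition lextR {K : choiceType} (f : K -> R) (a : malg K R) : R :=
  \sum_(k <- msupp a) mcoeff k a * f k.

Definition tens {K L : choiceType} (a : malg K R) (b : malg L R) :
    malg (K * L)%type R :=
  \sum_(k <- msupp a) \sum_(l <- msupp b)
    mkmalgU (k, l) (mcoeff k a * mcoeff l b).

End FreeModule.

Notation Hsp R d := (malg (expr d) R).
Notation Hsp2 R d := (malg (expr d * expr d)%type R).

(* Linear maps out of a space spanned by a set of expressions are given by
   their values on these expressions and extended by [lext] ([lextR] for scalar
   values); their values on other expressions are irrelevant.
   An element X^k \prod_j J_{k_j} t_j of F_+ is represented by the expression
   X^k \prod_j I_{k_j} t_j, which has the same weight; so H_+ is the subspace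
   of H spanned by the expressions in [Fplus] below. *)

Section Algebra.
Context {R : realType} {d : nat}.
Variables (s : 'I_d -> nat) (alpha beta : R).
Implicit Types (t u : expr d) (k l : mindex d).

Fixpoint term_weight (a : term d) : R :=
  match a with
  | TOne => 0
  | TXi => alpha
  | TX i => (s i)%:R
  | TMul b c => term_weight b + term_weight c
  | TI k b => term_weight b + beta - (sdeg s k)%:R
  end.

Definition weight t : R := term_weight (repr t).

Lemma term_weight_eqv a b : term_eqv a b -> term_weight a = term_weight b.
Proof.
elim=> //= [? ? ? _ -> _ -> //|? ?|? ? ?|?|? ? ? ? _ -> _ -> //|? ? ? _ -> //].
- by rewrite addrC.
- by rewrite addrA.
- by rewrite add0r.
Qed.

Definition Iop k t : Hsp R d := if `[< is_Xpow t >] then 0 else bas (II k t).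

Definition Jop k t : Hsp R d :=
  if (weight t + beta - (sdeg s k)%:R <= 0) || `[< is_Xpow t >] then 0
  else bas (II k t).

Definition Alg (C : set (expr d)) : set (expr d) :=
  [set t | exists (k : mindex d) (e : seq (mindex d * expr d)),
    (forall q, q \in e -> [/\ C q.2, ~ is_Xpow q.2 &
        0 < weight q.2 + beta - (sdeg s q.1)%:R]) /\
    t = emul (Xpow k) (\big[emul/one]_(q <- e) II q.1 q.2)].

Definition Fplus : set (expr d) := Alg formal.

(* Finite-support sums: the summands with large multi-indices vanish because
   of the sign condition in [Jop]. *)
Fixpoint term_coproduct (a : term d) : Hsp2 R d :=
  match a with
  | TOne => 1
  | TXi => tens (bas Xi) 1
  | TX i => tens (bas (Xvar i)) 1 + tens 1 (bas (Xvar i))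
  | TMul b c => term_coproduct b * term_coproduct c
  | TI k b =>
      lext (fun p => tens (Iop k p.1) (bas p.2)) (term_coproduct b) +
      \sum_(p \in [set: mindex d * mindex d])
        tens ((mfact p.1)%:R^-1 *: bas (Xpow p.1))
             ((mfact p.2)%:R^-1 *: bas (Xpow p.2) *
              Jop (k + p.1 + p.2) (pi_expr b))
  end.

Definition coproduct t : Hsp2 R d := term_coproduct (repr t).

Fixpoint term_coproductp (a : term d) : Hsp2 R d :=
  match a with
  | TOne => 1
  | TXi => 0
  | TX i => tens (bas (Xvar i)) 1 + tens 1 (bas (Xvar i))
  | TMul b c => term_coproductp b * term_coproductp c
  | TI k b =>
      lext (fun p =>
        \sum_(l \in [set: mindex d])
          tens (Jop (k + l) p.1)
               ((mfact l)%:R^-1 *: \prod_(i < d) (- bas (Xvar i)) ^+ l i *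
                bas p.2)) (coproduct (pi_expr b)) +
      tens 1 (Jop k (pi_expr b))
  end.

(* The branch [TXi] is not used: elements of [Fplus] have no factor Xi. *)
Definition coproductp t : Hsp2 R d := term_coproductp (repr t).

Lemma term_coproduct_eqv a b :
  term_eqv a b -> term_coproduct a = term_coproduct b.
Proof.
elim=> {a b} [a|a b _ ih|a b c _ ih1 _ ih2|a b|a b c|a|a a' b b' _ ih1 _ ih2|k a b e ih].
- reflexivity.
- exact: esym ih.
- exact: etrans ih1 ih2.
- exact: mulrC.
- exact: mulrA.
- exact: mul1r.
- exact: congr2 ih1 ih2.
- have pe : pi_expr a = pi_expr b by apply/pi_exprP.
  by cbn [term_coproduct]; rewrite ih pe.
Qed.

Lemma term_coproductp_eqv a b :
  term_eqv a b -> term_coproductp a = term_coproductp b.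
Proof.
elim=> {a b} [a|a b _ ih|a b c _ ih1 _ ih2|a b|a b c|a|a a' b b' _ ih1 _ ih2|k a b e ih].
- reflexivity.
- exact: esym ih.
- exact: etrans ih1 ih2.
- exact: mulrC.
- exact: mulrA.
- exact: mul1r.
- exact: congr2 ih1 ih2.
- have pe : pi_expr a = pi_expr b by apply/pi_exprP.
  by cbn [term_coproductp]; rewrite pe.
Qed.

Lemma coproduct_pi a : coproduct (pi_expr a) = term_coproduct a.
Proof. exact/term_coproduct_eqv/repr_pi. Qed.

Lemma coproductp_pi a : coproductp (pi_expr a) = term_coproductp a.
Proof. exact/term_coproductp_eqv/repr_pi. Qed.

Lemma weight_pi a : weight (pi_expr a) = term_weight a.
Proof. exact/term_weight_eqv/repr_pi. Qed.

Definition is_antipode (A : expr d -> Hsp R d) : Prop :=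
  forall t, Fplus t ->
    [/\ lspan Fplus (A t),
        lext (fun p => A p.1 * bas p.2) (coproductp t) = (t == one)%:R%:A
      & lext (fun p => bas p.1 * A p.2) (coproductp t) = (t == one)%:R%:A].

Definition multiplicative_on (P : set (expr d)) (g : expr d -> R) : Prop :=
  g one = 1 /\ forall t u, P t -> P u -> g (emul t u) = g t * g u.

Definition Gamma_of (g : expr d -> R) (a : Hsp R d) : Hsp R d :=
  lext (fun p => g p.2 *: bas p.1) (lext coproduct a).

(* l^1 norm of the component of degree m of a. *)
Definition hnorm (m : R) (a : Hsp R d) : R :=
  \sum_(t <- msupp a | weight t == m) `|mcoeff t a|.

Definition homogeneous (m : R) (a : Hsp R d) : Prop :=
  forall t, mcoeff t a != 0 -> weight t = m.

End Algebra.

Section Nonlinearity.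
Context {R : realType} {d : nat}.
Variables (s : 'I_d -> nat) (alpha beta : R).

(* F is a function of (u, d_1 u, ..., d_d u, xi), in this order. *)
Notation jet := (1 + (d + 1))%N.
Definition var_u : 'I_jet := lshift (d + 1) ord0.
Definition var_p (i : 'I_d) : 'I_jet := rshift 1 (lshift 1 i).
Definition var_xi : 'I_jet := rshift 1 (rshift d ord0).

Variable F : 'rV[R]_jet -> R.

Definition affine_in_xi : Prop :=
  forall (v : 'rV[R]_jet) (c : R),
    F (v + c *: delta_mx ord0 var_xi) =
    F v + c * (F (v + delta_mx ord0 var_xi) - F v).

Definition is_dummy (j : 'I_jet) : Prop :=
  [\/ j = var_xi,
      exists2 i, j = var_p i & beta + alpha <= (s i)%:R
    | j = var_u /\ beta + alpha <= 0].

Definition monomial_homogeneity (q : mindex jet) : R :=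
  alpha *+ q var_xi + (beta + alpha) *+ q var_u +
  \sum_(i < d) (beta + alpha - (s i)%:R) *+ q (var_p i).

(* S lists the monomials in the dummy variables that may occur in F, and c q
   is the coefficient of the monomial q. *)
Definition locally_subcritical : Prop :=
  exists (S : seq (mindex jet)) (c : mindex jet -> 'rV[R]_jet -> R),
  [/\ uniq S,
      forall q, q \in S -> forall j, (0 < q j)%N -> is_dummy j,
      forall q, q \in S -> forall v w : 'rV[R]_jet,
        (forall j, ~ is_dummy j -> v ord0 j = w ord0 j) -> c q v = c q w,
      forall v, F v = \sum_(q <- S) c q v * monomial q v
    & forall q, q \in S -> (exists v, c q v != 0) ->
        if (0 < q var_xi)%N then forall j, j != var_xi -> q j = 0%N
        else alpha < monomial_homogeneity q].

(* F contains a term with exponents at least q, non-polynomial functions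
   counting as infinite powers, if and only if the corresponding partial
   derivative of F is not identically zero. *)
Definition M_F : set (mindex jet) := [set q | exists v, Dpart q F v != 0].

Definition substitute (U : set (expr d)) (P : 'I_d -> set (expr d)) :
    set (expr d) :=
  [set t | exists2 q, M_F q &
    exists (u : 'I_(q var_u) -> expr d)
           (p : forall i, 'I_(q (var_p i)) -> expr d),
    [/\ forall j, U (u j), forall i j, P i (p i j)
      & t = iter (q var_xi) (emul Xi)
              (emul (\big[emul/one]_j u j)
                    (\big[emul/one]_(i < d) \big[emul/one]_j p i j))]].

(* I_k of the elements of W, together with all X^l; I_k(X^l) = 0 is omitted. *)
Definition planted (k : mindex d) (W : set (expr d)) : set (expr d) :=
  is_Xpow `|` [set II k t | t in W `\` is_Xpow].

Fixpoint W_ (n : nat) : set (expr d) :=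
  match n with
  | 0 => set0
  | m.+1 => W_ m `|`
      substitute (if m is 0 then set0 else planted 0 (W_ m))
                 (fun i => if m is 0 then set0 else planted (munit i) (W_ m))
  end.

Definition U_ (n : nat) : set (expr d) :=
  if n is 0 then set0 else planted 0 (W_ n).

Definition F_F : set (expr d) := \bigcup_n (W_ n `|` U_ n).

Definition no_integer_weight : Prop :=
  forall t, F_F t -> ~ is_Xpow t -> forall n : nat, weight s alpha beta t <> n%:R.

Definition F_F_plus : set (expr d) := Alg s alpha beta F_F.

Definition F_F_upto (r : R) : set (expr d) :=
  [set t | F_F t /\ weight s alpha beta t <= r].

End Nonlinearity.

Section Models.
Context {R : realType} {d : nat}.
Variables (s : 'I_d -> nat) (alpha beta : R).
Local Notation pt := 'rV[R]_d.
Local Notation test := ('rV[R]_d -> R).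
Local Notation wt := (weight s alpha beta).

(* T is the basis of the regularity structure, whose minimal weight fixes the
   regularity of the test functions: n is the least integer > - min A. *)
Definition is_test_order (T : set (expr d)) (n : nat) : Prop :=
  (forall t, T t -> - wt t < n%:R) /\
  (forall m : nat, (forall t, T t -> - wt t < m%:R) -> (n <= m)%N).

Definition unit_test (n : nat) (phi : test) : Prop :=
  [/\ smooth phi, supported_in [set y | snorm s y <= 1] phi
    & forall k, (mdeg k <= n)%N -> forall y, `|Dpart k phi y| <= 1].

Definition Pi_lin (Pi : pt -> expr d -> test -> R) (x : pt) (a : Hsp R d)
  (phi : test) : R := lextR (fun t => Pi x t phi) a.

(* A model on the span of B, the structure group being given by the
   multiplicative functionals on the span of P. *)
Definition is_model (T B P : set (expr d))
    (Pi : pt -> expr d -> test -> R) (Gam : pt -> pt -> Hsp R d -> Hsp R d) :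
    Prop :=
  [/\ forall x t, B t -> distribution (Pi x t),
      forall x y, exists2 g, multiplicative_on P g &
        forall a, lspan B a -> Gam x y a = Gamma_of s alpha beta g a,
      (forall x a, lspan B a -> Gam x x a = a) /\
      (forall x y z a, lspan B a -> Gam x y (Gam y z a) = Gam x z a),
      forall x y a phi, lspan B a -> test_function phi ->
        Pi_lin Pi y a phi = Pi_lin Pi x (Gam x y a) phi
    & exists2 n, is_test_order T n &
        forall (gamma : R) (A : set pt), 0 < gamma -> compact A ->
        exists C : R, forall x y (l : R) a, A x -> A y -> l < gamma ->
          lspan B a -> homogeneous s alpha beta l a ->
          (forall (delta : R) phi, 0 < delta -> delta <= 1 -> unit_test n phi ->
             `|Pi_lin Pi x a (rescale s delta x phi)| <=
               C * hnorm s alpha beta l a * delta `^ l) /\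
          (forall m : R, m < l ->
             hnorm s alpha beta m (Gam x y a) <=
               C * hnorm s alpha beta l a * snorm s (x - y) `^ (l - m))].

(* F_x^{-1} o F_y on the span of B, where F_x = Gamma_{f_x}. *)
Definition Gamma_from (B : set (expr d)) (f : pt -> expr d -> R)
    (x y : pt) : Hsp R d -> Hsp R d :=
  'pinv_(fun=> 0) (lspan B) (Gamma_of s alpha beta (f x))
    \o Gamma_of s alpha beta (f y).

(* D_1^k K(x, z) is (D^k K)(x - z), and its pairing with a distribution is the
   sum over n of the pairings of the K_n.  The conditions are imposed for the t
   on which Pi is given. *)
Definition admissible_with (T B P : set (expr d)) (K : nat -> pt -> R)
    (Pi : pt -> expr d -> test -> R) (Gam : pt -> pt -> Hsp R d -> Hsp R d)
    (f : pt -> expr d -> R) : Prop :=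
  [/\ is_model T B P Pi Gam,
      (forall x, multiplicative_on P (f x)) /\
      (forall x y a, lspan B a -> Gam x y a = Gamma_from B f x y a),
      (forall x i, f x (Xvar i) = - x ord0 i) /\
      (forall x k t, B t -> P (II k t) ->
         series (fun n => Pi x t (fun z => Dpart k (K n) (x - z))) @ \oo -->
           - f x (II k t)),
      forall x k phi, B (Xpow k) -> test_function phi ->
        Pi x (Xpow k) phi = integral_rV (fun y => monomial k (y - x) * phi y)
    & forall x k t phi, B t -> B (II k t) -> test_function phi ->
        series (fun n => integral_rV (fun y =>
                  phi y * Pi x t (fun z => Dpart k (K n) (y - z)))) @ \oo -->
          Pi x (II k t) phi -
          \sum_(l \in [set: mindex d])
            lextR (f x) (Jop s alpha beta (k + l) t) *
            integral_rV (fun y =>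
              (mfact l)%:R^-1 * monomial l (y - x) * phi y)].

Definition admissible (T B P : set (expr d)) (K : nat -> pt -> R)
    (Pi : pt -> expr d -> test -> R) (Gam : pt -> pt -> Hsp R d -> Hsp R d) :
    Prop :=
  exists f, admissible_with T B P K Pi Gam f.

Definition model_agree (B : set (expr d))
    (Pi Pi' : pt -> expr d -> test -> R)
    (Gam Gam' : pt -> pt -> Hsp R d -> Hsp R d) : Prop :=
  (forall x t phi, B t -> test_function phi -> Pi x t phi = Pi' x t phi) /\
  (forall x y a, lspan B a -> Gam x y a = Gam' x y a).

End Models.

Section Renormalisation.
Context {R : realType} {d : nat}.
Variables (s : 'I_d -> nat) (alpha beta : R).
Local Notation wt := (weight s alpha beta).
Local Notation Jop := (Jop s alpha beta).
Local Notation Delta := (coproduct s alpha beta).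
Local Notation Deltap := (coproductp s alpha beta).
Local Notation Alg := (Alg s alpha beta).

Definition renorm_sets (FF Fstar F0 : set (expr d)) : Prop :=
  [/\ Fstar `<=` F0, F0 `<=` FF, forall t, FF t -> wt t <= 0 -> F0 t
    & forall t, F0 t -> lspan (F0 `*` Alg Fstar) (Delta t)].

(* (I (x) mult)(D (x) I) on H (x) H, for D : H -> H (x) H. *)
Definition comul_mul (D : expr d -> Hsp2 R d) : Hsp2 R d -> Hsp2 R d :=
  lext (fun p => lext (fun q => bas (q.1, emul q.2 p.2)) (D p.1)).

(* (A (x) B) for linear A, B. *)
Definition tmap (A B : expr d -> Hsp R d) : Hsp2 R d -> Hsp2 R d :=
  lext (fun p => tens (A p.1) (B p.2)).

Variables (Fstar F0 : set (expr d)).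
Local Notation F0p := (Alg Fstar).

Definition commutes_with_I (M : expr d -> Hsp R d) : Prop :=
  (forall t, F0 t -> lspan F0 (M t)) /\
  (forall k t, F0 t -> F0 (II k t) -> M (II k t) = lext (Iop k) (M t)).

(* DM and hM are the maps Delta^M and \hat M associated with M.  The first
   identity is imposed on the elements J_k t of F_0^+ only: when J_k t is zero
   because of its weight, J_k need not vanish on the other terms of Delta^M t. *)
Definition is_DeltaM (M : expr d -> Hsp R d) (DM : expr d -> Hsp2 R d)
    (hM : expr d -> Hsp R d) : Prop :=
  [/\ (forall t, F0 t -> lspan (F0 `*` F0p) (DM t)) /\
      (forall t, F0p t -> lspan F0p (hM t)),
      forall k t, Fstar t -> Jop k t != 0 ->
        lext hM (Jop k t) = lext (fun p => Jop k p.1 * bas p.2) (DM t),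
      forall t, F0 t -> comul_mul Delta (DM t) = tmap M hM (Delta t),
      forall t u, F0p t -> F0p u -> hM (emul t u) = hM t * hM u
    & forall k, hM (Xpow k) = bas (Xpow k)].

(* The identity defining \hat\Delta^M presupposes that the Hopf algebra
   operations of H_+ restrict to H_0^+, on which alone hM is meaningful. *)
Definition is_hDeltaM (hM : expr d -> Hsp R d) (hDM : expr d -> Hsp2 R d) :
    Prop :=
  exists A, is_antipode s alpha beta A /\
    forall t, F0p t ->
    [/\ lspan F0p (A t), lspan (F0p `*` F0p) (Deltap t),
        lspan (F0p `*` F0p) (hDM t)
      & tmap (fun u => lext A (lext hM (A u))) hM (Deltap t) =
        comul_mul Deltap (hDM t)].

Definition upper_triangular (B : set (expr d)) (D : expr d -> Hsp2 R d) :
    Prop :=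
  forall t, B t ->
    lspan ([set u | B u /\ wt t < wt u] `*` F0p) (D t - tens (bas t) 1).

Definition renorm_group : set (expr d -> Hsp R d) :=
  [set M | commutes_with_I M /\
    exists DM hM hDM,
    [/\ is_DeltaM M DM hM, is_hDeltaM hM hDM,
        forall k, F0 (Xpow k) -> M (Xpow k) = bas (Xpow k),
        upper_triangular F0 DM & upper_triangular F0p hDM]].

(* (Pi_x (x) f_x) Delta^M t and f_x \hat M t. *)
Definition Pi_renorm (DM : expr d -> Hsp2 R d)
    (Pi : 'rV[R]_d -> expr d -> ('rV[R]_d -> R) -> R)
    (f : 'rV[R]_d -> expr d -> R) :
    'rV[R]_d -> expr d -> ('rV[R]_d -> R) -> R :=
  fun x t phi => lextR (fun p => Pi x p.1 phi * f x p.2) (DM t).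

Definition f_renorm (hM : expr d -> Hsp R d) (f : 'rV[R]_d -> expr d -> R) :
    'rV[R]_d -> expr d -> R :=
  fun x t => lextR (f x) (hM t).

End Renormalisation.

(* Main.v *)
From HB Require Import structures.
Require Import Defs.
From mathcomp Require Import all_boot all_order all_algebra finmap.
From mathcomp Require Import all_classical all_reals all_analysis.
From mathcomp Require Import ring lra.

(* An admissible model is determined by functionals bP that do not depend on a
   base point: Pi_x = bP o F_x, with F_x the action of the character f_x, and f_x
   is itself determined by Pi_x through f_x(J_k t) = - (D^k K * Pi_x t)(x).
   Conversely, if bP is compatible with K on the planted trees, the operators
   F_x^-1 o F_y are automatically bounded as required: their coefficients are
   controlled by induction on the weight, by splitting the series over the
   kernels K_m at the scale of x - y and using a Taylor expansion above it.
   Such families (bP, Pi) replace models throughout.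

   Triangularity of Delta^M and the identity
   (I (x) mult)(Delta (x) I) Delta^M = (M (x) hat M) Delta
   give Pi^M_x = bP o M o F^M_x, so that bP o M plays the role of bP for the
   renormalised model, the bound on Pi^M_x t being inherited from those on the
   Pi_x u with wt u >= wt t.

   The remaining trees t have positive weight, and below any given weight they
   are finitely many by subcriticality, so bP t is constructed by induction on
   the weight. It is forced on planted trees by convolution with K (a Schauder
   estimate, the weights not being integers), and on products by
   reconstruction: two candidates differ by a functional of positive order at
   every point, which vanishes. The same dichotomy gives uniqueness. *)

Set Implicit Arguments.
Unset Strict Implicit.
Unset Printing Implicit Defensive.
Import Order.TTheory GRing.Theory Num.Theory.
Import numFieldNormedType.Exports.
Local Open Scope classical_set_scope.
Local Open Scope ring_scope.

(** * Partial derivatives of smooth functions *)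

Section OneVariable.
Context {R : realType}.

(** Base-point free functionals are workable because characters are composed and inverted by an
    explicit recursion on trees ([comp]): comparing the coefficients of X^l at a planted tree gives
    a linear equation for the new J-coefficient, and the translation of Taylor coefficients is a
    flow, hence invertible. Injectivity of F_x, which is unitriangular for the weight, then turns
    identities between the F_x into identities between the Gamma_xy.

    The analytic obstacle is that a distribution is paired with test functions only, while K enters
    through its smooth pieces K_m. Every statement on K becomes a series in m of terms T (D^k K_m (y
    - .)), integrated against phi in y. The interchange of T with that integral ([exchange_bound])
    is made on Riemann sums over a partition of unity, which serves for reconstruction as well. The
    series are summed by a two-sided geometric bound whose constant does not depend on the scale
    where the two regimes meet; it has room to work because the relevant weights are not
    integers. *)

Lemma mvt_bound (g g' : R -> R) (M h : R) :
  (forall t : R, is_derive t (1 : R) g (g' t)) -> 0 <= M ->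
  (forall t, `|t| <= `|h| -> `|g' t| <= M) -> `|g h - g 0| <= M * `|h|.
Proof.
move=> dg M0 gM.
have cg a b : {within `[a, b], continuous g}.
  apply: continuous_subspaceT => t; apply: differentiable_continuous.
  by apply/derivable1_diffP; exact: (@ex_derive _ _ _ _ _ _ _ (dg t)).
have [h0|h0|->] := ltgtP h 0; last by rewrite subrr normr0 mulr0.
- have [c /[!in_itv]/= /andP[c1 c2] e] :=
    MVT h0 (fun x _ => dg x) (cg _ _).
  rewrite -normrN opprB e normrM sub0r normrN ler_wpM2r//.
  by apply: gM; rewrite !ltr0_norm// lerN2 ltW.
- have [c /[!in_itv]/= /andP[c1 c2] e] :=
    MVT h0 (fun x _ => dg x) (cg _ _).
  rewrite e normrM subr0 ler_wpM2r//.
  by apply: gM; rewrite !gtr0_norm// ltW.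
Qed.

Lemma is_derive_ext (f g : R -> R) (x v df : R) : f =1 g ->
  is_derive x v f df -> is_derive x v g df.
Proof. by move=> /funext ->. Qed.

Lemma cross_quotient_eq (a b c e a' p q h : R) : 0 < h -> a = a' ->
  a - b - c + e = p * h * h -> a' - c - b + e = q * h * h -> p = q.
Proof.
move=> h0 <- E1 E2; apply: (mulIf (lt0r_neq0 h0)); apply: (mulIf (lt0r_neq0 h0)).
by rewrite -E1 -E2; ring.
Qed.

Lemma dist_half (a b c e : R) : `|a - c| <= e / 2 -> `|b - c| <= e / 2 ->
  `|a - b| <= e.
Proof.
move=> ac bc; rewrite (splitr e) (_ : a - b = (a - c) - (b - c)); last by ring.
by rewrite (le_trans (ler_normB _ _))// lerD.
Qed.

End OneVariable.

Section Partials.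
Context {R : realType} {n : nat}.
Local Notation V := 'rV[R]_n.
Implicit Types (f g : V -> R) (x y : V) (i j : 'I_n) (l : seq 'I_n).
Local Notation e_ i := (delta_mx ord0 i : V).

(** Derivatives are indexed by words because [smooth] is, and because words can be extended at
    either end in inductions; [pder_lidx] returns to multi-indices, using that partial derivatives
    commute. *)
Definition pder l f : V -> R := foldr partial f l.

Lemma pder_cons i l f : pder (i :: l) f = partial i (pder l f).
Proof. by []. Qed.

Lemma pder_cat l l' f : pder (l ++ l') f = pder l (pder l' f).
Proof. by rewrite /pder foldr_cat. Qed.

Lemma pder_rcons l i f : pder (rcons l i) f = pder l (partial i f).
Proof. by rewrite /pder foldr_rcons. Qed.

Lemma smooth_diff f : smooth f -> forall x, differentiable f x.
Proof. by move=> sf x; exact: (sf [::]). Qed.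

Lemma smooth_partial i f : smooth f -> smooth (partial i f).
Proof. by move=> sf l x; have := sf (rcons l i) x; rewrite foldr_rcons. Qed.

Lemma smooth_pder l f : smooth f -> smooth (pder l f).
Proof. by move=> sf; elim: l => //= i l; exact: smooth_partial. Qed.

(** [smooth] is the largest class of differentiable functions stable under partial derivatives. The
    word is consumed from the right, where the first derivative taken stands. *)
Lemma smooth_coind (P : (V -> R) -> Prop) :
  (forall f, P f -> (forall x, differentiable f x) /\
     forall i, P (partial i f)) ->
  forall f, P f -> smooth f.
Proof.
move=> Pi f Pf l; elim/last_ind: l f Pf => [|l i ih] f Pf x.
  by apply: (Pi f Pf).1.
by rewrite foldr_rcons; apply: ih; exact: (Pi f Pf).2.
Qed.

Lemma is_derive_line f x i (t : R) : differentiable f (x + t *: e_ i) ->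
  is_derive t (1 : R) (fun t => f (x + t *: e_ i)) (partial i f (x + t *: e_ i)).
Proof.
move=> df.
have E : (fun h : R => h^-1 *: (f (h *: e_ i + (x + t *: e_ i)) -
                               f (x + t *: e_ i))) =
  (fun h : R => h^-1 *: (f (x + (h *: (1 : R) + t) *: e_ i) -
                               f (x + t *: e_ i))).
  apply/funext => h; congr (_ *: (f _ - _)).
  by rewrite scaler1 scalerDl addrCA.
have : derivable f (x + t *: e_ i) (e_ i) by exact: diff_derivable.
rewrite /derivable => cv; split; first by rewrite /derivable -E.
by rewrite /derive -E /partial /derive.
Qed.

Lemma partialE f i x (t v : R) :
  is_derive t (1 : R) (fun t => f (x + t *: e_ i)) v ->
  partial i f (x + t *: e_ i) = v.
Proof.
case=> _ <-; rewrite /partial /derive.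
suff -> : (fun h : R => h^-1 *: ((f \o shift (x + t *: e_ i)) (h *: e_ i) -
                               f (x + t *: e_ i))) =
  (fun h : R => h^-1 *: (((fun u => f (x + u *: e_ i)) \o shift t) (h *: (1 : R)) -
                               f (x + t *: e_ i))) by [].
apply/funext => h /=; congr (_ *: (f _ - _)).
by rewrite scaler1 scalerDl addrCA.
Qed.

Lemma partialE0 f i x (v : R) :
  is_derive (0 : R) (1 : R) (fun t => f (x + t *: e_ i)) v -> partial i f x = v.
Proof. by move=> /partialE; rewrite scale0r addr0. Qed.

Lemma is_derive_line0 f x i : differentiable f x ->
  is_derive (0 : R) (1 : R) (fun t => f (x + t *: e_ i)) (partial i f x).
Proof.
move=> df; have := @is_derive_line f x i 0.
by rewrite scale0r addr0; exact.
Qed.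

Lemma line_bound f x i (h M : R) : (forall x, differentiable f x) -> 0 <= M ->
  (forall t, `|t| <= `|h| -> `|partial i f (x + t *: e_ i)| <= M) ->
  `|f (x + h *: e_ i) - f x| <= M * `|h|.
Proof.
move=> df M0 b.
have := @mvt_bound R (fun t => f (x + t *: e_ i))
  (fun t => partial i f (x + t *: e_ i)) M h
  (fun t => is_derive_line (df _)) M0 b.
by rewrite scale0r addr0.
Qed.

Lemma partial_mvt f x i (h : R) : (forall x, differentiable f x) -> 0 < h ->
  exists2 t, 0 <= t <= h & f (x + h *: e_ i) - f x = partial i f (x + t *: e_ i) * h.
Proof.
move=> df h0.
have cg : {within `[0, h], continuous (fun t => f (x + t *: e_ i))}.
  apply: continuous_subspaceT => t; apply: differentiable_continuous.
  by apply/derivable1_diffP; exact: (@ex_derive _ _ _ _ _ _ _ (is_derive_line (df _))).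
have [c /[!in_itv]/= /andP[c1 c2] e] :=
    MVT h0 (fun t _ => @is_derive_line f x i t (df _)) cg.
exists c; first by rewrite !ltW.
by move: e; rewrite scale0r addr0 subr0.
Qed.

Lemma norm_delta i : `|e_ i| <= 1.
Proof.
rewrite [leLHS]mx_normrE; apply: bigmax_le => // -[a b] _ /=.
by rewrite !mxE; case: (_ && _); rewrite ?normr1 ?normr0.
Qed.

Lemma partialC i j f : smooth f -> partial i (partial j f) = partial j (partial i f).
Proof.
move=> sf; apply/funext => x.
(* The second difference of f over a parallelogram of side h, evaluated by two applications of the
   mean value theorem. Exchanging a and b does not change it, so the two mixed derivatives agree at
   points p and q close to x. *)
have key a b (h : R) : 0 < h -> exists2 p, `|p - x| <= h + h &
    f (x + h *: e_ a + h *: e_ b) - f (x + h *: e_ a) - f (x + h *: e_ b) + f x =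
    partial b (partial a f) p * h * h.
  move=> h0.
  pose g := fun y => f (y + h *: e_ b) - f y.
  have dg y : differentiable g y.
    apply: differentiableB; last exact: smooth_diff.
    apply: (@differentiable_comp _ _ _ _ (fun y => y + h *: e_ b) f) => //.
    exact: smooth_diff.
  have [t /andP[t0 th] E] := @partial_mvt g x a h dg h0.
  have dga y : partial a g y = partial a f (y + h *: e_ b) - partial a f y.
    apply: partialE0; rewrite /g.
    apply: is_deriveB; last exact/is_derive_line0/smooth_diff.
    have := @is_derive_line0 f (y + h *: e_ b) a (smooth_diff sf _).
    by under eq_fun do rewrite addrAC.
  have sfa := smooth_diff (smooth_partial a sf).
  have [u /andP[u0 uh] E2] := @partial_mvt (partial a f) (x + t *: e_ a) b h sfa h0.
  exists (x + t *: e_ a + u *: e_ b).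
    rewrite addrC !addrA [- x + x]addNr add0r.
    apply: (le_trans (ler_normD _ _)); apply: lerD;
    by rewrite normrZ ger0_norm// (le_trans (ler_wpM2l _ (norm_delta _)))// mulr1.
  move: E; rewrite /g dga E2 => <-.
  by ring.
have cij : {for x, continuous (partial i (partial j f))}.
  by apply: differentiable_continuous; apply: smooth_diff; do 2!apply: smooth_partial.
have cji : {for x, continuous (partial j (partial i f))}.
  by apply: differentiable_continuous; apply: smooth_diff; do 2!apply: smooth_partial.
apply/eqP; rewrite -subr_eq0 -normr_le0; apply/ler_addgt0Pl => e e0; rewrite addr0.
have e2 : 0 < e / 2 by rewrite divr_gt0.
have /cvgrPdist_le /(_ _ e2) /nbhs_normP [r1 r10 H1] := cij.
have /cvgrPdist_le /(_ _ e2) /nbhs_normP [r2 r20 H2] := cji.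
rewrite /= in r10 r20.
pose h := Num.min r1 r2 / 4.
have m0 : 0 < Num.min r1 r2 by rewrite lt_min r10.
have h0 : 0 < h by rewrite divr_gt0.
have h1 : h + h < r1.
  apply: (@lt_le_trans _ _ (Num.min r1 r2)); last by rewrite ge_min lexx.
  by rewrite /h; lra.
have h2 : h + h < r2.
  apply: (@lt_le_trans _ _ (Num.min r1 r2)); last by rewrite ge_min lexx orbT.
  by rewrite /h; lra.
have [p px E1] := key i j h h0.
have [q qx E2] := key j i h h0.
have E : partial j (partial i f) p = partial i (partial j f) q.
  by apply: (cross_quotient_eq h0 _ E1 E2); rewrite addrAC.
have Bp : `|partial j (partial i f) x - partial j (partial i f) p| <= e / 2.
  by apply: H2; rewrite /= distrC (le_lt_trans px).
have Bq : `|partial i (partial j f) x - partial i (partial j f) q| <= e / 2.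
  by apply: H1; rewrite /= distrC (le_lt_trans qx).
by rewrite E in Bp; exact: dist_half Bq Bp.
Qed.

Lemma pder_perm l l' f : smooth f -> perm_eq l l' -> pder l f = pder l' f.
Proof.
move=> sf; elim: l l' => [|i l ih] l' /=.
  by move=> p; have := perm_size p; case: l' {p}.
move=> p; have il' : i \in l' by rewrite -(perm_mem p) mem_head.
have /perm_to_rem p' := il'.
have {}ih := ih (rem i l') _; rewrite -[partial i _]/(partial i (pder l f)) ih; last first.
  by rewrite -(perm_cons i); exact: perm_trans p p'.
have {p p' ih} : forall m, i \in m -> partial i (pder (rem i m) f) = pder m f.
  elim=> // j m ihm /=; have [->//|ij /=] := eqVneq j i.
  rewrite in_cons eq_sym (negbTE ij) /= => im.
  by rewrite (partialC _ _ (smooth_pder _ sf)) ihm.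
exact.
Qed.

Lemma pderC l l' f : smooth f -> pder l (pder l' f) = pder l' (pder l f).
Proof. by move=> sf; rewrite -!pder_cat; apply: pder_perm => //; rewrite perm_catC. Qed.

Definition mlist (k : mindex n) : seq 'I_n :=
  flatten [seq nseq (k i) i | i <- enum 'I_n].

Lemma Dpart_pder k f : Dpart k f = pder (mlist k) f.
Proof.
rewrite /Dpart /mlist; elim: (enum _) => //= i s ->.
by rewrite pder_cat; elim: (k i) => //= m ->.
Qed.

Lemma count_mlist k i : count_mem i (mlist k) = k i.
Proof.
rewrite /mlist count_flatten -map_comp sumnE big_map.
rewrite (eq_bigr (fun j => (j == i) * k j)%N); last first.
  by move=> j _ /=; rewrite count_nseq.
rewrite big_enum /= (bigD1 i)//= eqxx mul1n big1 ?addn0// => j ji.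
by rewrite (negbTE ji).
Qed.

Lemma big_mlist (T : Type) (idx : T) (op : Monoid.com_law idx) (F : 'I_n -> T) k :
  \big[op/idx]_(i <- mlist k) F i = \big[op/idx]_(i < n) iterop (k i) op (F i) idx.
Proof.
rewrite /mlist big_flatten big_map big_enum /=; apply: eq_bigr => i _.
by rewrite big_nseq -Monoid.iteropE.
Qed.

Lemma size_mlist k : size (mlist k) = mdeg k.
Proof.
rewrite /mlist size_flatten /shape -map_comp sumnE big_map big_enum /=.
by apply: eq_bigr => i _; rewrite size_nseq.
Qed.

Definition lidx l : mindex n := [ffun i => count_mem i l].

Lemma mlist_lidx l : perm_eq (mlist (lidx l)) l.
Proof. by apply/allP => i _ /=; rewrite count_mlist ffunE. Qed.

Lemma pder_lidx l f : smooth f -> pder l f = Dpart (lidx l) f.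
Proof. by move=> sf; rewrite Dpart_pder; apply: pder_perm => //; rewrite perm_sym mlist_lidx. Qed.

Lemma mdeg_lidx l : mdeg (lidx l) = size l.
Proof. by rewrite -size_mlist; exact/perm_size/mlist_lidx. Qed.

End Partials.

Section Closure.
Context {R : realType} {n : nat}.
Local Notation V := 'rV[R]_n.
Implicit Types (f g : V -> R) (x y : V) (i j : 'I_n) (l : seq 'I_n).
Local Notation e_ i := (delta_mx ord0 i : V).

Lemma partialD i f g x : differentiable f x -> differentiable g x ->
  partial i (fun y => f y + g y) x = partial i f x + partial i g x.
Proof. by move=> df dg; rewrite /partial deriveD//; exact: diff_derivable. Qed.

Lemma partialM i f g x : differentiable f x -> differentiable g x ->
  partial i (fun y => f y * g y) x = partial i f x * g x + f x * partial i g x.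
Proof.
move=> df dg; rewrite /partial deriveM; try exact: diff_derivable.
by rewrite addrC mulrC.
Qed.

Lemma partialZ i (c : R) f x : differentiable f x ->
  partial i (fun y => c * f y) x = c * partial i f x.
Proof. by move=> df; rewrite /partial (deriveZ c)//; exact: diff_derivable. Qed.

Lemma partial_cst i (c : R) x : partial i (fun=> c) x = 0.
Proof. by rewrite /partial derive_cst. Qed.

Lemma partial0 i : partial i (fun=> 0 : R) = fun=> 0.
Proof. by apply/funext => x; exact: partial_cst. Qed.

Lemma pder0 l : pder l (fun=> 0 : R) = (fun=> 0) :> (V -> R).
Proof. by elim: l => //= i l ->; exact: partial0. Qed.

Lemma smooth_cst (c : R) : smooth (fun _ : V => c).
Proof.
apply: (@smooth_coind _ _ (fun f => exists c, f = fun=> c)); last by exists c.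
move=> _ [{}c ->]; split; first by move=> x; exact: differentiable_cst.
by move=> i; exists 0; apply/funext => x; exact: partial_cst.
Qed.

(** The derivative of a product is a sum of products: with sums built in, the class is stable under
    [partial] and [smooth_coind] applies. *)
Inductive sgen : (V -> R) -> Prop :=
| sgen_base f : smooth f -> sgen f
| sgen_add f g : sgen f -> sgen g -> sgen (fun x => f x + g x)
| sgen_mul f g : sgen f -> sgen g -> sgen (fun x => f x * g x).

Lemma sgen_smooth f : sgen f -> smooth f.
Proof.
apply: smooth_coind => {}f; elim=> {f}.
- move=> f sf; split=> [|i]; first exact: smooth_diff.
  exact/sgen_base/smooth_partial.
- move=> f g _ [df pf] _ [dg pg]; split=> [x|i]; first exact: differentiableD.
  rewrite (_ : partial i _ = fun x => partial i f x + partial i g x).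
    exact: sgen_add.
  by apply/funext => x; exact: partialD.
- move=> f g Gf [df pf] Gg [dg pg]; split=> [x|i]; first exact: differentiableM.
  rewrite (_ : partial i _ = fun x => partial i f x * g x + f x * partial i g x).
    by apply: sgen_add; apply: sgen_mul.
  by apply/funext => x; exact: partialM.
Qed.

Lemma smoothD f g : smooth f -> smooth g -> smooth (fun x => f x + g x).
Proof. by move=> sf sg; apply/sgen_smooth/sgen_add; exact: sgen_base. Qed.

Lemma smoothM f g : smooth f -> smooth g -> smooth (fun x => f x * g x).
Proof. by move=> sf sg; apply/sgen_smooth/sgen_mul; exact: sgen_base. Qed.

Lemma smoothZ (c : R) f : smooth f -> smooth (fun x => c * f x).
Proof. by move=> sf; apply: smoothM => //; exact: smooth_cst. Qed.

Lemma smooth_sum (I : Type) (r : seq I) (F : I -> V -> R) :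
  (forall k, smooth (F k)) -> smooth (fun x => \sum_(k <- r) F k x).
Proof.
move=> sF; elim: r => [|k r ih].
  by under eq_fun do rewrite big_nil; exact: smooth_cst.
by under eq_fun do rewrite big_cons; exact: smoothD.
Qed.

Lemma smooth_prod (I : Type) (r : seq I) (F : I -> V -> R) :
  (forall k, smooth (F k)) -> smooth (fun x => \prod_(k <- r) F k x).
Proof.
move=> sF; elim: r => [|k r ih].
  by under eq_fun do rewrite big_nil; exact: smooth_cst.
by under eq_fun do rewrite big_cons; exact: smoothM.
Qed.

Lemma pderZ l (c : R) f : smooth f ->
  pder l (fun x => c * f x) = fun x => c * pder l f x.
Proof.
move=> sf; elim/last_ind: l f sf => // l i ih f sf.
rewrite pder_rcons (_ : partial i _ = fun x => c * partial i f x).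
  by rewrite ih ?pder_rcons//; exact: smooth_partial.
by apply/funext => x; rewrite partialZ//; exact: smooth_diff.
Qed.

Lemma pderD l f g : smooth f -> smooth g ->
  pder l (fun x => f x + g x) = fun x => pder l f x + pder l g x.
Proof.
elim/last_ind: l f g => // l i ih f g sf sg.
rewrite pder_rcons (_ : partial i _ = fun x => partial i f x + partial i g x).
  by rewrite ih ?pder_rcons//; exact: smooth_partial.
by apply/funext => x; rewrite partialD//; exact: smooth_diff.
Qed.

Lemma pder_sum (I : Type) (r : seq I) (F : I -> V -> R) l :
  (forall k, smooth (F k)) ->
  pder l (fun x => \sum_(k <- r) F k x) = fun x => \sum_(k <- r) pder l (F k) x.
Proof.
move=> sF; elim: r => [|k r ih].
  under eq_fun do rewrite big_nil.
  by rewrite pder0; apply/funext => x; rewrite big_nil.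
under eq_fun do rewrite big_cons.
rewrite pderD//; last exact: smooth_sum.
by rewrite ih; apply/funext => x; rewrite big_cons.
Qed.

(** Each letter of [l] splits the product in two, whence the power of 2. The price [w i] of a
    derivative in direction i is free, so that anisotropic scales can be inserted. *)
Lemma pderM_bound (w : 'I_n -> R) x l f g a b :
  smooth f -> smooth g -> (forall i, 0 <= w i) ->
  (forall l', (size l' <= size l)%N -> `|pder l' f x| <= a * \prod_(i <- l') w i) ->
  (forall l', (size l' <= size l)%N -> `|pder l' g x| <= b * \prod_(i <- l') w i) ->
  `|pder l (fun y => f y * g y) x| <= 2 ^+ size l * a * b * \prod_(i <- l) w i.
Proof.
move=> sf sg w0; elim/last_ind: l f g a b sf sg => [|l i ih] f g a b sf sg fa gb.
  have := fa [::] isT; have := gb [::] isT; rewrite /= !big_nil !mulr1 mul1r => B A.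
  by rewrite normrM ler_pM.
rewrite pder_rcons size_rcons.
rewrite (_ : partial i _ = fun x => partial i f x * g x + f x * partial i g x); last first.
  by apply/funext => y; rewrite partialM//; exact: smooth_diff.
have sfi := smooth_partial i sf; have sgi := smooth_partial i sg.
rewrite pderD; [|exact: smoothM|exact: smoothM].
rewrite size_rcons in fa gb.
apply: (le_trans (ler_normD _ _)).
have B1 := ih (partial i f) g (a * w i) b sfi sg _ _.
have B2 := ih f (partial i g) a (b * w i) sf sgi _ _.
apply: (le_trans (lerD (B1 _ _) (B2 _ _))).
- move=> l' ll'; rewrite -pder_rcons (le_trans (fa _ _)) ?size_rcons//.
  by rewrite big_rcons/= mulrAC mulrA.
- by move=> l' ll'; rewrite (le_trans (gb _ _))// ltnW.
- by move=> l' ll'; rewrite (le_trans (fa _ _))// ltnW.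
- move=> l' ll'; rewrite -pder_rcons (le_trans (gb _ _)) ?size_rcons//.
  by rewrite big_rcons/= mulrAC mulrA.
by rewrite big_rcons/= exprS le_eqVlt; apply/orP; left; apply/eqP; ring.
Qed.

Definition aff (c b : 'I_n -> R) (y : V) : V := \row_i (c i * y ord0 i + b i).

Lemma aff_line c b x i (t : R) :
  aff c b (x + t *: e_ i) = aff c b x + (c i * t) *: e_ i.
Proof.
apply/rowP => j; rewrite /aff !mxE /=.
have [->|ji] := eqVneq j i; first by rewrite !mulr1; ring.
by rewrite !mulr0 !addr0.
Qed.

Lemma aff_diff c b x : differentiable (aff c b) x.
Proof.
rewrite (_ : aff c b = \sum_i (fun y : V => (c i * y ord0 i + b i) *: e_ i)).
  apply: differentiable_sum => i.
  apply: (@differentiable_comp _ _ _ _ (fun y : V => c i * y ord0 i + b i)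
    (fun t : R => t *: e_ i)).
    apply: differentiableD; last exact: differentiable_cst.
    by apply: differentiableZ; exact: differentiable_coord.
  exact: differentiableZl.
apply/funext => y; rewrite fct_sumE; apply/rowP => j; rewrite mxE summxE.
rewrite (bigD1 j)//= !mxE !eqxx mulr1 big1 ?addr0// => k kj.
by rewrite !mxE eqxx eq_sym (negbTE kj) mulr0.
Qed.

Lemma partial_aff c b i f : (forall x, differentiable f x) ->
  partial i (fun y => f (aff c b y)) = fun y => c i * partial i f (aff c b y).
Proof.
move=> df; apply/funext => x; apply: partialE0.
under eq_fun do rewrite aff_line.
have h : is_derive (0 : R) (1 : R) (fun t => c i * t) (c i).
  by have := is_deriveZ (c i) (is_derive_id (0 : R) (1 : R)); rewrite scaler1.
have h2 : is_derive (c i * 0) (1 : R) (fun t => f (aff c b x + t *: e_ i))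
    (partial i f (aff c b x)).
  by rewrite mulr0; exact: is_derive_line0.
have := @is_derive1_comp _ _ _ _ _ _ h2 h.
by rewrite mulrC.
Qed.

Lemma smooth_aff c b f : smooth f -> smooth (fun y => f (aff c b y)).
Proof.
move=> sf; apply: (@smooth_coind _ _ (fun g => exists a f, smooth f /\
  g = fun y => a * f (aff c b y))); last first.
  by exists 1, f; split => //; apply/funext => y; rewrite mul1r.
move=> _ [a [{}f [{}sf ->]]].
have D x : differentiable (fun y => f (aff c b y)) x.
  by apply: (@differentiable_comp _ _ _ _ (aff c b) f);
    [exact: aff_diff|exact: smooth_diff].
split=> [x|i]; first exact: differentiableZ.
exists (a * c i), (partial i f); split; first exact: smooth_partial.
apply/funext => x; rewrite partialZ// partial_aff ?mulrA//; exact: smooth_diff.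
Qed.

Lemma pder_aff c b l f : smooth f ->
  pder l (fun y => f (aff c b y)) =
  fun y => \prod_(i <- l) c i * pder l f (aff c b y).
Proof.
elim/last_ind: l f => [|l i ih] f sf.
  by apply/funext => y; rewrite big_nil mul1r.
rewrite !pder_rcons partial_aff; last exact: smooth_diff.
have si := smooth_partial i sf.
rewrite pderZ; last exact: smooth_aff.
rewrite ih//; apply/funext => y; rewrite big_rcons/=; ring.
Qed.

Lemma sub_aff x y : x - y = aff (fun=> -1) (fun i => x ord0 i) y.
Proof. by apply/rowP => i; rewrite !mxE; ring. Qed.

Lemma smooth_sub x f : smooth f -> smooth (fun y => f (x - y)).
Proof. by move=> /(smooth_aff (fun=> -1) (fun i => x ord0 i)); under eq_fun do rewrite -sub_aff. Qed.

Lemma pder_sub x l f : smooth f ->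
  pder l (fun y => f (x - y)) = fun y => (-1) ^+ size l * pder l f (x - y).
Proof.
move=> sf; under eq_fun do rewrite sub_aff.
rewrite pder_aff//; apply/funext => y; rewrite -sub_aff.
by rewrite big_const_seq iter_mulr_1 count_predT.
Qed.

Lemma add_aff x y : x + y = aff (fun=> 1) (fun i => x ord0 i) y.
Proof. by apply/rowP => i; rewrite !mxE; ring. Qed.

Lemma smooth_add x f : smooth f -> smooth (fun y => f (x + y)).
Proof. by move=> /(smooth_aff (fun=> 1) (fun i => x ord0 i)); under eq_fun do rewrite -add_aff. Qed.

Lemma pder_add x l f : smooth f ->
  pder l (fun y => f (x + y)) = fun y => pder l f (x + y).
Proof.
move=> sf; under eq_fun do rewrite add_aff.
rewrite pder_aff//; apply/funext => y; rewrite -add_aff.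
by rewrite big_const_seq iter_mulr_1 count_predT expr1n mul1r.
Qed.

(** The path from 0 to [h] changes one coordinate at a time and stays among points whose coordinates
    are dominated by those of [h]. *)
Lemma box_bound g (h : V) (M : 'I_n -> R) : (forall x, differentiable g x) ->
  (forall i, 0 <= M i) ->
  (forall i (h' : V), (forall j, `|h' ord0 j| <= `|h ord0 j|) ->
     `|partial i g h'| <= M i) ->
  `|g h - g 0| <= \sum_i M i * `|h ord0 i|.
Proof.
move=> dg M0 gM.
pose hs (s : seq 'I_n) : V := \row_i (if i \in s then h ord0 i else 0).
suff : forall s, uniq s -> `|g (hs s) - g 0| <= \sum_(i <- s) M i * `|h ord0 i|.
  move=> /(_ (enum 'I_n) (enum_uniq _)); rewrite big_enum /=.
  rewrite (_ : hs _ = h)//; apply/rowP => i; rewrite !mxE mem_enum //.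
elim=> [_|i s ih /= /andP[nis us]].
  rewrite (_ : hs [::] = 0) ?subrr ?normr0 ?big_nil//.
  by apply/rowP => i; rewrite !mxE.
have -> : hs (i :: s) = hs s + h ord0 i *: e_ i.
  apply/rowP => j; rewrite !mxE in_cons eqxx /=.
  have [->|ji] := eqVneq j i; first by rewrite (negbTE nis) add0r mulr1.
  by rewrite mulr0 addr0.
rewrite big_cons -(subrK (g (hs s)) (g (_ + _))) -addrA.
apply: (le_trans (ler_normD _ _)); apply: lerD; last exact: ih.
apply: line_bound => // t th; apply: gM => j; rewrite !mxE eqxx /=.
have [->|ji] := eqVneq j i; first by rewrite (negbTE nis) add0r mulr1.
by rewrite mulr0 addr0; case: ifP; rewrite ?normr0.
Qed.

End Closure.

(** * Anisotropic Taylor expansion *)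

Section MultiIndices.
Context {d : nat}.
Implicit Types (k l : mindex d) (i : 'I_d).

Lemma midxD k l i : (k + l)%R i = (k i + l i)%N.
Proof. by rewrite ffunE. Qed.

Lemma munitE i j : munit i j = (j == i).
Proof. by rewrite ffunE. Qed.

Lemma mfact_gt0 k : (0 < mfact k)%N.
Proof. by apply: prodn_gt0 => i; exact: fact_gt0. Qed.

Lemma midx_subK k i : (0 < k i)%N ->
  ([ffun j => (k j - (j == i))%N] + munit i)%R = k.
Proof.
move=> ki; apply/ffunP => j; rewrite midxD munitE ffunE subnK//.
by have [->|] := eqVneq j i.
Qed.

Lemma midx0 i : (0 : mindex d)%R i = 0%N.
Proof. by rewrite ffunE. Qed.

Context (s : 'I_d -> nat).

Lemma sdegD k l : sdeg s (k + l)%R = (sdeg s k + sdeg s l)%N.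
Proof.
by rewrite /sdeg -big_split; apply: eq_bigr => i _; rewrite midxD mulnDr.
Qed.

Lemma sdeg_munit i : sdeg s (munit i) = s i.
Proof.
rewrite /sdeg (bigD1 i)//= munitE eqxx muln1 big1 ?addn0// => j ji.
by rewrite munitE (negbTE ji) muln0.
Qed.

Lemma sdeg0 : sdeg s 0%R = 0%N.
Proof. by rewrite /sdeg big1// => i _; rewrite midx0 muln0. Qed.

Hypothesis s_gt0 : forall i, (0 < s i)%N.

Lemma sdeg_coord k i : (k i <= sdeg s k)%N.
Proof.
by rewrite /sdeg (bigD1 i)//= (leq_trans (leq_pmull _ (s_gt0 i)))// leq_addr.
Qed.

(** Since the scaling is positive, an index of scaled degree below N has all its entries below N, so
    enumerating the functions into 'I_N misses none. *)
Definition midx (N : nat) : seq (mindex d) :=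
  [seq l <- [seq [ffun i => h i : nat] | h : {ffun 'I_d -> 'I_N}] | (sdeg s l < N)%N].

Lemma mem_midx N l : (l \in midx N) = (sdeg s l < N)%N.
Proof.
rewrite mem_filter; apply: andb_idr => lN.
have li i : (l i < N)%N by exact: leq_ltn_trans (sdeg_coord l i) lN.
apply/mapP; exists [ffun i => Ordinal (li i)]; first by rewrite mem_enum.
by apply/ffunP => i; rewrite !ffunE.
Qed.

Lemma midx_uniq N : uniq (midx N).
Proof.
apply: filter_uniq; rewrite map_inj_uniq ?enum_uniq// => f g /ffunP fg.
by apply/ffunP => i; apply: val_inj; have := fg i; rewrite !ffunE.
Qed.

(** Reindexing behind the derivative of a Taylor polynomial: removing one unit from the entry i
    lowers the scaled degree by [s i]. *)
Lemma big_midx_shift (T : Type) (idx : T) (op : Monoid.com_law idx) N i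
  (F : mindex d -> T) :
  \big[op/idx]_(l <- midx N | (0 < l i)%N) F l =
  \big[op/idx]_(l <- midx (N - s i)) F (l + munit i)%R.
Proof.
rewrite -big_filter -(big_map (fun l => (l + munit i)%R) xpredT F).
apply: perm_big; apply: uniq_perm.
- exact/filter_uniq/midx_uniq.
- rewrite map_inj_uniq ?midx_uniq// => a b /ffunP ab; apply/ffunP => j.
  by have := ab j; rewrite !midxD => /addIn.
move=> l; rewrite mem_filter mem_midx; apply/andP/mapP.
  move=> [li lN]; exists [ffun j => (l j - (j == i))%N]; last by rewrite midx_subK.
  rewrite mem_midx ltn_subRL -sdeg_munit -sdegD addrC midx_subK//.
case=> k; rewrite mem_midx ltn_subRL -sdeg_munit -sdegD addrC => kN ->.
by rewrite midxD munitE eqxx addn1.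
Qed.

End MultiIndices.

Section Taylor.
Context {R : realType} {d : nat} (s : 'I_d -> nat).
Hypothesis s_gt0 : forall i, (0 < s i)%N.
Local Notation V := 'rV[R]_d.
Implicit Types (f g : V -> R) (x y h : V) (i j : 'I_d) (l : seq 'I_d).

Definition lwt l : nat := (\sum_(i <- l) s i)%N.

Lemma lwt_mlist k : lwt (mlist k) = sdeg s k.
Proof.
rewrite /lwt big_mlist /sdeg; apply: eq_bigr => i _.
by rewrite Monoid.iteropE iter_addn_0.
Qed.

Lemma partial_coord i j x : partial j (fun x : V => x ord0 i) x = (i == j)%:R.
Proof.
apply: partialE0.
under eq_fun do rewrite !mxE eqxx /=.
have := is_deriveD (is_derive_cst (x ord0 i) (0 : R) (1 : R))
  (is_deriveZ ((i == j)%:R : R) (is_derive_id (0 : R) (1 : R))).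
rewrite add0r scaler1; apply: is_derive_ext => t /=.
by rewrite [in RHS]mulrC.
Qed.

Lemma smooth_coord i : smooth (fun x : V => x ord0 i).
Proof.
apply: (@smooth_coind _ _ (fun f => f = (fun x => x ord0 i) \/ exists c, f = fun=> c)); last by left.
move=> _ [->|[c ->]]; last first.
  split; first by move=> x; exact: differentiable_cst.
  by move=> j; right; exists 0; apply/funext => x; exact: partial_cst.
split; first by move=> x; exact: differentiable_coord.
by move=> j; right; exists ((i == j)%:R); apply/funext => x; exact: partial_coord.
Qed.

Lemma smooth_monomial (k : mindex d) : smooth (@monomial R d k).
Proof.
apply: smooth_prod => i.
rewrite (_ : (fun x : V => _) = fun x => \prod_(j <- nseq (k i) tt) x ord0 i).
  by apply: smooth_prod => _; exact: smooth_coord.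
by apply/funext => x; rewrite big_nseq iter_mulr_1.
Qed.

Lemma monomialD (k : mindex d) i x :
  monomial (k + munit i) x = x ord0 i * monomial k x.
Proof.
rewrite /monomial (bigD1 i)//= [in RHS](bigD1 i)//= midxD munitE eqxx addn1 exprS.
rewrite -!mulrA; congr (_ * (_ * _)); apply: eq_bigr => j ji.
by rewrite midxD munitE (negbTE ji) addn0.
Qed.

Lemma partial_monomial i (k : mindex d) x :
  partial i (monomial k) x =
  (k i)%:R * monomial [ffun j => (k j - (j == i))%N] x.
Proof.
pose c := \prod_(j < d | j != i) x ord0 j ^+ k j.
have -> : monomial [ffun j => (k j - (j == i))%N] x = x ord0 i ^+ (k i).-1 * c.
  rewrite /monomial (bigD1 i)//= ffunE eqxx subn1; congr (_ * _).
  by apply: eq_bigr => j ji; rewrite ffunE (negbTE ji) subn0.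
apply: partialE0.
apply: (@is_derive_ext _ (fun t => c * (x ord0 i + t) ^+ k i)).
  move=> t; rewrite /monomial [in RHS](bigD1 i)//= mulrC; congr (_ * _).
    by rewrite !mxE !eqxx mulr1.
  by apply: eq_bigr => j ji; rewrite !mxE (negbTE ji) mulr0 addr0.
have h1 : is_derive (0 : R) (1 : R) (fun t => x ord0 i + t) 1.
  have := is_deriveD (is_derive_cst (x ord0 i) (0 : R) (1 : R))
    (is_derive_id (0 : R) (1 : R)).
  by rewrite add0r.
have := is_deriveZ c (@is_deriveX _ _ _ (k i) _ _ _ h1).
rewrite addr0 => h.
have e : (c \*: (fun t => x ord0 i + t) ^+ k i) =1 (fun t => c * (x ord0 i + t) ^+ k i).
  by move=> t /=; rewrite exprfctE.
have := is_derive_ext e h.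
rewrite (_ : _ *: _ = (k i)%:R * (x ord0 i ^+ (k i).-1 * c))//.
by rewrite /GRing.scale /=; ring.
Qed.

Definition tay (N : nat) f x h : R :=
  \sum_(l <- midx s N) monomial l h / (mfact l)%:R * Dpart l f x.

Lemma mfactD (k : mindex d) i : mfact (k + munit i) = ((k i).+1 * mfact k)%N.
Proof.
rewrite /mfact (bigD1 i)//= [in RHS](bigD1 i)//= midxD munitE eqxx addn1 factS.
rewrite -!mulnA; congr (_ * (_ * _))%N; apply: eq_bigr => j ji.
by rewrite midxD munitE (negbTE ji) addn0.
Qed.

Lemma Dpart_munit (k : mindex d) i f : smooth f ->
  Dpart (k + munit i) f = Dpart k (partial i f).
Proof.
move=> sf; rewrite !Dpart_pder -pder_rcons; apply: pder_perm => //.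
apply/allP => j _ /=; rewrite -cats1 count_cat !count_mlist midxD munitE /=.
by rewrite addn0 [j == i]eq_sym.
Qed.

Lemma partial_tay N f x h i : smooth f ->
  partial i (tay N f x) h = tay (N - s i) (partial i f) x h.
Proof.
move=> sf.
have -> : tay N f x = fun h => \sum_(l <- midx s N)
    ((mfact l)%:R^-1 * Dpart l f x) * monomial l h.
  by apply/funext => y; apply: eq_bigr => l _; rewrite [RHS]mulrC mulrA.
have E : partial i (fun h => \sum_(l <- midx s N)
    ((mfact l)%:R^-1 * Dpart l f x) * monomial l h) = fun h => \sum_(l <- midx s N)
    ((mfact l)%:R^-1 * Dpart l f x) * partial i (monomial l) h.
  rewrite -[LHS]/(pder [:: i] _) pder_sum => [|l]; last first.
    exact/smoothZ/smooth_monomial.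
  apply/funext => y; apply: eq_bigr => l _ /=; rewrite partialZ//.
  exact/smooth_diff/smooth_monomial.
rewrite E (bigID (fun l : mindex d => 0 < l i)%N) /= [X in _ + X]big1 ?addr0; last first.
  by move=> l; rewrite -eqn0Ngt partial_monomial => /eqP ->; rewrite mul0r mulr0.
rewrite (big_midx_shift s_gt0); apply: eq_bigr => l _.
rewrite partial_monomial mfactD Dpart_munit// midxD munitE eqxx addn1 natrM.
have -> : [ffun j => ((l + munit i)%R j - (j == i))%N] = l.
  by apply/ffunP => j; rewrite ffunE midxD munitE addnK.
rewrite invfM.
have n0 : (l i).+1%:R != 0 :> R by rewrite pnatr_eq0.
have m0 : (mfact l)%:R != 0 :> R by rewrite pnatr_eq0 -lt0n mfact_gt0.
move: n0 m0; set a := (l i).+1%:R; set b := (mfact l)%:R => n0 m0.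
by field; apply/andP.
Qed.

Lemma smooth_tay N f x : smooth (tay N f x).
Proof.
apply: smooth_sum => l; apply: smoothM; last exact: smooth_cst.
by apply: smoothM; [exact: smooth_monomial|exact: smooth_cst].
Qed.

Lemma monomial_at0 (k : mindex d) : monomial k (0 : V) = (k == 0)%:R.
Proof.
have [->|k0] := eqVneq k 0.
  by rewrite /monomial big1// => i _; rewrite midx0 expr0.
have : exists i, k i != 0%N.
  apply/existsP; apply: contraNT k0; rewrite negb_exists => /forallP k0.
  by apply/eqP/ffunP => i; rewrite midx0; apply/eqP; have := k0 i; rewrite negbK.
by case=> i ki; rewrite /monomial (bigD1 i)//= mxE expr0n (negbTE ki) mul0r.
Qed.

Lemma tay_at0 N f x : (0 < N)%N -> tay N f x 0 = f x.
Proof.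
move=> N0; rewrite /tay (bigD1_seq 0)/= ?midx_uniq ?mem_midx ?sdeg0//.
rewrite monomial_at0 eqxx big1 ?addr0 => [|l l0]; last first.
  by rewrite monomial_at0 (negbTE l0) !mul0r.
rewrite (_ : mfact _ = 1%N); last by rewrite /mfact big1// => i _; rewrite midx0.
rewrite divr1 mul1r Dpart_pder (_ : mlist _ = [::])//.
by apply: size0nil; rewrite size_mlist /mdeg big1// => i _; rewrite midx0.
Qed.

(** Strong induction on N: the remainder vanishes at 0 and its partial derivative in direction i is
    the remainder of order N - s i of [partial i f], so that [box_bound] applies. A derivative costs
    mu and an increment is worth rho, both to the power [s i]; only the product rho * mu matters. *)
Lemma taylor_bound N : exists2 C : R, 0 <= C &
  forall f (B mu rho : R) x h, smooth f -> 0 <= B -> 0 <= mu -> 0 <= rho ->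
  rho * mu <= 1 -> (forall i, `|h ord0 i| <= rho ^+ s i) ->
  (forall l, (size l <= N)%N -> forall y, `|pder l f y| <= B * mu ^+ lwt l) ->
  `|f (x + h) - tay N f x h| <= C * B * (rho * mu) ^+ N.
Proof.
elim/ltn_ind: N => N ih.
have [->|N0] := posnP N.
  exists 1 => // f B mu rho x h sf B0 mu0 rho0 _ _ fB.
  rewrite expr0 mulr1 mul1r /tay (_ : midx s 0 = [::]); last first.
    case E : (midx s 0) => [//|l t].
    by have := mem_head l t; rewrite -E mem_midx.
  by rewrite big_nil subr0; have := fB [::] isT (x + h); rewrite /lwt big_nil mulr1.
have Ni i : (N - s i < N)%N by rewrite ltn_subrL s_gt0.
have /choice [C CP] : forall i, exists C : R, 0 <= C /\
  forall f (B mu rho : R) x h, smooth f -> 0 <= B -> 0 <= mu -> 0 <= rho ->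
  rho * mu <= 1 -> (forall i, `|h ord0 i| <= rho ^+ s i) ->
  (forall l, (size l <= N - s i)%N -> forall y, `|pder l f y| <= B * mu ^+ lwt l) ->
  `|f (x + h) - tay (N - s i) f x h| <= C * B * (rho * mu) ^+ (N - s i).
  by move=> i; have [C C0 CP] := ih _ (Ni i); exists C.
exists (\sum_i C i); first by apply: sumr_ge0 => i _; exact: (CP i).1.
move=> f B mu rho x h sf B0 mu0 rho0 rm1 hrho fB.
have rm0 : 0 <= rho * mu by rewrite mulr_ge0.
pose g := fun h => f (x + h) + (-1) * tay N f x h.
have sg : smooth g.
  by apply: smoothD; [exact: smooth_add|apply: smoothZ; exact: smooth_tay].
have g0 : g 0 = 0 by rewrite /g addr0 tay_at0// mulN1r subrr.
have pg i h' : partial i g h' = partial i f (x + h') - tay (N - s i) (partial i f) x h'.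
  rewrite /g partialD; [|exact/smooth_diff/smooth_add|exact/smooth_diff/smoothZ/smooth_tay].
  rewrite partialZ; last exact/smooth_diff/smooth_tay.
  by rewrite partial_tay// mulN1r -[partial i _]/(pder [:: i] _) pder_add.
pose M i := C i * (B * mu ^+ s i) * (rho * mu) ^+ (N - s i).
have M0 i : 0 <= M i.
  by rewrite /M !mulr_ge0 ?exprn_ge0//; exact: (CP i).1.
have := @box_bound _ _ g h M (smooth_diff sg) M0 _.
have -> : f (x + h) - tay N f x h = g h by rewrite /g mulN1r.
rewrite g0 subr0 => bb; apply: (le_trans (bb _)).
  move=> i h' hh'; rewrite pg; apply: (CP i).2 => //.
  - exact: smooth_partial.
  - by rewrite mulr_ge0 ?exprn_ge0.
  - by move=> j; rewrite (le_trans (hh' j)).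
  move=> l lN y; rewrite -pder_rcons (le_trans (fB _ _ _))//.
    by rewrite size_rcons (leq_ltn_trans lN).
  by rewrite /lwt big_rcons/= exprD -mulrA [mu ^+ s i * _]mulrC.
rewrite !mulr_suml; apply: ler_sum => i _.
apply: (@le_trans _ _ (M i * rho ^+ s i)); first by rewrite ler_wpM2l.
(* If s i > N the truncated subtraction makes the exponent exceed N; rho * mu <= 1 absorbs the
   excess. *)
rewrite /M (_ : _ * rho ^+ s i = C i * B * (rho * mu) ^+ (s i + (N - s i))).
  rewrite ler_wpM2l ?mulr_ge0//; first exact: (CP i).1.
  by apply: ler_wiXn2l => //; rewrite -leq_subLR.
rewrite exprD [(rho * mu) ^+ s i]exprMn.
by move: (mu ^+ s i) (rho ^+ s i) (_ ^+ (N - _)) => u v w; ring.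
Qed.

End Taylor.

(** * A smooth partition of unity *)

Section OneVariableSmooth.
Context {R : realType}.
Implicit Types f g : R -> R.

(** Infinite differentiability in one variable is encoded as membership in some class stable under
    derivation, so that no iterated derivative has to be named. *)
Definition der_closed (P : (R -> R) -> Prop) : Prop :=
  forall f, P f -> exists2 f', P f' & forall t : R, is_derive t (1 : R) f (f' t).

Definition smooth1 f : Prop := exists2 P, der_closed P & P f.

Lemma smooth1_der f : smooth1 f -> exists2 f', smooth1 f' &
  forall t : R, is_derive t (1 : R) f (f' t).
Proof. by case=> P cP /cP[f' Pf' df]; exists f' => //; exists P. Qed.

Inductive gen1 : (R -> R) -> Prop :=
| gen1_base f : smooth1 f -> gen1 f
| gen1_cst c : gen1 (fun=> c)
| gen1_add f g : gen1 f -> gen1 g -> gen1 (fun t => f t + g t)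
| gen1_mul f g : gen1 f -> gen1 g -> gen1 (fun t => f t * g t)
| gen1_inv f : gen1 f -> (forall t, f t != 0) -> gen1 (fun t => (f t)^-1)
| gen1_aff a b f : gen1 f -> gen1 (fun t => f (a * t + b)).

Lemma gen1_smooth1 f : gen1 f -> smooth1 f.
Proof.
move=> Gf; exists gen1 => // {Gf} {}f; elim=> {f}.
- by move=> f /smooth1_der[f' sf' df]; exists f' => //; exact: gen1_base.
- by move=> c; exists (fun=> 0); [exact: gen1_cst|move=> t; exact: is_derive_cst].
- move=> f g _ [f' Gf df] _ [g' Gg dg].
  exists (fun t => f' t + g' t); first exact: gen1_add.
  by move=> t; exact: is_deriveD.
- move=> f g Gf [f' Gf' df] Gg [g' Gg' dg].
  exists (fun t => f t * g' t + g t * f' t).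
    by apply: gen1_add; apply: gen1_mul.
  by move=> t; exact: is_deriveM.
- move=> f Gf [f' Gf' df] f0.
  exists (fun t => -1 * ((f t)^-1 * (f t)^-1) * f' t).
    apply: gen1_mul => //; apply: gen1_mul; first exact: gen1_cst.
    by apply: gen1_mul; exact: gen1_inv.
  move=> t; have := is_deriveV (f0 t) (df t).
  by rewrite (_ : _ *: _ = -1 * ((f t)^-1 * (f t)^-1) * f' t)// /GRing.scale /= -invfM mulN1r -expr2.
- move=> a b f Gf [f' Gf' df].
  exists (fun t => a * f' (a * t + b)).
    by apply: gen1_mul; [exact: gen1_cst|exact: gen1_aff].
  move=> t.
  have h : is_derive t (1 : R) (fun t => a * t + b) a.
    have := is_deriveD (is_deriveZ a (is_derive_id t (1 : R))) (is_derive_cst b t (1 : R)).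
    by rewrite addr0 scaler1.
  by have := @is_derive1_comp _ f (fun t => a * t + b) t _ _ (df _) h; rewrite mulrC.
Qed.

Lemma smooth_smooth1 n f (i : 'I_n) : smooth1 f ->
  smooth (fun y : 'rV[R]_n => f (y ord0 i)).
Proof.
move=> sf; apply: (@smooth_coind _ _ (fun g : 'rV[R]_n -> R => exists2 h, smooth1 h &
   exists c, g = fun y => c * h (y ord0 i))); last first.
  by exists f => //; exists 1; apply/funext => y; rewrite mul1r.
move=> _ [h sh [c ->]]; have [h' sh' dh] := smooth1_der sh.
have D (x : 'rV[R]_n) : differentiable (fun y : 'rV[R]_n => h (y ord0 i)) x.
  apply: (@differentiable_comp _ _ _ _ (fun y : 'rV[R]_n => y ord0 i) h).
    exact: differentiable_coord.
  by apply/derivable1_diffP; exact: (@ex_derive _ _ _ _ _ _ _ (dh _)).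
split=> [x|j]; first exact: differentiableZ.
exists h' => //; exists (c * (i == j)%:R); apply/funext => x.
rewrite partialZ// -mulrA; congr (_ * _).
apply: partialE0; under eq_fun do rewrite !mxE eqxx /=.
have h2 : is_derive (0 : R) (1 : R) (fun t => x ord0 i + t * (i == j)%:R) ((i == j)%:R).
  have := is_deriveD (is_derive_cst (x ord0 i) (0 : R) (1 : R))
    (is_deriveZ ((i == j)%:R : R) (is_derive_id (0 : R) (1 : R))).
  rewrite add0r scaler1; apply: is_derive_ext => t /=.
  by rewrite [in RHS]mulrC.
have h3 : is_derive (x ord0 i + 0 * (i == j)%:R) (1 : R) h (h' (x ord0 i)).
  by rewrite mul0r addr0.
by have := @is_derive1_comp _ h (fun t => x ord0 i + t * (i == j)%:R) 0 _ _ h3 h2; rewrite mulrC.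
Qed.

Lemma is_derive0_quad f (C : R) : f 0 = 0 -> (forall t, `|f t| <= C * t ^+ 2) ->
  is_derive (0 : R) (1 : R) f 0.
Proof.
move=> f0 fC.
have C0 : 0 <= C by have := fC 1; rewrite expr1n mulr1; apply: le_trans.
have C1 : 0 < C + 1 by rewrite ltr_wpDl.
have cv : (fun h : R => h^-1 *: (f (h *: (1 : R) + 0) - f 0)) @ 0^' --> (0 : R).
  apply/cvgrPdist_le => e e0; near=> h.
  rewrite sub0r normrN addr0 f0 subr0 scaler1 normrM normfV.
  have h0 : 0 < `|h| by rewrite normr_gt0; near: h; exact: nbhs_dnbhs_neq.
  rewrite ler_pdivrMl//; apply: (le_trans (fC h)).
  rewrite -real_normK ?num_real// expr2 mulrA mulrC ler_pM2l//.
  apply: (@le_trans _ _ ((C + 1) * `|h|)); first by rewrite ler_wpM2r// lerDl.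
  rewrite mulrC -ler_pdivlMr//.
  near: h; apply: dnbhs0_le; exact: divr_gt0.
split; first by apply/cvg_ex; exists 0.
by rewrite /derive; exact/cvg_lim.
Unshelve. all: by end_near. Qed.

Lemma poly_expR_bounded (p : {poly R}) : exists C : R, forall x, 0 <= x ->
  `|p.[x] * expR (- x)| <= C.
Proof.
exists (\sum_(i < size p) `|p`_i| * (i`!%:R)) => x x0.
rewrite horner_coef mulr_suml (le_trans (ler_norm_sum _ _ _))//.
apply: ler_sum => i _; rewrite -mulrA normrM ler_wpM2l//.
rewrite ger0_norm ?mulr_ge0 ?exprn_ge0 ?expR_ge0// expRN ler_pdivrMr ?expR_gt0//.
case: (val i) => [|m].
  by rewrite expr0 fact0 mul1r -expR0 ler_expR.
rewrite mulrC -ler_pdivrMr ?ltr0n ?fact_gt0//.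
by rewrite (le_trans _ (expR_ge1Dxn m x0))// lerDr.
Qed.

(** The family p(1/t) exp(-1/t), extended by 0, is stable under derivation: p is replaced by X^2 (p
    - p'). The case p = 1 is the classical smooth function that is flat at the origin. *)
Definition flat (p : {poly R}) (t : R) : R :=
  if 0 < t then p.[t^-1] * expR (- t^-1) else 0.

Lemma flat_der p (t : R) : is_derive t (1 : R) (flat p) (flat (('X^2) * (p - p^`())) t).
Proof.
have [t0|t0|->] := ltgtP t 0.
- rewrite {2}/flat ltNge ltW//=.
  have := is_derive_cst (0 : R) t (1 : R); apply: near_eq_is_derive.
  near=> u; rewrite /flat /=; case: ifPn => // u0; exfalso.
  have : u < 0 by near: u; exact: lt_nbhsl.
  by rewrite ltNge ltW.
- rewrite {2}/flat t0.
  have tn0 : t != 0 by rewrite gt_eqF.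
  have hi : is_derive t (1 : R) (fun u : R => u^-1) (- t ^- 2).
    have := is_deriveV (f := id) tn0 (is_derive_id t (1 : R)).
    by rewrite scaler1.
  have hn : is_derive t (1 : R) (fun u : R => - u^-1) (t ^- 2).
    by have := is_deriveN hi; rewrite opprK.
  have h1 := @is_derive1_comp _ _ _ _ _ _ (is_derive_poly p t^-1) hi.
  have h2 := @is_derive1_comp _ expR (fun u => - u^-1) t _ _ (is_derive_expR (- t^-1)) hn.
  have := is_deriveM h1 h2.
  rewrite (_ : _ + _ = ('X^2 * (p - p^`())).[t^-1] * expR (- t^-1)); last first.
    by rewrite hornerM hornerD hornerN hornerXn /GRing.scale /= exprVn; ring.
  apply: near_eq_is_derive; near=> u; rewrite /flat /=; suff -> : 0 < u by [].
  by near: u; exact: lt_nbhsr.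
- rewrite {2}/flat ltxx.
  (* Near 0, p(1/u) exp(-1/u) is u^2 times the bounded quantity (p X^2)(1/u) exp(-1/u), hence is
     quadratically small. *)
  have [C HC] := poly_expR_bounded (p * 'X^2).
  apply: (@is_derive0_quad _ C); first by rewrite /flat ltxx.
  move=> u; rewrite /flat; case: ifPn => u0; last first.
    rewrite normr0 mulr_ge0 ?sqr_ge0//.
    by have := HC 0 (lexx _); apply: le_trans.
  have := HC u^-1 (ltW _); rewrite invr_gt0 => /(_ u0).
  rewrite hornerM hornerXn -mulrA mulrCA normrM exprVn ger0_norm ?invr_ge0 ?sqr_ge0//.
  by rewrite mulrC ler_pdivrMr// exprn_gt0.
Unshelve. all: by end_near. Qed.

Lemma flat_smooth1 p : smooth1 (flat p).
Proof.
exists (fun f => exists q, f = flat q); last by exists p.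
move=> _ [q ->]; exists (flat (('X^2) * (q - q^`()))); first by eexists.
by move=> t; exact: flat_der.
Qed.

Let ex := flat 1.

Let ex_ge0 t : 0 <= ex t.
Proof. by rewrite /ex /flat; case: ifP => // _; rewrite hornerC mul1r expR_ge0. Qed.

Let ex_den t : 0 < ex t + ex (1 - t).
Proof.
have [t0|t0] := leP t 0.
  apply: ltr_wpDl => //.
  by rewrite /ex /flat subr_gt0 (le_lt_trans t0)// hornerC mul1r expR_gt0.
by apply: ltr_pwDl => //; rewrite /ex /flat t0 hornerC mul1r expR_gt0.
Qed.

Definition sstep (t : R) : R := ex t / (ex t + ex (1 - t)).

Lemma sstep_smooth1 : smooth1 sstep.
Proof.
apply: gen1_smooth1; apply: gen1_mul; first exact/gen1_base/flat_smooth1.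
apply: gen1_inv; last by move=> t; rewrite gt_eqF.
apply: gen1_add; first exact/gen1_base/flat_smooth1.
rewrite (_ : (fun t => ex (1 - t)) = fun t => ex (-1 * t + 1)).
  exact/gen1_aff/gen1_base/flat_smooth1.
by apply/funext => t; rewrite mulN1r addrC.
Qed.

Lemma sstep_le0 t : t <= 0 -> sstep t = 0.
Proof. by move=> t0; rewrite /sstep {1}/ex /flat ltNge t0/= mul0r. Qed.

Lemma sstep_ge1 t : 1 <= t -> sstep t = 1.
Proof.
move=> t1; rewrite /sstep [ex (1 - t)]/ex /flat ltNge subr_le0 t1/= addr0 divff//.
have t0 : 0 < t := lt_le_trans ltr01 t1.
have e0 : 0 < ex t by rewrite /ex /flat t0 hornerC mul1r expR_gt0.
by rewrite gt_eqF.
Qed.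

(** A difference of consecutive steps: the integer translates telescope to 1. *)
Definition tooth (t : R) : R := sstep (t + 1) - sstep t.

Lemma tooth_smooth1 : smooth1 tooth.
Proof.
apply: gen1_smooth1.
rewrite (_ : tooth = fun t => sstep (1 * t + 1) + -1 * sstep t).
  apply: gen1_add; first exact/gen1_aff/gen1_base/sstep_smooth1.
  by apply: gen1_mul; [exact: gen1_cst|exact/gen1_base/sstep_smooth1].
by apply/funext => t; rewrite mul1r mulN1r.
Qed.

Lemma tooth_supp t : 1 <= `|t| -> tooth t = 0.
Proof.
rewrite /tooth ler_normr => /orP[t1|t1].
  by rewrite !sstep_ge1 ?subrr// ler_wpDr.
by rewrite !sstep_le0 ?subrr//; lra.
Qed.

Lemma tooth_sum (K : nat) (a u : R) : a <= u -> u + 1 <= a + K%:R ->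
  \sum_(k < K) tooth (u - (a + k%:R)) = 1.
Proof.
move=> au uK.
have -> : \sum_(k < K) tooth (u - (a + k%:R)) =
  - \sum_(0 <= k < K) (sstep (u - (a + (k.+1%:R - 1))) - sstep (u - (a + (k%:R - 1)))).
  rewrite big_mkord -sumrN; apply: eq_bigr => k _.
  by rewrite /tooth [RHS]opprB -natr1; congr (sstep _ - sstep _); ring.
rewrite telescope_sumr// opprB sstep_ge1 ?sstep_le0 ?subr0//; first by lra.
by rewrite sub0r; lra.
Qed.

End OneVariableSmooth.

Section Supports.
Context {R : realType} {n : nat}.
Local Notation V := 'rV[R]_n.

Definition rbox (x : V) (rho : 'I_n -> R) : set V :=
  [set y : V | forall i, `|y ord0 i - x ord0 i| <= rho i].

Lemma rbox_compact x rho : compact (rbox x rho).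
Proof.
have h : compact [set v : V | forall i,
    `[x ord0 i - rho i, x ord0 i + rho i]%classic (v ord0 i)].
  exact: (rV_compact (fun i => @segment_compact R _ _)).
rewrite (_ : rbox x rho = [set v : V | forall i,
    `[x ord0 i - rho i, x ord0 i + rho i]%classic (v ord0 i)])//.
apply/seteqP; split => y yb i; have := yb i; rewrite /= in_itv/= ler_norml;
  move=> /andP[? ?]; apply/andP; lra.
Qed.

Lemma rbox_closed x rho : closed (rbox x rho).
Proof. by apply: compact_closed; [exact: norm_hausdorff|exact: rbox_compact]. Qed.

Lemma supported_partial (A : set V) (f : V -> R) i : closed A -> supported_in A f ->
  supported_in A (partial i f).
Proof.
move=> cA fA x; apply: contraNP => nAx; rewrite /partial.
rewrite (@near_eq_derive _ _ _ f (fun=> 0)); first by rewrite derive_cst.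
have : open (~` A) by rewrite openC.
rewrite openE => /(_ x nAx); rewrite /interior; apply: filterS => y nAy.
by apply/eqP; apply: contra_notT nAy; exact: fA.
Qed.

Lemma supported_pder (A : set V) (f : V -> R) l : closed A -> supported_in A f ->
  supported_in A (pder l f).
Proof. by move=> cA fA; elim: l => //= i l; exact: supported_partial. Qed.

Lemma smooth_continuous (f : V -> R) : smooth f -> continuous f.
Proof. by move=> sf x; apply: differentiable_continuous; exact: smooth_diff. Qed.

Lemma supported_bounded (A : set V) (f : V -> R) : compact A -> supported_in A f ->
  continuous f -> exists2 C, 0 <= C & forall x, `|f x| <= C.
Proof.
move=> cA fA df; have cf : {within A, continuous f} by exact: continuous_subspaceT.
have [M [_ MP]] := compact_bounded (continuous_compact cf cA).
have M1 : M < `|M| + 1 by rewrite (le_lt_trans (ler_norm _))// ltrDl.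
exists (`|M| + 1) => [|x]; first by rewrite addr_ge0.
have [->|fx] := eqVneq (f x) 0; first by rewrite normr0 addr_ge0.
by apply: (MP _ M1); exists x => //; exact: fA.
Qed.

Lemma supported_bounded_pder (A : set V) (f : V -> R) N : compact A ->
  supported_in A f -> smooth f -> exists2 C, 0 <= C &
  forall l, (size l <= N)%N -> forall x, `|pder l f x| <= C.
Proof.
move=> cA; have clA : closed A by apply: compact_closed => //; exact: norm_hausdorff.
elim: N f => [|N ih] f fA sf.
  have [C C0 fC] := supported_bounded cA fA (smooth_continuous sf).
  by exists C => // -[|//] _ x; exact: fC.
have [C C0 fC] := supported_bounded cA fA (smooth_continuous sf).
have /choice [D DP] : forall i, exists D : R, 0 <= D /\
    forall l, (size l <= N)%N -> forall x, `|pder l (partial i f) x| <= D.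
  move=> i; have [D D0 DP] := ih _ (@supported_partial _ _ i clA fA) (smooth_partial i sf).
  by exists D.
have D0 : 0 <= \sum_i D i by apply: sumr_ge0 => i _; exact: (DP i).1.
exists (C + \sum_i D i) => [|l]; first exact: addr_ge0.
case/lastP: l => [_ x|l i]; first by rewrite (le_trans (fC x))// lerDl.
rewrite size_rcons ltnS => lN x; rewrite pder_rcons (le_trans ((DP i).2 l lN x))//.
rewrite (bigD1 i)//= addrCA lerDl addr_ge0// sumr_ge0// => j _; exact: (DP j).1.
Qed.

End Supports.

Section Cells.
Context {R : realType} {d : nat} (s : 'I_d -> nat).
Local Notation V := 'rV[R]_d.
Implicit Types (x y : V) (phi : V -> R).

Definition sbox (x : V) (delta : R) : set V := rbox x (fun i => delta ^+ s i).
Definition stot : nat := (\sum_i s i)%N.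

(* phi is a test function adapted to the scale delta around x, of size b. *)
Definition loc (N : nat) (x : V) (delta b : R) (phi : V -> R) : Prop :=
  [/\ smooth phi, supported_in (sbox x delta) phi &
    forall l, (size l <= N)%N -> forall y,
      `|pder l phi y| <= b * (delta^-1) ^+ (stot + lwt s l)].

Definition cell (eps : R) (k : {ffun 'I_d -> int}) (y : V) : R :=
  \prod_i tooth (y ord0 i / eps ^+ s i - (k i)%:~R).

Definition ctr (eps : R) (k : {ffun 'I_d -> int}) : V :=
  \row_i (eps ^+ s i * (k i)%:~R).

Let cell0 (y : V) : R := \prod_i tooth (y ord0 i).

Let cell0_smooth : smooth cell0.
Proof. by apply: smooth_prod => i; exact/smooth_smooth1/tooth_smooth1. Qed.

Lemma cellE eps k : cell eps k =
  fun y => cell0 (aff (fun i => (eps^-1) ^+ s i) (fun i => - (k i)%:~R) y).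
Proof.
apply/funext => y; apply: eq_bigr => i _; rewrite mxE; congr tooth.
by rewrite mulrC exprVn.
Qed.

Lemma cell_smooth eps k : smooth (cell eps k).
Proof. by rewrite cellE; exact: smooth_aff. Qed.

Lemma cell_supp eps k : 0 < eps -> supported_in (sbox (ctr eps k) eps) (cell eps k).
Proof.
move=> e0 y; rewrite /cell prodf_seq_neq0 => /allP yk i.
have := yk i (mem_index_enum _); rewrite implyTb => t0.
have e1 : 0 < eps ^+ s i by rewrite exprn_gt0.
have : `|y ord0 i / eps ^+ s i - (k i)%:~R| <= 1.
  by rewrite leNgt; apply: contraNN t0 => /ltW/tooth_supp ->.
rewrite mxE (_ : _ - _ * _ = (y ord0 i / eps ^+ s i - (k i)%:~R) * eps ^+ s i).
  by rewrite normrM (gtr0_norm e1) => h; rewrite ler_piMl// ltW.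
by field; rewrite gt_eqF.
Qed.

Lemma cell_bound N : exists2 C : R, 0 <= C & forall eps k l, 0 < eps ->
  (size l <= N)%N -> forall y, `|pder l (cell eps k) y| <= C * (eps^-1) ^+ lwt s l.
Proof.
have c0s : supported_in (rbox (0 : V) (fun=> 1)) cell0.
  move=> y; rewrite /cell0 prodf_seq_neq0 => /allP yk i.
  have := yk i (mem_index_enum _); rewrite implyTb mxE subr0 => t0.
  by rewrite leNgt; apply: contraNN t0 => /ltW/tooth_supp ->.
have [C C0 CP] := supported_bounded_pder N (@rbox_compact _ _ _ _) c0s cell0_smooth.
exists C => // eps k l e0 lN y; rewrite cellE pder_aff// normrM mulrC.
apply: ler_pM => //; first exact: CP.
by rewrite -expr_sum ger0_norm// exprn_ge0// invr_ge0 ltW.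
Qed.

(** The factor (eps / delta) ^+ stot s is a change of normalisation: b * delta^-stot equals b * (eps
    / delta)^stot * eps^-stot. Derivatives cost at most 1 / eps, because eps <= delta. *)
Lemma loc_cell N : exists2 C : R, 0 <= C & forall eps delta b x phi k,
  0 < eps -> eps <= delta -> loc N x delta b phi ->
  loc N (ctr eps k) eps (C * b * (eps / delta) ^+ stot) (fun y => phi y * cell eps k y).
Proof.
have [C C0 CP] := cell_bound N.
exists (2 ^+ N * C) => [|eps delta b x phi k e0 ed [sp sup pb]].
  by rewrite mulr_ge0// exprn_ge0.
have d0 : 0 < delta by exact: lt_le_trans ed.
split; first by apply: smoothM => //; exact: cell_smooth.
  by move=> y; rewrite mulf_eq0 negb_or => /andP[_]; exact: cell_supp.
move=> l lN y.
have b0 : 0 <= b.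
  have := pb [::] isT y; rewrite /lwt big_nil addn0 => h.
  by move: (le_trans (normr_ge0 _) h); rewrite pmulr_lge0// exprn_gt0// invr_gt0.
have E l' : \prod_(i <- l') (eps^-1) ^+ s i = (eps^-1) ^+ lwt s l' by rewrite -expr_sum.
have := @pderM_bound _ _ (fun i => (eps^-1) ^+ s i) y l phi (cell eps k)
  (b * (delta^-1) ^+ stot) C sp (cell_smooth _ _) _ _ _.
rewrite E => h; apply: (le_trans (h _ _ _)).
- by move=> i; rewrite exprn_ge0// invr_ge0 ltW.
- move=> l' ll'; rewrite E (le_trans (pb l' (leq_trans ll' lN) y))//.
  rewrite exprD mulrA ler_wpM2l ?mulr_ge0 ?exprn_ge0 ?invr_ge0 ?(ltW d0)//.
  by rewrite lerXn2r ?nnegrE ?invr_ge0 ?(ltW d0) ?(ltW e0)// lef_pV2.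
- by move=> l' ll'; rewrite E CP// (leq_trans ll' lN).
have -> : 2 ^+ N * C * b * (eps / delta) ^+ stot * (eps^-1) ^+ (stot + lwt s l) =
  2 ^+ N * C * b * (delta^-1) ^+ stot * (eps^-1) ^+ lwt s l.
  have u : eps ^+ stot != 0 by rewrite expf_neq0 ?gt_eqF.
  have v : delta ^+ stot != 0 by rewrite expf_neq0 ?gt_eqF.
  rewrite exprD expr_div_n [eps^-1 ^+ stot]exprVn [delta^-1 ^+ stot]exprVn.
  move: u v (eps^-1 ^+ lwt s l) (2 ^+ N); set a := eps ^+ stot; set c := delta ^+ stot.
  by move=> u v w z; field; rewrite u v.
rewrite ler_wpM2r ?exprn_ge0 ?invr_ge0 ?(ltW e0)//.
rewrite [leRHS](_ : _ = 2 ^+ N * (b * (delta^-1) ^+ stot * C)); last by ring.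
rewrite -mulrA ler_wpM2r ?mulr_ge0 ?exprn_ge0 ?invr_ge0 ?(ltW d0)//.
by apply: ler_weXn2l => //; rewrite ler1n.
Qed.

(* Indices of the cells of size eps that may meet the box of size delta. *)
Definition lbase (x : V) (delta eps : R) (i : 'I_d) : int :=
  Num.floor ((x ord0 i - delta ^+ s i) / eps ^+ s i) - 1.
(** The box has width 2 (delta / eps)^(s i) in units of the mesh. Of the added 4, two units pay for
    the roundings by [floor] and [truncn], one for the shift by 1 in [lbase], and one is a margin on
    the right. *)
Definition lnum (delta eps : R) (i : 'I_d) : nat :=
  (Num.truncn (2 * (delta / eps) ^+ s i) + 4)%N.
(** The number of indices depends on the coordinate; they are embedded in a common ordinal type, as
    distributing a product over sums requires. *)
Definition lcells (x : V) (delta eps : R) : seq {ffun 'I_d -> int} :=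
  [seq [ffun i => lbase x delta eps i + (h i)%:Z] |
     h : {ffun 'I_d -> 'I_(\max_i lnum delta eps i)} in
       family (fun i => [pred a : 'I_(\max_i lnum delta eps i) | (a < lnum delta eps i)%N])].

Lemma lcells_uniq x delta eps : uniq (lcells x delta eps).
Proof.
rewrite map_inj_uniq ?enum_uniq// => f g /ffunP fg.
apply/ffunP => i; apply: val_inj; have := fg i; rewrite !ffunE.
by move=> /addrI [].
Qed.

(** In each coordinate 2 q + 4 <= 6 q, where q = (delta / eps)^(s i) is at least 1. *)
Lemma size_lcells x delta eps : 0 < eps -> eps <= delta ->
  (size (lcells x delta eps))%:R <= (\prod_(i < d) 6) * (delta / eps) ^+ stot.
Proof.
move=> e0 ed; have d0 : 0 < delta by exact: lt_le_trans ed.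
have E : size (lcells x delta eps) = (\prod_i lnum delta eps i)%N.
  rewrite size_image -sum1_card.
  rewrite (eq_bigr (fun f : {ffun 'I_d -> 'I_(\max_i lnum delta eps i)} => \prod_(i < d) 1)%N); last first.
    by move=> f _; rewrite big1.
  rewrite -(bigA_distr_big_dep (fun i (a : 'I_(\max_i lnum delta eps i)) =>
    (a < lnum delta eps i)%N) (fun _ _ => 1%N)).
  apply: eq_bigr => i _.
  have le_i : (lnum delta eps i <= \max_i lnum delta eps i)%N by exact: leq_bigmax.
  by rewrite (big_ord_narrow le_i) sum1_card card_ord.
rewrite E natr_prod /stot expr_sum -big_split.
apply: ler_prod => i _; rewrite ler0n/= /lnum natrD.
have r1 : 1 <= (delta / eps) ^+ s i by apply: exprn_ege1; rewrite ler_pdivlMr// mul1r.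
have := truncn_le (2 * (delta / eps) ^+ s i).
rewrite mulr_ge0 ?exprn_ge0 ?divr_ge0 ?(ltW d0) ?(ltW e0)// => h.
lra.
Qed.

Lemma lnum_lb (x : V) delta eps i : 0 < eps -> 0 <= delta ->
  (x ord0 i + delta ^+ s i) / eps ^+ s i + 1 <=
  (lbase x delta eps i)%:~R + (lnum delta eps i)%:R.
Proof.
move=> e0 d0; have e1 : 0 < eps ^+ s i by rewrite exprn_gt0.
rewrite /lbase /lnum natrD intrD /=.
have h1 := floorD1_gt ((x ord0 i - delta ^+ s i) / eps ^+ s i).
have h2 := truncnS_gt (2 * (delta / eps) ^+ s i).
rewrite intrD in h1; rewrite -natr1 in h2; move: h1 h2.
set A := (Num.floor _)%:~R; set B := (Num.truncn _)%:R => h1 h2.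
have : (x ord0 i + delta ^+ s i) / eps ^+ s i =
  (x ord0 i - delta ^+ s i) / eps ^+ s i + 2 * (delta / eps) ^+ s i.
  by rewrite expr_div_n; field; rewrite gt_eqF.
lra.
Qed.

Lemma lbase_ub (x : V) delta eps i :
  (lbase x delta eps i)%:~R + 1 <= (x ord0 i - delta ^+ s i) / eps ^+ s i.
Proof.
rewrite /lbase intrD /= subrK; exact: floor_le_tmp.
Qed.

Lemma mem_lcells x delta eps k : 0 < eps -> 0 <= delta ->
  k \notin lcells x delta eps -> forall y, sbox x delta y -> cell eps k y = 0.
Proof.
move=> e0 d0 kn y xy.
have /existsP [i ki] : [exists i, (k i < lbase x delta eps i) ||
    (lbase x delta eps i + (lnum delta eps i)%:Z <= k i)].
  apply: contraNT kn; rewrite negb_exists => /forallP kk.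
  have kb i : lbase x delta eps i <= k i /\ k i < lbase x delta eps i + (lnum delta eps i)%:Z.
    by have := kk i; rewrite negb_or -leNgt -ltNge => /andP[].
  have hb i : (`|k i - lbase x delta eps i| < \max_i lnum delta eps i)%N.
    apply: leq_trans (leq_bigmax i); rewrite -ltz_nat gez0_abs ?subr_ge0//.
      by rewrite ltrBlDl; exact: (kb i).2.
    exact: (kb i).1.
  apply/mapP; exists [ffun i => Ordinal (hb i)].
    rewrite mem_enum; apply/familyP => i; rewrite ffunE inE /= -ltz_nat gez0_abs ?subr_ge0.
      by rewrite ltrBlDl; exact: (kb i).2.
    exact: (kb i).1.
  apply/ffunP => i; rewrite !ffunE /= gez0_abs ?subr_ge0.
    by rewrite addrCA subrr addr0.
  exact: (kb i).1.
rewrite /cell (bigD1 i)//= tooth_supp ?mul0r//.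
have e1 : 0 < eps ^+ s i by rewrite exprn_gt0.
have := xy i; rewrite ler_norml => /andP[y1 y2].
have u1 : (x ord0 i - delta ^+ s i) / eps ^+ s i <= y ord0 i / eps ^+ s i.
  by rewrite ler_pM2r ?invr_gt0//; lra.
have u2 : y ord0 i / eps ^+ s i <= (x ord0 i + delta ^+ s i) / eps ^+ s i.
  by rewrite ler_pM2r ?invr_gt0//; lra.
have h1 := lnum_lb x i e0 d0; have h2 := lbase_ub x delta eps i.
rewrite ler_normr; case/orP: ki => ki; apply/orP; [left|right].
  have : (k i)%:~R <= (lbase x delta eps i)%:~R :> R by rewrite ler_int ltW.
  lra.
have : (lbase x delta eps i)%:~R + (lnum delta eps i)%:R <= (k i)%:~R :> R.
  by rewrite -[X in _ + X]/((lnum delta eps i)%:Z%:~R) -intrD ler_int.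
lra.
Qed.

Lemma sum_lcells x delta eps y : 0 < eps -> 0 <= delta -> sbox x delta y ->
  \sum_(k <- lcells x delta eps) cell eps k y = 1.
Proof.
move=> e0 d0 xy; rewrite big_image /=.
pose F i (a : 'I_(\max_i lnum delta eps i)) : R := tooth (y ord0 i / eps ^+ s i - ((lbase x delta eps i)%:~R + a%:R)).
rewrite (eq_bigr (fun f : {ffun 'I_d -> 'I_(\max_i lnum delta eps i)} =>
   \prod_i F i (f i))); last first.
  move=> f _; apply: eq_bigr => i _; rewrite /F ffunE intrD; congr tooth.
rewrite -(bigA_distr_big_dep (fun i (a : 'I_(\max_i lnum delta eps i)) =>
    (a < lnum delta eps i)%N) F).
apply: big1 => i _.
have le_i : (lnum delta eps i <= \max_i lnum delta eps i)%N by exact: leq_bigmax.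
rewrite (big_ord_narrow le_i) /F /=.
have e1 : 0 < eps ^+ s i by rewrite exprn_gt0.
have := xy i; rewrite ler_norml => /andP[y1 y2].
have u1 : (x ord0 i - delta ^+ s i) / eps ^+ s i <= y ord0 i / eps ^+ s i.
  by rewrite ler_pM2r ?invr_gt0//; lra.
have u2 : y ord0 i / eps ^+ s i <= (x ord0 i + delta ^+ s i) / eps ^+ s i.
  by rewrite ler_pM2r ?invr_gt0//; lra.
have h1 := lnum_lb x i e0 d0; have h2 := lbase_ub x delta eps i.
apply: tooth_sum; lra.
Qed.

End Cells.

(** * The iterated integral on compactly supported continuous functions *)

Section OneDimIntegral.
Context {R : realType}.
Implicit Types (g : R -> R) (c rho M t : R).
Local Notation mu := (@lebesgue_measure R).

Lemma int1_mkcond g c rho : (forall t, g t != 0 -> `|t - c| <= rho) ->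
  g \_ `[c - rho, c + rho] = g.
Proof.
move=> gA; apply/funext => t; rewrite patchE; case: ifPn => // tA.
apply/esym/eqP; apply: contraNT tA => /gA; rewrite ler_norml => /andP[h1 h2].
by apply/mem_set; rewrite /= in_itv/=; apply/andP; lra.
Qed.

Lemma int1_integrable g c rho : continuous g ->
  (forall t, g t != 0 -> `|t - c| <= rho) -> mu.-integrable setT (EFin \o g).
Proof.
move=> cg gA.
have := @continuous_compact_integrable R g `[c - rho, c + rho] (@segment_compact R _ _)
  (continuous_subspaceT cg).
have mD : measurable (`[c - rho, c + rho]%classic : set (measurableTypeR R)).
  exact: measurable_itv.
move=> /(integrable_mkcond _ mD).1.
rewrite (_ : _ \_ _ = EFin \o g)//; apply/funext => t /=.
rewrite -[in RHS](int1_mkcond gA) !patchE; by case: ifP.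
Qed.

Lemma int1_bound g c rho M : continuous g -> 0 <= rho ->
  (forall t, g t != 0 -> `|t - c| <= rho) -> (forall t, `|g t| <= M) ->
  `|\int[mu]_t g t| <= M * (2 * rho).
Proof.
move=> cg rho0 gA gM.
have mD : measurable (`[c - rho, c + rho]%classic : set (measurableTypeR R)).
  exact: measurable_itv.
have cn : continuous (fun t => `|g t|).
  by move=> t; apply: continuous_comp; [exact: cg|exact: norm_continuous].
rewrite (le_trans (le_normr_Rintegral _ _))//; first exact: int1_integrable gA.
have sA t : `|g t| != 0 -> `|t - c| <= rho by rewrite normr_eq0; exact: gA.
rewrite -(int1_mkcond sA) -Rintegral_mkcond.
apply: (@le_trans _ _ (\int[mu]_(t in `[c - rho, c + rho]) M)).
  apply: le_Rintegral => //.
  - apply: (@continuous_compact_integrable R (fun t => `|g t|)); first exact: segment_compact.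
    exact: continuous_subspaceT.
  - apply: (@continuous_compact_integrable R (fun=> M)); first exact: segment_compact.
    by apply: continuous_subspaceT => t; exact: cvg_cst.
rewrite (Rintegral_cst _ mD).
have -> : fine (mu `[c - rho, c + rho]) = fine (if ((c - rho)%:E < (c + rho)%:E)%E then ((c + rho)%:E - (c - rho)%:E)%E else 0%E).
  by congr fine; exact: lebesgue_measure_itv.
case: ifPn => [_|h]; first by rewrite -EFinB /= ler_wpM2l ?(le_trans _ (gM 0))//; lra.
by rewrite /= mulr0 mulr_ge0 ?(le_trans _ (gM 0))// mulr_ge0.
Qed.

Lemma int1_lin g h (a : R) c rho : continuous g -> continuous h ->
  (forall t, g t != 0 -> `|t - c| <= rho) -> (forall t, h t != 0 -> `|t - c| <= rho) ->
  \int[mu]_t (a * g t + h t) = a * \int[mu]_t g t + \int[mu]_t h t.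
Proof.
move=> cg ch gA hA.
have ig := int1_integrable cg gA; have ih := int1_integrable ch hA.
rewrite RintegralD//; first by rewrite RintegralZl.
apply: (@int1_integrable _ c rho).
  by move=> t; apply: cvgM; [exact: cvg_cst|exact: cg].
by move=> t; rewrite mulf_eq0 negb_or => /andP[_]; exact: gA.
Qed.

Lemma int1_deriv (G g : R -> R) c rho : continuous g -> 0 <= rho ->
  (forall t, g t != 0 -> `|t - c| <= rho) -> (forall t, G t != 0 -> `|t - c| <= rho) ->
  (forall t : R, is_derive t (1 : R) G (g t)) ->
  \int[mu]_t g t = 0.
Proof.
move=> cg rho0 gA GA dG.
(* The segment is widened by 1 so that G vanishes at its ends, where the fundamental theorem of
   calculus evaluates it. *)
have gA' t : g t != 0 -> `|t - c| <= rho + 1 by move=> /gA h; rewrite (le_trans h)// lerDl.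
rewrite -(int1_mkcond gA') -Rintegral_mkcond /Rintegral.
have cG t : {for t, continuous G}.
  by apply: differentiable_continuous; apply/derivable1_diffP; exact: (@ex_derive _ _ _ _ _ _ _ (dG t)).
have GZ t : rho < `|t - c| -> G t = 0.
  by move=> h; apply/eqP; apply: contraTT h => /GA; rewrite -leNgt.
rewrite (@continuous_FTC2 _ g G); last first.
- by move=> t _; rewrite derive1E; exact: (@derive_val _ _ _ _ _ _ _ (dG t)).
- split.
  + by move=> t _; exact: (@ex_derive _ _ _ _ _ _ _ (dG t)).
  + exact/cvg_at_right_filter/cG.
  + exact/cvg_at_left_filter/cG.
- exact: continuous_subspaceT.
- lra.
rewrite !GZ; first by rewrite -EFinB subrr.
  rewrite (_ : c - (rho + 1) - c = - (rho + 1)); last by ring.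
  by rewrite normrN ger0_norm; lra.
rewrite (_ : c + (rho + 1) - c = rho + 1); last by ring.
by rewrite ger0_norm; lra.
Qed.

End OneDimIntegral.

Section DerivativeTools.
Context {R : realType}.

Lemma is_derive_of (G : R -> R) (t v : R) :
  (forall e : R, 0 < e -> exists2 eta : R, 0 < eta &
     forall h, `|h| <= eta -> `|G (t + h) - G t - h * v| <= e * `|h|) ->
  is_derive t (1 : R) G v.
Proof.
move=> H.
have cv : (fun h : R => h^-1 *: (G (h *: (1 : R) + t) - G t)) @ 0^' --> v.
  apply/cvgrPdist_le => e e0; have [eta eta0 He] := H _ e0; near=> h.
  have h0 : h != 0 by near: h; exact: nbhs_dnbhs_neq.
  have hn : 0 < `|h| by rewrite normr_gt0.
  have hh : `|h| <= eta by near: h; exact: dnbhs0_le.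
  have -> : v - h^-1 *: (G (h *: (1 : R) + t) - G t) = - ((G (t + h) - G t - h * v) / h).
    rewrite scaler1 [h + t]addrC /GRing.scale /=.
    by move: (G (t + h)) (G t) => A B; field.
  by rewrite normrN normrM normfV ler_pdivrMr// He.
split; first by apply/cvg_ex; exists v.
by rewrite /derive; exact/cvg_lim.
Unshelve. all: by end_near. Qed.

Lemma is_derive_shift (F : R -> R) (u v : R) :
  is_derive (0 : R) (1 : R) (fun w => F (u + w)) v -> is_derive u (1 : R) F v.
Proof.
move=> h.
have h2 : is_derive u (1 : R) (fun w => w - u) 1.
  have := is_deriveB (is_derive_id u (1 : R)) (is_derive_cst u u (1 : R)).
  by rewrite subr0.
have h3 : is_derive (u - u) (1 : R) (fun w => F (u + w)) v by rewrite subrr.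
have := @is_derive1_comp _ (fun w => F (u + w)) (fun w => w - u) u _ _ h3 h2.
by rewrite mulr1; apply: is_derive_ext => w /=; rewrite addrCA subrr addr0.
Qed.

End DerivativeTools.

Section IteratedIntegral.
Context {R : realType}.

(** Uniform continuity is what makes an inner integral continuous in the outer variable; measured
    coordinate by coordinate, it passes to sections at once. *)
Definition ucont (n : nat) (f : 'rV[R]_n -> R) : Prop :=
  forall e : R, 0 < e -> exists2 eta : R, 0 < eta &
    forall x y : 'rV[R]_n, (forall i, `|x ord0 i - y ord0 i| <= eta) -> `|f x - f y| <= e.

Definition cpt (n : nat) (f : 'rV[R]_n -> R) : Prop :=
  ucont f /\ exists x rho, (forall i, 0 <= rho i) /\ supported_in (rbox x rho) f.

Lemma ucontD n (f g : 'rV[R]_n -> R) : ucont f -> ucont g -> ucont (fun x => f x + g x).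
Proof.
move=> uf ug e e0; have e2 : 0 < e / 2 by rewrite divr_gt0.
have [r r0 fr] := uf _ e2; have [r' r'0 gr] := ug _ e2.
exists (Num.min r r'); first by rewrite lt_min r0.
move=> x y xy; rewrite opprD addrACA (splitr e) (le_trans (ler_normD _ _))// lerD//.
  by apply: fr => i; rewrite (le_trans (xy i))// ge_min lexx.
by apply: gr => i; rewrite (le_trans (xy i))// ge_min lexx orbT.
Qed.

Lemma ucontM n (f g : 'rV[R]_n -> R) (A B : R) : ucont f -> ucont g ->
  (forall x, `|f x| <= A) -> (forall x, `|g x| <= B) -> ucont (fun x => f x * g x).
Proof.
move=> uf ug fA gB e e0.
have A0 : 0 <= A by exact: le_trans (fA 0).
have B0 : 0 <= B by exact: le_trans (gB 0).
have e2 : 0 < e / 2 / (A + B + 1) by rewrite !divr_gt0//; lra.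
have [r r0 fr] := uf _ e2; have [r' r'0 gr] := ug _ e2.
exists (Num.min r r'); first by rewrite lt_min r0.
move=> x y xy; rewrite (_ : _ - _ = f x * (g x - g y) + (f x - f y) * g y); last by ring.
have h1 : `|g x - g y| <= e / 2 / (A + B + 1).
  by apply: gr => i; rewrite (le_trans (xy i))// ge_min lexx orbT.
have h2 : `|f x - f y| <= e / 2 / (A + B + 1).
  by apply: fr => i; rewrite (le_trans (xy i))// ge_min lexx.
rewrite (le_trans (ler_normD _ _))// !normrM.
apply: (@le_trans _ _ (A * (e / 2 / (A + B + 1)) + (e / 2 / (A + B + 1)) * B)).
  by rewrite lerD// ler_pM.
rewrite [X in X + _]mulrC -mulrDr mulrAC ler_pdivrMr; last by lra.
by rewrite -mulrA ler_wpM2l ?ltW//; nra.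
Qed.

Lemma ucontZ n (f : 'rV[R]_n -> R) (c : R) : ucont f -> ucont (fun x => c * f x).
Proof.
move=> uf e e0; have e2 : 0 < e / (`|c| + 1) by rewrite divr_gt0// ltr_wpDl.
have [r r0 fr] := uf _ e2; exists r => // x y xy.
rewrite -mulrBr normrM (le_trans (ler_wpM2l (normr_ge0 _) (fr _ _ xy)))//.
rewrite mulrC mulrAC ler_pdivrMr; last by rewrite ltr_wpDl.
by rewrite ler_wpM2l ?lerDl// ltW.
Qed.

Lemma rbox_join n (x x' : 'rV[R]_n) rho rho' : (forall i, 0 <= rho i) -> (forall i, 0 <= rho' i) ->
  exists2 r : 'I_n -> R, forall i, 0 <= r i & rbox x rho `<=` rbox 0 r /\ rbox x' rho' `<=` rbox 0 r.
Proof.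
move=> r0 r'0; exists (fun i => `|x ord0 i| + rho i + (`|x' ord0 i| + rho' i)).
  by move=> i; rewrite !addr_ge0.
split=> y yb i; rewrite mxE subr0.
  rewrite -[y ord0 i](subrK (x ord0 i)) (le_trans (ler_normD _ _))//.
  by have := yb i; have := normr_ge0 (x' ord0 i); have := r'0 i; lra.
rewrite -[y ord0 i](subrK (x' ord0 i)) (le_trans (ler_normD _ _))//.
by have := yb i; have := normr_ge0 (x ord0 i); have := r0 i; lra.
Qed.

Lemma cpt_common n (f g : 'rV[R]_n -> R) : cpt f -> cpt g ->
  exists r, [/\ forall i, 0 <= r i, supported_in (rbox 0 r) f & supported_in (rbox 0 r) g].
Proof.
move=> [_ [x [rho [r0 fx]]]] [_ [x' [rho' [r'0 gx]]]].
have [r r1 [h1 h2]] := rbox_join x x' r0 r'0.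
by exists r; split => // y; [move=> /fx/h1|move=> /gx/h2].
Qed.

Lemma cpt_lin n (a : R) (f g : 'rV[R]_n -> R) : cpt f -> cpt g -> cpt (fun x => a * f x + g x).
Proof.
move=> cf cg; split.
  by apply: ucontD; [apply: ucontZ; exact: cf.1|exact: cg.1].
have [r [r0 fr gr]] := cpt_common cf cg; exists 0, r; split=> // x.
have [/eqP|/fr//] := boolP (f x == 0); rewrite -/(f x) => ->.
by rewrite mulr0 add0r; exact: gr.
Qed.

Definition sec (m : nat) (t : R) (v : 'rV[R]_m) : 'rV[R]_(1 + m) := row_mx (scalar_mx t : 'rV_1) v.

Lemma secEl m t (v : 'rV[R]_m) i : sec t v ord0 (lshift m i) = t.
Proof.
rewrite /sec row_mxEl mxE; case: eqP => [_|]; first by rewrite mulr1n.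
by rewrite !ord1.
Qed.

Lemma secEr m t (v : 'rV[R]_m) i : sec t v ord0 (rshift 1 i) = v ord0 i.
Proof. by rewrite /sec row_mxEr. Qed.

Lemma sec_line_l m t u (v : 'rV[R]_m) :
  sec t v + u *: delta_mx ord0 (lshift m (ord0 : 'I_1)) = sec (t + u) v.
Proof.
rewrite /sec delta_mx_lshift scale_row_mx add_row_mx scaler0 addr0; congr row_mx.
by apply/rowP => k; rewrite !mxE (ord1 k) !eqxx !mulr1n mulr1.
Qed.

Lemma sec_line_r m t u (v : 'rV[R]_m) j :
  sec t v + u *: delta_mx ord0 (rshift 1 j) = sec t (v + u *: delta_mx ord0 j).
Proof. by rewrite /sec delta_mx_rshift scale_row_mx add_row_mx scaler0 addr0. Qed.

Lemma cpt_sec m (f : 'rV[R]_(1 + m) -> R) t : cpt f -> cpt (fun v => f (sec t v)).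
Proof.
move=> [uf [x [rho [r0 fx]]]]; split.
  move=> e /uf[eta eta0 H]; exists eta => // v w vw; apply: H => i.
  by case: (split_ordP i) => j ->; rewrite ?secEl ?secEr ?subrr ?normr0 ?(ltW eta0).
exists (\row_i x ord0 (rshift 1 i)), (fun i => rho (rshift 1 i)); split=> // v /fx h i.
by have := h (rshift 1 i); rewrite secEr mxE.
Qed.

Lemma integral_rVS m (f : 'rV[R]_m.+1 -> R) :
  integral_rV f = \int[@lebesgue_measure R]_t integral_rV (fun v => f (sec t v)).
Proof. by []. Qed.

(** The bound and linearity are proved together by induction on the dimension: in dimension m.+1
    both require the inner integral to be continuous in the outer variable, which follows from both
    in dimension m. *)
Let P (n : nat) := (forall (f : 'rV[R]_n -> R) x rho M, cpt f -> (forall i, 0 <= rho i) ->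
    supported_in (rbox x rho) f -> (forall y, `|f y| <= M) ->
    `|integral_rV f| <= M * \prod_i (2 * rho i)) /\
  (forall (a : R) (f g : 'rV[R]_n -> R), cpt f -> cpt g ->
    integral_rV (fun x => a * f x + g x) = a * integral_rV f + integral_rV g).

Let int0 n : P n -> integral_rV (fun _ : 'rV[R]_n => 0) = 0.
Proof.
move=> [Pb _]; apply/eqP; rewrite -normr_le0.
have := Pb (fun=> 0) 0 (fun=> 0) 0; rewrite mul0r; apply => //.
- split; first by move=> e e0; exists 1 => // *; rewrite subrr normr0 ltW.
  by exists 0, (fun=> 0); split => // x; rewrite eqxx.
- by move=> x; rewrite eqxx.
- by move=> x; rewrite normr0.
Qed.

Let inner m (f : 'rV[R]_(1 + m) -> R) x rho : P m -> cpt f -> (forall i, 0 <= rho i) ->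
    supported_in (rbox x rho) f ->
  continuous (fun t => integral_rV (fun v => f (sec t v))) /\
  (forall t, integral_rV (fun v => f (sec t v)) != 0 ->
     `|t - x ord0 (lshift m ord0)| <= rho (lshift m ord0)).
Proof.
move=> Pm cf r0 fx; split; last first.
  move=> t; apply: contraNT; rewrite -ltNge => ht; apply/eqP.
  rewrite -[RHS](int0 Pm); congr integral_rV; apply/funext => v.
  apply/eqP; apply: contraTT ht => /fx/(_ (lshift m ord0)).
  by rewrite secEl -leNgt.
pose V := \prod_(i < m) (2 * rho (rshift 1 i)).
have V0 : 0 <= V by apply: prodr_ge0 => i _; rewrite mulr_ge0.
have [uf _] := cf.
move=> t; apply/cvgrPdist_le => e e0.
have e1 : 0 < e / (V + 1) by rewrite divr_gt0// ltr_wpDl.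
have [eta eta0 H] := uf _ e1.
have nt : \forall u \near t, `|t - u| <= eta.
  by apply/nbhs_normP; exists eta => // w /= /ltW.
near=> u; have tu : `|t - u| <= eta by near: u.
have -> : integral_rV (fun v => f (sec t v)) - integral_rV (fun v => f (sec u v)) =
   integral_rV (fun v => -1 * f (sec u v) + f (sec t v)).
  by rewrite Pm.2; [rewrite mulN1r addrC|exact: cpt_sec|exact: cpt_sec].
apply: (@le_trans _ _ (e / (V + 1) * V)).
  apply: (Pm.1 _ (\row_i x ord0 (rshift 1 i)) (fun i => rho (rshift 1 i))) => //.
  - by apply: cpt_lin; exact: cpt_sec.
  - move=> v; have [e2|/fx h _ i] := eqVneq (f (sec t v)) 0; last first.
      by have := h (rshift 1 i); rewrite secEr mxE.
    rewrite e2 addr0 mulf_eq0 negb_or => /andP[_ /fx h] i.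
    by have := h (rshift 1 i); rewrite secEr mxE.
  - move=> v; rewrite mulN1r addrC; apply: H => i.
    case: (split_ordP i) => j ->; rewrite ?secEl ?secEr ?subrr ?normr0 ?(ltW eta0)//.
rewrite mulrAC ler_pdivrMr; last by rewrite ltr_wpDl.
by rewrite ler_wpM2l ?lerDl// ltW.
Unshelve. all: by end_near. Qed.

Let PP n : P n.
Proof.
elim: n => [|m Pm].
  split=> [f x rho M _ _ _ fM|a f g _ _] /=; last by [].
  by rewrite big_ord0 mulr1.
split=> [f x rho M cf r0 fx fM|a f g cf cg].
  have [ci si] := inner Pm cf r0 fx.
  rewrite integral_rVS; apply: (le_trans (int1_bound ci (r0 _) si (M := M * \prod_(i < m) (2 * rho (rshift 1 i))) _)).
    move=> t; apply: (Pm.1 _ (\row_i x ord0 (rshift 1 i))) => //; first exact: cpt_sec.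
    by move=> v /fx h i; have := h (rshift 1 i); rewrite secEr mxE.
  have e0 : lshift m (ord0 : 'I_1) = ord0 :> 'I_(1 + m) by exact: val_inj.
  rewrite e0 big_ord_recl (eq_bigr (fun i : 'I_m => 2 * rho (lift ord0 i))); last first.
    by move=> i _; congr (_ * rho _); exact: val_inj.
  by rewrite le_eqVlt; apply/orP; left; apply/eqP; rewrite /=; ring.
have [r [r0 fr gr]] := cpt_common cf cg.
have [ci si] := inner Pm cf r0 fr; have [ci' si'] := inner Pm cg r0 gr.
rewrite !integral_rVS -(int1_lin a ci ci' si si').
by apply: eq_Rintegral => t _; rewrite Pm.2//; exact: cpt_sec.
Qed.

Lemma integral_bound n (f : 'rV[R]_n -> R) x rho M : cpt f -> (forall i, 0 <= rho i) ->
    supported_in (rbox x rho) f -> (forall y, `|f y| <= M) ->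
    `|integral_rV f| <= M * \prod_i (2 * rho i).
Proof. exact: (PP n).1. Qed.

Lemma integral_lin n (a : R) (f g : 'rV[R]_n -> R) : cpt f -> cpt g ->
    integral_rV (fun x => a * f x + g x) = a * integral_rV f + integral_rV g.
Proof. exact: (PP n).2. Qed.

Lemma integral0 n : integral_rV (fun _ : 'rV[R]_n => 0) = 0.
Proof. exact: int0 (PP n). Qed.

(** If i is the first coordinate, the inner integral is differentiated under the sign and
    [int1_deriv] concludes; otherwise the inner integral already vanishes, by induction. *)
Lemma integral_partial n i (f g : 'rV[R]_n -> R) x rho : cpt f -> cpt g ->
  (forall i, 0 <= rho i) -> supported_in (rbox x rho) f -> supported_in (rbox x rho) g ->
  (forall y, is_derive (0 : R) (1 : R) (fun t => f (y + t *: delta_mx ord0 i)) (g y)) ->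
  integral_rV g = 0.
Proof.
elim: n i f g x rho => [[//]|m ih] i f g x rho cf cg r0 fx gx dfg.
rewrite integral_rVS; case: (@split_ordP 1 m i) => j ij; last first.
  rewrite (_ : (fun t => integral_rV _) = fun=> 0).
    by rewrite Rintegral_cst// mul0r.
  apply/funext => t.
  apply: (ih j (fun v => f (sec t v)) _ (\row_i x ord0 (rshift 1 i)) (fun i => rho (rshift 1 i))) => //; try exact: cpt_sec.
  - by move=> v /fx h k; have := h (rshift 1 k); rewrite secEr mxE.
  - by move=> v /gx h k; have := h (rshift 1 k); rewrite secEr mxE.
  move=> v; have := dfg (sec t v); apply: is_derive_ext => u /=; congr f.
  by rewrite ij -sec_line_r.
have {}ij : i = lshift m (ord0 : 'I_1) by rewrite ij (ord1 j).
have [cgi sgi] := inner (PP m) cg r0 gx; have [_ sfi] := inner (PP m) cf r0 fx.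
apply: (int1_deriv cgi (r0 _) sgi sfi) => t.
apply: is_derive_of => e e0.
pose V := \prod_(k < m) (2 * rho (rshift 1 k)).
have V0 : 0 <= V by apply: prodr_ge0 => k _; rewrite mulr_ge0.
have e1 : 0 < e / (V + 1) by rewrite divr_gt0// ltr_wpDl.
have [ug _] := cg; have [eta eta0 H] := ug _ e1.
exists eta => // h heta.
have dl u v : is_derive u (1 : R) (fun u => f (sec (t + u) v)) (g (sec (t + u) v)).
  apply: is_derive_shift; have := dfg (sec (t + u) v); apply: is_derive_ext => w /=.
  by congr f; rewrite ij sec_line_l addrA.
(* First-order expansion in the outer variable, uniform in v by the uniform continuity of g;
   integrating it over v differentiates the inner integral. *)
have B v : `|f (sec (t + h) v) - f (sec t v) - h * g (sec t v)| <= e / (V + 1) * `|h|.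
  have d2 u : is_derive u (1 : R) (fun u => f (sec (t + u) v) - u * g (sec t v))
      (g (sec (t + u) v) - g (sec t v)).
    apply: is_deriveB; have := is_deriveZ (g (sec t v)) (is_derive_id u (1 : R)).
    rewrite scaler1; apply: is_derive_ext => w /=; exact: mulrC.
  have := mvt_bound (h := h) d2 (ltW e1) _.
  rewrite addr0 mul0r subr0 addrAC; apply => u uh; apply: H => k.
  case: (@split_ordP 1 m k) => k' ->; rewrite ?secEl ?secEr ?subrr ?normr0 ?(ltW eta0)//.
  by rewrite addrAC subrr add0r (le_trans uh).
have -> : integral_rV (fun v => f (sec (t + h) v)) - integral_rV (fun v => f (sec t v)) -
    h * integral_rV (fun v => g (sec t v)) = integral_rV (fun v => - h * g (sec t v) +
      (-1 * f (sec t v) + f (sec (t + h) v))).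
  rewrite integral_lin; [|exact: cpt_sec|by apply: cpt_lin; exact: cpt_sec].
  by rewrite integral_lin; [ring|exact: cpt_sec|exact: cpt_sec].
apply: (@le_trans _ _ (e / (V + 1) * `|h| * V)).
  apply: (@integral_bound _ _ (\row_i x ord0 (rshift 1 i)) (fun i => rho (rshift 1 i))) => //.
  - by do 2?[apply: cpt_lin]; exact: cpt_sec.
  - have Z F (v : 'rV[R]_m) : supported_in (rbox x rho) F -> (exists k, rho (rshift 1 k) < `|v ord0 k - (\row_i x ord0 (rshift 1 i) : 'rV_m) ord0 k|) -> forall w : R, F (sec w v) = 0.
      move=> Fx [k]; rewrite mxE => hk w; apply/eqP; apply: contraTT hk => /Fx /(_ (rshift 1 k)).
      by rewrite secEr -leNgt.
    move=> v; apply: contraNP => /existsNP[k /negP]; rewrite -ltNge => hk.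
    by rewrite !(Z f v fx (ex_intro _ k hk)) (Z g v gx (ex_intro _ k hk)) !mulr0 !addr0.
  - move=> v; have := B v; rewrite (_ : _ - _ - _ = - h * g (sec t v) + (-1 * f (sec t v) + f (sec (t + h) v)))//; ring.
rewrite (mulrAC (e / (V + 1))) ler_wpM2r// (mulrAC e) ler_pdivrMr; last by rewrite ltr_wpDl.
by rewrite ler_wpM2l ?lerDl// ltW.
Qed.

Lemma coord_norm n (x : 'rV[R]_n) i : `|x ord0 i| <= `|x|.
Proof.
rewrite [leRHS]mx_normrE.
by rewrite (le_trans _ (le_bigmax _ _ (ord0, i)))//=.
Qed.

Lemma ucont_continuous n (f : 'rV[R]_n -> R) : ucont f -> continuous f.
Proof.
move=> uf x A /nbhs_normP[e /= e0 eA].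
have [r r0 H] := uf (e / 2) (divr_gt0 e0 (ltr0n _ 2)).
suff : nbhs x (f @^-1` A) by [].
apply/(@nbhs_normP R 'rV[R]_n x); exists r => // y /= xy; apply: eA => /=.
apply: (@le_lt_trans _ _ (e / 2)); last by lra.
apply: H => i; have := coord_norm (x - y) i; rewrite !mxE => h.
by rewrite (le_trans h)// ltW.
Qed.

Lemma cpt_bounded n (f : 'rV[R]_n -> R) : cpt f -> exists2 A, 0 <= A & forall x, `|f x| <= A.
Proof.
move=> [uf [x [rho [_ fx]]]].
exact: (supported_bounded (@rbox_compact _ _ x rho) fx (ucont_continuous uf)).
Qed.

Lemma cptM n (f g : 'rV[R]_n -> R) : cpt f -> ucont g -> (exists B, forall x, `|g x| <= B) ->
  cpt (fun x => f x * g x).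
Proof.
move=> cf ug [B gB]; have [A _ fA] := cpt_bounded cf; have [uf [x [rho [r0 fx]]]] := cf.
split; first exact: ucontM uf ug fA gB.
by exists x, rho; split => // y; rewrite mulf_eq0 negb_or => /andP[/fx].
Qed.

Lemma cpt0 n : cpt (fun _ : 'rV[R]_n => 0).
Proof.
split; first by move=> e e0; exists 1 => // *; rewrite subrr normr0 ltW.
by exists 0, (fun=> 0); split => // x; rewrite eqxx.
Qed.

Lemma cptZ n (c : R) (f : 'rV[R]_n -> R) : cpt f -> cpt (fun x => c * f x).
Proof.
by move=> cf; have := cpt_lin c cf (cpt0 n); under eq_fun do rewrite addr0.
Qed.

Lemma cptD n (f g : 'rV[R]_n -> R) : cpt f -> cpt g -> cpt (fun x => f x + g x).
Proof.
by move=> cf cg; have := cpt_lin 1 cf cg; under eq_fun do rewrite mul1r.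
Qed.

Lemma integralZ n (c : R) (f : 'rV[R]_n -> R) : cpt f ->
  integral_rV (fun x => c * f x) = c * integral_rV f.
Proof.
move=> cf; have := integral_lin c cf (cpt0 n); rewrite integral0 addr0 => <-.
by congr integral_rV; apply/funext => x; rewrite addr0.
Qed.

Lemma integralD n (f g : 'rV[R]_n -> R) : cpt f -> cpt g ->
  integral_rV (fun x => f x + g x) = integral_rV f + integral_rV g.
Proof.
move=> cf cg; have := integral_lin 1 cf cg; rewrite mul1r => <-.
by congr integral_rV; apply/funext => x; rewrite mul1r.
Qed.

Lemma cpt_sum n (I : Type) (r : seq I) (F : I -> 'rV[R]_n -> R) :
  (forall k, cpt (F k)) -> cpt (fun x => \sum_(k <- r) F k x).
Proof.
move=> cF; elim: r => [|k r ih].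
  by under eq_fun do rewrite big_nil; exact: cpt0.
by under eq_fun do rewrite big_cons; exact: cptD.
Qed.

Lemma integral_sum n (I : Type) (r : seq I) (F : I -> 'rV[R]_n -> R) :
  (forall k, cpt (F k)) ->
  integral_rV (fun x => \sum_(k <- r) F k x) = \sum_(k <- r) integral_rV (F k).
Proof.
move=> cF; elim: r => [|k r ih].
  by under eq_fun do rewrite big_nil; rewrite integral0 big_nil.
by under eq_fun do rewrite big_cons; rewrite integralD ?ih ?big_cons//; exact: cpt_sum.
Qed.

Lemma lip_smooth n (f : 'rV[R]_n -> R) (C : R) (x y : 'rV[R]_n) (eta : R) : smooth f -> 0 <= C ->
  (forall i z, `|partial i f z| <= C) -> (forall i, `|x ord0 i - y ord0 i| <= eta) ->
  `|f x - f y| <= n%:R * C * eta.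
Proof.
move=> sf C0 fC xy.
have := @box_bound _ _ (fun h => f (y + h)) (x - y) (fun=> C) _ (fun=> C0) _.
rewrite addr0 [y + (x - y)]addrC subrK => h; apply: (le_trans (h _ _)).
- exact/smooth_diff/smooth_add.
- by move=> i h' _; rewrite -[partial i _]/(pder [:: i] _) pder_add//; exact: fC.
apply: (@le_trans _ _ (\sum_(i < n) C * eta)); last by rewrite sumr_const card_ord -[X in X <= _]mulr_natl mulrA.
by apply: ler_sum => i _; rewrite ler_wpM2l// !mxE.
Qed.

Lemma smooth_cpt n (f : 'rV[R]_n -> R) x rho : smooth f -> (forall i, 0 <= rho i) ->
  supported_in (rbox x rho) f -> cpt f.
Proof.
move=> sf r0 fx; split; last by exists x, rho.
have [C C0 fC] := supported_bounded_pder 1 (@rbox_compact _ _ x rho) fx sf.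
move=> e e0; have D0 : 0 < n%:R * C + 1 by rewrite ltr_wpDl// mulr_ge0.
exists (e / (n%:R * C + 1)) => [|y z yz]; first by rewrite divr_gt0.
rewrite (le_trans (lip_smooth sf C0 _ yz))//; first by move=> i w; exact: (fC [:: i]).
by rewrite mulrA ler_pdivrMr// mulrC ler_wpM2l ?lerDl// ltW.
Qed.

Lemma integral_partial0 n i (f : 'rV[R]_n -> R) x rho : smooth f -> (forall i, 0 <= rho i) ->
  supported_in (rbox x rho) f -> integral_rV (partial i f) = 0.
Proof.
move=> sf r0 fx.
have gx : supported_in (rbox x rho) (partial i f).
  exact: supported_partial (@rbox_closed _ _ _ _) fx.
apply: (integral_partial (i := i) (smooth_cpt sf r0 fx) _ r0 fx gx).
  exact: smooth_cpt (smooth_partial i sf) r0 gx.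
by move=> y; exact/is_derive_line0/smooth_diff.
Qed.

End IteratedIntegral.

(** * Riemann sums over the partition of unity *)

Section RiemannSums.
Context {R : realType} {d : nat} (s : 'I_d -> nat).
Local Notation V := 'rV[R]_d.

Definition wcell (eps : R) (k : {ffun 'I_d -> int}) : R := integral_rV (cell s eps k).

Lemma cell_cpt (eps : R) k : 0 < eps -> cpt (cell s eps k).
Proof.
move=> e0; apply: (@smooth_cpt _ _ _ (ctr s eps k) (fun i => eps ^+ s i)).
- exact: cell_smooth.
- by move=> i; rewrite exprn_ge0// ltW.
- exact: cell_supp.
Qed.

(** The error is omega times the number of cells, of order (delta / eps)^stot, times the volume of a
    cell, of order eps^stot: the mesh cancels. *)
Lemma riemann : exists2 C : R, 0 <= C & forall (f : V -> R) x (delta eps omega : R),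
  cpt f -> supported_in (sbox s x delta) f -> 0 < eps -> eps <= delta -> 0 <= omega ->
  (forall k y, sbox s (ctr s eps k) eps y -> `|f y - f (ctr s eps k)| <= omega) ->
  `|integral_rV f - \sum_(k <- lcells s x delta eps) f (ctr s eps k) * wcell eps k|
    <= C * delta ^+ stot s * omega.
Proof.
have [C C0 CP] := cell_bound (R := R) s 0.
exists (C * (\prod_(i < d) 2) * (\prod_(i < d) 6)).
  by rewrite !mulr_ge0// prodr_ge0.
move=> f x delta eps omega cf fx e0 ed o0 fo.
have d0 : 0 < delta by exact: lt_le_trans ed.
have cb k y : `|cell s eps k y| <= C.
  by have := CP eps k [::] e0 isT y; rewrite /lwt big_nil mulr1.
have cc k := cell_cpt k e0.
have cfc k : cpt (fun y => f y * cell s eps k y).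
  by apply: cptM => //; [exact: (cc k).1|exists C].
have -> : integral_rV f = \sum_(k <- lcells s x delta eps) integral_rV (fun y => f y * cell s eps k y).
  rewrite -integral_sum//; congr integral_rV; apply/funext => y.
  rewrite -mulr_sumr; have [->|/fx xy] := eqVneq (f y) 0; first by rewrite mul0r.
  by rewrite sum_lcells ?mulr1// ltW.
rewrite -sumrB (le_trans (ler_norm_sum _ _ _))//.
apply: (@le_trans _ _ (\sum_(k <- lcells s x delta eps) (omega * C * \prod_(i < d) (2 * eps ^+ s i)))).
  apply: ler_sum => k _.
  have -> : integral_rV (fun y => f y * cell s eps k y) - f (ctr s eps k) * wcell eps k =
     integral_rV (fun y => - f (ctr s eps k) * cell s eps k y + f y * cell s eps k y).
    by rewrite integral_lin// addrC mulNr.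
  apply: (@integral_bound _ _ _ (ctr s eps k) (fun i => eps ^+ s i)).
  - exact: cpt_lin.
  - by move=> i; rewrite exprn_ge0// ltW.
  - move=> y; rewrite -mulrDl mulf_eq0 negb_or => /andP[_]; exact: cell_supp.
  - move=> y; rewrite -mulrDl normrM.
    have [->|/(cell_supp e0) yk] := eqVneq (cell s eps k y) 0.
      by rewrite normr0 mulr0 mulr_ge0.
    by rewrite ler_pM// addrC fo.
rewrite big_const_seq count_predT iter_addr_0 -[X in X <= _]mulr_natl.
have := size_lcells s x e0 ed; set sz := (size _)%:R => hsz.
rewrite (le_trans (ler_wpM2r _ hsz))//.
  by rewrite !mulr_ge0// prodr_ge0// => i _; rewrite mulr_ge0// exprn_ge0// ltW.
rewrite big_split /= -expr_sum expr_div_n.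
have u : eps ^+ stot s != 0 by rewrite expf_neq0 ?gt_eqF.
rewrite le_eqVlt; apply/orP; left; apply/eqP.
rewrite -/(stot s); move: u; set a := eps ^+ _ => u; by field.
Qed.

End RiemannSums.

(** * Real powers and geometric sums *)

Section Powers.
Context {R : realType}.
Implicit Types (x a b kappa rho A : R) (m n M : nat).

Lemma pwD x a b : 0 < x -> x `^ (a + b) = x `^ a * x `^ b.
Proof. by move=> x0; rewrite powRD// (gt_eqF x0) implybT. Qed.

Lemma pwN x a : x `^ (- a) = (x `^ a)^-1.
Proof. exact: powRN. Qed.

Lemma pwn x n : 0 <= x -> x ^+ n = x `^ n%:R.
Proof. by move=> x0; rewrite powR_mulrn. Qed.

Lemma pwV x a : 0 <= x -> (x^-1) `^ a = (x `^ a)^-1.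
Proof. by move=> x0; rewrite -(powR_inv1 x0) -powRrM mulN1r powRN. Qed.

Lemma pwVn x n : 0 <= x -> x^-1 ^+ n = x `^ (- n%:R).
Proof. by move=> x0; rewrite exprVn pwn// powRN. Qed.

Lemma pw_le1 x a b : 0 < x -> x <= 1 -> b <= a -> x `^ a <= x `^ b.
Proof. by move=> x0 x1 ab; apply: ger_powR => //; rewrite x0. Qed.

(** The scale of [K m]: the radius of its support. *)
Definition lam m : R := 2 ^- m.

Lemma lam_gt0 m : 0 < lam m.
Proof. by rewrite /lam invr_gt0 exprn_gt0. Qed.

Lemma lam_ge0 m : 0 <= lam m.
Proof. exact/ltW/lam_gt0. Qed.

Lemma lam_le1 m : lam m <= 1.
Proof. by rewrite /lam invf_le1 ?exprn_gt0// exprn_ege1// ler1n. Qed.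

Lemma lam_pow m a : 2 `^ (a * m%:R) = lam m `^ (- a).
Proof.
rewrite /lam -exprVn pwn ?invr_ge0// -powRrM pwV// -powRN mulrN; congr (_ `^ _).
by rewrite opprK mulrC.
Qed.

(** The hypotheses bound u m by A min (z, 1 / z) with z = z0 q^m. Up to a factor depending on q this
    is an increment of 1 / (1 + z), so the sum telescopes and its bound does not depend on z0, that
    is, on where z crosses 1. *)
Lemma geo_sum (q z0 A : R) (u : nat -> R) : 1 < q -> 0 < z0 -> 0 <= A ->
  (forall m, `|u m| <= A * (z0 * q ^+ m)) -> (forall m, `|u m| <= A / (z0 * q ^+ m)) ->
  forall M, \sum_(m < M) `|u m| <= A * (2 * (1 + q) / (q - 1)).
Proof.
move=> q1 z00 A0 u1 u2 M.
have q0 : 0 < q by lra.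
pose z m := z0 * q ^+ m; have zp m : 0 < z m by rewrite mulr_gt0// exprn_gt0.
pose g m := (1 + z m)^-1.
have zS m : z m.+1 = z m * q by rewrite /z exprS; ring.
have K0 : 0 < 2 * (1 + q) / (q - 1) by rewrite divr_gt0; lra.
have key m : `|u m| <= A * (2 * (1 + q) / (q - 1)) * (g m - g m.+1).
  have -> : g m - g m.+1 = z m * (q - 1) / ((1 + z m) * (1 + z m * q)).
    by rewrite /g zS; field; apply/andP; split; rewrite gt_eqF//; have := zp m; nra.
  have D0 : 0 < (1 + z m) * (1 + z m * q) by have := zp m; nra.
  rewrite mulrA ler_pdivlMr// -mulrA.
  have -> : 2 * (1 + q) / (q - 1) * (z m * (q - 1)) = 2 * (1 + q) * z m.
    by field; rewrite subr_eq0 gt_eqF.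
  have [z1|z1] := leP (z m) 1.
    apply: le_trans (ler_wpM2r (ltW D0) (u1 m)) _; rewrite -[X in X <= _]mulrA ler_wpM2l//.
    rewrite -/(z m) [X in _ <= X]mulrC ler_wpM2l ?(ltW (zp _))//.
    have zm := zp m; have zq : z m * q <= q by rewrite ler_piMl// ltW.
    have zz : z m * (z m * q) <= q.
      by rewrite (le_trans _ zq)// ler_piMl// mulr_ge0// ltW.
    by move: zm zq zz; set w := z m * q => zm zq zz; lra.
  apply: le_trans (ler_wpM2r (ltW D0) (u2 m)) _; rewrite -[X in X <= _]mulrA ler_wpM2l//.
  rewrite mulrC ler_pdivrMr//; have := zp m; rewrite -/(z m); nra.
apply: (le_trans (ler_sum _ (fun (m : 'I_M) _ => key m))).
rewrite -mulr_sumr; have : \sum_(m < M) (g m - g m.+1) <= 1.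
  have -> : \sum_(m < M) (g m - g m.+1) = - \sum_(0 <= m < M) (g m.+1 - g m).
    by rewrite big_mkord -sumrN; apply: eq_bigr => m _; rewrite opprB.
  rewrite telescope_sumr// opprB.
  have g0 : g 0%N <= 1 by rewrite /g invf_le1 ?addr_gt0// lerDl ltW.
  have gM : 0 < g M by rewrite /g invr_gt0 addr_gt0.
  lra.
by move=> h; rewrite -[leRHS]mulr1 ler_wpM2l// mulr_ge0// ltW.
Qed.

(** The form in which all series over the scales of K are summed: rho is the scale at which the
    estimate changes, and the constant is independent of it. *)
Lemma geo_bound kappa : 0 < kappa -> exists2 C : R, 0 <= C & forall (u : nat -> R) A rho,
  0 < rho -> 0 <= A ->
  (forall m, rho <= lam m -> `|u m| <= A * (rho / lam m) `^ kappa) ->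
  (forall m, lam m < rho -> `|u m| <= A * (lam m / rho) `^ kappa) ->
  forall M, \sum_(m < M) `|u m| <= A * C.
Proof.
move=> k0; pose q : R := 2 `^ kappa.
have q1 : 1 < q.
  have h : (1 : R) `^ kappa < 2 `^ kappa.
    by apply: gt0_ltr_powR => //; rewrite ?nnegrE ?ltr1n.
  by move: h; rewrite powR1.
have o : (1 : R) `^ kappa = 1 by rewrite powR1.
exists (2 * (1 + q) / (q - 1)) => [|u A rho r0 A0 H1 H2 M].
  by rewrite divr_ge0//; lra.
have E m : (rho / lam m) `^ kappa = rho `^ kappa * q ^+ m.
  rewrite /lam invrK powRM ?exprn_ge0 ?ltW//; congr (_ * _).
  by rewrite /q (pwn m (powR_ge0 _ _)) (pwn m (ler0n _ 2)) -!powRrM mulrC.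
have E2 m : (lam m / rho) `^ kappa = (rho `^ kappa * q ^+ m)^-1.
  rewrite -E -pwV ?invf_div// divr_ge0//; [exact: ltW|exact: lam_ge0].
have le1 t : 0 <= t -> t <= 1 -> t `^ kappa <= 1.
  by move=> t0 t1; rewrite -[X in _ <= X]o ge0_ler_powR ?nnegrE// ltW.
have ge1 t : 1 <= t -> 1 <= t `^ kappa.
  by move=> t1; rewrite -[X in X <= _]o ge0_ler_powR ?nnegrE ?(ltW k0)// (le_trans ler01).
apply: (@geo_sum q (rho `^ kappa)) => //; first exact: powR_gt0.
- move=> m; have [h|h] := leP rho (lam m); first by rewrite -E H1.
  rewrite (le_trans (H2 _ h))// -E ler_wpM2l// (@le_trans _ _ 1)//.
    by apply: le1; rewrite ?divr_ge0 ?lam_ge0 ?(ltW r0)// ler_pdivrMr// mul1r ltW.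
  by apply: ge1; rewrite ler_pdivlMr ?lam_gt0// mul1r ltW.
- move=> m; have [h|h] := leP rho (lam m); last by rewrite -E2 H2.
  rewrite (le_trans (H1 _ h))// -E2 ler_wpM2l// (@le_trans _ _ 1)//.
    by apply: le1; rewrite ?divr_ge0 ?lam_ge0 ?(ltW r0)// ler_pdivrMr ?lam_gt0// mul1r.
  by apply: ge1; rewrite ler_pdivlMr// mul1r.
Qed.

Lemma series_bound (u : nat -> R) (B : R) :
  (forall M, \sum_(m < M) `|u m| <= B) ->
  cvgn (series u) /\ `|limn (series u)| <= B.
Proof.
move=> uB.
have cv : cvgn [normed series u].
  apply: nondecreasing_is_cvgn; first by apply: nondecreasing_series => ? _ _; exact: normr_ge0.
  by exists B => _ [M _ <-]; have := uB M; rewrite -(big_mkord xpredT (fun m => `|u m|)).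
split; first exact: normed_cvg.
apply: le_trans (lim_series_norm cv) _.
apply: limr_le => //; near=> M; have := uB M.
by rewrite -(big_mkord xpredT (fun m => `|u m|)).
Unshelve. all: by end_near. Qed.

End Powers.

(** * Kernels and adapted test functions *)

Section Kernels.
Context {R : realType} {d : nat} (s : 'I_d -> nat).
Hypothesis s_gt0 : forall i, (0 < s i)%N.
Local Notation V := 'rV[R]_d.
Implicit Types (x y z : V) (phi psi f g : V -> R) (l : seq 'I_d) (m N : nat).
Implicit Types (delta eps b c a rho : R).
Local Notation S := (stot s).
Local Notation sbox := (@sbox R d s).
Local Notation loc := (@loc R d s).

(** This is the triangle inequality for the anisotropic boxes: it makes their radii additive in
    [sbox_trans]. *)
Lemma exprD_super (n : nat) a b : (0 < n)%N -> 0 <= a -> 0 <= b ->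
  a ^+ n + b ^+ n <= (a + b) ^+ n.
Proof.
move=> n0 a0 b0; case: n n0 => // n _; elim: n => [|n ih]; first by rewrite !expr1.
rewrite exprS [b ^+ n.+2]exprS [leRHS]exprS mulrDl.
have an : a ^+ n.+1 <= (a + b) ^+ n.+1 by rewrite lerXn2r ?nnegrE ?addr_ge0// lerDl.
have bn : b ^+ n.+1 <= (a + b) ^+ n.+1 by rewrite lerXn2r ?nnegrE ?addr_ge0// lerDr.
by rewrite lerD// ler_wpM2l.
Qed.

Lemma sbox_trans x y z delta eps : 0 <= delta -> 0 <= eps -> sbox x delta y ->
  sbox y eps z -> sbox x (delta + eps) z.
Proof.
move=> d0 e0 xy yz i; apply: le_trans (exprD_super (s_gt0 i) d0 e0).
rewrite (_ : z ord0 i - x ord0 i = (y ord0 i - x ord0 i) + (z ord0 i - y ord0 i)); last by ring.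
by rewrite (le_trans (ler_normD _ _))// lerD// ?xy ?yz.
Qed.

Lemma sbox_sym x y delta : sbox x delta y -> sbox y delta x.
Proof. by move=> xy i; rewrite distrC. Qed.

Lemma sbox_refl x delta : 0 <= delta -> sbox x delta x.
Proof. by move=> d0 i; rewrite subrr normr0 exprn_ge0. Qed.

Lemma sbox_mono x y delta eps : 0 <= delta -> delta <= eps -> sbox x delta y -> sbox x eps y.
Proof.
move=> d0 de xy i; rewrite (le_trans (xy i))// lerXn2r ?nnegrE//.
exact: le_trans de.
Qed.

Lemma loc_supp N x delta b phi : loc N x delta b phi -> supported_in (sbox x delta) phi.
Proof. by case. Qed.

Lemma loc_ge0 N x delta b phi : 0 < delta -> loc N x delta b phi -> 0 <= b.
Proof.
move=> d0 [_ _ pb]; have := pb [::] isT 0; rewrite /lwt big_nil addn0 => h.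
by move: (le_trans (normr_ge0 _) h); rewrite pmulr_lge0// exprn_gt0// invr_gt0.
Qed.

Lemma loc_test N x delta b phi : loc N x delta b phi -> test_function phi.
Proof. by case=> sp sup _; split=> //; exists (sbox x delta) => //; exact: rbox_compact. Qed.

Lemma lwt_size l N : (size l <= N)%N -> (lwt s l <= N * S)%N.
Proof.
move=> lN; apply: (@leq_trans (size l * S)); last by rewrite leq_mul2r lN orbT.
elim: l {lN} => [|i l ih]; first by rewrite /lwt big_nil.
by rewrite /lwt big_cons mulSn leq_add// /stot (bigD1 i)//= leq_addr.
Qed.

(** Replacing 1 / delta by c / delta' costs c per unit of weight; the normalisation together with N
    derivatives weighs at most S + N * S. *)
Lemma loc_widen N x' delta delta' b c phi : 0 < delta -> 0 < delta' -> 1 <= c ->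
  delta' <= c * delta -> smooth phi -> supported_in (sbox x' delta') phi ->
  0 <= b -> (forall l, (size l <= N)%N -> forall y,
      `|pder l phi y| <= b * (delta^-1) ^+ (S + lwt s l)) ->
  loc N x' delta' (c ^+ (S + N * S) * b) phi.
Proof.
move=> d0 d'0 c1 dd sp sup b0 pb; split=> // l lN y.
have c0 : 0 < c by exact: lt_le_trans c1.
apply: le_trans (pb l lN y) _; rewrite [X in _ <= X * _]mulrC -mulrA.
apply: ler_wpM2l => //.
apply: (@le_trans _ _ (c ^+ (S + lwt s l) * (delta'^-1) ^+ (S + lwt s l))).
  rewrite -exprMn lerXn2r ?nnegrE ?mulr_ge0 ?invr_ge0 ?(ltW d0) ?(ltW d'0) ?(ltW c0)//.
  by rewrite ler_pdivlMr// mulrC ler_pdivrMr.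
rewrite ler_wpM2r ?exprn_ge0 ?invr_ge0 ?(ltW d'0)//.
by apply: ler_weXn2l => //; rewrite leq_add2l lwt_size.
Qed.

Definition Tlin (T : (V -> R) -> R) : Prop :=
  forall c phi psi, test_function phi -> test_function psi ->
    T (fun x => c * phi x + psi x) = c * T phi + T psi.

(** T has order a at the point x, on scales up to [rad]. The size b of the test function is kept
    explicit, so that functions cut into cells can be estimated piece by piece. *)
Definition Tb N x (rad C a : R) (T : (V -> R) -> R) : Prop :=
  forall delta b phi, 0 < delta -> delta <= rad -> loc N x delta b phi ->
    `|T phi| <= C * b * delta `^ a.

Lemma test0 : test_function (fun _ : V => 0).
Proof.
split; first exact: smooth_cst.
by exists set0; [exact: compact0|move=> x; rewrite eqxx].
Qed.

Lemma testD phi psi : test_function phi -> test_function psi ->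
  test_function (fun x => phi x + psi x).
Proof.
move=> [sp [A cA pA]] [sq [B cB qB]]; split; first exact: smoothD.
exists (A `|` B); first exact: compactU.
move=> x; have [->|/pA ? _] := eqVneq (phi x) 0; last by left.
by rewrite add0r => /qB; right.
Qed.

Lemma testZ c phi : test_function phi -> test_function (fun x => c * phi x).
Proof.
move=> [sp [A cA pA]]; split; first exact: smoothZ.
by exists A => // x; rewrite mulf_eq0 negb_or => /andP[_ /pA].
Qed.

Lemma testM phi f : test_function phi -> smooth f -> test_function (fun x => phi x * f x).
Proof.
move=> [sp [A cA pA]] sf; split; first exact: smoothM.
by exists A => // x; rewrite mulf_eq0 negb_or => /andP[/pA].
Qed.

Lemma test_sum (I : Type) (r : seq I) (F : I -> V -> R) :
  (forall k, test_function (F k)) -> test_function (fun x => \sum_(k <- r) F k x).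
Proof.
move=> tF; elim: r => [|k r ih].
  by under eq_fun do rewrite big_nil; exact: test0.
by under eq_fun do rewrite big_cons; exact: testD.
Qed.

Lemma Tlin0 T : Tlin T -> T (fun=> 0) = 0.
Proof.
move=> lT; have E := lT (-1) _ _ test0 test0; rewrite mulN1r addNr in E.
by rewrite E mulN1r addNr.
Qed.

Lemma TlinD T phi psi : Tlin T -> test_function phi -> test_function psi ->
  T (fun x => phi x + psi x) = T phi + T psi.
Proof.
move=> lT tp tq; have := lT 1 _ _ tp tq; rewrite mul1r => <-.
by congr T; apply/funext => x; rewrite mul1r.
Qed.

Lemma TlinZ T c phi : Tlin T -> test_function phi -> T (fun x => c * phi x) = c * T phi.
Proof.
move=> lT tp; have := lT c _ _ tp test0; rewrite Tlin0// addr0 => <-.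
by congr T; apply/funext => x; rewrite addr0.
Qed.

Lemma TlinB T phi psi : Tlin T -> test_function phi -> test_function psi ->
  T (fun x => phi x - psi x) = T phi - T psi.
Proof.
move=> lT tp tq; have := lT (-1) _ _ tq tp; rewrite mulN1r addrC => <-.
by congr T; apply/funext => x; rewrite mulN1r addrC.
Qed.

Lemma Tlin_sum T (I : Type) (r : seq I) (F : I -> V -> R) : Tlin T ->
  (forall k, test_function (F k)) ->
  T (fun x => \sum_(k <- r) F k x) = \sum_(k <- r) T (F k).
Proof.
move=> lT tF; elim: r => [|k r ih].
  by under eq_fun do rewrite big_nil; rewrite Tlin0// big_nil.
by under eq_fun do rewrite big_cons; rewrite TlinD ?ih ?big_cons//; exact: test_sum.
Qed.

Context (beta : R) (K : nat -> V -> R).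
Hypothesis sK : forall m, smooth (K m).
Hypothesis supK : forall m, supported_in (sbox 0 (lam m)) (K m).
Hypothesis bK : forall k : mindex d, exists C : R, forall m x,
  `|Dpart k (K m) x| <= C * 2 `^ ((S%:R - beta + (sdeg s k)%:R) * m%:R).

(** The constants of the kernel depend on the multi-index; those with entries at most N are finitely
    many, and are summed. *)
Lemma K_bound N : exists2 C : R, 0 <= C & forall l m x, (size l <= N)%N ->
  `|pder l (K m) x| <= C * lam m `^ beta * ((lam m)^-1) ^+ (S + lwt s l).
Proof.
have /choice [C CP] := bK.
pose D : R := \sum_(h : {ffun 'I_d -> 'I_N.+1}) `|C [ffun i => h i : nat]|.
exists D => [|l m x lN]; first by apply: sumr_ge0.
rewrite pder_lidx//; apply: (le_trans (CP _ _ _)).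
have -> : sdeg s (lidx l) = lwt s l.
  by rewrite -lwt_mlist /lwt; exact/perm_big/mlist_lidx.
rewrite lam_pow pwVn ?lam_ge0// -mulrA -pwD ?lam_gt0//.
rewrite (_ : - (S%:R - beta + (lwt s l)%:R) = beta - (S + lwt s l)%:R); last by rewrite natrD; ring.
rewrite ler_wpM2r ?powR_ge0// (le_trans (ler_norm _))// /D.
have hb i : (lidx l i < N.+1)%N by rewrite ffunE ltnS (leq_trans (count_size _ _)).
rewrite (bigD1 [ffun i => Ordinal (hb i)])//= (_ : [ffun i => _] = lidx l).
  by rewrite lerDl sumr_ge0.
by apply/ffunP => i; rewrite !ffunE /= ffunE.
Qed.

Lemma supK_pder l m : supported_in (sbox 0 (lam m)) (pder l (K m)).
Proof. by apply: supported_pder; [exact: rbox_closed|exact: supK]. Qed.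

Lemma supK_sub l m x : supported_in (sbox x (lam m)) (fun z => pder l (K m) (x - z)).
Proof.
by move=> z /supK_pder h i; have := h i; rewrite !mxE subr0 distrC.
Qed.

Lemma loc_kernel N l : exists2 C : R, 0 <= C & forall m x,
  loc N x (lam m) (C * lam m `^ (beta - (lwt s l)%:R)) (fun z => pder l (K m) (x - z)).
Proof.
have [C C0 CP] := K_bound (N + size l); exists C => // m x.
have sKl : smooth (pder l (K m)) by exact: smooth_pder.
split; [exact: smooth_sub|exact: supK_sub|move=> l' l'N y].
rewrite pder_sub// normrM normrX normrN1 expr1n mul1r -pder_cat.
rewrite (le_trans (CP _ _ _ _)) ?size_cat ?leq_add2r//.
rewrite -!mulrA ler_wpM2l// !pwVn ?lam_ge0// -!pwD ?lam_gt0//.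
by rewrite le_eqVlt; apply/orP; left; apply/eqP; congr (_ `^ _); rewrite /lwt big_cat !natrD; ring.
Qed.

Definition kres N0 l m x y z : R :=
  pder l (K m) (y - z) - tay s N0 (pder l (K m)) (x - z) (y - x).

(** [taylor_bound] is applied with mu = 1 / lam m to every derivative in z of the kernel. The box of
    radius 2 * lam m around x contains the supports for both base points, as rho <= lam m. *)
Lemma loc_taylor N N0 l : exists2 C : R, 0 <= C & forall m x y rho,
  0 <= rho -> rho <= lam m -> sbox x rho y ->
  loc N x (2 * lam m) (C * lam m `^ (beta - (lwt s l)%:R) * (rho / lam m) ^+ N0)
    (kres N0 l m x y).
Proof.
have [CT CT0 CTP] := taylor_bound (R := R) s_gt0 N0.
have [C C0 CP] := K_bound (N0 + (N + size l)).
exists (2 ^+ (S + N * S) * (CT * C)) => [|m x y rho r0 rl xy].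
  by rewrite !mulr_ge0 ?exprn_ge0.
have l0 := lam_gt0 (R := R) m.
have sKl l' : smooth (pder l' (K m)) by exact: smooth_pder.
rewrite -!mulrA; apply: (@loc_widen _ x (lam m)) => //.
- by rewrite mulr_gt0.
- by rewrite ler1n.
- rewrite /kres; under eq_fun do rewrite /tay -mulN1r mulr_sumr.
  apply: smoothD; first exact: smooth_sub.
  apply: smooth_sum => j; under eq_fun do rewrite mulrA.
  by apply: smoothZ; rewrite Dpart_pder; apply: smooth_sub; exact: smooth_pder.
- move=> z; rewrite /kres; have [e|h _] := eqVneq (pder l (K m) (y - z)) 0; last first.
    apply: (@sbox_mono _ _ (rho + lam m)); rewrite ?addr_ge0 ?(ltW l0)//; first lra.
    by apply: sbox_trans xy (supK_sub h) => //; exact: ltW.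
  rewrite e sub0r oppr_eq0 => h.
  have [j jx] : exists j, Dpart j (pder l (K m)) (x - z) != 0.
    apply: contrapT => /forallNP hj; move: h; rewrite /tay big1 ?eqxx// => j _.
    by have /negP := hj j; rewrite negbK => /eqP ->; rewrite mulr0.
  apply: (@sbox_mono _ _ (lam m)); rewrite ?(ltW l0)//; first lra.
  by move: jx; rewrite Dpart_pder -pder_cat => /supK_sub.
- by rewrite !mulr_ge0 ?powR_ge0 ?exprn_ge0 ?divr_ge0 ?lam_ge0.
move=> l' l'N z.
have -> : pder l' (kres N0 l m x y) z = (-1) ^+ size l' *
    (pder l' (pder l (K m)) (y - z) - tay s N0 (pder l' (pder l (K m))) (x - z) (y - x)).
  rewrite /kres; under [in pder _ _]eq_fun do rewrite /tay -mulN1r mulr_sumr.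
  rewrite pderD; last 2 first.
  - exact: smooth_sub.
  - apply: smooth_sum => j; under eq_fun do rewrite mulrA.
    by apply: smoothZ; rewrite Dpart_pder; apply: smooth_sub; exact: smooth_pder.
  rewrite pder_sub// mulrBr; congr (_ + _).
  rewrite pder_sum => [|j]; last first.
    under eq_fun do rewrite mulrA.
    by apply: smoothZ; rewrite Dpart_pder; apply: smooth_sub; exact: smooth_pder.
  rewrite /tay -mulrN -sumrN mulr_sumr; apply: eq_bigr => j _.
  under [in pder _ _]eq_fun do rewrite mulrA.
  rewrite pderZ; last by rewrite Dpart_pder; apply: smooth_sub; exact: smooth_pder.
  rewrite Dpart_pder pder_sub; last exact: smooth_pder.
  rewrite Dpart_pder (pderC (mlist j) l')//; first by ring.
rewrite normrM normrX normrN1 expr1n mul1r -pder_cat.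
have := CTP (pder (l' ++ l) (K m)) (C * lam m `^ beta * ((lam m)^-1) ^+ (S + lwt s (l' ++ l)))
  ((lam m)^-1) rho (x - z) (y - x) (sKl _) _ _ r0 _ _ _.
rewrite (_ : x - z + (y - x) = y - z); last by rewrite addrC addrA subrK.
move=> h; apply: (le_trans (h _ _ _ _ _)).
- by rewrite !mulr_ge0 ?powR_ge0 ?exprn_ge0 ?invr_ge0 ?lam_ge0.
- by rewrite invr_ge0 lam_ge0.
- by rewrite ler_pdivrMr// mul1r.
- by move=> i; have := xy i; rewrite !mxE.
- move=> l2 l2N w; rewrite -pder_cat (le_trans (CP _ _ _ _))//.
    by rewrite !size_cat leq_add// leq_add2r.
  by rewrite -[leRHS]mulrA -exprD /lwt big_cat /= addnAC -addnA addnC.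
rewrite le_eqVlt; apply/orP; left; apply/eqP.
have E : lam m `^ beta * (lam m)^-1 ^+ (S + lwt s (l' ++ l)) =
    lam m `^ (beta - (lwt s l)%:R) * (lam m)^-1 ^+ (S + lwt s l').
  rewrite !pwVn ?lam_ge0// -!pwD//; congr (_ `^ _).
  by rewrite /lwt big_cat !natrD; ring.
by rewrite -[C * _ * _]mulrA E; move: (_ `^ _) (_ ^+ N0) (_ ^+ _) => u v w; ring.
Qed.

End Kernels.

Ltac nneg := solve [repeat first [assumption | done | by apply: ltW | apply: mulr_ge0
  | apply: addr_ge0 | apply: exprn_ge0 | apply: powR_ge0 | rewrite invr_ge0 | apply: sumr_ge0 => ? _]].

(** * Exchanging a distribution with an integral *)

Section Exchange.
Context {R : realType} {d : nat} (s : 'I_d -> nat).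
Hypothesis s_gt0 : forall i, (0 < s i)%N.
Local Notation V := 'rV[R]_d.
Implicit Types (x y z : V) (phi psi f g : V -> R) (l : seq 'I_d) (m N : nat).
Implicit Types (delta eps b c a rho : R).
Local Notation S := (stot s).
Local Notation sbox := (@sbox R d s).
Local Notation loc := (@loc R d s).

(** U is controlled only near the support of phi; the margin 1 handles two close points of which one
    lies outside that support. *)
Lemma cptM_loc phi (U : V -> R) x (rho : 'I_d -> R) (L : R) : cpt phi -> 0 <= L -> (forall i, 0 <= rho i) ->
  supported_in (rbox x rho) phi ->
  (forall y, rbox x (fun i => rho i + 1) y -> `|U y| <= L) ->
  (forall y y' (eta : R), rbox x (fun i => rho i + 1) y -> rbox x (fun i => rho i + 1) y' ->
     (forall i, `|y ord0 i - y' ord0 i| <= eta) -> 0 <= eta -> eta <= 1 -> `|U y - U y'| <= L * eta) ->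
  cpt (fun y => phi y * U y).
Proof.
move=> cp L0 r0 px UL UL'; have [A A0 pA] := cpt_bounded cp; have [up _] := cp.
split; last first.
  by exists x, rho; split=> // y; rewrite mulf_eq0 negb_or => /andP[/px].
move=> e e0.
have e1 : 0 < e / 2 / (L + 1) by rewrite !divr_gt0// ltr_wpDl.
have [r r1 pr] := up _ e1.
pose eta := Num.min 1 (Num.min r (e / 2 / (A * L + 1))).
have AL : 0 < A * L + 1 by rewrite ltr_wpDl// mulr_ge0.
have eta0 : 0 < eta by rewrite !lt_min ltr01 r1 divr_gt0// divr_gt0.
have eta1 : eta <= 1 by rewrite ge_min lexx.
have etar : eta <= r by rewrite !ge_min lexx orbT.
have etae : eta <= e / 2 / (A * L + 1) by rewrite !ge_min lexx !orbT.
exists eta => // y y' yy'.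
wlog yx : y y' yy' / rbox x rho y => [H|].
  have [py|/px yx] := eqVneq (phi y) 0; last exact: H.
  have [py'|/px yx] := eqVneq (phi y') 0; last first.
    by rewrite distrC; apply: H => // i; rewrite distrC.
  by rewrite py py' !mul0r subrr normr0 ltW.
have by_ : rbox x (fun i => rho i + 1) y.
  by move=> i; rewrite (le_trans (yx i))// lerDl.
have by' : rbox x (fun i => rho i + 1) y'.
  move=> i; rewrite (_ : _ - _ = (y ord0 i - x ord0 i) - (y ord0 i - y' ord0 i)); last by ring.
  by rewrite (le_trans (ler_normB _ _))// lerD// ?yx// (le_trans (yy' i)).
rewrite (_ : _ - _ = phi y * (U y - U y') + (phi y - phi y') * U y'); last by ring.
rewrite (splitr e) (le_trans (ler_normD _ _))// lerD// normrM.
  apply: (@le_trans _ _ (A * (L * eta))); first by rewrite ler_pM//; apply: UL' => //; exact: ltW.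
  rewrite mulrA; apply: (@le_trans _ _ ((A * L + 1) * eta)).
    by rewrite ler_wpM2r ?lerDl// ltW.
  by rewrite mulrC -ler_pdivlMr.
apply: (@le_trans _ _ (e / 2 / (L + 1) * L)).
  by rewrite ler_pM ?UL// pr// => i; rewrite (le_trans (yy' i)).
by rewrite mulrAC ler_pdivrMr ?ltr_wpDl// ler_wpM2l ?lerDl// ltW// divr_gt0.
Qed.

Lemma supported_sub_iter phi (f : V -> R) x delta : supported_in (sbox x delta) phi ->
  supported_in (sbox x delta) (fun y => phi y * f y).
Proof. by move=> px y; rewrite mulf_eq0 negb_or => /andP[/px]. Qed.

Lemma test_cpt N x delta b phi : 0 <= delta -> loc N x delta b phi -> cpt phi.
Proof.
move=> d0 [sp sup _]; apply: (@smooth_cpt _ _ _ x (fun i => delta ^+ s i)) => //.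
by move=> i; rewrite exprn_ge0.
Qed.

Lemma prod_scale delta : \prod_(i < d) (2 * delta ^+ s i) = 2 ^+ d * delta ^+ S.
Proof. by rewrite big_split /= prodr_const card_ord -expr_sum. Qed.

Lemma integral_loc N x delta b phi (f : V -> R) (M : R) : 0 < delta ->
  loc N x delta b phi -> 0 <= M -> (forall y, sbox x delta y -> `|f y| <= M) ->
  cpt (fun y => phi y * f y) -> `|integral_rV (fun y => phi y * f y)| <= 2 ^+ d * b * M.
Proof.
move=> d0 L M0 fM cpf; have b0 := loc_ge0 d0 L; have [sp sup pb] := L.
have D0 : 0 <= delta by exact: ltW.
have := @integral_bound _ _ (fun y => phi y * f y) x (fun i => delta ^+ s i)
  (b * delta^-1 ^+ S * M) cpf _ (@supported_sub_iter phi f x delta sup) _.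
rewrite prod_scale => h; apply: (le_trans (h _ _)).
- by move=> i; rewrite exprn_ge0.
- move=> y; rewrite normrM; have [->|/sup yx] := eqVneq (phi y) 0.
    by rewrite normr0 mul0r !mulr_ge0 ?exprn_ge0 ?invr_ge0.
  rewrite ler_pM ?fM//; have := pb [::] isT y.
  by rewrite /lwt big_nil addn0.
have u : delta ^+ S != 0 by rewrite expf_neq0 ?gt_eqF.
rewrite exprVn le_eqVlt; apply/orP; left; apply/eqP; move: u.
by move: (delta ^+ S) (2 ^+ d) => p q u; field.
Qed.

Lemma integral_parts (kap phi : V -> R) x (rho : 'I_d -> R) l z : smooth kap -> smooth phi ->
  (forall i, 0 <= rho i) -> supported_in (rbox x rho) phi ->
  integral_rV (fun y => phi y * pder l kap (y - z)) =
  (-1) ^+ size l * integral_rV (fun y => pder l phi y * kap (y - z)).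
Proof.
move=> sk; elim/last_ind: l phi => [|l i ih] phi sp r0 px.
  by rewrite mul1r.
have skz l' : smooth (fun y => pder l' kap (y - z)).
  have := smooth_add (- z) (smooth_pder l' sk).
  by under eq_fun do rewrite addrC.
have pz l' j y : partial j (fun y => pder l' kap (y - z)) y = pder (j :: l') kap (y - z).
  have -> : (fun y => pder l' kap (y - z)) = (fun y => pder l' kap (- z + y)).
    by apply/funext => w; rewrite addrC.
  rewrite -[LHS]/(pder [:: j] _ y) pder_add; first by rewrite addrC.
  exact: smooth_pder.
have ppx : supported_in (rbox x rho) (partial i phi).
  exact: supported_partial (@rbox_closed _ _ _ _) px.
have spi := smooth_partial i sp.
have -> : pder (rcons l i) phi = pder l (partial i phi) by rewrite pder_rcons.
have -> : pder (rcons l i) kap = pder (i :: l) kap.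
  by apply: pder_perm => //; rewrite perm_rcons.
have := @integral_partial0 _ _ i (fun y => phi y * pder l kap (y - z)) x rho _ r0 _.
have := ih _ spi r0 ppx; rewrite size_rcons exprS -mulrA => <-.
have -> : partial i (fun y => phi y * pder l kap (y - z)) =
  fun y => partial i phi y * pder l kap (y - z) + phi y * pder (i :: l) kap (y - z).
  by apply/funext => y; rewrite partialM ?pz//; exact: smooth_diff.
have c1 : cpt (fun y => partial i phi y * pder l kap (y - z)).
  apply: (@smooth_cpt _ _ _ x rho) => //; first exact: smoothM.
  by move=> y; rewrite mulf_eq0 negb_or => /andP[/ppx].
have c2 : cpt (fun y => phi y * pder (i :: l) kap (y - z)).
  apply: (@smooth_cpt _ _ _ x rho) => //; first exact: smoothM (skz (i :: l)).
  by move=> y; rewrite mulf_eq0 negb_or => /andP[/px].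
rewrite integralD// => h; apply/eqP; rewrite -subr_eq0 mulN1r opprK addrC; apply/eqP.
apply: h; first exact: smoothM.
by move=> y; rewrite mulf_eq0 negb_or => /andP[/px].
Qed.

Lemma supported_sbox (kap : V -> R) eta y : supported_in (sbox 0 eta) kap ->
  supported_in (sbox y eta) (fun z => kap (y - z)).
Proof.
by move=> sup z /sup h i; have := h i; rewrite !mxE subr0 distrC.
Qed.

(** A qualitative statement, whose constant depends on everything: it makes the integral of phi y *
    T (kap (y - .)) meaningful and its Riemann sums convergent. The difference at y and y' is T
    applied to a test function of size proportional to the distance. *)
Lemma pairing_lip N x a T (kap : V -> R) (eta rad : R) : Tlin T ->
  (forall r, exists C', Tb s N x r C' a T) -> smooth kap ->
  supported_in (sbox 0 eta) kap -> 0 < eta -> 0 <= rad ->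
  exists2 L : R, 0 <= L &
  (forall y, rbox x (fun=> rad) y -> `|T (fun z => kap (y - z))| <= L) /\
  (forall y y' (e : R), rbox x (fun=> rad) y -> rbox x (fun=> rad) y' ->
     (forall i, `|y ord0 i - y' ord0 i| <= e) -> 0 <= e ->
     `|T (fun z => kap (y - z)) - T (fun z => kap (y' - z))| <= L * e).
Proof.
move=> Tl TB sk sup e0 rad0.
pose r := 1 + rad + eta; have r1 : 1 <= r by rewrite /r; lra.
have r0 : 0 < r by exact: lt_le_trans r1.
have [C' TC'] := TB r; pose C1 := `|C'|.
have TC : Tb s N x r C1 a T.
  move=> dl b phi dl0 dlr L; apply: (le_trans (TC' _ _ _ dl0 dlr L)).
  rewrite ler_wpM2r ?powR_ge0// ler_wpM2r ?ler_norm//.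
  exact: loc_ge0 L.
have csb : compact (sbox 0 eta) by exact: rbox_compact.
have [M M0 kM] := supported_bounded_pder N.+1 csb sup sk.
have inr y z : rbox x (fun=> rad) y -> kap (y - z) != 0 -> sbox x r z.
  move=> yx /(supported_sbox sup) zy; rewrite /r.
  apply: sbox_trans zy => //.
  - by lra.
  - by rewrite ltW.
  - move=> i; rewrite (le_trans (yx i))//.
    rewrite (@le_trans _ _ (1 + rad))//; first by lra.
    by rewrite ler_eXnr ?s_gt0//; lra.
have rr l : (size l <= N)%N -> 1 <= (r ^+ (S + N * S)) * r^-1 ^+ (S + lwt s l).
  move=> /(lwt_size s) h; rewrite exprVn ler_pdivlMr ?exprn_gt0// mul1r.
  by rewrite ler_weXn2l// leq_add2l.
have bound (g : V -> R) (m : R) : 0 <= m -> smooth g -> supported_in (sbox x r) g ->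
    (forall l, (size l <= N)%N -> forall z, `|pder l g z| <= m) ->
    `|T g| <= C1 * r ^+ (S + N * S) * r `^ a * m.
  move=> m0 sg sug gm; have LL : loc N x r (m * r ^+ (S + N * S)) g.
    split=> // l lN z; apply: (le_trans (gm l lN z)).
    by rewrite -mulrA ler_peMr// rr.
  apply: (le_trans (TC _ _ _ r0 (lexx _) LL)).
  by rewrite le_eqVlt; apply/orP; left; apply/eqP; ring.
have Q0 : 0 <= C1 * r ^+ (S + N * S) * r `^ a.
  by rewrite /C1; nneg.
exists (C1 * r ^+ (S + N * S) * r `^ a * (M + d%:R * M)).
  by rewrite mulr_ge0// addr_ge0// mulr_ge0.
have ss y : smooth (fun z => kap (y - z)) by exact: smooth_sub.
have tt y : test_function (fun z => kap (y - z)).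
  by split=> //; exists (sbox y eta); [exact: rbox_compact|exact: supported_sbox sup].
split=> [y yx|y y' e yx yx' yy ege].
  apply: (@le_trans _ _ (C1 * r ^+ (S + N * S) * r `^ a * M)); last first.
    by rewrite ler_wpM2l// lerDl mulr_ge0.
  apply: bound => // [z|l lN z]; first exact: inr.
  rewrite pder_sub// normrM normrX normrN1 expr1n mul1r.
  by apply: kM; rewrite leqW.
rewrite -TlinB//.
apply: (@le_trans _ _ (C1 * r ^+ (S + N * S) * r `^ a * (d%:R * M * e))); last first.
  by rewrite -[X in _ <= X]mulrA ler_wpM2l// ler_wpM2r// lerDr.
apply: bound; first by rewrite !mulr_ge0.
- have -> : (fun z => kap (y - z) - kap (y' - z)) =
    (fun z => kap (y - z) + (-1) * kap (y' - z)) by apply/funext => z; ring.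
  by apply: smoothD => //; exact: smoothZ.
- move=> z; have [->|k0 _] := eqVneq (kap (y - z)) 0; last exact: inr k0.
  by rewrite sub0r oppr_eq0 => /inr; apply.
move=> l lN z.
have -> : (fun z => kap (y - z) - kap (y' - z)) =
    (fun z => kap (y - z) + (-1) * kap (y' - z)) by apply/funext => w; ring.
rewrite pderD//; last exact: smoothZ.
rewrite pderZ// !pder_sub// mulN1r -mulrBr normrM normrX normrN1 expr1n mul1r.
apply: lip_smooth => //; first exact: smooth_pder.
  by move=> i w; rewrite -pder_cons kM.
by move=> i; rewrite !mxE opprD addrACA subrr addr0.
Qed.

(** The integral should be T applied to the convolution of phi with kap, a test function of scale 2
    * delta and size proportional to b * B. The interchange is made on Riemann sums, which are
    finite, with errors proportional to their mesh eps. *)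
Lemma exchange_bound N (T : (V -> R) -> R) (kap : V -> R) x delta eta b a C B phi :
  Tlin T -> 0 < eta -> eta <= delta -> smooth kap -> supported_in (sbox 0 eta) kap ->
  0 <= C -> 0 <= B -> (forall z, `|kap z| <= B * eta^-1 ^+ S) ->
  Tb s N x (2 * delta) C a T -> (forall r, exists C', Tb s N x r C' a T) ->
  loc N x delta b phi ->
  cpt (fun y => phi y * T (fun z => kap (y - z))) /\
  `|integral_rV (fun y => phi y * T (fun z => kap (y - z)))| <=
    2 ^+ (S + N * S) * 2 ^+ d * C * b * B * (2 * delta) `^ a.
Proof.
move=> Tl e0 ed sk sup C0 B0 kB TC TB Lphi.
have d0 : 0 < delta by exact: lt_le_trans ed.
have D0 : 0 <= delta by exact: ltW.
have b0 := loc_ge0 d0 Lphi; have [sp sup_phi pb] := Lphi.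
have [CR CR0 CRP] := @riemann R d s.
pose rad := 1 + \sum_(i < d) delta ^+ s i.
have radi i : delta ^+ s i + 1 <= rad.
  rewrite addrC lerD2l (bigD1 i)//= lerDl sumr_ge0// => j _.
  by rewrite exprn_ge0.
have rad0 : 0 <= rad by rewrite addr_ge0// sumr_ge0// => j _; rewrite exprn_ge0.
have [L L0 [UL UL']] := pairing_lip Tl TB sk sup e0 rad0.
set U := fun y => T (fun z => kap (y - z)).
have inrad y : rbox x (fun i => delta ^+ s i + 1) y -> rbox x (fun=> rad) y.
  by move=> h i; rewrite (le_trans (h i)).
have inbox y : sbox x delta y -> rbox x (fun i => delta ^+ s i + 1) y.
  by move=> h i; rewrite (le_trans (h i))// lerDl.
have cphi := test_cpt D0 Lphi.
have cU : cpt (fun y => phi y * U y).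
  apply: (@cptM_loc phi U x (fun i => delta ^+ s i) L) => //.
  - by move=> i; rewrite exprn_ge0.
  - by move=> y /inrad /UL.
  - by move=> y y' e /inrad yx /inrad yx' yy e_ge _; exact: UL'.
split=> //.
have csx : compact (sbox x delta) by exact: rbox_compact.
have csb : compact (sbox 0 eta) by exact: rbox_compact.
have [M M0 kM] := supported_bounded_pder N.+1 csb sup sk.
have [P P0 pP] := supported_bounded_pder 1 csx sup_phi sp.
pose Lam := P * (d%:R * M) + d%:R * P * M.
have Lam0 : 0 <= Lam by rewrite addr_ge0// !mulr_ge0.
have lipphi y y' (e : R) : (forall i, `|y ord0 i - y' ord0 i| <= e) ->
    `|phi y - phi y'| <= d%:R * P * e.
  move=> h; apply: lip_smooth => // i z; exact: (pP [:: i]).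
have lipf l z y y' (e : R) : (size l <= N)%N -> 0 <= e -> (forall i, `|y ord0 i - y' ord0 i| <= e) ->
    `|phi y * pder l kap (y - z) - phi y' * pder l kap (y' - z)| <= Lam * e.
  move=> lN e_ge h.
  rewrite (_ : _ - _ = phi y * (pder l kap (y - z) - pder l kap (y' - z)) +
     (phi y - phi y') * pder l kap (y' - z)); last by ring.
  rewrite /Lam [X in _ <= X]mulrDl (le_trans (ler_normD _ _))// lerD// normrM.
    rewrite -mulrA ler_pM ?(pP [::])//; apply: lip_smooth => //.
    - exact: smooth_pder.
    - by move=> i w; rewrite -pder_cons kM.
    - by move=> i; rewrite !mxE opprD addrACA subrr addr0.
  rewrite mulrAC ler_pM//; first exact: lipphi.
  by apply: kM; rewrite leqW.
pose LU := P * L + d%:R * P * L.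
have LU0 : 0 <= LU by rewrite addr_ge0// !mulr_ge0.
have sub1 eps (c y : V) : 0 < eps -> eps <= 1 -> sbox c eps y ->
    forall i, `|y ord0 i - c ord0 i| <= eps.
  move=> ep ep1 h i; apply: (le_trans (h i)).
  by rewrite ler_iXnr// ltW.
have lipU eps (c y : V) : 0 < eps -> eps <= 1 -> sbox c eps y ->
    `|phi y * U y - phi c * U c| <= LU * eps.
  move=> ep ep1 h; have h' := sub1 _ _ _ ep ep1 h.
  have far (u v : V) : rbox x (fun i => delta ^+ s i) u ->
      (forall i, `|v ord0 i - u ord0 i| <= eps) -> rbox x (fun=> rad) v.
    move=> ux uv i; apply: le_trans (radi i).
    rewrite (_ : _ - _ = (u ord0 i - x ord0 i) + (v ord0 i - u ord0 i)); last by ring.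
    by rewrite (le_trans (ler_normD _ _))// lerD ?ux// (le_trans (uv i)).
  have main (u v : V) : rbox x (fun i => delta ^+ s i) u ->
      (forall i, `|v ord0 i - u ord0 i| <= eps) ->
      `|phi u * U u - phi v * U v| <= LU * eps.
    move=> ux uv; have ux' := inrad _ (inbox _ ux); have vx := far _ _ ux uv.
    have uv' i : `|u ord0 i - v ord0 i| <= eps by rewrite distrC.
    rewrite (_ : _ - _ = phi u * (U u - U v) + (phi u - phi v) * U v); last by ring.
    rewrite /LU [X in _ <= X]mulrDl (le_trans (ler_normD _ _))// lerD// normrM.
      by rewrite -mulrA ler_pM ?(pP [::])//; apply: UL' => //; exact: ltW.
    by rewrite mulrAC ler_pM ?lipphi ?UL.
  have [py|/sup_phi yx] := eqVneq (phi y) 0; last first.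
    by apply: main => // i; rewrite distrC.
  have [pc|/sup_phi cx] := eqVneq (phi c) 0.
    by rewrite py pc !mul0r subrr normr0 mulr_ge0// ltW.
  by rewrite distrC; exact: main.
pose G := (1 + delta) ^+ (S + N * S).
have G0 : 0 <= G by rewrite exprn_ge0// addr_ge0.
(* Coefficient of eps in the total error: the first term comes from the size of the Riemann sum as a
   test function, the second from the Riemann sum of the integral itself. *)
pose Q := C * 2 ^+ (S + N * S) * (CR * delta ^+ S * Lam * G) * (2 * delta) `^ a +
  CR * delta ^+ S * LU.
suff key eps : 0 < eps -> eps <= 1 -> eps <= delta ->
    `|integral_rV (fun y => phi y * U y)| <=
    2 ^+ (S + N * S) * 2 ^+ d * C * b * B * (2 * delta) `^ a + Q * eps.
  apply/ler_addgt0Pr => e epos.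
  have Q0 : 0 <= Q.
    by rewrite /Q; nneg.
  pose eps := Num.min 1 (Num.min delta (e / (Q + 1))).
  have Q1 : 0 < Q + 1 by rewrite ltr_wpDl.
  have ep : 0 < eps by rewrite !lt_min ltr01 d0 divr_gt0.
  apply: (le_trans (key eps ep _ _)).
  - by rewrite ge_min lexx.
  - by rewrite !ge_min lexx orbT.
  rewrite lerD2l (@le_trans _ _ ((Q + 1) * eps))//.
    by rewrite ler_wpM2r ?lerDl// ltW.
  by rewrite mulrC -ler_pdivlMr// !ge_min lexx !orbT.
move=> ep ep1 epd.
pose w k := phi (ctr s eps k) * wcell s eps k.
pose ks := lcells s x delta eps.
pose Rs := fun z => \sum_(k <- ks) w k * kap (ctr s eps k - z).
have sk' y : smooth (fun z => kap (y - z)) by exact: smooth_sub.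
have tk' y : test_function (fun z => kap (y - z)).
  by split=> //; exists (sbox y eta); [exact: rbox_compact|exact: supported_sbox sup].
have TRs : T Rs = \sum_(k <- ks) (phi (ctr s eps k) * U (ctr s eps k)) * wcell s eps k.
  rewrite (Tlin_sum _ Tl); last by move=> k; exact: testZ.
  by apply: eq_bigr => k _; rewrite TlinZ// /w -!mulrA [wcell _ _ _ * _]mulrC.
have locRs : loc N x (2 * delta) (2 ^+ (S + N * S) *
    (2 ^+ d * b * B + CR * delta ^+ S * Lam * G * eps)) Rs.
  have pos : 0 <= 2 ^+ d * b * B + CR * delta ^+ S * Lam * G * eps.
    by nneg.
  apply: (loc_widen d0) => //.
  - by rewrite mulr_gt0.
  - by rewrite ler1n.
  - by apply: smooth_sum => k; exact: smoothZ.
  - move=> z Rz; have [k kks /eqP kz] : exists2 k, k \in ks & w k * kap (ctr s eps k - z) != 0.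
      apply/hasP; apply: contraNT Rz => /hasPn h.
      by rewrite /Rs big_seq big1// => k /h; rewrite negbK => /eqP.
    have /andP[wk kz'] : (w k != 0) && (kap (ctr s eps k - z) != 0).
      by rewrite -negb_or -mulf_eq0; apply/eqP.
    have /sup_phi cx : phi (ctr s eps k) != 0.
      by apply: contraNneq wk; rewrite /w => ->; rewrite mul0r.
    have zc := supported_sbox sup kz'.
    have := sbox_trans s_gt0 D0 (ltW e0) cx zc; apply: sbox_mono; first by lra.
    by lra.
  move=> l lN z.
  have -> : pder l Rs z = (-1) ^+ size l *
      \sum_(k <- ks) (phi (ctr s eps k) * pder l kap (ctr s eps k - z)) * wcell s eps k.
    rewrite /Rs pder_sum; last by move=> k; exact: smoothZ.
    rewrite mulr_sumr; apply: eq_bigr => k _; rewrite pderZ// pder_sub// /w.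
    ring.
  rewrite normrM normrX normrN1 expr1n mul1r.
  set f := fun y => phi y * pder l kap (y - z).
  have spl : smooth (fun y => pder l kap (y - z)).
    have := smooth_add (- z) (smooth_pder l sk).
    by under eq_fun do rewrite addrC.
  have supf : supported_in (sbox x delta) f by exact: supported_sub_iter.
  have cf : cpt f.
    apply: (@smooth_cpt _ _ _ x (fun i => delta ^+ s i)) => //; first exact: smoothM.
    by move=> i; rewrite exprn_ge0.
  have h1 : `|integral_rV f - \sum_(k <- ks) f (ctr s eps k) * wcell s eps k| <=
      CR * delta ^+ S * (Lam * eps).
    apply: CRP => //; first by rewrite mulr_ge0// ltW.
    by move=> k y h; apply: lipf => //; [rewrite ltW|exact: sub1].
  (* Integration by parts moves the derivatives to phi, where they cost 1 / delta instead of 1 /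
     eta; of kap only the supremum enters. *)
  have h2 : `|integral_rV f| <= 2 ^+ d * b * B * delta^-1 ^+ (S + lwt s l).
    rewrite /f (@integral_parts kap phi x (fun i => delta ^+ s i) l z)//; last first.
      by move=> i; rewrite exprn_ge0.
    rewrite normrM normrX normrN1 expr1n mul1r.
    have spp : smooth (pder l phi) by exact: smooth_pder.
    have sz : smooth (fun y => kap (y - z)).
      by have := smooth_add (- z) sk; under eq_fun do rewrite addrC.
    have supz : supported_in (sbox z eta) (fun y => pder l phi y * kap (y - z)).
      move=> y; rewrite mulf_eq0 negb_or => /andP[_ /sup] h i.
      by have := h i; rewrite !mxE subr0.
    have cz : cpt (fun y => pder l phi y * kap (y - z)).
      apply: (@smooth_cpt _ _ _ z (fun i => eta ^+ s i)) => //; first exact: smoothM.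
      by move=> i; rewrite exprn_ge0// ltW.
    have := @integral_bound _ _ _ z (fun i => eta ^+ s i)
      (b * delta^-1 ^+ (S + lwt s l) * (B * eta^-1 ^+ S)) cz _ supz _.
    rewrite prod_scale => h; apply: (le_trans (h _ _)).
    - by move=> i; rewrite exprn_ge0// ltW.
    - by move=> y; rewrite normrM ler_pM// pb.
    have u : eta ^+ S != 0 by rewrite expf_neq0 ?gt_eqF.
    rewrite (exprVn eta) le_eqVlt; apply/orP; left; apply/eqP; move: u.
    by move: (eta ^+ S) (2 ^+ d) (delta^-1 ^+ _) => p q v u; field.
  have dG : 1 <= G * delta^-1 ^+ (S + lwt s l).
    rewrite exprVn ler_pdivlMr ?exprn_gt0// mul1r.
    apply: (@le_trans _ _ ((1 + delta) ^+ (S + lwt s l))).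
      by rewrite lerXn2r ?nnegrE// ?lerDr// addr_ge0.
    by apply: ler_weXn2l; [rewrite lerDl|rewrite leq_add2l lwt_size].
  rewrite mulrDl -[X in `|X|](subrK (integral_rV f)) (le_trans (ler_normD _ _))//.
  rewrite addrC lerD// distrC (le_trans h1)//.
  rewrite (_ : CR * delta ^+ S * Lam * G * eps * delta^-1 ^+ (S + lwt s l) =
    CR * delta ^+ S * (Lam * eps) * (G * delta^-1 ^+ (S + lwt s l))); last by ring.
  by rewrite ler_peMr// !mulr_ge0 ?exprn_ge0// ltW.
have TR := TC _ _ _ (mulr_gt0 (ltr0n _ 2) d0) (lexx _) locRs.
have h3 : `|integral_rV (fun y => phi y * U y) - T Rs| <= CR * delta ^+ S * (LU * eps).
  rewrite TRs; apply: CRP => //; first exact: supported_sub_iter.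
  - by rewrite mulr_ge0// ltW.
  - by move=> k y h; exact: lipU.
rewrite -[X in `|X|](subrK (T Rs)) (le_trans (ler_normD _ _))//.
apply: (le_trans (lerD h3 TR)).
rewrite le_eqVlt; apply/orP; left; apply/eqP; rewrite /Q.
move: ((2 * delta) `^ a) => p; move: (2 ^+ (S + N * S)) (2 ^+ d) (delta ^+ S) => u v t.
by ring.
Qed.

End Exchange.

Section PowerRatio.
Context {R : realType}.
Lemma pw_ratio (x p w : R) : 0 < x -> 0 < p -> p `^ w = x `^ w * (p / x) `^ w.
Proof.
move=> x0 p0; have e : p = x * (p / x) by rewrite mulrC divfK// gt_eqF.
by rewrite {1}e powRM// ?divr_ge0// ltW.
Qed.

Lemma pw_ratioN (x p w : R) : 0 < x -> 0 < p -> p `^ w = x `^ w * (x / p) `^ (- w).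
Proof.
move=> x0 p0; have q0 : 0 <= x / p by rewrite divr_ge0// ltW.
by rewrite pwN -pwV// invf_div; exact: pw_ratio.
Qed.
End PowerRatio.

(** * Schauder estimates *)

Section Schauder.
Context {R : realType} {d : nat} (s : 'I_d -> nat).
Hypothesis s_gt0 : forall i, (0 < s i)%N.
Local Notation V := 'rV[R]_d.
Implicit Types (x y z : V) (phi psi f g : V -> R) (l : seq 'I_d) (m N : nat).
Implicit Types (delta eps b a rho : R) (k j : mindex d).
Local Notation S := (stot s).
Local Notation sbox := (@sbox R d s).
Local Notation loc := (@loc R d s).

Lemma Dpart_add k j f : smooth f -> Dpart j (Dpart k f) = Dpart (k + j) f.
Proof.
move=> sf; rewrite !Dpart_pder -pder_cat; apply: pder_perm => //.
apply/allP => i _ /=; rewrite count_cat !count_mlist midxD addnC eqxx//.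
Qed.

Definition all_Tb N x a (T : (V -> R) -> R) : Prop := forall r, exists C', Tb s N x r C' a T.

Lemma Tb_le N x r r' C C' a T : r' <= r -> C <= C' -> Tb s N x r C a T -> Tb s N x r' C' a T.
Proof.
move=> rr CC h dl b phi d0 dr L; apply: (le_trans (h _ _ _ d0 (le_trans dr rr) L)).
by rewrite ler_wpM2r ?powR_ge0// ler_wpM2r//; exact: loc_ge0 L.
Qed.

Lemma pairing_cpt N x T (kap : V -> R) (eta : R) a delta b phi : Tlin T -> all_Tb N x a T ->
  smooth kap -> supported_in (sbox 0 eta) kap -> 0 < eta -> 0 < delta ->
  loc N x delta b phi -> cpt (fun y => phi y * T (fun z => kap (y - z))).
Proof.
move=> Tl TB sk sup e0 d0 L.
have D0 := ltW d0; have cp := test_cpt D0 L; have [_ sup_phi _] := L.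
pose rad := 1 + \sum_(i < d) delta ^+ s i.
have radi i : delta ^+ s i + 1 <= rad.
  rewrite addrC lerD2l (bigD1 i)//= lerDl sumr_ge0// => j _.
  by rewrite exprn_ge0.
have rad0 : 0 <= rad by rewrite /rad; nneg.
have [La La0 [UL UL']] := pairing_lip s_gt0 Tl TB sk sup e0 rad0.
have inrad y : rbox x (fun i => delta ^+ s i + 1) y -> rbox x (fun=> rad) y.
  by move=> h i; rewrite (le_trans (h i)).
apply: (@cptM_loc _ _ phi _ x (fun i => delta ^+ s i) La) => //.
- by move=> i; rewrite exprn_ge0.
- by move=> y /inrad /UL.
- by move=> y y' e /inrad yx /inrad yx' yy e_ge _; exact: UL'.
Qed.

Context (beta : R) (K : nat -> V -> R).
Hypothesis sK : forall m, smooth (K m).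
Hypothesis supK : forall m, supported_in (sbox 0 (lam m)) (K m).
Hypothesis bK : forall k : mindex d, exists C : R, forall m x,
  `|Dpart k (K m) x| <= C * 2 `^ ((S%:R - beta + (sdeg s k)%:R) * m%:R).

Definition kk k m x : V -> R := fun z => Dpart k (K m) (x - z).

Lemma kk_pder k m x : kk k m x = fun z => pder (mlist k) (K m) (x - z).
Proof. by apply/funext => z; rewrite /kk Dpart_pder. Qed.

Lemma smooth_kk k m x : smooth (kk k m x).
Proof. by rewrite kk_pder; apply: smooth_sub; exact: smooth_pder. Qed.

Lemma supp_kk k m x : supported_in (sbox x (lam m)) (kk k m x).
Proof. by rewrite kk_pder; exact: supK_sub. Qed.

Lemma test_kk k m x : test_function (kk k m x).
Proof.
by split; [exact: smooth_kk|exists (sbox x (lam m)); [exact: rbox_compact|exact: supp_kk]].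
Qed.

Lemma kk_pair N k : exists2 C : R, 0 <= C & forall T x C' a m, Tb s N x 1 C' a T ->
  `|T (kk k m x)| <= C * C' * lam m `^ (a + beta - (sdeg s k)%:R).
Proof.
have [C C0 LC] := loc_kernel sK supK bK N (mlist k).
exists C => // T x C' a m TC; rewrite kk_pder.
apply: (le_trans (TC _ _ _ (lam_gt0 m) (lam_le1 m) (LC m x))).
rewrite lwt_mlist -addrA (pwD a _ (lam_gt0 m)) le_eqVlt; apply/orP; left; apply/eqP; ring.
Qed.

(* The Taylor remainder, in the base point, of the kernel at level m. *)
Definition kr N0 k m x y : V -> R := fun z =>
  kk k m y z - \sum_(j <- midx s N0) (mfact j)%:R^-1 * monomial j (y - x) * kk (k + j) m x z.

Lemma kr_kres N0 k m x y : kr N0 k m x y = kres s K N0 (mlist k) m x y.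
Proof.
apply/funext => z; rewrite /kr /kres /tay kk_pder; congr (_ - _).
apply: eq_bigr => j _; rewrite [_^-1 * _]mulrC; congr (_ * _).
by rewrite /kk -Dpart_pder Dpart_add.
Qed.

Lemma T_kr N0 k m x y T : Tlin T -> T (kr N0 k m x y) = T (kk k m y) -
  \sum_(j <- midx s N0) (mfact j)%:R^-1 * monomial j (y - x) * T (kk (k + j) m x).
Proof.
move=> Tl; rewrite /kr TlinB//; last 2 first.
- exact: test_kk.
- by apply: test_sum => j; apply: testZ; exact: test_kk.
congr (_ - _); rewrite (Tlin_sum _ Tl); last by move=> j; apply: testZ; exact: test_kk.
by apply: eq_bigr => j _; rewrite TlinZ//; exact: test_kk.
Qed.

Lemma kr_pair N N0 k : exists2 C : R, 0 <= C & forall T x y C' a m rho, Tb s N x 2 C' a T ->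
  0 <= rho -> rho <= lam m -> sbox x rho y ->
  `|T (kr N0 k m x y)| <=
    C * C' * 2 `^ a * lam m `^ (a + beta - (sdeg s k)%:R) * (rho / lam m) ^+ N0.
Proof.
have [C C0 LC] := loc_taylor s_gt0 sK supK bK N N0 (mlist k).
exists C => // T x y C' a m rho TC r0 rl yx; rewrite kr_kres.
have l2 : 0 < 2 * (lam m : R) by rewrite mulr_gt0// lam_gt0.
have l2' : 2 * (lam m : R) <= 2 by rewrite ler_piMr// lam_le1.
apply: (le_trans (TC _ _ _ l2 l2' (LC m x y rho r0 rl yx))).
rewrite lwt_mlist -addrA (pwD a _ (lam_gt0 m)) powRM// ?lam_ge0//.
by rewrite le_eqVlt; apply/orP; left; apply/eqP; ring.
Qed.

Lemma monomial_bound x y delta j : 0 <= delta -> sbox x delta y ->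
  `|monomial j (y - x)| <= delta ^+ sdeg s j.
Proof.
move=> d0 yx; rewrite /monomial normr_prod /sdeg expr_sum ler_prod// => i _.
by rewrite normr_ge0 normrX exprM lerXn2r ?nnegrE ?exprn_ge0// !mxE.
Qed.

Definition moment x j phi : R := integral_rV (fun y => (mfact j)%:R^-1 * monomial j (y - x) * phi y).

Lemma smooth_mon x j : smooth (fun y => (mfact j)%:R^-1 * monomial j (y - x) : R).
Proof.
apply: smoothZ; have := smooth_add (- x) (@smooth_monomial R d j).
by under eq_fun do rewrite addrC.
Qed.

Lemma moment_cpt N x x' delta b j phi : 0 < delta -> loc N x delta b phi ->
  cpt (fun y => (mfact j)%:R^-1 * monomial j (y - x') * phi y).
Proof.
move=> d0 [sp sup _]; apply: (@smooth_cpt _ _ _ x (fun i => delta ^+ s i)).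
- by apply: smoothM => //; exact: smooth_mon.
- by move=> i; rewrite exprn_ge0// ltW.
- by move=> y; rewrite mulf_eq0 negb_or => /andP[_ /sup].
Qed.

Lemma moment_bound N x delta b j phi : 0 < delta -> loc N x delta b phi ->
  `|moment x j phi| <= 2 ^+ d * b * delta ^+ sdeg s j.
Proof.
move=> d0 L; have b0 := loc_ge0 d0 L.
have E : (fun y => (mfact j)%:R^-1 * monomial j (y - x) * phi y) =
  fun y => phi y * ((mfact j)%:R^-1 * monomial j (y - x)).
  by apply/funext => y; rewrite mulrC.
have c := moment_cpt x j d0 L; rewrite E in c; rewrite /moment E.
apply: (integral_loc d0 L) => //; first by rewrite exprn_ge0// ltW.
move=> y yx; rewrite normrM.
apply: (@le_trans _ _ (1 * delta ^+ sdeg s j)); last by rewrite mul1r.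
apply: ler_pM => //; last by apply: monomial_bound => //; exact: ltW.
rewrite normfV normr_nat invf_le1 ?ltr0n ?mfact_gt0//.
by rewrite ler1n mfact_gt0.
Qed.

Lemma monomial_cbound x y delta j : 0 <= delta -> sbox x delta y ->
  `|(mfact j)%:R^-1 * monomial j (y - x)| <= delta ^+ sdeg s j.
Proof.
move=> d0 yx; rewrite normrM -[X in _ <= X]mul1r.
apply: ler_pM => //; last exact: monomial_bound.
rewrite normfV normr_nat invf_le1 ?ltr0n ?mfact_gt0//.
by rewrite ler1n mfact_gt0.
Qed.

Definition Vk k m T phi : R := integral_rV (fun y => phi y * T (kk k m y)).

Definition Pk N0 k m x T phi : R :=
  \sum_(j <- midx s N0) T (kk (k + j) m x) * moment x j phi.

Lemma Vk_cpt N x a k m T delta b phi : Tlin T -> all_Tb N x a T -> 0 < delta ->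
  loc N x delta b phi -> cpt (fun y => phi y * T (kk k m y)).
Proof.
move=> Tl TB d0 L; have := @pairing_cpt N x T (pder (mlist k) (K m)) (lam m) a delta b phi Tl TB.
have E y : kk k m y = fun z => pder (mlist k) (K m) (y - z) by exact: kk_pder.
rewrite (_ : (fun y => phi y * T (kk k m y)) =
  fun y => phi y * T (fun z => pder (mlist k) (K m) (y - z))); last first.
  by apply/funext => y; rewrite E.
apply => //; first exact: smooth_pder.
- exact: supK_pder.
- exact: lam_gt0.
Qed.

Lemma Vk_Pk N x a N0 k m T delta b phi : Tlin T -> all_Tb N x a T -> 0 < delta ->
  loc N x delta b phi ->
  cpt (fun y => phi y * T (kr N0 k m x y)) /\
  Vk k m T phi - Pk N0 k m x T phi = integral_rV (fun y => phi y * T (kr N0 k m x y)).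
Proof.
move=> Tl TB d0 L; have cV := Vk_cpt k m Tl TB d0 L.
have E : (fun y => phi y * T (kr N0 k m x y)) = fun y => (-1) *
   (\sum_(j <- midx s N0) T (kk (k + j) m x) * ((mfact j)%:R^-1 * monomial j (y - x) * phi y)) +
   phi y * T (kk k m y).
  apply/funext => y; rewrite T_kr// mulrBr addrC mulN1r; congr (- _ + _).
  by rewrite mulr_sumr; apply: eq_bigr => j _; ring.
have cM j : cpt (fun y => T (kk (k + j) m x) * ((mfact j)%:R^-1 * monomial j (y - x) * phi y)).
  by apply: cptZ; exact: moment_cpt L.
rewrite E; split; first by apply: cpt_lin => //; exact: cpt_sum.
rewrite integral_lin//; last exact: cpt_sum.
rewrite mulN1r addrC /Vk; congr (- _ + _).
rewrite integral_sum// /Pk; apply: eq_bigr => j _.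
by rewrite integralZ//; exact: moment_cpt L.
Qed.

(** Uniformity over a finite family of properties monotone in their constant: the sum of the
    constants serves for all. *)
Lemma cst_sum (I : eqType) (r : seq I) (P : I -> R -> Prop) :
  (forall i, exists2 C : R, 0 <= C & P i C) ->
  (forall i C C', C <= C' -> P i C -> P i C') ->
  exists2 C : R, 0 <= C & forall i, i \in r -> P i C.
Proof.
move=> h mono; elim: r => [|i r [C C0 ih]]; first by exists 0.
have [C' C'0 PC'] := h i; exists (C + C'); first exact: addr_ge0.
move=> j; rewrite inE => /predU1P[->|/ih]; first by apply: mono PC'; rewrite lerDr.
by apply: mono; rewrite lerDl.
Qed.

Lemma kk_pair_all N k N0 : exists2 C : R, 0 <= C & forall j, j \in midx s N0 ->
  forall T x C' a m, 0 <= C' -> Tb s N x 1 C' a T ->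
  `|T (kk (k + j) m x)| <= C * C' * lam m `^ (a + beta - (sdeg s (k + j))%:R).
Proof.
apply: (@cst_sum _ _ (fun j C => forall T x C' a m, 0 <= C' -> Tb s N x 1 C' a T ->
  `|T (kk (k + j) m x)| <= C * C' * lam m `^ (a + beta - (sdeg s (k + j))%:R))).
  by move=> j; have [C C0 h] := kk_pair N (k + j); exists C => // *; exact: h.
move=> j C C' CC h T x C1 a m C10 TC; apply: (le_trans (h _ _ _ _ _ C10 TC)).
by rewrite ler_wpM2r ?powR_ge0// ler_wpM2r.
Qed.

(** Here N0 - 1 < w < N0. For lam m >= delta the Taylor remainder gains (delta / lam m)^(N0 - w).
    For lam m < delta the two terms are estimated apart: the convolution gains (lam m / delta)^(beta
    - |k|) by [exchange_bound], and each Taylor term at least (lam m / delta)^(w - (N0 - 1)). [kap]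
    is the least of the three exponents. *)
Lemma schauder N N0 k a : (sdeg s k)%:R < beta ->
  a + beta - (sdeg s k)%:R < N0%:R -> N0%:R - 1 < a + beta - (sdeg s k)%:R ->
  exists2 C : R, 0 <= C & forall T x C' rad delta b phi,
    Tlin T -> all_Tb N x a T -> 0 <= C' -> Tb s N x (2 * rad + 2) C' a T ->
    0 < delta -> delta <= rad -> loc N x delta b phi ->
    forall M, \sum_(m < M) `|Vk k m T phi - Pk N0 k m x T phi| <=
      C * C' * b * delta `^ (a + beta - (sdeg s k)%:R).
Proof.
set w := a + beta - _ => kb wN0 N0w.
pose kap := Num.min (N0%:R - w) (Num.min (beta - (sdeg s k)%:R) (w - (N0%:R - 1))).
have kap0 : 0 < kap by rewrite !lt_min !subr_gt0 wN0 kb N0w.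
have [G G0 GP] := geo_bound kap0.
have [C1 C10 h1] := kr_pair N N0 k.
have [C2 C20 h2] := kk_pair_all N k N0.
have [C3 C30 h3] := K_bound sK bK (size (mlist k)).
pose D1 := 2 ^+ d * (C1 * 2 `^ a).
pose D2 := 2 ^+ (S + N * S) * 2 ^+ d * C3 * 2 `^ a.
pose D3 := \sum_(j <- midx s N0) C2 * 2 ^+ d.
exists (G * (D1 + D2 + D3)); first by rewrite /D1 /D2 /D3; nneg.
move=> T x C' rad delta b phi Tl TB C'0 TC d0 drad L M.
have b0 := loc_ge0 d0 L; have D0 := ltW d0.
have rad0 : 0 < rad by exact: lt_le_trans drad.
have TC2 : Tb s N x 2 C' a T by apply: Tb_le TC => //; lra.
have TC1 : Tb s N x 1 C' a T by apply: Tb_le TC => //; lra.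
have TCd : Tb s N x (2 * delta) C' a T by apply: Tb_le TC => //; lra.
have D30 : 0 <= D3 by rewrite /D3; nneg.
have D10 : 0 <= D1 by rewrite /D1; nneg.
have D20 : 0 <= D2 by rewrite /D2; nneg.
rewrite (_ : _ * b * _ = (D1 + D2 + D3) * C' * b * delta `^ w * G); last by ring.
apply: (GP (fun m => Vk k m T phi - Pk N0 k m x T phi) _ delta) => //.
- nneg.
- move=> m dm; have [_ ->] := Vk_Pk N0 k m Tl TB d0 L.
  have [cK _] := Vk_Pk N0 k m Tl TB d0 L.
  have l0 := lam_gt0 (R := R) m.
  have bd y : sbox x delta y -> `|T (kr N0 k m x y)| <=
      C1 * C' * 2 `^ a * lam m `^ w * (delta / lam m) ^+ N0 by move=> yx; exact: h1.
  have q0 : 0 < delta / lam m by rewrite divr_gt0.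
  have B0 : 0 <= C1 * C' * 2 `^ a * lam m `^ w * (delta / lam m) ^+ N0.
    by have q0' := ltW q0; nneg.
  apply: (le_trans (integral_loc d0 L B0 bd cK)).
  rewrite (pw_ratioN w d0 l0) (pwn _ (ltW q0)) (_ : _ * (_ * _ * _ * _ * _) =
    D1 * C' * b * delta `^ w * ((delta / lam m) `^ (N0%:R - w))); last first.
    by rewrite (pwD _ _ q0) /D1; ring.
  apply: ler_pM; [nneg|nneg| |].
    by rewrite ler_wpM2r ?powR_ge0// ler_wpM2r// ler_wpM2r// -addrA lerDl addr_ge0.
  apply: pw_le1 => //; first by rewrite ler_pdivrMr// mul1r.
  by rewrite ge_min lexx.
- move=> m md; have l0 := lam_gt0 (R := R) m.
  have q0 : 0 < lam m / delta by rewrite divr_gt0.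
  have q1 : lam m / delta <= 1 by rewrite ler_pdivrMr// mul1r ltW.
  rewrite (le_trans (ler_normB _ _))//.
  have kB z : `|pder (mlist k) (K m) z| <= (C3 * lam m `^ (beta - (sdeg s k)%:R)) * (lam m)^-1 ^+ S.
    apply: (le_trans (h3 _ _ _ (leqnn _))).
    rewrite lwt_mlist exprD (pwD _ _ l0) -(pwVn _ (ltW l0)).
    by rewrite le_eqVlt; apply/orP; left; apply/eqP; ring.
  have B0 : 0 <= C3 * lam m `^ (beta - (sdeg s k)%:R) by nneg.
  have [_ V1] := exchange_bound s_gt0 Tl l0 (ltW md) (smooth_pder (mlist k) (sK m))
    (supK_pder supK (l := mlist k) (m := m)) C'0 B0 kB TCd TB L.
  have V2 : `|Vk k m T phi| <= D2 * C' * b * delta `^ w * (lam m / delta) `^ kap.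
    rewrite /Vk (_ : (fun y => _) = fun y => phi y * T (fun z => pder (mlist k) (K m) (y - z))); last first.
      by apply/funext => y; rewrite kk_pder.
    apply: (le_trans V1).
    rewrite powRM// (pw_ratio (beta - (sdeg s k)%:R) d0 l0) (_ : _ * (2 `^ a * _) =
      D2 * C' * b * delta `^ w * (lam m / delta) `^ (beta - (sdeg s k)%:R)); last first.
      by rewrite /w -addrA (pwD _ (beta - _) d0) /D2; ring.
    rewrite ler_wpM2l//; first nneg.
    by apply: pw_le1 => //; rewrite !ge_min lexx orbT.
  have P2 : `|Pk N0 k m x T phi| <= D3 * C' * b * delta `^ w * (lam m / delta) `^ kap.
    rewrite /Pk (le_trans (ler_norm_sum _ _ _))// /D3 !mulr_suml big_seq [X in _ <= X]big_seq.
    apply: ler_sum => j jN; rewrite normrM.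
    have := ler_pM (normr_ge0 _) (normr_ge0 _) (h2 j jN T x C' a m C'0 TC1) (moment_bound j d0 L).
    move=> h; apply: (le_trans h).
    rewrite sdegD natrD opprD addrA -/w (pw_ratio _ d0 l0) (pwD _ _ d0) pwN -(pwn _ D0).
    have u : delta ^+ sdeg s j != 0 by rewrite expf_neq0 ?gt_eqF.
    rewrite [X in X <= _](_ : _ = C2 * 2 ^+ d * C' * b * delta `^ w *
      (lam m / delta) `^ (w - (sdeg s j)%:R)); last first.
      move: u; move: (delta ^+ sdeg s j) ((lam m / delta) `^ _) (delta `^ _) (2 ^+ d) => u1 u2 u3 u4 u; field.
      exact: u.
    rewrite ler_wpM2l//; first nneg.
    apply: pw_le1 => //; rewrite !ge_min; apply/orP; right; apply/orP; right.
    rewrite lerB// lerBrDr natr1 ler_nat; move: jN; rewrite mem_midx//.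
  apply: (le_trans (lerD V2 P2)); rewrite -mulrDl -!mulrDl ler_wpM2r ?powR_ge0//.
  by rewrite ler_wpM2r ?powR_ge0// ler_wpM2r// ler_wpM2r// -addrA lerDr.
Qed.

(* The combination below is the summand, at level m, of the coefficient of
   J_k in Gamma_xy; both ways of grouping it are needed. *)
Lemma gamma_core N (I : eqType) (r : seq I) (a : I -> R) (Nn : I -> nat) k (A : R) :
  (forall i, i \in r -> a i + beta - (sdeg s k)%:R < (Nn i)%:R) ->
  (forall i, i \in r -> (0 < Nn i)%N -> (Nn i)%:R - 1 < a i + beta - (sdeg s k)%:R) ->
  0 < A + beta - (sdeg s k)%:R ->
  exists2 C : R, 0 <= C & forall (c : I -> R) (T : I -> (V -> R) -> R) T0 x y rho D C',
    (forall i, Tlin (T i)) -> (forall m, T0 (kk k m y) = \sum_(i <- r) c i * T i (kk k m y)) ->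
    0 < rho -> 0 <= C' -> 0 <= D -> sbox x rho y ->
    (forall i, i \in r -> `|c i| <= D * rho `^ (A - a i)) ->
    (forall i, i \in r -> Tb s N x 2 C' (a i) (T i)) -> Tb s N y 2 C' A T0 ->
    forall M, \sum_(m < M) `|\sum_(i <- r) c i * T i (kr (Nn i) k m x y)| <=
      C * (D + 1) * C' * rho `^ (A + beta - (sdeg s k)%:R).
Proof.
set w := A + beta - _ => aN Na w0.
pose wi i := a i + beta - (sdeg s k)%:R.
(* The guard 0 < Nn i reflects that an empty Taylor sum puts no lower bound on wi i. Finitely many
   positive gaps leave a positive [kap]. *)
have [kap kap0 [k1 k2 k3]] : exists2 kap : R, 0 < kap &
    [/\ forall i, i \in r -> kap <= (Nn i)%:R - wi i,
        forall i, i \in r -> (0 < Nn i)%N -> kap <= wi i - ((Nn i)%:R - 1) & kap <= w].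
  elim: r aN Na => [|i r ih] aN Na; first by exists w.
  case: ih => [j jr|j jr N0|kap kap0 [k1 k2 k3]].
  - by apply: aN; rewrite inE jr orbT.
  - by apply: Na => //; rewrite inE jr orbT.
  have h1 : 0 < (Nn i)%:R - wi i by rewrite subr_gt0 aN// inE eqxx.
  pose k' := if (0 < Nn i)%N then wi i - ((Nn i)%:R - 1) else 1.
  have h2 : 0 < k' by rewrite /k'; case: ifP => // /Na; rewrite subr_gt0 inE eqxx; apply.
  exists (Num.min kap (Num.min ((Nn i)%:R - wi i) k')).
    by rewrite !lt_min kap0 h1.
  split=> [j|j|]; last by rewrite ge_min k3.
  - rewrite inE => /predU1P[->|jr]; first by rewrite !ge_min lexx orbT.
    by rewrite ge_min k1.
  - rewrite inE => /predU1P[->|jr] N0; last by rewrite ge_min k2.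
    by rewrite !ge_min /k' N0 lexx !orbT.
have [G G0 GP] := geo_bound kap0.
have [C1 C10 h1] : exists2 C : R, 0 <= C & forall i, i \in r -> forall T x y C' m rho, 0 <= C' ->
    Tb s N x 2 C' (a i) T -> 0 <= rho -> rho <= lam m -> sbox x rho y ->
    `|T (kr (Nn i) k m x y)| <= C * C' * lam m `^ wi i * (rho / lam m) ^+ Nn i.
  apply: (@cst_sum _ _ (fun i C => forall T x y C' m rho, 0 <= C' ->
    Tb s N x 2 C' (a i) T -> 0 <= rho -> rho <= lam m -> sbox x rho y ->
    `|T (kr (Nn i) k m x y)| <= C * C' * lam m `^ wi i * (rho / lam m) ^+ Nn i)).
    move=> i; have [C C0 h] := kr_pair N (Nn i) k; exists (C * 2 `^ (a i)); first nneg.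
    move=> T x y C' m rho C'0 TC r0 rl yx; apply: (le_trans (h _ _ _ _ _ _ _ TC r0 rl yx)).
    by rewrite le_eqVlt; apply/orP; left; apply/eqP; rewrite /wi; ring.
  move=> i C C' CC h T x y C2 m rho C20 TC r0 rl yx.
  apply: (le_trans (h _ _ _ _ _ _ C20 TC r0 rl yx)).
  have l0 := lam_gt0 (R := R) m.
  have q : 0 <= rho / lam m by rewrite divr_ge0// ltW.
  by rewrite ler_wpM2r ?exprn_ge0// ler_wpM2r ?powR_ge0// ler_wpM2r.
have [C2 C20 h2] := kk_pair N k.
have [C3 C30 h3] : exists2 C : R, 0 <= C & forall i, i \in r -> forall j, j \in midx s (Nn i) ->
    forall T x C' m, 0 <= C' -> Tb s N x 1 C' (a i) T ->
    `|T (kk (k + j) m x)| <= C * C' * lam m `^ (wi i - (sdeg s j)%:R).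
  apply: (@cst_sum _ _ (fun i C => forall j, j \in midx s (Nn i) ->
    forall T x C' m, 0 <= C' -> Tb s N x 1 C' (a i) T ->
    `|T (kk (k + j) m x)| <= C * C' * lam m `^ (wi i - (sdeg s j)%:R))).
    move=> i; have [C C0 h] := kk_pair_all N k (Nn i); exists C => // j jN T x C' m C'0 TC.
    apply: (le_trans (h _ jN _ _ _ _ _ C'0 TC)).
    by rewrite sdegD natrD opprD addrA.
  move=> i C C' CC h j jN T x C1' m C'0 TC; apply: (le_trans (h _ jN _ _ _ _ C'0 TC)).
  by rewrite ler_wpM2r ?powR_ge0// ler_wpM2r.
pose E1 := \sum_(i <- r) C1; pose E2 := \sum_(i <- r) \sum_(j <- midx s (Nn i)) C3.
have E10 : 0 <= E1 by rewrite /E1; nneg.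
have E20 : 0 <= E2 by rewrite /E2; nneg.
exists (G * (E1 + C2 + E2)); first nneg.
move=> c T T0 x y rho D C' Tl TT r0 C'0 D0 yx cD TC TC0 M.
have R0 := ltW r0.
rewrite (_ : _ * C' * _ = (E1 + C2 + E2) * (D + 1) * C' * rho `^ w * G); last by ring.
apply: (GP (fun m => \sum_(i <- r) c i * T i (kr (Nn i) k m x y)) _ rho) => //; first nneg.
- move=> m rm; have l0 := lam_gt0 (R := R) m.
  have q0 : 0 < rho / lam m by rewrite divr_gt0.
  apply: (@le_trans _ _ (E1 * (D + 1) * C' * rho `^ w * (rho / lam m) `^ kap)); last first.
    rewrite ler_wpM2r ?powR_ge0// ler_wpM2r ?powR_ge0// ler_wpM2r// ler_wpM2r ?addr_ge0//.
    by rewrite -addrA lerDl addr_ge0.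
  rewrite (le_trans (ler_norm_sum _ _ _))// /E1 !mulr_suml big_seq [X in _ <= X]big_seq.
  apply: ler_sum => i ir; rewrite normrM.
  have := ler_pM (normr_ge0 _) (normr_ge0 _) (cD i ir) (h1 i ir _ _ _ _ m _ C'0 (TC i ir) R0 rm yx).
  move=> h; apply: (le_trans h); rewrite (pw_ratioN (wi i) r0 l0) (pwn _ (ltW q0)).
  rewrite (_ : _ * _ * (_ * _ * _ * _) = C1 * D * C' * rho `^ w * (rho / lam m) `^ ((Nn i)%:R - wi i)).
    apply: ler_pM; [nneg|nneg| |].
      rewrite ler_wpM2r ?powR_ge0// ler_wpM2r// ler_wpM2l// lerDl//.
    by apply: pw_le1 => //; [rewrite ler_pdivrMr// mul1r|exact: k1].
  rewrite (pwD _ _ q0) (_ : w = (A - a i) + wi i); last by rewrite /w /wi; ring.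
  by rewrite (pwD _ (wi i) r0); ring.
- move=> m mr; have l0 := lam_gt0 (R := R) m.
  have q0 : 0 < lam m / rho by rewrite divr_gt0.
  have q1 : lam m / rho <= 1 by rewrite ler_pdivrMr// mul1r ltW.
  (* Below the scale rho the remainders are expanded: their leading parts recombine into T0, whose
     order at y is known, and the rest are Taylor terms at x. *)
  have -> : \sum_(i <- r) c i * T i (kr (Nn i) k m x y) = T0 (kk k m y) -
      \sum_(i <- r) \sum_(j <- midx s (Nn i)) c i * ((mfact j)%:R^-1 * monomial j (y - x) * T i (kk (k + j) m x)).
    rewrite TT -sumrB; apply: eq_bigr => i _.
    by rewrite T_kr// mulrBr mulr_sumr.
  rewrite (le_trans (ler_normB _ _))//.
  have TC1 : Tb s N y 1 C' A T0 by apply: Tb_le TC0 => //; lra.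
  have V2 : `|T0 (kk k m y)| <= C2 * (D + 1) * C' * rho `^ w * (lam m / rho) `^ kap.
    apply: (le_trans (h2 _ _ _ _ m TC1)); rewrite -/w (pw_ratio w r0 l0).
    rewrite mulrA; apply: ler_pM; [nneg|nneg| |exact: pw_le1].
    rewrite ler_wpM2r ?powR_ge0// ler_wpM2r// ler_peMr// lerDr//.
  have P2 : `|\sum_(i <- r) \sum_(j <- midx s (Nn i)) c i * ((mfact j)%:R^-1 * monomial j (y - x) *
      T i (kk (k + j) m x))| <= E2 * (D + 1) * C' * rho `^ w * (lam m / rho) `^ kap.
    rewrite (le_trans (ler_norm_sum _ _ _))// /E2 !mulr_suml big_seq [X in _ <= X]big_seq.
    apply: ler_sum => i ir; rewrite (le_trans (ler_norm_sum _ _ _))// !mulr_suml.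
    rewrite big_seq [X in _ <= X]big_seq; apply: ler_sum => j jN.
    have TC1i : Tb s N x 1 C' (a i) (T i) by apply: Tb_le (TC i ir) => //; lra.
    rewrite !normrM -normrM.
    have h4 := ler_pM (normr_ge0 _) (normr_ge0 _) (monomial_cbound j R0 yx) (h3 i ir j jN _ _ _ m C'0 TC1i).
    have := ler_pM (normr_ge0 _) (mulr_ge0 (normr_ge0 _) (normr_ge0 _)) (cD i ir) h4.
    move=> h; apply: (le_trans h); rewrite (pw_ratio _ r0 l0).
    rewrite [X in X <= _](_ : _ = C3 * D * C' * rho `^ w * (lam m / rho) `^ (wi i - (sdeg s j)%:R)).
      apply: ler_pM; [nneg|nneg| |].
        rewrite ler_wpM2r ?powR_ge0// ler_wpM2r// ler_wpM2l// lerDl//.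
      have jN' : (sdeg s j < Nn i)%N by move: jN; rewrite mem_midx.
      have Ni : (0 < Nn i)%N by exact: leq_ltn_trans jN'.
      apply: pw_le1 => //; apply: (le_trans (k2 i ir Ni)).
      by rewrite lerB// lerBrDr natr1 ler_nat.
    rewrite (_ : w = (A - a i) + ((wi i - (sdeg s j)%:R) + (sdeg s j)%:R)); last by rewrite /w /wi; ring.
    by rewrite (pwn _ R0) !(pwD _ _ r0); ring.
  apply: (le_trans (lerD V2 P2)); rewrite -!mulrDl ler_wpM2r ?powR_ge0//.
  rewrite ler_wpM2r ?powR_ge0// ler_wpM2r// ler_wpM2r ?addr_ge0//.
  by rewrite -addrA lerDr.
Qed.

End Schauder.

(** * Reconstruction *)

Lemma big_supp_eq (I : eqType) (V : zmodType) (r1 r2 : seq I) (F : I -> V) : uniq r1 -> uniq r2 ->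
  (forall k, k \notin r1 -> F k = 0) -> (forall k, k \notin r2 -> F k = 0) ->
  \sum_(k <- r1) F k = \sum_(k <- r2) F k.
Proof.
move=> u1 u2 h1 h2.
have aux (r r' : seq I) : (forall k, k \notin r' -> F k = 0) ->
    \sum_(k <- r) F k = \sum_(k <- r | k \in r') F k.
  move=> h; rewrite [RHS]big_mkcond; apply: eq_bigr => k _.
  by case: ifPn => // /h.
rewrite (aux _ _ h2) [RHS](aux _ _ h1) -big_filter -[RHS]big_filter.
apply: perm_big; apply: uniq_perm; rewrite ?filter_uniq//.
by move=> k; rewrite !mem_filter andbC.
Qed.

Section Reconstruction.
Context {R : realType} {d : nat} (s : 'I_d -> nat).
Hypothesis s_gt0 : forall i, (0 < s i)%N.
Local Notation V := 'rV[R]_d.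
Implicit Types (x y z : V) (phi psi f g : V -> R) (l : seq 'I_d) (m N : nat).
Implicit Types (delta eps b a rho rad gamma : R).
Local Notation S := (stot s).
Local Notation sbox := (@sbox R d s).
Local Notation loc := (@loc R d s).
Local Notation cell := (cell s).
Local Notation ctr := (ctr s).
Local Notation lcells := (lcells s).

Lemma phi_cells phi x delta eps : 0 < eps -> 0 <= delta -> supported_in (sbox x delta) phi ->
  phi = fun y => \sum_(k <- lcells x delta eps) phi y * cell eps k y.
Proof.
move=> e0 d0 sup; apply/funext => y; rewrite -mulr_sumr.
have [->|/sup yx] := eqVneq (phi y) 0; first by rewrite mul0r.
by rewrite (sum_lcells e0 d0 yx) mulr1.
Qed.

Lemma cell_out phi x delta eps k : 0 < eps -> 0 <= delta -> supported_in (sbox x delta) phi ->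
  k \notin lcells x delta eps -> (fun y => phi y * cell eps k y) = fun=> 0.
Proof.
move=> e0 d0 sup kn; apply/funext => y.
have [->|/sup yx] := eqVneq (phi y) 0; first by rewrite mul0r.
by rewrite (mem_lcells e0 d0 kn yx) mulr0.
Qed.

Lemma test_cell phi eps k : test_function phi -> test_function (fun y => phi y * cell eps k y).
Proof. by move=> tp; apply: testM => //; exact: cell_smooth. Qed.

Lemma ctr_near phi x delta eps k y : 0 < eps -> 0 <= delta -> supported_in (sbox x delta) phi ->
  phi y * cell eps k y != 0 -> sbox x (delta + eps) (ctr eps k).
Proof.
move=> e0 d0 sup; rewrite mulf_eq0 negb_or => /andP[/sup yx /(cell_supp e0) yk].
by apply: sbox_trans yx (sbox_sym yk) => //; exact: ltW.
Qed.

Lemma fun_neq0 phi : (phi <> fun=> 0) -> exists y, phi y != 0.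
Proof.
move=> h; apply: contrapT => h'; apply: h; apply/funext => y.
by apply: contrapT => /eqP p; apply: h'; exists y.
Qed.

Lemma in_sbox0 y : exists2 r, 0 < r & sbox 0 r y.
Proof.
exists (1 + \sum_i `|y ord0 i|).
  by rewrite ltr_wpDr//; nneg.
move=> i; rewrite !mxE subr0 (@le_trans _ _ (1 + \sum_i `|y ord0 i|))//.
  by rewrite (bigD1 i)//= addrCA lerDl; nneg.
by rewrite ler_eXnr ?s_gt0// lerDl; nneg.
Qed.

Lemma ratio1 delta eps : 0 < delta -> 0 < eps -> (eps / delta) ^+ S * (delta / eps) ^+ S = 1.
Proof.
move=> d0 e0; rewrite -exprMn (_ : _ * _ = 1) ?expr1n//.
by field; rewrite !gt_eqF.
Qed.

(** Cut phi into about (delta / lam m)^S cells of relative size (lam m / delta)^S: the sum of their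
    contributions is of order (lam m)^gamma, with m arbitrary. *)
Lemma Tb_eq0 N gamma (T : (V -> R) -> R) : Tlin T -> 0 < gamma ->
  (forall rad, exists2 C, 0 <= C & forall y delta b phi, sbox 0 rad y -> 0 < delta -> delta <= rad ->
     loc N y delta b phi -> `|T phi| <= C * b * delta `^ gamma) ->
  forall y delta b phi, 0 < delta -> loc N y delta b phi -> T phi = 0.
Proof.
move=> Tl g0 TB y delta b phi d0 L; have D0 := ltW d0.
have [C1 C10 LC] := @loc_cell R d s N.
have b0 := loc_ge0 d0 L; have [sp sup _] := L.
have [r0 /ltW r00 r0y] := in_sbox0 y.
have [C C0 TC] := TB (r0 + 2 * delta).
pose A := (\prod_(i < d) 6) * C * C1 * b.
have A0 : 0 <= A by rewrite /A; apply: mulr_ge0 => //; apply: mulr_ge0 => //; apply: mulr_ge0 => //; apply: prodr_ge0.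
have key m : lam m <= delta -> `|T phi| <= A * (lam m) `^ gamma.
  move=> md; have e0 := lam_gt0 (R := R) m.
  rewrite {1}(phi_cells e0 D0 sup) (Tlin_sum _ Tl); last by move=> k; apply: test_cell; exact: loc_test L.
  rewrite (le_trans (ler_norm_sum _ _ _))//.
  apply: (@le_trans _ _ (\sum_(k <- lcells y delta (lam m)) C * (C1 * b * (lam m / delta) ^+ S) * lam m `^ gamma)).
    apply: ler_sum => k _.
    have [->|/fun_neq0[z pz]] := pselect ((fun z => phi z * cell (lam m) k z) = fun=> 0).
      rewrite Tlin0// normr0; have := ltW e0; have : 0 <= lam m / delta by rewrite divr_ge0// ltW.
      by move=> ? ?; nneg.
    apply: (TC (ctr (lam m) k)) => //.
    - have := ctr_near e0 D0 sup pz => h.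
      have h2 : 0 <= delta + lam m by rewrite addr_ge0// ltW.
      apply: sbox_mono (sbox_trans s_gt0 r00 h2 r0y h); first by rewrite addr_ge0.
      by lra.
    - by lra.
    - exact: LC L.
  rewrite big_const_seq count_predT iter_addr_0 -[X in X <= _]mulr_natl.
  have q0 : 0 < delta / lam m by rewrite divr_gt0.
  have e1 := ratio1 d0 e0.
  apply: (@le_trans _ _ ((\prod_(i < d) 6) * (delta / lam m) ^+ S *
     (C * (C1 * b * (lam m / delta) ^+ S) * lam m `^ gamma))).
    apply: ler_wpM2r; last exact: size_lcells.
    have := ltW e0; have : 0 <= lam m / delta by rewrite divr_ge0// ltW.
    by move=> ? ?; nneg.
  rewrite le_eqVlt; apply/orP; left; apply/eqP.
  transitivity (A * lam m `^ gamma * ((lam m / delta) ^+ S * (delta / lam m) ^+ S)).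
    by rewrite /A; ring.
  by rewrite e1 mulr1.
apply/eqP; rewrite -normr_eq0; apply/eqP; apply/le_anti; rewrite normr_ge0 andbT.
have [G G0 GP] := geo_bound g0.
apply/ler_addgt0Pr => e epos; rewrite add0r.
(* (lam m)^gamma tends to 0 as the general term of a series that [geo_bound] sums; the cut-off keeps
   the scales at which [key] applies. *)
pose u m : R := if lam m <= delta then lam m `^ gamma else 0.
have us M : \sum_(m < M) `|u m| <= (2 * delta) `^ gamma * G.
  apply: (GP u _ (2 * delta)); rewrite ?mulr_gt0 ?powR_ge0//.
    move=> m dm; rewrite /u; case: ifP => [h|_].
      by have := le_trans dm h; lra.
    by rewrite normr0 mulr_ge0// powR_ge0.
  move=> m _; have e0 := lam_gt0 (R := R) m.
  rewrite -pw_ratio ?mulr_gt0// /u; case: ifP => _; first by rewrite ger0_norm ?powR_ge0.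
  by rewrite normr0 powR_ge0.
have [cu _] := series_bound us.
have : (fun m => A * u m) @ \oo --> (A * 0 : R).
  by apply: cvgM; [exact: cvg_cst|exact: cvg_series_cvg_0].
rewrite mulr0 => /cvgrPdist_le /(_ e epos) [M _ hM].
have [m0 m0P] : exists m0 : nat, forall m, (m0 <= m)%N -> lam m <= delta.
  have [n hn] : exists n : nat, delta^-1 <= n%:R :> R.
    by exists (Num.truncn delta^-1).+1; rewrite ltW// truncnS_gt.
  exists n => m nm; rewrite /lam -[delta]invrK lef_pV2 ?posrE ?exprn_gt0 ?invr_gt0//.
  apply: (le_trans hn); rewrite (@le_trans _ _ m%:R) ?ler_nat//.
  by rewrite -natrX ler_nat ltnW// ltn_expl.
have lm := m0P (maxn M m0) (leq_maxr _ _).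
have := hM (maxn M m0) (leq_maxl _ _); rewrite /= sub0r normrN /u lm => h.
by apply: (le_trans (key _ lm)); apply: le_trans h; exact: ler_norm.
Qed.

(** A bound at the single scale delta0 propagates to all larger scales up to [rad], by cutting into
    cells of size delta0; their number is bounded in terms of rad / delta0. *)
Lemma scale_up N delta0 rad : 0 < delta0 -> delta0 <= rad -> exists2 A : R, 0 <= A &
  forall T C y delta b phi, Tlin T -> 0 <= C -> delta0 <= delta -> delta <= rad ->
  (forall z psi b', sbox y (2 * rad) z -> loc N z delta0 b' psi -> `|T psi| <= C * b') ->
  loc N y delta b phi -> `|T phi| <= A * C * b.
Proof.
move=> d00 dr; have [C1 C10 LC] := @loc_cell R d s N.
have p6 : 0 <= \prod_(i < d) (6 : R) by apply: prodr_ge0.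
have r0 : 0 < rad by exact: lt_le_trans dr.
have q00 : 0 <= rad / delta0 by rewrite divr_ge0// ltW.
exists ((\prod_(i < d) 6) * (rad / delta0) ^+ S * C1); first nneg.
move=> T C y delta b phi Tl C0 dd ddr TC L.
have d0 : 0 < delta by exact: lt_le_trans dd.
have D0 := ltW d0; have b0 := loc_ge0 d0 L; have [sp sup _] := L.
rewrite {1}(phi_cells d00 D0 sup) (Tlin_sum _ Tl); last by move=> k; apply: test_cell; exact: loc_test L.
rewrite (le_trans (ler_norm_sum _ _ _))//.
apply: (@le_trans _ _ (\sum_(k <- lcells y delta delta0) C * (C1 * b * 1))).
  apply: ler_sum => k _.
  have [->|/fun_neq0[z pz]] := pselect ((fun z => phi z * cell delta0 k z) = fun=> 0).
    by rewrite Tlin0// normr0; nneg.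
  have := TC (ctr delta0 k) _ _ _ (LC _ _ _ _ _ k d00 dd L) => h.
  apply: (le_trans (h _)).
    apply: sbox_mono (ctr_near d00 D0 sup pz); first by rewrite addr_ge0// ltW.
    by lra.
  rewrite ler_wpM2l// ler_wpM2l//; first nneg.
  by rewrite exprn_ile1// ?divr_ge0 ?ler_pdivrMr ?mul1r// ltW.
rewrite big_const_seq count_predT iter_addr_0 -[X in X <= _]mulr_natl.
apply: (@le_trans _ _ ((\prod_(i < d) 6) * (rad / delta0) ^+ S * (C * (C1 * b * 1)))).
  apply: ler_wpM2r; first nneg.
  apply: (le_trans (size_lcells s y d00 dd)); rewrite ler_wpM2l//.
  have q0 : 0 <= delta / delta0 by rewrite divr_ge0// ltW.
  by rewrite lerXn2r ?nnegrE// ler_wpM2r// invr_ge0 ltW.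
by rewrite le_eqVlt; apply/orP; left; apply/eqP; ring.
Qed.

Lemma test_loc N phi : test_function phi -> exists r b, 0 < r /\ loc N 0 r b phi.
Proof.
move=> [sp [A cA Ap]].
have [C C0 pC] := supported_bounded_pder N cA Ap sp.
have [r r1 rA] : exists2 r, 1 <= r & supported_in (sbox 0 r) phi.
  have [M [Mr MP]] := compact_bounded cA.
  pose r := Num.max 1 (M + 1); exists r; first by rewrite le_max lexx.
  move=> y /Ap Ay i; rewrite !mxE subr0.
  apply: (@le_trans _ _ r); last by rewrite ler_eXnr ?s_gt0// le_max lexx.
  apply: (le_trans (coord_norm y i)); apply: MP => //.
  by rewrite lt_max ltrDl ltr01 orbT.
have r0 : 0 < r by exact: lt_le_trans r1.
exists r, (C * r ^+ (S + N * S)); split=> //; split=> // l lN y.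
apply: (le_trans (pC l lN y)); rewrite -mulrA ler_peMr//.
rewrite exprVn ler_pdivlMr ?exprn_gt0// mul1r ler_weXn2l// leq_add2l.
exact: lwt_size.
Qed.

Context (N : nat) (gamma : R) (Z : V -> (V -> R) -> R).
Hypothesis gamma0 : 0 < gamma.
Hypothesis Zl : forall z, Tlin (Z z).
Hypothesis Zb : forall rad, exists2 C : R, 0 <= C & forall y z delta b phi,
  sbox 0 rad y -> 0 < delta -> delta <= rad -> sbox y (4 * delta) z ->
  loc N y delta b phi -> `|Z z phi - Z y phi| <= C * b * delta `^ gamma.

(** A radius of the support is chosen for each phi, so that [approx] is a function of phi alone; by
    [approxE] any box containing the support gives the same value. *)
Let srad phi : R := xget 0 [set r | 0 <= r /\ supported_in (sbox 0 r) phi].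

Let approx m phi : R :=
  \sum_(k <- lcells 0 (srad phi) (lam m)) Z (ctr (lam m) k) (fun y => phi y * cell (lam m) k y).

Let approxE m phi x delta : 0 <= delta -> supported_in (sbox x delta) phi -> approx m phi =
  \sum_(k <- lcells x delta (lam m)) Z (ctr (lam m) k) (fun y => phi y * cell (lam m) k y).
Proof.
move=> d0 sup; have [r r0 rx] := in_sbox0 x.
have [q0 qs] : 0 <= srad phi /\ supported_in (sbox 0 (srad phi)) phi.
  apply: (@xgetPex _ 0 [set r | 0 <= r /\ supported_in (sbox 0 r) phi]).
  exists (r + delta); split; first by rewrite addr_ge0// ltW.
  by move=> y /sup yx; apply: sbox_trans rx yx => //; exact: ltW.
apply: big_supp_eq; rewrite ?lcells_uniq// => k kn.
  by rewrite (cell_out (lam_gt0 m) q0 qs kn) Tlin0.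
by rewrite (cell_out (lam_gt0 m) d0 sup kn) Tlin0.
Qed.

Let approx_lin m c phi psi : test_function phi -> test_function psi ->
  approx m (fun x => c * phi x + psi x) = c * approx m phi + approx m psi.
Proof.
move=> tp tq; have [r [b [r0 Lp]]] := test_loc N tp; have [r' [b' [r'0 Lq]]] := test_loc N tq.
pose q := Num.max r r'; have q0 : 0 <= q by rewrite le_max ltW.
have sp : supported_in (sbox 0 q) phi.
  by move=> y /(loc_supp Lp); apply: sbox_mono; [exact: ltW|rewrite le_max lexx].
have sq : supported_in (sbox 0 q) psi.
  by move=> y /(loc_supp Lq); apply: sbox_mono; [exact: ltW|rewrite le_max lexx orbT].
rewrite (@approxE _ _ 0 q q0 sp) (@approxE _ _ 0 q q0 sq) (@approxE _ _ 0 q) //; last first.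
  move=> y; have [->|/sp//] := eqVneq (phi y) 0.
  by rewrite mulr0 add0r => /sq.
rewrite mulr_sumr -big_split; apply: eq_bigr => k _ /=.
rewrite -Zl; [|exact: test_cell|exact: test_cell].
by congr (Z _ _); apply/funext => y; ring.
Qed.

Let six : R := \prod_(i < d) 6.
Let six0 : 0 <= six. Proof. exact: prodr_ge0. Qed.

Let lam_half m : lam m = 2 * lam m.+1 :> R.
Proof. by rewrite /lam exprS invfM mulrA mulfV ?mul1r. Qed.

(** At a scale comparable to delta the number of cells is bounded, so the coherence of the germ can
    be applied cell by cell. *)
Let first_step rad : 0 < rad -> exists2 A : R, 0 <= A & forall m y delta b phi, sbox 0 rad y ->
  0 < delta -> delta <= rad -> lam m <= delta -> delta <= 2 * (1 + rad) * lam m ->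
  loc N y delta b phi -> `|approx m phi - Z y phi| <= A * b * delta `^ gamma.
Proof.
move=> rad0; have [C1 C10 LC] := @loc_cell R d s N.
have [C C0 ZC] := Zb rad.
pose c := 2 * (1 + rad); have c1 : 1 <= c by rewrite /c; lra.
have c0 : 0 <= c by exact: le_trans c1.
exists (six * c ^+ S * C * (c ^+ (S + N * S) * C1)); first nneg.
move=> m y delta b phi y0 d0 drad md dm L.
have D0 := ltW d0; have e0 := lam_gt0 (R := R) m; have b0 := loc_ge0 d0 L; have [sp sup _] := L.
rewrite (approxE _ D0 sup) {2}(phi_cells e0 D0 sup) (Tlin_sum _ (Zl y)); last first.
  by move=> k; apply: test_cell; exact: loc_test L.
rewrite -sumrB (le_trans (ler_norm_sum _ _ _))//.
apply: (@le_trans _ _ (\sum_(k <- lcells y delta (lam m)) C * (c ^+ (S + N * S) * (C1 * b * 1)) * delta `^ gamma)).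
  apply: ler_sum => k _.
  have [->|/fun_neq0[z pz]] := pselect ((fun z => phi z * cell (lam m) k z) = fun=> 0).
    by rewrite !Tlin0// subrr normr0; nneg.
  apply: ZC => //.
    apply: sbox_mono (ctr_near e0 D0 sup pz); first by rewrite addr_ge0// ltW.
    by lra.
  have [s1 s2 s3] := LC _ _ _ _ _ k e0 md L.
  apply: (loc_widen e0) => //.
  - by move=> w; rewrite mulf_eq0 negb_or => /andP[/sup].
  - nneg.
  - move=> l lN w; apply: (le_trans (s3 l lN w)); rewrite ler_wpM2r//.
      by rewrite exprn_ge0// invr_ge0 ltW.
    rewrite ler_wpM2l//; first nneg.
    by rewrite exprn_ile1// ?divr_ge0 ?ler_pdivrMr ?mul1r// ltW.
rewrite big_const_seq count_predT iter_addr_0 -[X in X <= _]mulr_natl.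
apply: (@le_trans _ _ (six * c ^+ S * (C * (c ^+ (S + N * S) * (C1 * b * 1)) * delta `^ gamma))).
  apply: ler_wpM2r; first nneg.
  apply: (le_trans (size_lcells s y e0 md)); rewrite ler_wpM2l//.
  have q0 : 0 <= delta / lam m by rewrite divr_ge0// ltW.
  by rewrite lerXn2r ?nnegrE// ler_pdivrMr.
by rewrite le_eqVlt; apply/orP; left; apply/eqP; ring.
Qed.

(** Both sums are expanded over pairs of a fine cell k' and a coarse cell k. They then differ only
    in the base point of the germ, and the centres of two overlapping cells are within 4 * lam m.+1
    of each other: this is the 4 in the coherence hypothesis. *)
Let next_step rad : 0 < rad -> exists2 A : R, 0 <= A & forall m y delta b phi, sbox 0 rad y ->
  0 < delta -> delta <= rad -> lam m <= delta ->
  loc N y delta b phi -> `|approx m.+1 phi - approx m phi| <= A * b * (lam m) `^ gamma.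
Proof.
move=> rad0; have [C1 C10 LC] := @loc_cell R d s N.
have [C C0 ZC] := Zb (3 * rad).
exists (six * six * C * (C1 * C1)); first nneg.
move=> m y delta b phi y0 d0 drad md L.
have D0 := ltW d0; have b0 := loc_ge0 d0 L; have [sp sup _] := L; have tp := loc_test L.
pose e : R := lam m; pose e' : R := lam m.+1; rewrite -/e.
have e0 : 0 < e := lam_gt0 m; have e'0 : 0 < e' := lam_gt0 m.+1.
have E0 := ltW e0; have E'0 := ltW e'0.
have ee : e = 2 * e' by exact: lam_half.
have e'e : e' <= e by rewrite ee; lra.
have e'd : e' <= delta by exact: le_trans e'e md.
pose G k' k : V -> R := fun z => phi z * cell e' k' z * cell e k z.
have tG k' k : test_function (G k' k) by apply: test_cell; exact: test_cell.
have suppk' k' : supported_in (sbox (ctr e' k') e) (fun z => phi z * cell e' k' z).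
  move=> z; rewrite mulf_eq0 negb_or => /andP[_ /(cell_supp e'0)].
  by apply: sbox_mono.
have E1 : approx m.+1 phi = \sum_(k' <- lcells y delta e') \sum_(k <- lcells (ctr e' k') e e)
    Z (ctr e' k') (G k' k).
  rewrite (approxE _ D0 sup); apply: eq_bigr => k' _.
  rewrite -/e' {1}(phi_cells e0 E0 (suppk' k')) (Tlin_sum _ (Zl _))// => k.
  exact: (tG k' k).
have E2 : approx m phi = \sum_(k' <- lcells y delta e') \sum_(k <- lcells (ctr e' k') e e)
    Z (ctr e k) (G k' k).
  transitivity (\sum_(k' <- lcells y delta e') \sum_(k <- lcells y delta e) Z (ctr e k) (G k' k)).
    rewrite (approxE _ D0 sup) exchange_big; apply: eq_bigr => k _.
    have sk : supported_in (sbox y delta) (fun z => phi z * cell e k z).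
      by move=> z; rewrite mulf_eq0 negb_or => /andP[/sup].
    rewrite -/e {1}(phi_cells e'0 D0 sk) (Tlin_sum _ (Zl _)); last first.
      by move=> ?; apply: test_cell; exact: test_cell.
    by apply: eq_bigr => k' _; congr (Z _ _); apply/funext => z; rewrite /G mulrAC.
  apply: eq_bigr => k' _; apply: big_supp_eq; rewrite ?lcells_uniq// => k kn.
    have h := cell_out e0 D0 sup kn.
    have -> : G k' k = fun=> 0.
      by apply/funext => z; rewrite /G mulrAC; have := congr1 (@^~ z) h; rewrite /= => ->; rewrite mul0r.
    by rewrite Tlin0.
  by rewrite /G (cell_out e0 E0 (suppk' k') kn) Tlin0.
rewrite E1 E2 -sumrB (le_trans (ler_norm_sum _ _ _))//.
have q0 : 0 <= e' / delta by rewrite divr_ge0.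
pose B := C * (C1 * (C1 * b * (e' / delta) ^+ S) ) * e `^ gamma.
have B0 : 0 <= B by rewrite /B; nneg.
apply: (@le_trans _ _ (\sum_(k' <- lcells y delta e') (six * B))).
  apply: ler_sum => k' _; rewrite -sumrB (le_trans (ler_norm_sum _ _ _))//.
  apply: (@le_trans _ _ (\sum_(k <- lcells (ctr e' k') e e) B)).
    apply: ler_sum => k _; rewrite distrC.
    have [->|/fun_neq0[z pz]] := pselect (G k' k = fun=> 0).
      by rewrite !Tlin0// subrr normr0.
    have s1 := @ctr_near _ _ _ e k z e0 E0 (suppk' k') pz.
    have pz' : phi z * cell e' k' z != 0.
      by move: pz; rewrite /G mulf_eq0 negb_or => /andP[].
    have s2 := ctr_near e'0 D0 sup pz'.
    have L2 := LC _ _ _ _ _ k' e'0 e'e (LC _ _ _ _ _ k e0 md L).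
    have E3 : (fun z => phi z * cell e k z * cell e' k' z) = G k' k.
      by apply/funext => w; rewrite /G mulrAC.
    rewrite E3 in L2.
    have c0 : sbox 0 (3 * rad) (ctr e' k').
      have r0 : 0 <= rad by exact: ltW.
      have de : 0 <= delta + e' by rewrite addr_ge0.
      by apply: sbox_mono (sbox_trans s_gt0 r0 de y0 s2); [rewrite addr_ge0|lra].
    have c1 : sbox (ctr e' k') (4 * e') (ctr e k).
      by apply: sbox_mono s1; [rewrite addr_ge0|lra].
    have e3 : e' <= 3 * rad by lra.
    have h := ZC _ _ _ _ _ c0 e'0 e3 c1 L2.
    refine (le_trans h _); rewrite /B.
    rewrite [X in C * X * _](_ : _ = C1 * (C1 * b * (e' / delta) ^+ S)); last first.
      have -> : e' / delta = (e / delta) * (e' / e) by field; rewrite !gt_eqF.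
      by rewrite [(_ * (e' / e)) ^+ _]exprMn; ring.
    rewrite ler_wpM2l//; first nneg.
    by apply: ge0_ler_powR => //; rewrite ?nnegrE ?ltW.
  rewrite big_const_seq count_predT iter_addr_0 -[X in X <= _]mulr_natl ler_wpM2r//.
  apply: (le_trans (size_lcells s _ e0 (lexx _))).
  by rewrite divff ?gt_eqF// expr1n mulr1.
rewrite big_const_seq count_predT iter_addr_0 -[X in X <= _]mulr_natl.
apply: (@le_trans _ _ (six * (delta / e') ^+ S * (six * B))).
  by rewrite ler_wpM2r ?size_lcells// /B; nneg.
rewrite le_eqVlt; apply/orP; left; apply/eqP.
transitivity (six * six * C * (C1 * C1) * b * e `^ gamma * ((e' / delta) ^+ S * (delta / e') ^+ S)).
  by rewrite /B; ring.
by rewrite ratio1// mulr1.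
Qed.

Lemma reconstruction : exists2 T : (V -> R) -> R, Tlin T &
  forall rad, exists2 C : R, 0 <= C & forall y delta b phi, sbox 0 rad y ->
    0 < delta -> delta <= rad -> loc N y delta b phi ->
    `|T phi - Z y phi| <= C * b * delta `^ gamma.
Proof.
have [G G0 GP] := geo_bound gamma0.
have main rad : 0 < rad -> exists2 C : R, 0 <= C & forall y delta b phi, sbox 0 rad y ->
    0 < delta -> delta <= rad -> loc N y delta b phi ->
    cvgn (approx ^~ phi) /\ `|limn (approx ^~ phi) - Z y phi| <= C * b * delta `^ gamma.
  move=> rad0; have [A1 A10 h1] := first_step rad0; have [A2 A20 h2] := next_step rad0.
  exists (A1 + A2 * 2 `^ gamma * G); first nneg.
  move=> y delta b phi y0 d0 drad L; have b0 := loc_ge0 d0 L; have D0 := ltW d0.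
  (* The first dyadic scale not above delta. It is comparable to delta unless it equals 1, in which
     case delta <= rad bounds the ratio; whence the factor 1 + rad. *)
  have [m0 m01 m02] : exists2 m0, lam m0 <= delta & delta <= 2 * (1 + rad) * lam m0.
    have ex : exists m, lam m <= delta.
      exists (Num.truncn delta^-1).+1; set n := _.+1.
      have hn : delta^-1 <= n%:R by rewrite ltW// truncnS_gt.
      rewrite /lam -[delta]invrK lef_pV2 ?posrE ?exprn_gt0 ?invr_gt0//.
      by apply: (le_trans hn); rewrite -natrX ler_nat ltnW// ltn_expl.
    case: (ex_minnP ex) => m mP min; exists m => //.
    case: m mP min => [|m] mP min; first by rewrite /lam expr0 invr1; lra.
    have : ~~ (lam m <= delta) by apply/negP => /min; rewrite ltnn.
    rewrite -ltNge lam_half => /ltW h; apply: (le_trans h).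
    by rewrite ler_wpM2r ?lam_ge0//; lra.
  pose w i := approx (m0 + i).+1 phi - approx (m0 + i) phi.
  have wE n : series w n = approx (m0 + n) phi - approx m0 phi.
    rewrite /series /= /w; elim: n => [|n ih]; first by rewrite big_geq// addn0 subrr.
    by rewrite big_nat_recr//= ih addnS; ring.
  have lamD i : lam (m0 + i) = lam m0 * lam i :> R by rewrite /lam exprD invfM.
  have wb M : \sum_(i < M) `|w i| <= A2 * b * delta `^ gamma * 2 `^ gamma * G.
    apply: (GP w _ 2) => //; first nneg.
      by move=> i h; have := le_trans h (lam_le1 i); lra.
    move=> i _; have li0 := lam_gt0 (R := R) i; have l0 := lam_gt0 (R := R) m0.
    have ld : lam (m0 + i) <= delta.
      by rewrite lamD; apply: le_trans m01; rewrite ler_piMr ?lam_ge0// lam_le1.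
    apply: (le_trans (h2 _ _ _ _ _ y0 d0 drad ld L)).
    rewrite -[X in _ <= X]mulrA -(@pw_ratio R 2)// -[X in _ <= X]mulrA ler_wpM2l//; first nneg.
    rewrite lamD powRM ?lam_ge0// ler_wpM2r ?powR_ge0//.
    by apply: ge0_ler_powR => //; rewrite ?nnegrE ?ltW.
  have [cw lw] := series_bound wb.
  have cv : approx ^~ phi @ \oo --> approx m0 phi + limn (series w).
    rewrite -(cvg_shiftn m0) /=.
    have : (fun n => approx m0 phi + series w n) @ \oo --> approx m0 phi + limn (series w).
      by apply: cvgD; [exact: cvg_cst|exact: cw].
    apply: cvg_trans; apply: near_eq_cvg; near=> n.
    by rewrite wE addrC subrK addnC.
  split; first by apply/cvg_ex; exists (approx m0 phi + limn (series w)).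
  rewrite (cvg_lim _ cv)// addrAC (le_trans (ler_normD _ _))//.
  apply: (le_trans (lerD (h1 _ _ _ _ _ y0 d0 drad m01 m02 L) lw)).
  by rewrite le_eqVlt; apply/orP; left; apply/eqP; ring.
have ct phi : test_function phi -> cvgn (approx ^~ phi).
  move=> tp; have [r [b [r0 L]]] := test_loc N tp.
  have [C C0 h] := main r r0.
  have [] // := h 0 r b phi _ r0 (lexx _) L.
  by apply: sbox_refl; exact: ltW.
exists (fun phi => limn (approx ^~ phi)).
  move=> c phi psi tp tq.
  have -> : (approx ^~ (fun x => c * phi x + psi x)) = fun m => c * approx m phi + approx m psi.
    by apply/funext => m; exact: approx_lin.
  apply/cvg_lim => //; apply: cvgD; last exact: ct.
  by apply: cvgM; [exact: cvg_cst|exact: ct].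
move=> rad; have r1 : 0 < Num.max rad 1 by rewrite lt_max ltr01 orbT.
have [C C0 h] := main _ r1; exists C => // y delta b phi y0 d0 dr L.
have rad0 : 0 <= rad by apply: le_trans dr; exact: ltW.
have rm : rad <= Num.max rad 1 by rewrite le_max lexx.
have [] // := h y delta b phi _ d0 (le_trans dr rm) L.
exact: sbox_mono y0.
Unshelve. all: by end_near.
Qed.

End Reconstruction.

(** * Between the bounds of a model and boxes at all scales *)

Section Conversions.
Context {R : realType} {d : nat} (s : 'I_d -> nat).
Hypothesis s_gt0 : forall i, (0 < s i)%N.
Local Notation V := 'rV[R]_d.
Implicit Types (x y z : V) (phi psi f g : V -> R) (l : seq 'I_d) (m N : nat).
Implicit Types (delta eps b a rho rad : R) (k j p : mindex d).
Local Notation S := (stot s).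
Local Notation sbox := (@sbox R d s).
Local Notation loc := (@loc R d s).

Lemma snorm_ge0 x : 0 <= snorm s x.
Proof. by apply: sumr_ge0 => i _; exact: powR_ge0. Qed.

Lemma snorm_coord x delta i : snorm s x <= delta -> `|x ord0 i| <= delta ^+ s i.
Proof.
move=> h; have d0 : 0 <= delta by exact: le_trans (snorm_ge0 x) h.
have hi : `|x ord0 i| `^ (s i)%:R^-1 <= delta.
  apply: le_trans h; rewrite /snorm (bigD1 i)//= lerDl; apply: sumr_ge0 => j _; exact: powR_ge0.
have e : `|x ord0 i| = (`|x ord0 i| `^ (s i)%:R^-1) ^+ s i.
  by rewrite (pwn _ (powR_ge0 _ _)) -powRrM mulVf ?powRr1// pnatr_eq0 -lt0n.
by rewrite e lerXn2r ?nnegrE ?powR_ge0.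
Qed.

Lemma snorm_box x delta : 0 <= delta -> (forall i, `|x ord0 i| <= delta ^+ s i) ->
  snorm s x <= d%:R * delta.
Proof.
move=> d0 h; rewrite /snorm (@le_trans _ _ (\sum_(i < d) delta))//; last first.
  by rewrite sumr_const card_ord mulr_natl.
apply: ler_sum => i _.
have e : delta = (delta ^+ s i) `^ (s i)%:R^-1.
  by rewrite (pwn _ d0) -powRrM mulfV ?powRr1// pnatr_eq0 -lt0n.
rewrite [leRHS]e; apply: ge0_ler_powR => //; rewrite ?invr_ge0 ?nnegrE ?exprn_ge0//.
Qed.

Lemma sbox_snorm x y : sbox x (snorm s (x - y)) y.
Proof.
move=> i; rewrite distrC; have := @snorm_coord (x - y) _ i (lexx _).
by rewrite !mxE.
Qed.

Lemma compact_sbox (A : set V) : compact A -> exists2 r, 1 <= r & A `<=` sbox 0 r.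
Proof.
move=> cA; have [M [Mr MP]] := compact_bounded cA.
pose r := Num.max 1 (M + 1); exists r; first by rewrite le_max lexx.
move=> y Ay i; rewrite !mxE subr0.
apply: (@le_trans _ _ r); last by rewrite ler_eXnr ?s_gt0// le_max lexx.
apply: (le_trans (coord_norm y i)); apply: MP => //.
by rewrite lt_max ltrDl ltr01 orbT.
Qed.

Lemma rescale_aff delta x phi : rescale s delta x phi =
  fun y => delta ^- S * phi (aff (fun i => delta ^- s i) (fun i => - (delta ^- s i * x ord0 i)) y).
Proof.
apply/funext => y; rewrite /rescale; congr (_ * phi _); apply/rowP => i.
by rewrite !mxE mulrBr.
Qed.

Lemma loc_rescale n delta x phi : 0 < delta -> unit_test s n phi ->
  loc n x delta 1 (rescale s delta x phi).
Proof.
move=> d0 [sp sup pb]; rewrite rescale_aff; split.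
- by apply: smoothZ; exact: smooth_aff.
- move=> y; rewrite mulf_eq0 negb_or => /andP[_ /sup] h i.
  have := @snorm_coord _ _ i h; rewrite expr1n !mxE -mulrBr normrM ger0_norm.
    by rewrite mulrC ler_pdivrMr ?exprn_gt0// mul1r.
  by rewrite invr_ge0 exprn_ge0// ltW.
- move=> l ln y; rewrite pderZ; last exact: smooth_aff.
  rewrite pder_aff// !normrM mul1r exprD exprVn.
  have E : \prod_(i <- l) delta ^- s i = delta^-1 ^+ lwt s l.
    by rewrite /lwt expr_sum; apply: eq_bigr => i _; rewrite exprVn.
  rewrite E ger0_norm; last by rewrite invr_ge0 exprn_ge0// ltW.
  have p0 : 0 <= delta^-1 ^+ lwt s l by rewrite exprn_ge0// invr_ge0 ltW.
  have q0 : 0 <= delta ^- S by rewrite invr_ge0 exprn_ge0// ltW.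
  rewrite (ger0_norm p0) ler_wpM2l// ler_piMr// pder_lidx//.
  by apply: pb; rewrite mdeg_lidx.
Qed.

(** A box of radius delta contains points of [snorm] up to d * delta, so phi is written as a
    rescaled unit test function at the scale D = (d + 1) * delta; D <= 1 is the restriction on
    delta. The constant c normalises the derivatives of the profile, and b = 0 is set apart since c
    is divided by. *)
Lemma Tb_of_unit n x C a T : Tlin T -> 0 <= C ->
  (forall delta phi, 0 < delta -> delta <= 1 -> unit_test s n phi ->
     `|T (rescale s delta x phi)| <= C * delta `^ a) ->
  Tb s n x (d.+1%:R^-1) (C * d.+1%:R ^+ (S + n * S) * d.+1%:R `^ a) a T.
Proof.
move=> Tl C0 TC delta b phi d0 d1 L; have b0 := loc_ge0 d0 L; have [sp sup pb] := L.
pose e : R := d.+1%:R; have e0 : 0 < e by rewrite ltr0n.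
have e1 : 1 <= e by rewrite ler1n.
pose D := e * delta; have D0 : 0 < D by rewrite mulr_gt0.
have D1 : D <= 1 by rewrite /D mulrC -ler_pdivlMr// mul1r.
have [bz|bn] := eqVneq b 0.
  have -> : phi = fun=> 0.
    by apply/funext => y; apply/eqP; rewrite -normr_le0; have := pb [::] isT y; rewrite bz mul0r.
  rewrite Tlin0// normr0 -/e; nneg.
have bp : 0 < b by rewrite lt_neqAle eq_sym bn.
pose c := b * e ^+ (S + n * S); have c0 : 0 < c by rewrite mulr_gt0// exprn_gt0.
pose psi z := (c^-1 * D ^+ S) * phi (aff (fun i => D ^+ s i) (fun i => x ord0 i) z).
have phiE : phi = fun y => c * rescale s D x psi y.
  apply/funext => y; rewrite /rescale /psi -/S.
  have -> : aff (fun i => D ^+ s i) (fun i => x ord0 i)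
      (\row_i (D ^- s i * (y ord0 i - x ord0 i))) = y.
    by apply/rowP => i; rewrite !mxE mulrA mulfV ?mul1r ?subrK// expf_neq0// gt_eqF.
  have u : D ^+ S != 0 by rewrite expf_neq0// gt_eqF.
  move: u; move: (D ^+ S) => u un; field.
  by rewrite un gt_eqF.
have up : unit_test s n psi.
  split.
  - by apply: smoothZ; exact: smooth_aff.
  - move=> z; rewrite mulf_eq0 negb_or => /andP[_ /sup] h /=.
    apply: (@le_trans _ _ (d%:R * e^-1)).
      apply: snorm_box; first by rewrite invr_ge0 ltW.
      move=> i; have := h i; rewrite !mxE addrK normrM (ger0_norm (exprn_ge0 _ (ltW D0))).
      rewrite exprMn -mulrA => h2; rewrite exprVn -[leRHS]mul1r ler_pdivlMr ?exprn_gt0//.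
      rewrite mulrC -(ler_pM2l (exprn_gt0 (s i) d0)) mulr1 mulrCA.
      by move: h2; rewrite mulrCA.
    by rewrite ler_pdivrMr// mul1r ler_nat.
  - move=> k kn y; rewrite Dpart_pder pderZ; last exact: smooth_aff.
    rewrite pder_aff// !normrM.
    have E : \prod_(i <- mlist k) D ^+ s i = D ^+ lwt s (mlist k).
      by rewrite /lwt expr_sum.
    have h := pb (mlist k); rewrite size_mlist in h; have {h}h := h kn.
    have c0' := ltW c0; have D0' := ltW D0.
    have i0 : 0 <= c^-1 by rewrite invr_ge0.
    rewrite E (ger0_norm i0) !(ger0_norm (exprn_ge0 _ D0')).
    rewrite -!mulrA mulrC ler_pdivrMr// mul1r mulrA -exprD.
    have {}h := h (aff (fun i => D ^+ s i) (fun i => x ord0 i) y); apply: (@le_trans _ _ (D ^+ (S + lwt s (mlist k)) * (b * delta^-1 ^+ (S + lwt s (mlist k))))).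
      by apply: ler_wpM2l => //; exact: exprn_ge0.
    rewrite /D exprMn mulrCA /c ler_wpM2l// exprVn mulfK ?expf_neq0 ?gt_eqF//.
    by rewrite ler_weXn2l// leq_add2l lwt_size// size_mlist.
rewrite phiE TlinZ//.
  rewrite normrM (gtr0_norm c0).
  apply: (@le_trans _ _ (c * (C * D `^ a))); first by rewrite ler_wpM2l ?(ltW c0)// TC.
  have e0' := ltW e0; have d0' := ltW d0.
  rewrite /c /D powRM// le_eqVlt; apply/orP; left; apply/eqP.
  by rewrite -/e; ring.
have := @loc_rescale n D x psi D0 up; exact: loc_test.
Qed.

Lemma distribution_of_Tb n x a T : Tlin T -> all_Tb s n x a T -> Defs.distribution T.
Proof.
move=> Tl TB; split=> // A cA.
have [r r1 rA] := compact_sbox cA.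
have [r' r'0 xr'] := in_sbox0 s_gt0 x.
pose q := r' + r; have q1 : 1 <= q by rewrite /q; lra.
have q0 : 0 < q by lra.
have Aq : A `<=` sbox x q.
  move=> y /rA y0; apply: sbox_trans (sbox_sym xr') y0 => //; lra.
have [C TC] := TB q.
exists n, (C * q ^+ (S + n * S) * q `^ a) => phi b tp sup pb.
have L : loc n x q (b * q ^+ (S + n * S)) phi.
  split; [by case: tp|by move=> y /sup /Aq|move=> l ln y].
  have b0 : 0 <= b by apply: le_trans (normr_ge0 _) (pb 0 _ 0); rewrite /mdeg big1// => i _; rewrite ffunE.
  rewrite pder_lidx; last by case: tp.
  apply: (@le_trans _ _ b); first by apply: pb; rewrite mdeg_lidx.
  rewrite -mulrA ler_peMr// exprVn ler_pdivlMr ?exprn_gt0// mul1r ler_weXn2l// leq_add2l.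
  exact: lwt_size.
apply: (le_trans (TC _ _ _ q0 (lexx _) L)).
by rewrite le_eqVlt; apply/orP; left; apply/eqP; ring.
Qed.

Lemma distribution_Tlin (T : (V -> R) -> R) : Defs.distribution T -> Tlin T.
Proof. by case. Qed.

Definition polyfun (P : V -> R) (n : nat) : Prop := exists2 q : seq (R * mindex d),
  (forall u, u \in q -> (sdeg s u.2 <= n)%N) &
  P = fun y => \sum_(u <- q) u.1 * monomial u.2 y.

Lemma polyfunM P Q n m : polyfun P n -> polyfun Q m -> polyfun (fun y => P y * Q y) (n + m).
Proof.
move=> [p ph ->] [q qh ->].
exists [seq (u.1 * v.1, u.2 + v.2) | u <- p, v <- q].
  by move=> _ /allpairsP[[u v] /= [/ph hu /qh hv ->]] /=; rewrite sdegD leq_add.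
apply/funext => y; rewrite big_allpairs_dep mulr_suml; apply: eq_bigr => u _.
rewrite mulr_sumr; apply: eq_bigr => v _ /=.
have -> : monomial (u.2 + v.2) y = monomial u.2 y * monomial v.2 y.
  rewrite /monomial -big_split; apply: eq_bigr => i _.
  by rewrite midxD exprD.
by ring.
Qed.

Lemma polyfun_cst (c : R) : polyfun (fun=> c) 0.
Proof.
exists [:: (c, 0)] => [u|]; first by rewrite inE => /eqP -> /=; rewrite sdeg0.
apply/funext => y; rewrite big_seq1 /monomial /= big1 ?mulr1// => i _.
by rewrite midx0 expr0.
Qed.

Lemma polyfun_lin i x : polyfun (fun y => (y - x) ord0 i) (s i).
Proof.
exists [:: (1, munit i); (- x ord0 i, 0)] => [u|].
  by rewrite !inE => /orP[] /eqP -> /=; rewrite ?sdeg_munit ?sdeg0.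
apply/funext => y; rewrite big_cons big_seq1 /= mul1r.
have -> : monomial (munit i) y = y ord0 i :> R.
  rewrite -[munit i]add0r monomialD /monomial big1 ?mulr1// => j _.
  by rewrite midx0 expr0.
by rewrite /monomial big1 ?mulr1 ?mxE// => j _; rewrite midx0 expr0.
Qed.

Lemma polyfun_monomial p x : polyfun (fun y => monomial p (y - x)) (sdeg s p).
Proof.
rewrite /sdeg /monomial.
have h (r : seq 'I_d) : polyfun (fun y => \prod_(i <- r) (y - x) ord0 i ^+ p i)
    (\sum_(i <- r) s i * p i)%N.
  elim: r => [|i r ih].
    rewrite big_nil (_ : (fun=> _) = fun=> 1); first exact: polyfun_cst.
    by apply/funext => y; rewrite big_nil.
  rewrite big_cons (_ : (fun=> _) = fun y => (y - x) ord0 i ^+ p i *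
     \prod_(j <- r) (y - x) ord0 j ^+ p j); last first.
    by apply/funext => y; rewrite big_cons.
  apply: polyfunM ih; elim: (p i) => [|n ihn].
    by rewrite muln0 (_ : (fun=> _) = fun=> 1); [exact: polyfun_cst|apply/funext => y; rewrite expr0].
  rewrite mulnS (_ : (fun=> _) = fun y => (y - x) ord0 i * (y - x) ord0 i ^+ n).
    by apply: polyfunM ihn; exact: polyfun_lin.
  by apply/funext => y; rewrite exprS.
by have := h (index_enum _).
Qed.

Lemma polyfun_partial P n i : polyfun P n -> polyfun (partial i P) n.
Proof.
move=> [q qh ->].
exists [seq (u.1 * (u.2 i)%:R, ([ffun j => (u.2 j - (j == i))%N] : mindex d)) | u : R * mindex d <- q].
  move=> _ /mapP[u /qh h ->] /=; apply: leq_trans h; apply: leq_sum => j _.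
  by rewrite ffunE leq_mul2l leq_subr orbT.
apply/funext => y; rewrite big_map.
have E := @pder_sum R d _ q (fun u y => u.1 * monomial u.2 y) [:: i].
rewrite -[LHS]/(pder [:: i] _ y) E; last by move=> u; apply: smoothZ; exact: smooth_monomial.
apply: eq_bigr => u _ /=; rewrite partialZ; last by apply: smooth_diff; exact: smooth_monomial.
by rewrite partial_monomial mulrA.
Qed.

Lemma polyfun_smooth P n : polyfun P n -> smooth P.
Proof.
by move=> [q _ ->]; apply: smooth_sum => u; apply: smoothZ; exact: smooth_monomial.
Qed.

(** Derivatives of K are moved to the polynomial by parts. Differentiation does not raise the
    degree, so the induction on the word of derivatives ranges over all polynomials of the given
    degree. *)
Lemma kernel_annihilates (Km : V -> R) delta (r : R) : smooth Km -> 0 <= delta ->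
  supported_in (sbox 0 delta) Km ->
  (forall x (p : seq (R * mindex d)),
        (forall q, q \in p -> (sdeg s q.2)%:R <= r) ->
        integral_rV (fun y => Km (x - y) * \sum_(q <- p) q.1 * monomial q.2 y) = 0) ->
  forall k p x y, (sdeg s p)%:R <= r ->
    integral_rV (fun z => monomial p (z - x) * Dpart k Km (y - z)) = 0.
Proof.
move=> sK d0 sup ann k p x y pr.
have main l P n : n%:R <= r -> polyfun P n -> integral_rV (fun z => P z * pder l Km (y - z)) = 0.
  move=> nr; elim: l P => [|i l ih] P pP.
    have [q qn PE] := pP; rewrite PE -[RHS](ann y q); last first.
      by move=> u /qn h; rewrite (le_trans _ nr)// ler_nat.
    by congr integral_rV; apply/funext => z; rewrite mulrC.
  have sP := polyfun_smooth pP; have spl := smooth_pder l sK; have spil := smooth_pder (i :: l) sK.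
  have r0 (j : 'I_d) : 0 <= delta ^+ s j by rewrite exprn_ge0.
  have supl l' : supported_in (rbox y (fun j : 'I_d => delta ^+ s j)) (fun z => pder l' Km (y - z)).
    by apply: (@supported_sbox _ _ s); exact: supported_pder (@rbox_closed _ _ _ _) sup.
  have ss l' (f : V -> R) : supported_in (rbox y (fun j : 'I_d => delta ^+ s j)) (fun z => f z * pder l' Km (y - z)).
    by move=> z; rewrite mulf_eq0 negb_or => /andP[_ /supl].
  have := @integral_partial0 _ _ i (fun z => P z * pder l Km (y - z)) y _ _ r0 (ss l P).
  have -> : partial i (fun z => P z * pder l Km (y - z)) =
    fun z => (-1) * (P z * pder (i :: l) Km (y - z)) + partial i P z * pder l Km (y - z).
    apply/funext => z; rewrite partialM; last 2 first.
    - exact: smooth_diff.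
    - by apply: smooth_diff; exact: smooth_sub.
    have := pder_sub y [:: i] spl; rewrite /= => ->.
    by rewrite expr1; ring.
  rewrite integral_lin; last 2 first.
  - by apply: (@smooth_cpt _ _ _ y (fun j : 'I_d => delta ^+ s j)) => //; apply: smoothM => //; exact: smooth_sub.
  - apply: (@smooth_cpt _ _ _ y (fun j : 'I_d => delta ^+ s j)) => //; apply: smoothM; last exact: smooth_sub.
    exact: smooth_partial.
  rewrite ih; last exact: polyfun_partial.
  move=> h; apply/eqP; rewrite -oppr_eq0 -mulN1r -[X in X == _]addr0; apply/eqP/h.
  by apply: smoothM => //; exact: smooth_sub.
rewrite (_ : (fun z => _) = fun z => monomial p (z - x) * pder (mlist k) Km (y - z)).
  by apply: (main _ _ _ pr); exact: polyfun_monomial.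
by apply/funext => z; rewrite Dpart_pder.
Qed.

End Conversions.

Local Notation mm := monalg.mul.
Local Notation m1 := monalg.one.

(** * Linear extensions *)
Section Linear.
Context {R : realType}.

Lemma msupp_uniq (K : choiceType) (a : malg K R) : uniq (enum_fset (msupp a)).
Proof. exact: fset_uniq. Qed.

Lemma mem_msupp (K : choiceType) (a : malg K R) k : (k \in enum_fset (msupp a)) = (mcoeff k a != 0).
Proof. by rewrite mcoeff_neq0. Qed.

Lemma lext_w (K : choiceType) (V : lmodType R) (f : K -> V) (a : malg K R) (r : seq K) :
  uniq r -> (forall k, mcoeff k a != 0 -> k \in r) ->
  lext f a = \sum_(k <- r) mcoeff k a *: f k.
Proof.
move=> ur h; apply: (@big_supp_eq K V (enum_fset (msupp a)) r (fun k => mcoeff k a *: f k)) => //.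
  by move=> k; rewrite mem_msupp negbK => /eqP ->; rewrite scale0r.
by move=> k kr; have [->|/h] := eqVneq (mcoeff k a) 0; rewrite ?scale0r// (negPf kr).
Qed.

Lemma lext_is_linear (K : choiceType) (V : lmodType R) (f : K -> V) : linear (lext f).
Proof.
move=> c a b.
pose r := undup (enum_fset (msupp a) ++ enum_fset (msupp b)).
have ur : uniq r by exact: undup_uniq.
have ha k : mcoeff k a != 0 -> k \in r by rewrite mem_undup mem_cat -mem_msupp => ->.
have hb k : mcoeff k b != 0 -> k \in r by rewrite mem_undup mem_cat -mem_msupp => ->; rewrite orbT.
rewrite (lext_w _ ur ha) (lext_w _ ur hb) (lext_w _ ur); last first.
  move=> k; rewrite mcoeffD mcoeffZ.
  have [->|/ha//] := eqVneq (mcoeff k a) 0; have [->|/hb//] := eqVneq (mcoeff k b) 0.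
  by rewrite mulr0 addr0 eqxx.
rewrite scaler_sumr -big_split; apply: eq_bigr => k _ /=.
by rewrite mcoeffD mcoeffZ scalerDl scalerA.
Qed.

HB.instance Definition _ (K : choiceType) (V : lmodType R) (f : K -> V) :=
  GRing.isLinear.Build R (malg K R) V *:%R (lext f) (lext_is_linear f).

Lemma mcoeff_bas (K : choiceType) (k l : K) : mcoeff l (bas k : malg K R) = (k == l)%:R.
Proof. by rewrite /bas mcoeffU; case: eqP. Qed.

Lemma mkmalgUE (K : choiceType) (k : K) (c : R) : mkmalgU k c = c *: bas k :> malg K R.
Proof. by apply/malgP => l; rewrite mcoeffZ mcoeff_bas mcoeffU mulr_natr. Qed.

Lemma lext_bas (K : choiceType) (V : lmodType R) (f : K -> V) k : lext f (bas k) = f k.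
Proof.
rewrite (@lext_w _ _ f _ [:: k])//.
  by rewrite big_seq1 mcoeff_bas eqxx scale1r.
by move=> l; rewrite mcoeff_bas inE; have [_|_] := eqVneq k l; rewrite // eqxx.
Qed.

Lemma eq_lext (K : choiceType) (V : lmodType R) (f g : K -> V) a :
  (forall k, mcoeff k a != 0 -> f k = g k) -> lext f a = lext g a.
Proof.
by move=> h; rewrite /lext !big_seq; apply: eq_bigr => k; rewrite mem_msupp => /h ->.
Qed.

Lemma lext_id (K : choiceType) (a : malg K R) : lext bas a = a.
Proof.
rewrite [RHS]monalgE; apply: eq_bigr => k _.
by rewrite mkmalgUE.
Qed.

Lemma lext_comp (K : choiceType) (V W : lmodType R) (h : {linear V -> W}) (f : K -> V) a :
  h (lext f a) = lext (fun k => h (f k)) a.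
Proof. by rewrite /lext linear_sum; apply: eq_bigr => k _; rewrite linearZ. Qed.

Lemma lext_lext (K L : choiceType) (V : lmodType R) (f : L -> V) (g : K -> malg L R) a :
  lext f (lext g a) = lext (fun k => lext f (g k)) a.
Proof. exact: lext_comp. Qed.

Lemma lext_linear (K : choiceType) (V : lmodType R) (f g : K -> V) (c : R) a :
  lext (fun k => c *: f k + g k) a = c *: lext f a + lext g a.
Proof.
rewrite /lext scaler_sumr -big_split; apply: eq_bigr => k _ /=.
by rewrite scalerDr !scalerA mulrC.
Qed.

Lemma lext_sumf (K : choiceType) (V : lmodType R) (I : Type) (r : seq I) (f : I -> K -> V) a :
  lext (fun k => \sum_(i <- r) f i k) a = \sum_(i <- r) lext (f i) a.
Proof.
rewrite /lext exchange_big; apply: eq_bigr => k _.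
by rewrite scaler_sumr.
Qed.

Lemma lext_zero (K : choiceType) (V : lmodType R) a : lext (fun _ : K => 0 : V) a = 0.
Proof. by rewrite /lext big1// => k _; rewrite scaler0. Qed.

Lemma lextRE (K : choiceType) (f : K -> R) a : lextR f a = lext (V := R^o) f a.
Proof. by []. Qed.

Lemma lextRD (K : choiceType) (f : K -> R) (a b : malg K R) :
  lextR f (a + b) = lextR f a + lextR f b.
Proof. by rewrite !lextRE linearD. Qed.

Lemma lextRB (K : choiceType) (f : K -> R) (a b : malg K R) :
  lextR f (a - b) = lextR f a - lextR f b.
Proof. by rewrite !lextRE linearB. Qed.

Lemma lextR0 (K : choiceType) (f : K -> R) : lextR f 0 = 0.
Proof. by rewrite !lextRE linear0. Qed.

Lemma lextRZ (K : choiceType) (f : K -> R) c (a : malg K R) : lextR f (c *: a) = c * lextR f a.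
Proof. by rewrite !lextRE linearZ. Qed.

Lemma lextR_sum (K : choiceType) (f : K -> R) (I : Type) (r : seq I) (F : I -> malg K R) :
  lextR f (\sum_(i <- r) F i) = \sum_(i <- r) lextR f (F i).
Proof. by rewrite lextRE linear_sum. Qed.

Lemma lextR_bas (K : choiceType) (f : K -> R) k : lextR f (bas k) = f k.
Proof. by rewrite lextRE lext_bas. Qed.

Lemma lextR_lext (K L : choiceType) (f : L -> R) (g : K -> malg L R) a :
  lextR f (lext g a) = lextR (fun k => lextR f (g k)) a.
Proof. by rewrite !lextRE lext_lext. Qed.

Lemma eq_lextR (K : choiceType) (f g : K -> R) a :
  (forall k, mcoeff k a != 0 -> f k = g k) -> lextR f a = lextR g a.
Proof. exact: eq_lext. Qed.

Implicit Types (K L : choiceType).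

Lemma lspanP K (B : set K) (c : R) a b : lspan B a -> lspan B b -> lspan B (c *: a + b).
Proof.
move=> ha hb k; rewrite mcoeffD mcoeffZ.
have [->|/ha//] := eqVneq (mcoeff k a) 0; have [->|/hb//] := eqVneq (mcoeff k b) 0.
by rewrite mulr0 addr0 eqxx.
Qed.

Lemma lspan0 K (B : set K) : lspan B (0 : malg K R).
Proof. by move=> k; rewrite mcoeff0 eqxx. Qed.

Lemma lspanD K (B : set K) (a b : malg K R) : lspan B a -> lspan B b -> lspan B (a + b).
Proof. by move=> ha hb; rewrite -[a]scale1r; exact: lspanP. Qed.

Lemma lspanZ K (B : set K) (c : R) a : lspan B a -> lspan B (c *: a).
Proof. by move=> ha; rewrite -[_ *: _]addr0; apply: lspanP => //; exact: lspan0. Qed.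

Lemma lspanB K (B : set K) (a b : malg K R) : lspan B a -> lspan B b -> lspan B (a - b).
Proof. by move=> ha hb; apply: lspanD => //; rewrite -scaleN1r; exact: lspanZ. Qed.

Lemma lspan_sum K (B : set K) (I : eqType) (r : seq I) (F : I -> malg K R) :
  (forall i, i \in r -> lspan B (F i)) -> lspan B (\sum_(i <- r) F i).
Proof.
move=> h; rewrite big_seq; elim/big_rec: _ => [|i a ir ha]; first exact: lspan0.
by apply: lspanD => //; exact: h.
Qed.

Lemma lspan_bas K (B : set K) k : B k -> lspan B (bas k : malg K R).
Proof. by move=> Bk l; rewrite mcoeff_bas; have [<-//|_] := eqVneq k l; rewrite eqxx. Qed.

Lemma lspan_lext K L (B : set L) (f : K -> malg L R) (a : malg K R) :
  (forall k, mcoeff k a != 0 -> lspan B (f k)) -> lspan B (lext f a).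
Proof.
move=> h; apply: lspan_sum => k; rewrite mem_msupp => /h; exact: lspanZ.
Qed.

Lemma lspanS K (B C : set K) (a : malg K R) : B `<=` C -> lspan B a -> lspan C a.
Proof. by move=> BC h k /h /BC. Qed.

Lemma bas_mul (K : conomType) (k l : K) : bas k * bas l = bas (mm k l) :> malg K R.
Proof. by rewrite /bas malgM_def fgmulUU mulr1. Qed.

Lemma bas_one (K : conomType) : bas (m1 : K) = 1 :> malg K R.
Proof. by []. Qed.

Lemma mulE (K : conomType) (a b : malg K R) :
  a * b = lext (fun k => lext (fun l => bas (mm k l)) b) a.
Proof.
rewrite malgME /lext; apply: eq_bigr => k _; rewrite scaler_sumr.
by apply: eq_bigr => l _; rewrite scalerA mkmalgUE.
Qed.

Lemma lextM_on (K : conomType) (A : comAlgType R) (f : K -> A) (a b : malg K R) :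
  (forall k l, mcoeff k a != 0 -> mcoeff l b != 0 -> f (mm k l) = f k * f l) ->
  lext f (a * b) = lext f a * lext f b.
Proof.
move=> h; rewrite mulE lext_lext.
have -> : lext f a * lext f b = lext (fun k => f k * lext f b) a.
  by rewrite /lext mulr_suml; apply: eq_bigr => k _; rewrite scalerAl.
apply: eq_lext => k ka; rewrite lext_lext.
have -> : f k * lext f b = lext (fun l => f k * f l) b.
  by rewrite /lext mulr_sumr; apply: eq_bigr => l _; rewrite scalerAr.
by apply: eq_lext => l lb; rewrite lext_bas h.
Qed.

Lemma lextM (K : conomType) (A : comAlgType R) (f : K -> A) (a b : malg K R) :
  (forall k l, f (mm k l) = f k * f l) -> lext f (a * b) = lext f a * lext f b.
Proof. by move=> h; apply: lextM_on. Qed.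

Lemma lextRM_on (K : conomType) (f : K -> R) (a b : malg K R) :
  (forall k l, mcoeff k a != 0 -> mcoeff l b != 0 -> f (mm k l) = f k * f l) ->
  lextR f (a * b) = lextR f a * lextR f b.
Proof. exact: (@lextM_on K (R^o : comAlgType R)). Qed.

Lemma lspanM (K : conomType) (B C D : set K) (a b : malg K R) :
  (forall k l, B k -> C l -> D (mm k l)) -> lspan B a -> lspan C b -> lspan D (a * b).
Proof.
move=> h ha hb; rewrite mulE; apply: lspan_lext => k /ha Bk.
by apply: lspan_lext => l /hb Cl; apply: lspan_bas; exact: h.
Qed.

Lemma tensE K L (a : malg K R) (b : malg L R) :
  tens a b = lext (fun k => lext (fun l => bas (k, l)) b) a.
Proof.
rewrite /tens /lext; apply: eq_bigr => k _; rewrite scaler_sumr.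
by apply: eq_bigr => l _; rewrite scalerA mkmalgUE.
Qed.

Lemma lext_tens K L (V : lmodType R) (f : K * L -> V) (a : malg K R) (b : malg L R) :
  lext f (tens a b) = lext (fun k => lext (fun l => f (k, l)) b) a.
Proof.
rewrite tensE lext_lext; apply: eq_lext => k _; rewrite lext_lext; apply: eq_lext => l _.
exact: lext_bas.
Qed.

Lemma lspan_tens K L (B : set K) (C : set L) (a : malg K R) (b : malg L R) :
  lspan B a -> lspan C b -> lspan (B `*` C) (tens a b).
Proof.
move=> ha hb; rewrite tensE; apply: lspan_lext => k /ha Bk.
by apply: lspan_lext => l /hb Cl; exact: lspan_bas.
Qed.

Lemma tens_bas K L (k : K) (l : L) : tens (bas k) (bas l) = bas (k, l) :> malg _ R.
Proof. by rewrite tensE !lext_bas. Qed.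

Lemma tens0l K L (b : malg L R) : tens (0 : malg K R) b = 0.
Proof. by rewrite tensE linear0. Qed.

Lemma tens0r K L (a : malg K R) : tens a (0 : malg L R) = 0.
Proof. by rewrite tensE -[RHS](lext_zero _ a); apply: eq_lext => k _; rewrite linear0. Qed.

Lemma tensZ K L c e (a : malg K R) (b : malg L R) : tens (c *: a) (e *: b) = (c * e) *: tens a b.
Proof.
rewrite !tensE linearZ /= -scalerA; congr (_ *: _).
have := lext_comp (GRing.scale e) (fun k => lext (fun l => bas (k, l)) b) a => /= ->.
by apply: eq_lext => k _; rewrite linearZ.
Qed.

End Linear.

(** * Formal expressions *)
Section Expressions.
Context {d : nat}.
Implicit Types (t u : expr d) (a b : term d) (k l : mindex d).

HB.instance Definition _ := Monoid.isComLaw.Build (expr d) m1 emul emulA emulC emul1.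

Lemma eoneE : (m1 : expr d) = pi_expr TOne. Proof. by []. Qed.

Lemma Xpow0 : Xpow (0 : mindex d) = m1.
Proof.
rewrite /Xpow; elim/big_rec: _ => // i t _ ->; rewrite midx0 /=; exact: emul1.
Qed.

Lemma iter_emul n t u : iter n (emul t) u = emul (iter n (emul t) m1) u.
Proof. by elim: n => [|n ih] /=; [rewrite emul1|rewrite ih emulA]. Qed.

Lemma XpowD k l : Xpow (k + l) = emul (Xpow k) (Xpow l).
Proof.
rewrite /Xpow -big_split; apply: eq_bigr => i _ /=.
by rewrite midxD iterD iter_emul.
Qed.

Lemma Xpow_unit i : Xpow (munit i) = Xvar i :> expr d.
Proof.
rewrite /Xpow (bigD1 i)//= munitE eqxx /= big1; last first.
  by move=> j ji; rewrite munitE (negPf ji).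
by rewrite !emulx1.
Qed.

(** [fac k t u] says that I_k t is one of the factors of u. It is read off a representative, being
    invariant under [term_eqv]; such invariants take the place of a normal form for expressions. *)
Fixpoint facT k t a : Prop :=
  match a with
  | TMul b c => facT k t b \/ facT k t c
  | TI l b => k = l /\ t = pi_expr b
  | _ => False
  end.

Lemma facT_eqv k t a b : term_eqv a b -> facT k t a <-> facT k t b.
Proof.
elim=> {a b} //=; try tauto.
by move=> l a b /pi_exprP -> _.
Qed.

Definition fac k t u := facT k t (repr u).

Lemma fac_pi k t a : fac k t (pi_expr a) <-> facT k t a.
Proof. exact/facT_eqv/repr_pi. Qed.

Lemma fac_emul k t u v : fac k t (emul u v) <-> fac k t u \/ fac k t v.
Proof. by rewrite /emul fac_pi. Qed.

Lemma fac_II k t l u : fac k t (II l u) <-> k = l /\ t = u.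
Proof. by rewrite /II fac_pi /= pi_reprK. Qed.

Lemma fac_one k t : ~ fac k t m1. Proof. by rewrite fac_pi. Qed.
Lemma fac_Xi k t : ~ fac k t Xi. Proof. by rewrite fac_pi. Qed.
Lemma fac_Xvar k t i : ~ fac k t (Xvar i). Proof. by rewrite fac_pi. Qed.

Lemma II_inj k t l u : II k t = II l u -> k = l /\ t = u.
Proof. by move=> e; apply/fac_II; rewrite -e; apply/fac_II. Qed.

Fixpoint hasXiT a : Prop :=
  match a with
  | TMul b c => hasXiT b \/ hasXiT c
  | TXi => True
  | _ => False
  end.

Lemma hasXiT_eqv a b : term_eqv a b -> hasXiT a <-> hasXiT b.
Proof. by elim=> {a b} //=; tauto. Qed.

Definition hasXi u := hasXiT (repr u).

Lemma hasXi_pi a : hasXi (pi_expr a) <-> hasXiT a.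
Proof. exact/hasXiT_eqv/repr_pi. Qed.

Lemma hasXi_emul u v : hasXi (emul u v) <-> hasXi u \/ hasXi v.
Proof. by rewrite /emul hasXi_pi. Qed.

Lemma hasXi_II k u : ~ hasXi (II k u). Proof. by rewrite hasXi_pi. Qed.
Lemma hasXi_one : ~ hasXi m1. Proof. by rewrite hasXi_pi. Qed.

Lemma expr_ind (P : expr d -> Prop) : P m1 -> P Xi -> (forall i, P (Xvar i)) ->
  (forall t u, P t -> P u -> P (emul t u)) -> (forall k t, P t -> P (II k t)) ->
  forall t, P t.
Proof.
move=> h1 hX hx hm hI t; rewrite -(pi_reprK t); elim: (repr t) => //= [a ha b hb|k a ha].
  by rewrite -emul_pi; exact: hm.
have -> : pi_expr (TI k a) = II k (pi_expr a) by apply/pi_exprP/eqv_I/eqv_sym/repr_pi.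
exact: hI.
Qed.

Lemma Xpow_nofac k k' t : ~ fac k' t (Xpow k).
Proof.
rewrite /Xpow; elim/big_rec: _ => [|i u _ h]; first exact: fac_one.
by elim: (k i) => [|n ih] /=; rewrite ?emul1// -emulA => /fac_emul[/fac_Xvar|].
Qed.

Lemma Xpow_noXi k : ~ hasXi (Xpow k).
Proof.
rewrite /Xpow; elim/big_rec: _ => [|i u _ h]; first exact: hasXi_one.
elim: (k i) => [|n ih] /=; rewrite ?emul1// -emulA => /hasXi_emul[|//].
by rewrite hasXi_pi.
Qed.

(** Powers of X are recognised by what they lack, which makes [is_Xpow_emul] an equivalence and not
    just a stability property. *)
Lemma is_XpowP t : is_Xpow t <-> ~ hasXi t /\ forall k u, ~ fac k u t.
Proof.
split=> [[k ->]|]; first by split; [exact: Xpow_noXi|move=> *; exact: Xpow_nofac].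
elim/expr_ind: t.
- by move=> _; exists 0; rewrite Xpow0.
- by rewrite hasXi_pi => -[/(_ I)].
- by move=> i _; exists (munit i); rewrite Xpow_unit.
- move=> t u ht hu [nX nf].
  have [|k ->] := ht; first by split=> [h|k v h]; [apply: nX|apply: (nf k v)]; [apply/hasXi_emul|apply/fac_emul]; left.
  have [|l ->] := hu; first by split=> [h|l v h]; [apply: nX|apply: (nf l v)]; [apply/hasXi_emul|apply/fac_emul]; right.
  by exists (k + l); rewrite XpowD.
- by move=> k t _ [_ /(_ k t)]; case; apply/fac_II.
Qed.

Lemma is_Xpow_emul t u : is_Xpow (emul t u) <-> is_Xpow t /\ is_Xpow u.
Proof.
rewrite !is_XpowP hasXi_emul; split.
  by move=> [nX nf]; split; split; try tauto; move=> k v h; apply: (nf k v); apply/fac_emul; tauto.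
by move=> [[? h1] [? h2]]; split; [tauto|move=> k v /fac_emul[/h1|/h2]].
Qed.

Lemma is_Xpow_one : is_Xpow (m1 : expr d). Proof. by exists 0; rewrite Xpow0. Qed.

Lemma II_notXpow k t : ~ is_Xpow (II k t).
Proof. by move=> /is_XpowP[_ /(_ k t)]; case; apply/fac_II. Qed.

Lemma formal_Xpow k : formal (Xpow k).
Proof.
rewrite /Xpow; elim/big_rec: _ => [|i u _ h]; first exact: formal_one.
elim: (k i) => [|n ih] /=; rewrite ?emul1// -emulA; apply: formal_mul => //.
exact: formal_X.
Qed.

(** Unlike [fac], at any depth: t is the argument of some I_k inside u. *)
Fixpoint innT t a : Prop :=
  match a with
  | TMul b c => innT t b \/ innT t c
  | TI l b => t = pi_expr b \/ innT t b
  | _ => False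
  end.

Lemma innT_eqv t a b : term_eqv a b -> innT t a <-> innT t b.
Proof.
elim=> {a b} //=; try tauto.
by move=> l a b /pi_exprP -> ->.
Qed.

Definition inn t u := innT t (repr u).

Lemma inn_pi t a : inn t (pi_expr a) <-> innT t a.
Proof. exact/innT_eqv/repr_pi. Qed.

Lemma inn_emul t u v : inn t (emul u v) <-> inn t u \/ inn t v.
Proof. by rewrite /emul inn_pi. Qed.

Lemma inn_II t l u : inn t (II l u) <-> t = u \/ inn t u.
Proof. by rewrite /II inn_pi /= pi_reprK. Qed.

Lemma fac_inn k t u : fac k t u -> inn t u.
Proof.
rewrite /fac /inn; elim: (repr u) => //= [a ha b hb [/ha|/hb]|l a _ [_ ->]]; tauto.
Qed.

End Expressions.

Section Weights.
Context {R : realType} {d : nat} (s : 'I_d -> nat) (alpha beta : R).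
Hypothesis s_gt0 : forall i, (0 < s i)%N.
Implicit Types (t u : expr d) (a b : term d) (k l q : mindex d).
Local Notation wt := (weight s alpha beta).
Local Notation Delta := (coproduct s alpha beta).
Local Notation Jop := (Jop s alpha beta).
Local Notation Alg := (Alg s alpha beta).

Lemma wt_one : wt m1 = 0. Proof. exact: weight_pi. Qed.
Lemma wt_Xi : wt Xi = alpha. Proof. exact: weight_pi. Qed.
Lemma wt_X i : wt (Xvar i) = (s i)%:R. Proof. exact: weight_pi. Qed.
Lemma wt_emul t u : wt (emul t u) = wt t + wt u. Proof. exact: weight_pi. Qed.
Lemma wt_II k t : wt (II k t) = wt t + beta - (sdeg s k)%:R. Proof. exact: weight_pi. Qed.

Lemma wt_Xpow k : wt (Xpow k) = (sdeg s k)%:R.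
Proof.
rewrite /Xpow /sdeg natr_sum; elim/big_rec2: _ => [|i w t _ <-]; first exact: wt_one.
rewrite wt_emul; congr (_ + _); elim: (k i) => [|n ih] /=.
  by rewrite muln0 wt_one.
by rewrite wt_emul ih wt_X mulnS natrD.
Qed.

Lemma cop_one : Delta m1 = 1. Proof. exact: coproduct_pi. Qed.
Lemma cop_Xi : Delta Xi = tens (bas Xi) 1. Proof. exact: coproduct_pi. Qed.
Lemma cop_X i : Delta (Xvar i) = tens (bas (Xvar i)) 1 + tens 1 (bas (Xvar i)).
Proof. exact: coproduct_pi. Qed.
Lemma cop_emul t u : Delta (emul t u) = Delta t * Delta u. Proof. exact: coproduct_pi. Qed.

Definition pos_J q t : bool := ~~ ((wt t + beta - (sdeg s q)%:R <= 0) || `[< is_Xpow t >]).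

Lemma pos_JP q t : reflect (0 < wt t + beta - (sdeg s q)%:R /\ ~ is_Xpow t) (pos_J q t).
Proof.
rewrite /pos_J negb_or -ltNge; apply: (iffP andP) => -[h1 h2]; split=> //.
  by move: h2 => /asboolPn.
by apply/asboolPn.
Qed.

Lemma Jop_if q t : Jop q t = if pos_J q t then bas (II q t) else 0.
Proof. by rewrite /Defs.Jop /pos_J; case: (_ || _). Qed.

(** J_q t can be nonzero only for |q| < nb t: the common cut-off of all sums over multi-indices
    attached to t. *)
Definition nb t : nat := (Num.truncn (wt t + beta)).+1.

Lemma pos_J_nb q t : pos_J q t -> (sdeg s q < nb t)%N.
Proof.
move=> /pos_JP[h _]; rewrite /nb -(ltr_nat R); apply: lt_trans (truncnS_gt _).
by rewrite -subr_gt0.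
Qed.

Lemma nb_le t u : wt t <= wt u -> (nb t <= nb u)%N.
Proof. by move=> h; rewrite /nb ltnS le_truncn// lerD2r. Qed.

Definition Ex l : Hsp R d := (mfact l)%:R^-1 *: bas (Xpow l).

(** Any N above the cut-off is allowed, so that trees of smaller weight can share the range of
    summation of a given tree. *)
Lemma cop_II k t N : (nb t <= N)%N -> Delta (II k t) =
  lext (fun p => tens (Iop k p.1) (bas p.2)) (Delta t) +
  \sum_(l <- midx s N) \sum_(m <- midx s N) tens (Ex l) (Ex m * Jop (k + l + m) t).
Proof.
move=> tN; rewrite /II coproduct_pi /= -/(Delta t); congr (_ + _).
rewrite pi_reprK.
pose r := [seq (l, m) | l <- midx s N, m <- midx s N].
rewrite (@fsbigE _ _ _ _ _ r); last first.
- move=> [l m] _ lm; rewrite Jop_if; case: ifP => [/pos_J_nb h|_]; last by rewrite mulr0 tens0r.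
  case/negP: lm; apply/allpairsP; exists (l, m); split=> //=; rewrite mem_midx//;
    apply: leq_trans tN; apply: leq_ltn_trans h; rewrite !sdegD.
    by rewrite -addnA addnCA leq_addr.
  by rewrite leq_addl.
- by [].
- by apply: allpairs_uniq; rewrite ?midx_uniq// => -[? ?] [? ?].
rewrite (eq_bigl xpredT); last by move=> p; rewrite in_setT.
by rewrite /r big_allpairs_dep.
Qed.

Lemma lspan_one (K : conomType) (B : set K) : B m1 -> lspan B (1 : malg K R).
Proof. exact: lspan_bas. Qed.

(** Induction principle for the support of the coproduct: P t has to contain the pairs of Delta t. Q
    restricts to a class of trees stable under factors and arguments in which no I_k (X^l)
    occurs. *)
Lemma cop_span (P : expr d -> set (expr d * expr d)) (Q : expr d -> Prop) :
  (forall t u, Q (emul t u) -> Q t /\ Q u) -> (forall k t, Q (II k t) -> Q t /\ ~ is_Xpow t) ->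
  P m1 (m1, m1) -> P Xi (Xi, m1) -> (forall i, P (Xvar i) (Xvar i, m1)) ->
  (forall i, P (Xvar i) (m1, Xvar i)) ->
  (forall t u (p q : expr d * expr d), Q t -> Q u -> P t p -> P u q -> P (emul t u) (emul p.1 q.1, emul p.2 q.2)) ->
  (forall k t p, Q t -> ~ is_Xpow t -> P t p -> ~ is_Xpow p.1 -> P (II k t) (II k p.1, p.2)) ->
  (forall k t l m, Q t -> ~ is_Xpow t -> pos_J (k + l + m) t ->
     P (II k t) (Xpow l, emul (Xpow m) (II (k + l + m) t))) ->
  forall t, Q t -> lspan (P t) (Delta t).
Proof.
move=> Qm QI P1 PXi PX1 PX2 Pm PI PJ t; elim/(@expr_ind d): t.
- by move=> _; rewrite cop_one; exact: lspan_one.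
- by move=> _; rewrite cop_Xi -bas_one tens_bas; exact: lspan_bas.
- move=> i _; rewrite cop_X -!bas_one !tens_bas; apply: lspanD; exact: lspan_bas.
- move=> t u ht hu /Qm[Qt Qu]; rewrite cop_emul.
  apply: lspanM (ht Qt) (hu Qu) => p q; exact: Pm.
- move=> k t ht /QI[Qt nX]; rewrite (cop_II k (leqnn _)); apply: lspanD.
    apply: lspan_lext => p /(ht Qt) Pp; rewrite /Iop; case: asboolP => [_|nXp].
      by rewrite tens0l; exact: lspan0.
    by rewrite tens_bas; apply: lspan_bas; exact: PI.
  apply: lspan_sum => l _; apply: lspan_sum => m _; rewrite Jop_if.
  case: ifP => pJ; last by rewrite mulr0 tens0r; exact: lspan0.
  rewrite /Ex -scalerAl bas_mul tensZ tens_bas; apply: lspanZ; apply: lspan_bas.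
  exact: PJ.
Qed.

Fixpoint formalT a : Prop :=
  match a with
  | TMul b c => formalT b /\ formalT c
  | TI l b => formalT b /\ ~ is_Xpow (pi_expr b)
  | _ => True
  end.

Lemma formalT_eqv a b : term_eqv a b -> formalT a <-> formalT b.
Proof.
elim=> {a b} //=; try tauto.
by move=> l a b /pi_exprP -> ->.
Qed.

Lemma formalP t : formal t <-> formalT (repr t).
Proof.
have e a : formalT (repr (pi_expr a)) <-> formalT a by exact/formalT_eqv/repr_pi.
split.
  elim=> [||i|u v _ hu _ hv|k u _ hu nX]; rewrite ?eoneE ?e//.
  by split=> //; rewrite pi_reprK.
elim/(@expr_ind d): t => [_|_|i _|u v hu hv|k u hu].
- exact: formal_one.
- exact: formal_Xi.
- exact: formal_X.
- by rewrite /emul e => -[/hu fu /hv fv]; exact: formal_mul.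
- by rewrite /II e /= pi_reprK => -[/hu fu nX]; exact: formal_I.
Qed.

Lemma formal_emul t u : formal (emul t u) <-> formal t /\ formal u.
Proof.
rewrite !formalP /emul; have e := formalT_eqv (repr_pi (TMul (repr t) (repr u))).
by rewrite e.
Qed.

Lemma formal_II k t : formal (II k t) <-> formal t /\ ~ is_Xpow t.
Proof.
rewrite !formalP /II; have e := formalT_eqv (repr_pi (TI k (repr t))).
by rewrite e /= pi_reprK.
Qed.

(** A description by factors, which passes to products and to divisors alike. *)
Lemma AlgP (C : set (expr d)) t : Alg C t <-> ~ hasXi t /\
  forall k u, fac k u t -> [/\ C u, ~ is_Xpow u & 0 < wt u + beta - (sdeg s k)%:R].
Proof.
split.
  move=> [k [e [he ->]]]; split.
    move=> /hasXi_emul[/Xpow_noXi//|]; elim: e {he} => [|p e ih].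
      by rewrite big_nil => /hasXi_one.
    by rewrite big_cons => /hasXi_emul[/hasXi_II|].
  move=> l u /fac_emul[/Xpow_nofac//|]; elim: e he => [|p e ih] he.
    by rewrite big_nil => /fac_one.
  rewrite big_cons => /fac_emul[/fac_II[-> ->]|]; first by apply: he; rewrite inE eqxx.
  by apply: ih => q qe; apply: he; rewrite inE qe orbT.
elim/(@expr_ind d): t.
- by move=> _; exists 0, [::]; split=> //; rewrite big_nil Xpow0 emul1.
- by rewrite hasXi_pi => -[/(_ I)].
- by move=> i _; exists (munit i), [::]; split=> //; rewrite big_nil Xpow_unit emulx1.
- move=> t u ht hu [nX nf].
  case: ht => [|k [e [he ->]]].
    by split=> [h|k v h]; [apply: nX; apply/hasXi_emul; left|apply: nf; apply/fac_emul; left].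
  case: hu => [|k' [e' [he' ->]]].
    by split=> [h|k' v h]; [apply: nX; apply/hasXi_emul; right|apply: nf; apply/fac_emul; right].
  exists (k + k'), (e ++ e'); split.
    by move=> q; rewrite mem_cat => /orP[/he|/he'].
  rewrite XpowD big_cat /=; set A := Xpow k; set B := Xpow k'.
  set E := \big[_/_]_(q <- e) _; set E' := \big[_/_]_(q <- e') _.
  by rewrite -!emulA; congr emul; rewrite !emulA; congr (emul _ E'); exact: emulC.
- move=> k t _ [_ /(_ k t)]; case; first exact/fac_II.
  move=> Ct nX pt; exists 0, [:: (k, t)]; split; last by rewrite big_seq1 Xpow0 emul1.
  by move=> q; rewrite inE => /eqP ->.
Qed.

Lemma AlgS (C D : set (expr d)) : C `<=` D -> Alg C `<=` Alg D.
Proof.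
move=> CD t /AlgP[h1 h2]; apply/AlgP; split=> // k u /h2[Cu ? ?]; split=> //; exact: CD.
Qed.

Lemma Alg_one C : Alg C m1.
Proof. by apply/AlgP; split; [exact: hasXi_one|move=> k u /fac_one]. Qed.

Lemma Alg_X C i : Alg C (Xvar i).
Proof. by apply/AlgP; split; [rewrite hasXi_pi|move=> k u /fac_Xvar]. Qed.

Lemma Alg_Xpow C k : Alg C (Xpow k).
Proof. by apply/AlgP; split; [exact: Xpow_noXi|move=> l u /Xpow_nofac]. Qed.

Lemma Alg_emul C t u : Alg C (emul t u) <-> Alg C t /\ Alg C u.
Proof.
rewrite !AlgP hasXi_emul; split.
  move=> [nX nf]; split; split; try tauto; move=> k v h; apply: nf; apply/fac_emul; tauto.
move=> [[? h1] [? h2]]; split; first tauto.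
by move=> k v /fac_emul[/h1|/h2].
Qed.

Lemma Alg_II C k t : Alg C (II k t) <-> C t /\ pos_J k t.
Proof.
rewrite AlgP; split=> [[_ /(_ k t)]|[Ct /pos_JP[pt nX]]].
  by case=> [|? ? ?]; [exact/fac_II|split=> //; exact/pos_JP].
by split; [exact: hasXi_II|move=> l u /fac_II[-> ->]].
Qed.

Lemma AlgI (C D : set (expr d)) t : Alg C t -> Alg D t -> Alg (C `&` D) t.
Proof.
move=> /AlgP[h1 h2] /AlgP[_ h3]; apply/AlgP; split=> // k u f.
by have [? ? ?] := h2 _ _ f; have [? _ _] := h3 _ _ f; split.
Qed.

Lemma cop_weight t : lspan [set p | wt p.1 + wt p.2 = wt t] (Delta t).
Proof.
suff h : forall t, formal t \/ True -> lspan [set p | wt p.1 + wt p.2 = wt t] (Delta t) by apply: h; right.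
move=> {t}t _; elim/(@expr_ind d): t.
- by rewrite cop_one; apply: lspan_one => /=; rewrite wt_one addr0.
- by rewrite cop_Xi -bas_one tens_bas; apply: lspan_bas => /=; rewrite wt_one addr0.
- move=> i; rewrite cop_X -!bas_one !tens_bas; apply: lspanD; apply: lspan_bas => /=.
    by rewrite wt_one addr0.
  by rewrite wt_one add0r.
- move=> t u ht hu; rewrite cop_emul; apply: lspanM ht hu => p q /= hp hq.
  by rewrite !wt_emul -hp -hq addrACA.
- move=> k t ht; rewrite (cop_II k (leqnn _)); apply: lspanD.
    apply: lspan_lext => p /ht /= Pp; rewrite /Iop; case: asboolP => [_|nXp].
      by rewrite tens0l; exact: lspan0.
    by rewrite tens_bas; apply: lspan_bas => /=; rewrite !wt_II -Pp; ring.
  apply: lspan_sum => l _; apply: lspan_sum => m _; rewrite Jop_if.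
  case: ifP => pJ; last by rewrite mulr0 tens0r; exact: lspan0.
  rewrite /Ex -scalerAl bas_mul tensZ tens_bas; apply: lspanZ; apply: lspan_bas => /=.
  rewrite wt_emul !wt_II !wt_Xpow !sdegD !natrD; ring.
Qed.

(** The leading term t (x) 1 survives for formal trees only, since [Iop] erases I_k (X^l). A
    polynomial term X^l is lighter than I_k t because the accompanying J_(k + l + m) t has positive
    weight. *)
Lemma cop_lower t : formal t -> lspan [set p | wt p.1 < wt t] (Delta t - tens (bas t) 1).
Proof.
elim=> [||i|{}t u _ ht _ hu|k {}t ft ht nX].
- rewrite cop_one -(bas_one (expr d)) tens_bas (_ : _ - _ = 0); first exact: lspan0.
  by apply/eqP; rewrite subr_eq0.
- by rewrite cop_Xi subrr; exact: lspan0.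
- rewrite cop_X addrC addKr -bas_one tens_bas; apply: lspan_bas => /=.
  by rewrite wt_one wt_X ltr0n.
- rewrite cop_emul; set a := Delta t in ht *; set b := Delta u in hu *.
  set a0 := tens (bas t) 1 in ht; set b0 := tens (bas u) 1 in hu.
  have -> : a * b - tens (bas (emul t u)) 1 = (a - a0) * (b - b0) + a0 * (b - b0) + (a - a0) * b0.
    have -> : tens (bas (emul t u)) 1 = a0 * b0.
      by rewrite /a0 /b0 -!bas_one !tens_bas bas_mul; congr bas; rewrite /mm /= /pmul /= !mul1m.
    by ring.
  have sa : lspan [set p : expr d * expr d | wt p.1 = wt t] a0.
    by rewrite /a0 -bas_one tens_bas; apply: lspan_bas.
  have sb : lspan [set p : expr d * expr d | wt p.1 = wt u] b0.
    by rewrite /b0 -bas_one tens_bas; apply: lspan_bas.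
  apply: lspanD; first apply: lspanD.
  + by apply: lspanM ht hu => p q /= hp hq; rewrite !wt_emul ltrD.
  + by apply: lspanM sa hu => p q /= hp hq; rewrite !wt_emul hp ltrD2l.
  + by apply: lspanM ht sb => p q /= hp hq; rewrite !wt_emul hq ltrD2r.
- rewrite (cop_II k (leqnn _)) -[Delta t](subrK (tens (bas t) 1)) linearD /=.
  set low := lext _ (_ - _).
  have -> : lext (fun p => tens (Iop k p.1) (bas p.2)) (tens (bas t) 1) = tens (bas (II k t)) 1 :> Hsp2 R d.
    by rewrite -bas_one tens_bas lext_bas /= /Iop asboolF.
  rewrite addrAC addrK.
  apply: lspanD.
    apply: lspan_lext => p /ht /= Pp; rewrite /Iop; case: asboolP => [_|nXp].
      by rewrite tens0l; exact: lspan0.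
    by rewrite tens_bas; apply: lspan_bas => /=; rewrite !wt_II; lra.
  apply: lspan_sum => l _; apply: lspan_sum => m _; rewrite Jop_if.
  case: ifP => pJ; last by rewrite mulr0 tens0r; exact: lspan0.
  rewrite /Ex -scalerAl bas_mul tensZ tens_bas; apply: lspanZ; apply: lspan_bas => /=.
  move/pos_JP: pJ => [+ _]; rewrite wt_Xpow wt_II !sdegD !natrD => h.
  apply: le_lt_trans (_ : (sdeg s l)%:R + (sdeg s m)%:R < _); first by rewrite lerDl.
  by move: h; rewrite !subr_gt0; lra.
Qed.

(** The right components involve only trees occurring strictly inside t. With the drop of weight
    from a tree to those inside it, this allows recursion on the weight. *)
Lemma cop_right t : formal t -> lspan [set p | formal p.1 /\ Alg (inn^~ t) p.2] (Delta t).
Proof.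
apply: (@cop_span (fun t p => formal p.1 /\ Alg (inn^~ t) p.2) formal).
- by move=> u v /formal_emul.
- by move=> k u /formal_II.
- by split; [exact: formal_one|exact: Alg_one].
- by split; [exact: formal_Xi|exact: Alg_one].
- by move=> i; split; [exact: formal_X|exact: Alg_one].
- by move=> i; split; [exact: formal_one|exact: Alg_X].
- move=> u v p q _ _ [f1 a1] [f2 a2]; split; first exact: formal_mul.
  apply/Alg_emul; split; [apply: AlgS a1|apply: AlgS a2] => w /= h; apply/inn_emul; tauto.
- move=> k u p _ nX [f1 a1] nXp; split; first exact: formal_I.
  by apply: AlgS a1 => w /= h; apply/inn_II; right.
- move=> k u l m _ nX pJ; split; first exact: formal_Xpow.
  apply/Alg_emul; split; first exact: Alg_Xpow.
  by apply/Alg_II; split=> //=; apply/inn_II; left.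
Qed.

End Weights.

(** * The multivariate binomial formula *)
Section Binomial.
Context {R : realType} {d : nat} (s : 'I_d -> nat).
Hypothesis s_gt0 : forall i, (0 < s i)%N.
Context (A : comAlgType R).
Implicit Types (Y Z : 'I_d -> A) (p l m : mindex d).

(** Divided powers: in terms of them the binomial formula is a convolution without coefficients. *)
Definition dexp (n : nat) (y : A) : A := n`!%:R^-1 *: y ^+ n.
Definition mexp Y l : A := (mfact l)%:R^-1 *: \prod_i Y i ^+ l i.

Lemma mexpE Y l : mexp Y l = \prod_i dexp (l i) (Y i).
Proof. by rewrite /mexp /dexp scaler_prod /mfact natr_prod prodfV. Qed.

Lemma dexp_binom n N (y z : A) : (n < N)%N -> dexp n (y + z) =
  \sum_(j < N) if (j <= n)%N then dexp j y * dexp (n - j) z else 0.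
Proof.
move=> nN; pose F j := dexp j y * dexp (n - j) z.
transitivity (\sum_(j < n.+1) F j); last by rewrite (big_ord_widen N F nN) big_mkcond.
rewrite /F /dexp [y + z]addrC exprDn scaler_sumr; apply: eq_bigr => j _.
rewrite -[X in _ *: X = _]scaler_nat scalerA -scalerAl -scalerAr scalerA [z ^+ _ * _]mulrC.
congr (_ *: _).
have jn : (j <= n)%N by rewrite -ltnS.
rewrite -(bin_fact jn) !natrM.
have u (i : nat) : i`!%:R != 0 :> R by rewrite pnatr_eq0 -lt0n fact_gt0.
have v : 'C(n, j)%:R != 0 :> R by rewrite pnatr_eq0 -lt0n bin_gt0.
by field; rewrite !u v.
Qed.

Definition mle l p := [forall i, (l i <= p i)%N].
Definition msub p l : mindex d := [ffun i => (p i - l i)%N].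

Lemma mle_sdeg l p : mle l p -> (sdeg s l <= sdeg s p)%N.
Proof. by move=> /forallP h; apply: leq_sum => i _; rewrite leq_mul2l h orbT. Qed.

Lemma mexp_binom p N Y Z : (sdeg s p < N)%N -> mexp (fun i => Y i + Z i) p =
  \sum_(l <- midx s N | mle l p) mexp Y l * mexp Z (msub p l).
Proof.
move=> pN; rewrite mexpE.
have pi i : (p i < N)%N by apply: leq_ltn_trans pN; exact: sdeg_coord.
rewrite (eq_bigr _ (fun i _ => dexp_binom (Y i) (Z i) (pi i))) bigA_distr_bigA /=.
pose G l := \prod_i if (l i <= p i)%N then dexp (l i) (Y i) * dexp (p i - l i) (Z i) else 0.
have G0 l : ~~ mle l p -> G l = 0.
  by move=> /forallPn[i h]; rewrite /G (bigD1 i)//= (negPf h) mul0r.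
transitivity (\sum_(l <- midx s N) G l).
  rewrite /midx big_filter big_image_cond /= [RHS]big_mkcond; apply: eq_bigr => f _.
  set l := [ffun i => _]; have -> : \prod_i (if (f i <= p i)%N then dexp (f i) (Y i) * dexp (p i - f i) (Z i) else 0) = G l.
    by apply: eq_bigr => i _; rewrite ffunE.
  case: ifPn => // lN; apply: G0; apply: contra lN => /mle_sdeg h.
  exact: leq_ltn_trans pN.
rewrite [RHS]big_mkcond; apply: eq_bigr => l _.
case: ifPn => [lp|/G0//]; rewrite !mexpE -big_split /G; apply: eq_bigr => i _ /=.
by move/forallP: lp => ->; rewrite ffunE.
Qed.

(** The vanishing of c from degree N on makes the square range of summation on the right
    harmless. *)
Lemma mexp_conv N Y Z (c : mindex d -> R) : (forall q, (N <= sdeg s q)%N -> c q = 0) ->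
  \sum_(p <- midx s N) c p *: mexp (fun i => Y i + Z i) p =
  \sum_(l <- midx s N) \sum_(m <- midx s N) c (l + m) *: (mexp Y l * mexp Z m).
Proof.
move=> c0.
transitivity (\sum_(p <- midx s N) \sum_(l <- midx s N)
    if mle l p then c p *: (mexp Y l * mexp Z (msub p l)) else 0).
  rewrite !big_seq; apply: eq_bigr => p; rewrite mem_midx// => pN.
  rewrite (mexp_binom _ _ pN) scaler_sumr big_mkcond; apply: eq_bigr => l _.
  by [].
rewrite exchange_big; apply: eq_bigr => l _ /=; rewrite -big_mkcond -big_filter.
have -> : \sum_(m <- midx s N) c (l + m) *: (mexp Y l * mexp Z m) =
   \sum_(m <- [seq m <- midx s N | (sdeg s (l + m)%R < N)%N]) c (l + m) *: (mexp Y l * mexp Z m).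
  rewrite [RHS]big_filter [RHS]big_mkcond; apply: eq_bigr => m _ /=.
  by case: ltnP => // /c0 ->; rewrite scale0r.
have K m : msub (l + m) l = m by apply/ffunP => i; rewrite ffunE midxD addKn.
have K' p : mle l p -> (l + msub p l)%R = p.
  by move=> /forallP h; apply/ffunP => i; rewrite midxD ffunE subnKC.
transitivity (\sum_(p <- [seq (l + m)%R | m <- [seq m <- midx s N | (sdeg s (l + m)%R < N)%N]])
   c p *: (mexp Y l * mexp Z (msub p l))); last first.
  by rewrite big_map; apply: eq_bigr => m _; rewrite K.
apply: perm_big; apply: uniq_perm.
- by rewrite filter_uniq// midx_uniq.
- rewrite map_inj_uniq; first by rewrite filter_uniq// midx_uniq.
  by move=> m m' /(congr1 (msub^~ l)); rewrite /= !K.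
move=> p; rewrite mem_filter mem_midx//; apply/andP/mapP.
  move=> [lp pN]; exists (msub p l); rewrite ?K'//.
  rewrite mem_filter mem_midx// K'// pN /= (leq_ltn_trans _ pN)//.
  by rewrite -{2}(K' p lp) sdegD leq_addl.
move=> [m]; rewrite mem_filter mem_midx// => /andP[lmN _] ->; split=> //.
by apply/forallP => i; rewrite midxD leq_addr.
Qed.

Lemma mexp_shift N Y (v : 'I_d -> R) (c : mindex d -> R) :
  (forall q, (N <= sdeg s q)%N -> c q = 0) ->
  \sum_(p <- midx s N) c p *: mexp (fun i => Y i + (v i)%:A) p =
  \sum_(l <- midx s N) (\sum_(m <- midx s N) ((mfact m)%:R^-1 * \prod_i v i ^+ m i) * c (l + m)) *: mexp Y l.
Proof.
move=> c0; rewrite mexp_conv//; apply: eq_bigr => l _; rewrite scaler_suml; apply: eq_bigr => m _.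
have -> : mexp (fun i => (v i)%:A) m = ((mfact m)%:R^-1 * \prod_i v i ^+ m i)%:A.
  rewrite /mexp -scalerA; congr (_ *: _); rewrite -[RHS]/(in_alg A _) rmorph_prod; apply: eq_bigr => i _.
  by rewrite rmorphXn.
by rewrite mulr_algr scalerA mulrC.
Qed.

End Binomial.

Section Shift.
Context {R : realType} {d : nat} (s : 'I_d -> nat).
Hypothesis s_gt0 : forall i, (0 < s i)%N.
Implicit Types (u v : 'rV[R]_d) (c : mindex d -> R) (q l m : mindex d) (N : nat).

Definition ev v l : R := (mfact l)%:R^-1 * monomial l v.

(** Re-expansion of the Taylor coefficients c at a point moved by v. It is a flow in v
    ([shiftS_comp]), so the shift by -v inverts the shift by v; the definition of [compJ] rests on
    this. *)
Definition shiftS N v c q : R := \sum_(m <- midx s N) ev v m * c (q + m).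

Definition vanish N c := forall q, (N <= sdeg s q)%N -> c q = 0.

Lemma vanish_add N c q : vanish N c -> vanish N (fun m => c (q + m)).
Proof. by move=> h m mN; apply: h; rewrite sdegD (leq_trans mN)// leq_addl. Qed.

Lemma vanish_addl N c q : vanish N c -> vanish N (fun m => c (m + q)).
Proof. by move=> h m mN; apply: h; rewrite sdegD (leq_trans mN)// leq_addr. Qed.

Lemma shiftS_vanish N v c : vanish N c -> vanish N (shiftS N v c).
Proof.
move=> h q qN; rewrite /shiftS big1// => m _.
by rewrite (vanish_addl m h) ?mulr0.
Qed.

Lemma shiftS_comp N u v c q : vanish N c ->
  shiftS N u (shiftS N v c) q = shiftS N (u + v) c q.
Proof.
move=> h; have := @mexp_conv R d s s_gt0 R^o N (fun i => u ord0 i) (fun i => v ord0 i)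
  (fun m => c (q + m)) (vanish_add q h) => /= H.
rewrite /shiftS; transitivity (\sum_(l <- midx s N) \sum_(m <- midx s N) c (q + (l + m)) * (ev u l * ev v m)).
  apply: eq_bigr => l _; rewrite mulr_sumr; apply: eq_bigr => m _.
  by rewrite addrA; ring.
rewrite -[LHS]H; apply: eq_bigr => m _; rewrite mulrC; congr (_ * _).
rewrite /ev /mexp; congr (_ * _); rewrite /monomial; apply: eq_bigr => i _.
by rewrite mxE.
Qed.

Lemma shiftS0 N c q : vanish N c -> shiftS N 0 c q = c q.
Proof.
move=> h; case: (ltnP 0 N) => [N0|]; last first.
  rewrite leqn0 => /eqP N0; rewrite /shiftS N0; have -> : c q = 0 by apply: h; rewrite N0.
  by rewrite big1_seq// => m /=; rewrite mem_midx.
rewrite /shiftS (bigD1_seq (0 : mindex d)) ?midx_uniq ?mem_midx ?sdeg0//=.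
rewrite big1 ?addr0; last by move=> m /negPf m0; rewrite /ev monomial_at0 m0 mulr0 mul0r.
rewrite /ev monomial_at0 eqxx mulr1 /mfact big1 ?invr1 ?mul1r// => i _.
by rewrite midx0 fact0.
Qed.

Lemma eq_shiftS N v c c' q : (forall q, c q = c' q) -> shiftS N v c q = shiftS N v c' q.
Proof. by move=> h; apply: eq_bigr => m _; rewrite h. Qed.

Lemma shiftSB N v c c' q : shiftS N v (fun q => c q - c' q) q = shiftS N v c q - shiftS N v c' q.
Proof. by rewrite /shiftS -sumrB; apply: eq_bigr => m _; rewrite mulrBr. Qed.

End Shift.

(** A tree of maximal weight in the support of a keeps its coefficient in lext F a, as the images of
    the others only add strictly lighter terms. *)
Lemma unitriangular_inj (R : realType) (K : choiceType) (w : K -> R) (F : K -> malg K R) (Q : set K) a :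
  (forall k, Q k -> lspan [set l | w l < w k] (F k - bas k)) -> lspan Q a -> lext F a = 0 -> a = 0.
Proof.
move=> tri fa ga; apply/eqP/negPn/negP => a0.
have [t0 t0a] : exists t, mcoeff t a != 0.
  apply: contrapT => h; move/negP: a0; apply; apply/eqP/malgP => t.
  by rewrite mcoeff0; apply/eqP/negPn/negP => h'; apply: h; exists t.
have [t ta tmax] : exists2 t, mcoeff t a != 0 & forall t', mcoeff t' a != 0 -> w t' <= w t.
  have : t0 \in enum_fset (msupp a) by rewrite mem_msupp.
  have: forall t', mcoeff t' a != 0 -> t' \in enum_fset (msupp a) by move=> t'; rewrite mem_msupp.
  have: forall t', t' \in enum_fset (msupp a) -> mcoeff t' a != 0 by move=> t'; rewrite mem_msupp.
  move: (enum_fset _) => r h1 h2 _.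
  have [t tr tm] : exists2 t, t \in t0 :: r & forall t', t' \in t0 :: r -> w t' <= w t.
    elim: r t0 {t0a h1 h2} => [|x r ih] t0.
      by exists t0; rewrite ?inE// => t'; rewrite inE => /eqP ->.
    have [t tr tm] := ih t0; have [h|h] := lerP (w x) (w t).
      exists t; first by move: tr; rewrite !inE => /orP[->|->]; rewrite ?orbT.
      move=> t'; rewrite !inE => /or3P[/eqP ->|/eqP -> //|t'r]; apply: tm; rewrite inE ?eqxx// t'r orbT//.
    exists x; first by rewrite !inE eqxx orbT.
    move=> t'; rewrite !inE => /or3P[/eqP ->|/eqP -> //|t'r]; apply: le_trans (ltW h); apply: tm; rewrite inE ?eqxx// t'r orbT//.
  exists t; first by move: tr; rewrite inE => /predU1P[->//|/h1].
  by move=> t' /h2 h; apply: tm; rewrite inE h orbT.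
have : mcoeff t (lext F a) = mcoeff t a.
  apply/eqP; rewrite -subr_eq0 -mcoeffB; apply/eqP.
  have -> : lext F a - a = lext (fun t' => (-1) *: bas t' + F t') a.
    by rewrite lext_linear lext_id scaleN1r addrC.
  apply/eqP/negPn/negP; suff h : lspan [set t' | w t' < w t] (lext (fun t' => (-1) *: bas t' + F t') a).
    by move=> /h /=; rewrite ltxx.
  apply: lspan_lext => t' t'a; rewrite scaleN1r addrC.
  by apply: lspanS (tri _ (fa _ t'a)) => v /= h; exact: lt_le_trans h (tmax _ t'a).
by rewrite ga mcoeff0 => e; rewrite -e eqxx in ta.
Qed.

(** * Characters and their action *)
Section Characters.
Context {R : realType} {d : nat} (s : 'I_d -> nat) (alpha beta : R).
Hypothesis s_gt0 : forall i, (0 < s i)%N.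
Implicit Types (t : expr d) (a b : term d) (k l q : mindex d) (u v w : 'rV[R]_d).
Implicit Types (c : mindex d -> expr d -> R) (g : expr d -> R) (N : nat).
Local Notation wt := (weight s alpha beta).
Local Notation Delta := (coproduct s alpha beta).
Local Notation Alg := (Alg s alpha beta).
Local Notation pos_J := (pos_J s alpha beta).
Local Notation nb := (nb s alpha beta).
Local Notation H := (Hsp R d).

(** A character is given by its values v on the X_i and c on the J_k t. Elements of F_+ have no
    factor Xi, so the value there is a convention. *)
Fixpoint charT v c a : R :=
  match a with
  | TOne => 1
  | TXi => 1
  | TX i => v ord0 i
  | TMul b e => charT v c b * charT v c e
  | TI k b => c k (pi_expr b)
  end.

Lemma charT_eqv v c a b : term_eqv a b -> charT v c a = charT v c b.
Proof.
elim=> {a b} //=.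
- by move=> a b e _ -> _ ->.
- by move=> a b; exact: mulrC.
- by move=> a b e; exact: mulrA.
- by move=> a; exact: mul1r.
- by move=> a a' b b' _ -> _ ->.
- by move=> k a b /pi_exprP ->.
Qed.

Definition charE v c t : R := charT v c (repr t).

Lemma charE_pi v c a : charE v c (pi_expr a) = charT v c a.
Proof. exact/charT_eqv/repr_pi. Qed.

Lemma charE_one v c : charE v c m1 = 1. Proof. exact: charE_pi. Qed.
Lemma charE_X v c i : charE v c (Xvar i) = v ord0 i. Proof. exact: charE_pi. Qed.
Lemma charE_emul v c t t' : charE v c (emul t t') = charE v c t * charE v c t'.
Proof. exact: charE_pi. Qed.
Lemma charE_II v c k t : charE v c (II k t) = c k t.
Proof. by rewrite /II charE_pi /= pi_reprK. Qed.

Lemma charE_Xpow v c k : charE v c (Xpow k) = monomial k v.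
Proof.
rewrite /Xpow /monomial; elim/big_rec2: _ => [|i y t _ <-]; first exact: charE_one.
rewrite charE_emul; congr (_ * _); elim: (k i) => [|n ih] /=; first exact: charE_one.
by rewrite charE_emul ih charE_X exprS.
Qed.

Lemma alg_ind (C : set (expr d)) (P : expr d -> Prop) : P m1 -> (forall i, P (Xvar i)) ->
  (forall t t', Alg C t -> Alg C t' -> P t -> P t' -> P (emul t t')) ->
  (forall k t, C t -> pos_J k t -> P (II k t)) -> forall t, Alg C t -> P t.
Proof.
move=> h1 hX hm hI; elim/(@expr_ind d) => //.
- by move=> /AlgP[]; rewrite hasXi_pi => /(_ I).
- by move=> t t' ht ht' /Alg_emul[a a']; apply: hm => //; [exact: ht|exact: ht'].
- by move=> k t _ /Alg_II[]; exact: hI.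
Qed.

Lemma mult_char (C P : set (expr d)) g : (forall t, Alg C t -> P t) -> multiplicative_on P g ->
  forall t, Alg C t -> g t = charE (\row_i g (Xvar i)) (fun k t => g (II k t)) t.
Proof.
move=> CP [g1 gm]; apply: alg_ind.
- by rewrite charE_one.
- by move=> i; rewrite charE_X mxE.
- by move=> t t' at_ at' ht ht'; rewrite charE_emul -ht -ht' gm//; exact: CP.
- by move=> k t _ _; rewrite charE_II.
Qed.

Lemma eq_charE (C : set (expr d)) v c c' : (forall k t, C t -> pos_J k t -> c k t = c' k t) ->
  forall t, Alg C t -> charE v c t = charE v c' t.
Proof.
move=> h; apply: alg_ind.
- by rewrite !charE_one.
- by move=> i; rewrite !charE_X.
- by move=> t t' _ _ e e'; rewrite !charE_emul e e'.
- by move=> k t Ct p; rewrite !charE_II h.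
Qed.

Lemma char_mult P v c : multiplicative_on P (charE v c).
Proof. by split=> [|t t' _ _]; [exact: charE_one|exact: charE_emul]. Qed.

Definition Gm g t : H := lext (fun p => g p.2 *: bas p.1) (Delta t).

Lemma Gamma_ofE g (z : H) : Gamma_of s alpha beta g z = lext (Gm g) z.
Proof. by rewrite /Gamma_of lext_lext. Qed.

Lemma eq_Gm (B D : set (expr d)) g g' t : lspan (B `*` D) (Delta t) ->
  (forall t', D t' -> g t' = g' t') -> Gm g t = Gm g' t.
Proof. by move=> h e; apply: eq_lext => p /h[_ /= /e ->]. Qed.

Lemma Gm_span (B : set (expr d)) g t : lspan [set p | B p.1] (Delta t) -> lspan B (Gm g t).
Proof. by move=> h; apply: lspan_lext => p /h /= Bp; apply: lspanZ; exact: lspan_bas. Qed.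

Lemma Gm_lower g t : g m1 = 1 -> formal t -> lspan [set t' | wt t' < wt t] (Gm g t - bas t).
Proof.
move=> g1 ft; rewrite /Gm -[Delta t](subrK (tens (bas t) 1)) linearD /=.
rewrite -[X in tens _ X]bas_one tens_bas [X in _ + X - _]lext_bas /= g1 scale1r addrK.
apply: lspan_lext => p; rewrite -tens_bas bas_one => /(cop_lower s_gt0 ft) /= h.
by apply: lspanZ; exact: lspan_bas.
Qed.

Lemma Gm_formal g t : formal t -> lspan formal (Gm g t).
Proof.
move=> ft; apply: Gm_span; apply: lspanS (cop_right s_gt0 ft) => p [].
by [].
Qed.

Lemma Gm_le g t : g m1 = 1 -> formal t -> lspan [set t' | wt t' <= wt t] (Gm g t).
Proof.
move=> g1 ft; rewrite -[Gm g t](subrK (bas t)); apply: lspanD; last by apply: lspan_bas => /=.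
by apply: lspanS (Gm_lower g1 ft) => t' /= /ltW.
Qed.

Lemma Gm_inj g (a : H) : g m1 = 1 -> lspan formal a -> lext (Gm g) a = 0 -> a = 0.
Proof. by move=> g1; apply: (unitriangular_inj (w := wt)) => t; exact: Gm_lower. Qed.

Lemma Gm_one g : g m1 = 1 -> Gm g m1 = 1.
Proof. by move=> g1; rewrite /Gm cop_one -!bas_one lext_bas /= g1 scale1r. Qed.

Lemma Gm_Xi g : g m1 = 1 -> Gm g Xi = bas Xi.
Proof. by move=> g1; rewrite /Gm cop_Xi -bas_one tens_bas lext_bas /= g1 scale1r. Qed.

Lemma Gm_X g i : g m1 = 1 -> Gm g (Xvar i) = bas (Xvar i) + (g (Xvar i))%:A.
Proof.
by move=> g1; rewrite /Gm cop_X -!bas_one !tens_bas linearD /= !lext_bas /= g1 scale1r bas_one.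
Qed.

Lemma Gm_Xv v c i : Gm (charE v c) (Xvar i) = bas (Xvar i) + (v ord0 i)%:A.
Proof. by rewrite Gm_X ?charE_X// charE_one. Qed.

Lemma Gm_emul v c t t' : Gm (charE v c) (emul t t') = Gm (charE v c) t * Gm (charE v c) t'.
Proof.
rewrite /Gm cop_emul lextM// => p q.
by rewrite /= -scalerAl -scalerAr scalerA -charE_emul bas_mul.
Qed.

Definition Jc c q t : R := if pos_J q t then c q t else 0.

Lemma Jc_vanish c t N : (nb t <= N)%N -> vanish s N (fun q => Jc c q t).
Proof.
move=> tN q qN; rewrite /Jc; case: ifP => // /pos_J_nb h.
by have := leq_ltn_trans (leq_trans tN qN) h; rewrite ltnn.
Qed.

Lemma Gm_II v c k t N : (nb t <= N)%N -> Gm (charE v c) (II k t) =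
  lext (Iop k) (Gm (charE v c) t) +
  \sum_(l <- midx s N) shiftS s N v (fun q => Jc c q t) (k + l) *: Ex l.
Proof.
move=> tN; rewrite /Gm (cop_II s_gt0 k tN) linearD /=; congr (_ + _).
  rewrite !lext_lext; apply: eq_lext => p _; rewrite linearZ /= lext_bas.
  rewrite lext_tens (eq_lext (g := fun t' => charE v c p.2 *: bas t')); last first.
    by move=> t' _; rewrite lext_bas.
  rewrite -[in RHS](lext_id (Iop k p.1)) /lext scaler_sumr; apply: eq_bigr => t' _.
  by rewrite !scalerA mulrC.
rewrite linear_sum; apply: eq_bigr => l _; rewrite linear_sum scaler_suml; apply: eq_bigr => m _ /=.
rewrite Jop_if /Jc /Ex; case: ifP => _; last by rewrite !mulr0 tens0r linear0 scale0r.
rewrite -scalerAl bas_mul tensZ tens_bas linearZ /= lext_bas /= charE_emul charE_Xpow charE_II.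
by rewrite !scalerA /ev; congr (_ *: _); ring.
Qed.

Lemma bas_Xpow k : bas (Xpow k) = \prod_i bas (Xvar i) ^+ k i :> H.
Proof.
rewrite /Xpow; elim/big_rec2: _ => // i y t _ <-.
rewrite -bas_mul; congr (_ * _); elim: (k i) => [|n ih] //=.
by rewrite -bas_mul ih exprS.
Qed.

Lemma Ex_mexp l : Ex l = mexp (A := H) (fun i => bas (Xvar i)) l.
Proof. by rewrite /Ex /mexp bas_Xpow. Qed.

Lemma Gm_Xpow v c k : Gm (charE v c) (Xpow k) = \prod_i (bas (Xvar i) + (v ord0 i)%:A) ^+ k i.
Proof.
rewrite /Xpow; elim/big_rec2: _ => [|i y t _ <-]; first by rewrite Gm_one ?charE_one.
rewrite Gm_emul; congr (_ * _); elim: (k i) => [|n ih] /=; first by rewrite Gm_one ?charE_one.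
by rewrite Gm_emul ih Gm_Xv [RHS]exprS.
Qed.

(** On polynomials the action is a translation of the variable, that is, [shiftS] on the
    coefficients in the basis X^l / l!. *)
Lemma Gm_Ex v c N (A : mindex d -> R) : vanish s N A ->
  lext (Gm (charE v c)) (\sum_(l <- midx s N) A l *: Ex l) =
  \sum_(l <- midx s N) shiftS s N v A l *: Ex l.
Proof.
move=> A0; rewrite linear_sum.
transitivity (\sum_(l <- midx s N) A l *: mexp (A := H) (fun i => bas (Xvar i) + (v ord0 i)%:A) l).
  by apply: eq_bigr => l _; rewrite linearZ /= /Ex linearZ /= lext_bas Gm_Xpow.
have E := @mexp_shift R d s s_gt0 H N (fun i => bas (Xvar i)) (fun i => v ord0 i) A A0.
rewrite [LHS]E; apply: eq_bigr => l _; rewrite Ex_mexp; reflexivity.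
Qed.

Lemma Gm_Xpow_span v c k : lspan is_Xpow (Gm (charE v c) (Xpow k)).
Proof.
have P1 : is_Xpow (m1 : expr d) by exact: is_Xpow_one.
have hm t t' : is_Xpow t -> is_Xpow t' -> is_Xpow (mm t t') by move=> ? ?; apply/is_Xpow_emul.
rewrite /Xpow; elim/big_ind: _ => [|t t' ht ht'|i _].
- by rewrite Gm_one ?charE_one//; exact: lspan_one.
- by rewrite Gm_emul; apply: lspanM ht ht'.
elim: (k i) => [|n ih] /=; first by rewrite Gm_one ?charE_one//; exact: lspan_one.
rewrite Gm_emul; apply: lspanM ih => [x y|]; first exact: hm.
rewrite Gm_Xv; apply: lspanD; first by apply: lspan_bas; exists (munit i); rewrite Xpow_unit.
by apply: lspanZ; exact: lspan_one.
Qed.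

Lemma Gm_id t : formal t -> Gm (charE 0 (fun _ _ => 0)) t = bas t.
Proof.
elim=> [||i|{}t u _ ht _ hu|k {}t ft ht nX].
- by rewrite Gm_one ?charE_one.
- by rewrite Gm_Xi ?charE_one.
- by rewrite Gm_Xv mxE scale0r addr0.
- by rewrite Gm_emul ht hu bas_mul.
rewrite (Gm_II _ _ k (leqnn _)) ht lext_bas /Iop asboolF//.
rewrite big1 ?addr0// => l _; rewrite /shiftS big1 ?scale0r// => m _.
by rewrite /Jc; case: ifP; rewrite mulr0.
Qed.

Section Composition.
Variables (v : 'rV[R]_d) (c1 c2 : mindex d -> expr d -> R).

Definition Jbar (z : H) q : R := lextR (fun t => Jc c1 q t) z.

(** Comparing the coefficients of X^l in [comp_spec] at I_k t gives shiftS u (Jbar z) + shiftS (u +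
    v) comp = shiftS (u + v) c2, where z is the image of t; inverting the shift by u + v yields this
    formula. *)
Definition compJ (z : H) q t : R :=
  if pos_J q t then c2 q t - shiftS s (nb t) (- v) (Jbar z) q else 0.

(** Solves F_1 o Gamma = F_2 for the character of Gamma, where c1 and c2 are the coefficients of F_1
    and F_2. The coefficients of Gamma at I_k t involve its action on t, and its action on I_k t
    involves these coefficients, so one recursion on terms computes the action. *)
Fixpoint compT a : H :=
  match a with
  | TOne => 1
  | TXi => bas Xi
  | TX i => bas (Xvar i) + (v ord0 i)%:A
  | TMul b e => compT b * compT e
  | TI k b => lext (Iop k) (compT b) +
      \sum_(l <- midx s (nb (pi_expr b)))
        shiftS s (nb (pi_expr b)) v (fun q => compJ (compT b) q (pi_expr b)) (k + l) *: Ex l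
  end.

Lemma compT_eqv a b : term_eqv a b -> compT a = compT b.
Proof.
elim=> {a b} [a|a b _ ih|a b c _ ih1 _ ih2|a b|a b c|a|a a' b b' _ ih1 _ ih2|k a b e ih].
- reflexivity.
- exact: esym ih.
- exact: etrans ih1 ih2.
- exact: mulrC.
- exact: mulrA.
- exact: mul1r.
- exact: congr2 ih1 ih2.
- have pe : pi_expr a = pi_expr b by apply/pi_exprP.
  by cbn [compT]; rewrite ih pe.
Qed.

Definition comp q t : R := compJ (compT (repr t)) q t.

Lemma Jc_comp q t : Jc comp q t = comp q t.
Proof. by rewrite /Jc /comp /compJ; case: (pos_J q t). Qed.

Lemma compTE a : compT a = Gm (charE v comp) (pi_expr a).
Proof.
elim: a => [||i|a ha b hb|k a ha].
- by rewrite Gm_one ?charE_one.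
- by rewrite Gm_Xi ?charE_one.
- by rewrite Gm_Xv.
- by rewrite -emul_pi Gm_emul -ha -hb.
have -> : pi_expr (TI k a) = II k (pi_expr a) by apply/pi_exprP/eqv_I/eqv_sym/repr_pi.
rewrite (Gm_II _ _ k (leqnn _)) -ha /=; congr (_ + _); apply: eq_bigr => l _; congr (_ *: _).
apply: eq_shiftS => q; rewrite Jc_comp /comp.
by congr compJ; apply: compT_eqv; exact/eqv_sym/repr_pi.
Qed.

Lemma compE q t : pos_J q t ->
  comp q t = c2 q t - shiftS s (nb t) (- v) (Jbar (Gm (charE v comp) t)) q.
Proof. by move=> p; rewrite {1}/comp /compJ p compTE pi_reprK. Qed.

Lemma Jbar_vanish z t N : (nb t <= N)%N -> lspan [set t' | wt t' <= wt t] z ->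
  vanish s N (Jbar z).
Proof.
move=> tN zt q qN; rewrite /Jbar (_ : lextR _ z = lextR (fun=> 0) z).
  by rewrite lextRE lext_zero.
apply: eq_lextR => t' /zt /= h; apply: (Jc_vanish c1 (t := t')) qN.
by apply: leq_trans tN; exact: nb_le.
Qed.

Lemma comp_spec u t : formal t ->
  lext (Gm (charE u c1)) (Gm (charE v comp) t) = Gm (charE (u + v) c2) t.
Proof.
elim=> [||i|{}t t' _ ht _ ht'|k {}t ft ht nX].
- by rewrite !(Gm_one (charE_one _ _)) -bas_one lext_bas (Gm_one (charE_one _ _)).
- by rewrite !(Gm_Xi (charE_one _ _)) lext_bas (Gm_Xi (charE_one _ _)).
- have E1 := Gm_one (charE_one u c1); rewrite !Gm_Xv linearD /= linearZ /=.
  have E2 : lext (Gm (charE u c1)) 1 = 1 by rewrite -[X in lext _ X]bas_one lext_bas E1.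
  rewrite E2 lext_bas Gm_Xv mxE scalerDl addrA; reflexivity.
- rewrite (Gm_emul v) (Gm_emul (u + v)) -ht -ht'.
  exact: (lextM (A := H) _ _ (Gm_emul u c1)).
pose N := nb t; set z := Gm (charE v comp) t in ht *.
have zt : lspan [set t' | wt t' <= wt t] z by apply: Gm_le; rewrite ?charE_one.
have bv : vanish s N (Jbar z) by exact: Jbar_vanish zt.
have cv : vanish s N (fun q => Jc comp q t) by exact: Jc_vanish.
rewrite (Gm_II v comp k (leqnn _)) -/z -/N linearD /= (Gm_Ex _ _ (A := fun l => shiftS s N v (fun q => Jc comp q t) (k + l))); last first.
  by apply: vanish_add; exact: shiftS_vanish.
have -> : lext (Gm (charE u c1)) (lext (Iop k) z) = lext (Iop k) (Gm (charE (u + v) c2) t) +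
    \sum_(l <- midx s N) shiftS s N u (Jbar z) (k + l) *: Ex l.
  rewrite -ht (lext_lext (Gm (charE u c1)) (Iop k) z) (lext_lext (Iop k) (Gm (charE u c1)) z).
  transitivity (lext (fun t' => 1 *: lext (Iop k) (Gm (charE u c1) t') +
     \sum_(l <- midx s N) shiftS s N u (fun q => Jc c1 q t') (k + l) *: Ex l) z).
    apply: eq_lext => t' /zt /= wt'; rewrite scale1r.
    (* For a power of X in z both sides vanish: [Iop] kills it, and its image is again a combination
       of powers of X. *)
    rewrite {1}/Iop; case: asboolP => [xt|nXt].
      rewrite linear0 [X in X + _](_ : _ = 0) ?add0r ?big1//.
        move=> l _; rewrite /shiftS big1 ?scale0r// => m _; rewrite /Jc ifF ?mulr0//.
        by apply: negbTE; apply/pos_JP => -[_ /(_ xt)].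
      move: xt => [p ->]; rewrite -(lext_zero _ (Gm (charE u c1) (Xpow p))).
      by apply: eq_lext => w /(@Gm_Xpow_span u c1 p) xw; rewrite /Iop asboolT.
    by rewrite lext_bas (Gm_II u c1 k (nb_le wt')).
  rewrite lext_linear scale1r; congr (_ + _).
  rewrite lext_sumf; apply: eq_bigr => l _.
  rewrite /shiftS /Jbar.
  transitivity (lextR (fun t' => \sum_(m <- midx s N) ev u m * Jc c1 (k + l + m) t') z *: Ex l).
    by rewrite /lextR /lext scaler_suml; apply: eq_bigr => t' _; rewrite scalerA.
  congr (_ *: _); rewrite lextRE lext_sumf; apply: eq_bigr => m _.
  rewrite /lextR /lext mulr_sumr; apply: eq_bigr => t' _.
  by rewrite /GRing.scale /=; ring.
rewrite (Gm_II (u + v) c2 k (leqnn _)) -/N -addrA; congr (_ + _).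
rewrite -big_split; apply: eq_bigr => l _ /=; rewrite -scalerDl; congr (_ *: _).
have -> : shiftS s N u (fun l0 => shiftS s N v (fun q => Jc comp q t) (k + l0)) l =
    shiftS s N u (shiftS s N v (fun q => Jc comp q t)) (k + l).
  by apply: eq_bigr => m _; rewrite addrA.
rewrite (shiftS_comp s_gt0)//.
(* The defining formula also holds where J_q t vanishes: the trees of z weigh at most as much as t,
   so that their J_(q + m) vanish too. *)
have E q : Jc comp q t = Jc c2 q t - shiftS s N (- v) (Jbar z) q.
  rewrite /Jc; case: ifP => [p|np]; first by rewrite compE.
  rewrite /shiftS big1 ?subr0// => m _; rewrite /Jbar.
  rewrite (_ : lextR _ z = lextR (fun=> 0) z); first by rewrite lextRE lext_zero mulr0.
  apply: eq_lextR => t' /zt /= h; rewrite /Jc ifF//; apply: negbTE; apply/pos_JP => -[h1 _].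
  move/negbT/negP: np; apply; apply/pos_JP; split=> //.
  move: h1; rewrite sdegD natrD => h1.
  have : (0 : R) <= (sdeg s m)%:R by [].
  lra.
rewrite (eq_shiftS _ _ _ _ E) shiftSB (shiftS_comp s_gt0)// addrK.
by rewrite addrCA subrr addr0.
Qed.

End Composition.

End Characters.

(** * The monomials of the nonlinearity *)

Section Monomials.
Context {R : realType} {n : nat}.
Local Notation V := 'rV[R]_n.
Implicit Types (k q : mindex n) (l : seq 'I_n) (f : V -> R) (i j : 'I_n).
Local Notation e_ i := (delta_mx ord0 i : V).

Lemma pder_monomial0 l k j : (k j < count_mem j l)%N -> pder l (monomial k : V -> R) = (fun=> 0).
Proof.
elim/last_ind: l k => [|l i ih] k; first by rewrite ltn0.
rewrite -cats1 count_cat /= addn0 cats1 pder_rcons => h.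
have -> : partial i (monomial k : V -> R) = fun x : V => (k i)%:R * monomial [ffun j0 => (k j0 - (j0 == i))%N] x.
  by apply/funext => x; rewrite partial_monomial.
rewrite pderZ; last exact: smooth_monomial.
apply/funext => x; have [ij|ij] := eqVneq i j; last first.
  by rewrite ih ?mulr0// ffunE [j == i]eq_sym (negPf ij) subn0; move: h; rewrite (negPf ij) addn0.
have [k0|k0] := posnP (k i); first by rewrite k0 mul0r.
rewrite ih ?mulr0//; move: h; rewrite -ij eqxx addn1 ltnS ffunE eqxx => h.
by apply: leq_trans h; rewrite subn1 prednK.
Qed.

(** The coefficients c q do not depend on the dummy variables and act as constants under derivatives
    in these directions. *)
Lemma pder_dummy (D : 'I_n -> Prop) (S : seq (mindex n)) (c : mindex n -> V -> R) f :
  (forall q, q \in S -> forall v w : V, (forall j, ~ D j -> v ord0 j = w ord0 j) -> c q v = c q w) ->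
  (forall v, f v = \sum_(q <- S) c q v * monomial q v) ->
  forall l, (forall j, j \in l -> D j) ->
  forall v, pder l f v = \sum_(q <- S) c q v * pder l (monomial q) v.
Proof.
move=> cD fE; elim=> [|i l ih] hl v; first exact: fE.
have Di : D i by apply: hl; rewrite inE eqxx.
have {}ih w : pder l f w = \sum_(q <- S) c q w * pder l (monomial q) w.
  by apply: ih => j jl; apply: hl; rewrite inE jl orbT.
rewrite pder_cons; apply: partialE0.
have E t : pder l f (v + t *: e_ i) = \sum_(q <- S) c q v * pder l (monomial q) (v + t *: e_ i).
  rewrite ih !big_seq; apply: eq_bigr => q qS; congr (_ * _); apply: cD => // j nj.
  rewrite !mxE eqxx /=; case: eqP => [e|_]; last by rewrite mulr0 addr0.
  by case: nj; rewrite e.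
apply: (is_derive_ext (f := fun t => \sum_(q <- S) c q v * pder l (monomial q) (v + t *: e_ i))).
  by move=> t /=; rewrite E.
elim: (S) => [|q S' ihS].
  rewrite big_nil; apply: (is_derive_ext (f := fun=> 0)).
  by move=> t; rewrite big_nil.
rewrite big_cons; apply: (is_derive_ext (f := fun t => c q v * pder l (monomial q) (v + t *: e_ i) +
    \sum_(q <- S') c q v * pder l (monomial q) (v + t *: e_ i))).
  by move=> t /=; rewrite big_cons.
have h0 := is_derive_line0 i (smooth_diff (smooth_pder l (smooth_monomial (R := R) q)) v).
have h := is_deriveD (is_deriveZ (c q v) h0) ihS.
by apply: (is_derive_eq h).
Qed.

End Monomials.

(** * Consequences of local subcriticality *)

Section Subcritical.
Context {R : realType} {d : nat} (s : 'I_d -> nat) (alpha beta : R).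
Local Notation jet := (1 + (d + 1))%N.
Context (F : 'rV[R]_jet -> R).
Hypothesis sF : smooth F.
Hypothesis affF : affine_in_xi F.
Hypothesis subF : locally_subcritical s alpha beta F.
Implicit Types (q : mindex jet).

(** Two derivatives in xi annihilate an affine function, and derivatives may be reordered so that
    these two come first. *)
Lemma affine_xi q : M_F F q -> (q (var_xi (d := d)) <= 1)%N.
Proof.
move=> [v hv]; rewrite leqNgt; apply/negP => q2; move/eqP: hv; apply.
pose xi := var_xi (d := d).
have c2 : (1 < count_mem xi (mlist q))%N by rewrite count_mlist.
have P : perm_eq (mlist q) ([seq i <- mlist q | i != xi] ++ nseq (count_mem xi (mlist q)) xi).
  rewrite -(perm_filterC (fun i => i != xi) (mlist q)) perm_cat2l; rewrite (eq_filter (a2 := pred1 xi)); last by move=> i; rewrite /= negbK.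
  by rewrite [X in perm_eq X _](all_pred1P xi _ (filter_all _ _)) size_filter.
rewrite Dpart_pder (pder_perm _ P)// pder_cat.
have D2 : pder [:: xi; xi] F = fun=> 0.
  have D1 w : partial xi F w = F (w + delta_mx ord0 xi) - F w.
    apply: partialE0; apply: (is_derive_ext (f := fun t => F w + t * (F (w + delta_mx ord0 xi) - F w))).
      by move=> t /=; rewrite affF.
    set c := F _ - F w.
    have h := is_deriveD (is_derive_cst (F w) (0 : R) (1 : R)) (is_deriveZ c (is_derive_id (0 : R) (1 : R))).
    apply: (is_derive_ext _ (is_derive_eq h _)); last by rewrite /GRing.scale /=; ring.
    by move=> t /=; rewrite /GRing.scale /= [t * c]mulrC.
  apply/funext => w /=; apply: partialE0.
  apply: (is_derive_ext (f := fun=> partial xi F w)).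
  move=> t /=; rewrite !D1; have := affF w t; have := affF w (t + 1).
  by rewrite scalerDl scale1r addrA => -> ->; ring.
case: (count_mem xi (mlist q)) c2 => [//|[//|m]] _.
have -> : nseq m.+2 xi = nseq m xi ++ [:: xi; xi].
  by rewrite -[m.+2]addn2 nseqD.
by rewrite pder_cat D2 !pder0.
Qed.

(** If no active monomial dominated q in the dummy variables, the derivatives of q in these
    variables would annihilate every monomial of the expansion of F, and with it F. *)
Lemma M_F_active : exists S : seq (mindex jet),
  (forall q, q \in S -> (forall j, (0 < q j)%N -> is_dummy s alpha beta j) /\
      if (0 < q (var_xi (d := d)))%N then forall j, j != var_xi (d := d) -> q j = 0%N
        else alpha < monomial_homogeneity s alpha beta q) /\
  forall q, M_F F q -> exists2 q', q' \in S & forall j, is_dummy s alpha beta j -> (q j <= q' j)%N.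
Proof.
have [S [c [uS hd cD FE hS]]] := subF.
exists [seq q <- S | `[< exists v, c q v != 0 >]]; split.
  by move=> q; rewrite mem_filter => /andP[/asboolP h qS]; split; [exact: hd|exact: hS].
move=> q [v hv]; apply: contrapT => h; move/eqP: hv; apply.
pose dm := fun j => `[< is_dummy s alpha beta j >].
have P : perm_eq (mlist q) ([seq i <- mlist q | ~~ dm i] ++ [seq i <- mlist q | dm i]).
  rewrite -(perm_filterC (fun i => ~~ dm i) (mlist q)).
  by rewrite perm_cat2l; have -> : [seq x <- mlist q | predC (fun i => ~~ dm i) x] = [seq i <- mlist q | dm i]
    by apply: eq_filter => i; rewrite /= negbK.
rewrite Dpart_pder (pder_perm _ P)// pder_cat.
rewrite (_ : pder [seq i <- mlist q | dm i] F = fun=> 0) ?pder0//; apply/funext => w.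
rewrite (pder_dummy cD FE); last by move=> j; rewrite mem_filter => /andP[/asboolP].
rewrite big_seq big1// => q' q'S; have [q'a|q'n] := pselect (exists v, c q' v != 0); last first.
  by rewrite (_ : c q' w = 0) ?mul0r//; apply/eqP/negPn/negP => h'; apply: q'n; exists w.
have [j [dj qj]] : exists j, is_dummy s alpha beta j /\ (q' j < q j)%N.
  apply: contrapT => h'; apply: h; exists q'; first by rewrite mem_filter q'S andbT; apply/asboolP.
  by move=> j dj; rewrite leqNgt; apply/negP => lt; apply: h'; exists j.
rewrite (@pder_monomial0 _ _ _ _ j) ?mulr0//.
rewrite count_filter (eq_count (a2 := pred1 j)) ?count_mlist// => i /=.
by case: eqP => [->|]; rewrite ?andbF//= /dm asboolT.
Qed.

End Subcritical.

(** * The trees of the equation *)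

Section Trees.
Context {R : realType} {d : nat} (s : 'I_d -> nat) (alpha beta : R).
Local Notation jet := (1 + (d + 1))%N.
Context (F : 'rV[R]_jet -> R).
Hypothesis s_gt0 : forall i, (0 < s i)%N.
Hypothesis alpha0 : alpha < 0.
Hypothesis sF : smooth F.
Hypothesis affF : affine_in_xi F.
Hypothesis subF : locally_subcritical s alpha beta F.
Implicit Types (q : mindex jet) (t u x : expr d) (k l : mindex d) (o : option 'I_d).
Local Notation wt := (weight s alpha beta).
Local Notation Delta := (coproduct s alpha beta).
Local Notation fct := (option 'I_d * expr d)%type.
Implicit Types (L : seq fct).

(* A factor (None, x) stands for an occurrence of U, and (Some i, x) for one
   of P_i. *)
Definition ko o : mindex d := if o is Some i then munit i else 0.
Definition jo o : 'I_jet := if o is Some i then var_p i else var_u.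
Definition eprod L : expr d := \big[emul/m1]_(y <- L) y.2.
Definition tree q L : expr d := iter (q (var_xi (d := d))) (emul Xi) (eprod L).
Definition counts q L := forall o, count (fun y : fct => y.1 == o) L = q (jo o).

Lemma big_options (P : 'I_d -> seq (expr d)) :
  \big[emul/m1]_(y <- flatten [seq [seq (Some i, x) | x <- P i] | i <- enum 'I_d]) y.2 =
  \big[emul/m1]_(i < d) \big[emul/m1]_(x <- P i) x.
Proof. by rewrite big_flatten big_map big_enum; apply: eq_bigr => i _; rewrite big_map. Qed.

(** All substituted factors are gathered in one list, tagged by the variable they replace, so that
    trees are treated by induction on a list. *)
Lemma substituteP U P t : substitute F U P t <-> exists q L,
  [/\ M_F F q, counts q L, forall y, y \in L -> (if y.1 is Some i then P i else U) y.2 & t = tree q L].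
Proof.
split=> [[q Mq [u [p [hu hp ->]]]]|[q [L [Mq cL hL ->]]]].
  pose Lu := [seq (None, x) | x <- [seq u j | j <- enum 'I_(q var_u)]] : seq fct.
  pose lp i := [seq p i j | j <- enum 'I_(q (var_p i))].
  exists q, (Lu ++ flatten [seq [seq (Some i, x) | x <- lp i] | i <- enum 'I_d]); split=> //.
  - move=> o; rewrite count_cat count_map count_flatten -map_comp.
    case: o => [i|] /=.
      rewrite (@eq_count _ _ pred0) ?count_pred0 ?add0n//.
      rewrite sumnE big_map big_enum /= (bigD1 i)//= big1 ?addn0; last first.
        move=> j ji; rewrite count_map (@eq_count _ _ pred0) ?count_pred0// => x /=.
        by apply/eqP => -[e]; rewrite e eqxx in ji.
      rewrite count_map; transitivity (count predT (lp i)); first by apply: eq_count => x /=; rewrite eqxx.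
      by rewrite count_predT size_map size_enum_ord.
    rewrite (@eq_count _ _ predT) ?count_predT ?size_map ?size_enum_ord//.
    rewrite sumnE big_map big1 ?addn0 => [|i _ /=]; first by rewrite -enumT size_enum_ord.
    by rewrite count_map (@eq_count _ _ pred0) ?count_pred0.
  - move=> y; rewrite mem_cat => /orP[/mapP[x /mapP[j _ ->] ->]|/flattenP[z /mapP[i _ ->]]]; first exact: hu.
    by move=> /mapP[x /mapP[j _ ->] ->]; exact: hp.
  - rewrite /tree /eprod big_cat big_options big_map big_map big_enum; congr (iter _ _ (emul _ _)).
    by apply: eq_bigr => i _; rewrite big_map big_enum.
exists q => //.
pose lo o := [seq y.2 | y <- L & y.1 == o].
have so o : size (lo o) = q (jo o) by rewrite size_map size_filter cL.
have lP o x : x \in lo o -> (if o is Some i then P i else U) x.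
  by move=> /mapP[y]; rewrite mem_filter => /andP[/eqP <- yL] ->; exact: hL.
exists (fun j => nth m1 (lo None) j), (fun i j => nth m1 (lo (Some i)) j); split.
- by move=> j; apply: (lP None); rewrite mem_nth// so.
- by move=> i j; apply: (lP (Some i)); rewrite mem_nth// so.
rewrite /tree; congr (iter _ _ _).
have E o : \big[emul/m1]_(j < q (jo o)) nth m1 (lo o) j = \big[emul/m1]_(x <- lo o) x.
  by rewrite (big_nth m1) so big_mkord.
rewrite (E None) (eq_bigr _ (fun i _ => E (Some i))) /lo {E lP so cL hL lo}.
elim: L => [|[ o x] L ih].
  by rewrite /eprod !big_nil big1 ?emulx1// => i _; rewrite big_nil.
rewrite /eprod big_cons -/(eprod L) ih; case: o => [i|] /=; last by rewrite big_cons emulA.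
rewrite emulA [emul x _]emulC -emulA; congr (emul _ _).
rewrite [in RHS](bigD1 i)//= eqxx big_cons [in LHS](bigD1 i)//= emulA; congr (emul _ _).
by apply: eq_bigr => j ji; case: eqP => // -[e]; rewrite e eqxx in ji.
Qed.

Definition pl k n : set (expr d) := if n is 0 then set0 else planted k (W_ F n).

Lemma W_mono m n : (m <= n)%N -> W_ F m `<=` W_ F n.
Proof.
elim: n => [|n ih]; first by rewrite leqn0 => /eqP->.
by rewrite leq_eqVlt => /predU1P[->//|]; rewrite ltnS => /ih h t /h Wt /=; left.
Qed.

Lemma W_inv n t : W_ F n t -> exists m q L, [/\ (m < n)%N, M_F F q, counts q L,
  forall y, y \in L -> pl (ko y.1) m y.2 & t = tree q L].
Proof.
elim: n => [//|n ih] /= [/ih[m [q [L [mn h1 h2 h3 h4]]]]|].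
  by exists m, q, L; split => //; exact: ltnW.
move=> /substituteP[q [L [h1 h2 h3 h4]]]; exists n, q, L; split => // y /h3.
by case: n {ih h3} => [|n]; case: y.1.
Qed.

Lemma W_intro m q L : M_F F q -> counts q L -> (forall y, y \in L -> pl (ko y.1) m y.2) ->
  W_ F m.+1 (tree q L).
Proof.
move=> Mq cL hL /=; right; apply/substituteP; exists q, L; split => // y /hL.
by case: m {hL} => [|m]; case: y.1.
Qed.

Lemma pl_inv k n x : pl k n x -> is_Xpow x \/ exists2 u, W_ F n u /\ ~ is_Xpow u & x = II k u.
Proof. by case: n => // n [h|[u [Wu nu] <-]]; [left|right; exists u]. Qed.

Lemma eprod_ind (P : expr d -> Prop) q L : P m1 -> P Xi -> (forall t u, P t -> P u -> P (emul t u)) ->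
  (forall y, y \in L -> P y.2) -> P (tree q L).
Proof.
move=> P1 PX Pm hL; rewrite /tree; elim: (q _) => [|n ih] /=; last exact: Pm.
rewrite /eprod; elim: L hL => [|y L ih] hL; first by rewrite big_nil.
rewrite big_cons; apply: Pm; first by apply: hL; rewrite inE eqxx.
by apply: ih => z zL; apply: hL; rewrite inE zL orbT.
Qed.

Lemma W_formal n t : W_ F n t -> formal t.
Proof.
elim/ltn_ind: n t => n IH t /W_inv[m [q [L [mn _ _ hL ->]]]].
apply: eprod_ind => [||t' u' h1 h2|y /hL/pl_inv[[k ->]|[u [Wu nu] ->]]].
- exact: formal_one.
- exact: formal_Xi.
- exact: formal_mul.
- exact: formal_Xpow.
- by apply: formal_I => //; exact: IH mn _ Wu.
Qed.

Lemma wt_tree q L : wt (tree q L) = alpha *+ q (var_xi (d := d)) + \sum_(y <- L) wt y.2.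
Proof.
rewrite /tree; elim: (q _) => [|n ih] /=; last by rewrite wt_emul wt_Xi ih mulrS addrA.
rewrite mulr0n add0r /eprod; elim: L => [|y L ih]; first by rewrite !big_nil wt_one.
by rewrite !big_cons wt_emul ih.
Qed.

(** Lower bound for the weight of a factor replacing the variable o: powers of X weigh at least 0,
    planted trees at least alpha + beta - |k|. *)
Definition hm o : R := Num.min 0 (alpha + beta - (sdeg s (ko o))%:R).
Definition dummy o : bool := alpha + beta - (sdeg s (ko o))%:R <= 0.

Lemma hm_le0 o : hm o <= 0. Proof. by rewrite /hm ge_min lexx. Qed.

Lemma hm_le o : hm o <= alpha + beta - (sdeg s (ko o))%:R.
Proof. by rewrite /hm ge_min lexx orbT. Qed.

Lemma hmE o : hm o = if dummy o then alpha + beta - (sdeg s (ko o))%:R else 0.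
Proof.
by rewrite /hm /dummy; case: lerP.
Qed.

Lemma dummyP o : dummy o <-> is_dummy s alpha beta (jo o).
Proof.
rewrite /dummy; case: o => [i|] /=.
  rewrite sdeg_munit subr_le0 addrC; split=> [h|[]]; first by constructor 2; exists i.
  - by move=> /rshift_inj/eqP; rewrite eq_lrshift.
  - by move=> [j /rshift_inj/lshift_inj ->].
  - by move=> [/eqP]; rewrite eq_rlshift.
rewrite sdeg0 subr0 addrC; split=> [h|[]]; first by constructor 3.
- by move=> /eqP; rewrite eq_lrshift.
- by move=> [i /eqP]; rewrite eq_lrshift.
- by case.
Qed.

Lemma sum_counts (G : option 'I_d -> R) q L : counts q L ->
  \sum_(y <- L) G y.1 = G None *+ q var_u + \sum_(i < d) G (Some i) *+ q (var_p i).
Proof.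
move=> cL; rewrite -(cL None) (eq_bigr _ (fun i _ => congr1 _ (esym (cL (Some i))))) {cL}.
elim: L => [|[ o x] L ih]; first by rewrite big_nil /= mulr0n add0r big1.
rewrite big_cons ih /=; case: o => [i|] /=; last first.
  by rewrite mulrnDr mulr1n addrA; congr (_ + _); apply: eq_bigr => j _; rewrite add0n.
rewrite add0n addrCA; congr (_ + _); rewrite (bigD1 i)//= [in RHS](bigD1 i)//= eqxx mulrnDr mulr1n addrA.
congr (_ + _); apply: eq_bigr => j ji; case: eqP => [[e]|]; last by rewrite add0n.
by rewrite e eqxx in ji.
Qed.

Definition hom q L : R := alpha *+ q (var_xi (d := d)) + \sum_(y <- L) hm y.1.

(* Subcriticality: unless only Xi occurs among the dummy variables, the
   homogeneity exceeds alpha, by a uniform amount. *)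
Lemma subcritical_gap : exists2 kap : R, 0 < kap & exists Dm : nat, forall q L, M_F F q -> counts q L ->
  [/\ (q (var_xi (d := d)) <= 1)%N, (count (fun y : fct => dummy y.1) L <= Dm)%N &
    (forall y, y \in L -> ~~ dummy y.1) \/ alpha + kap <= hom q L].
Proof.
have [S [hS aS]] := M_F_active sF subF.
pose mh := monomial_homogeneity s alpha beta.
have [kap kap0 hk] : exists2 kap : R, 0 < kap &
    forall q', q' \in S -> q' (var_xi (d := d)) = 0%N -> alpha + kap <= mh q'.
  have : forall q', q' \in S -> q' (var_xi (d := d)) = 0%N -> alpha < mh q'.
    by move=> q' /hS[_ h] q0; move: h; rewrite q0.
  elim: (S) => [|q' S' ih] h; first by exists 1.
  have [kap kap0 hk] := ih (fun q'' qS => h q'' ltac:(by rewrite inE qS orbT)).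
  have [q0|q0] := posnP (q' (var_xi (d := d))); last first.
    exists kap => // q''; rewrite inE => /predU1P[->|]; last exact: hk.
    by move=> e; rewrite e in q0.
  have a1 := h q' (mem_head _ _) q0.
  exists (Num.min kap (mh q' - alpha)); first by rewrite lt_min kap0 subr_gt0.
  move=> q''; rewrite inE => /predU1P[-> _|/hk h1 /h1 h2].
    by rewrite -lerBrDl ge_min lexx orbT.
  by apply: le_trans h2; rewrite lerD2l ge_min lexx.
exists kap => //; exists (\sum_(q' <- S) mdeg q')%N => q L Mq cL.
have q1 := affine_xi sF affF Mq; have [q' q'S q'q] := aS q Mq; have [hd hx] := hS q' q'S.
split=> //.
  apply: (@leq_trans (mdeg q')); last by rewrite (big_rem q')//= leq_addr.
  rewrite -(ler_nat R) -sum1_count big_mkcond natr_sum.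
  rewrite (eq_bigr (fun y : fct => if dummy y.1 then 1 else 0 : R)); last by move=> y _; case: ifP.
  rewrite (sum_counts (fun o => if dummy o then 1 else 0 : R) cL).
  have b1 o : (if dummy o then 1 else 0 : R) *+ q (jo o) <= (q' (jo o))%:R.
    case: ifP => [/dummyP do_|_]; last by rewrite mul0rn.
    by rewrite ler_nat q'q.
  rewrite /mdeg big_split_ord /= big_ord1 big_split_ord /= big_ord1 !natrD natr_sum addrA.
  rewrite -[leLHS]addr0; apply: lerD; last by rewrite ler0n.
  apply: lerD; first exact: (b1 None).
  by apply: ler_sum => i _; exact: (b1 (Some i)).
case: posnP hx => [q0 _|q0 hx]; last first.
  left=> y yL; apply/negP => dy; have := q'q _ ((dummyP y.1).1 dy).
  rewrite -cL hx ?leqn0; last first.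
    by case: y.1 {yL dy} => [i|]; rewrite /jo /var_xi /var_p /var_u; apply/eqP; [move=> /rshift_inj/eqP|move=> /eqP]; rewrite eq_lrshift.
  rewrite -leqn0 leqNgt -has_count => /hasP; apply.
  by exists y.
right; apply: le_trans (hk q' q'S q0) _.
have -> : hom q L = alpha *+ q (var_xi (d := d)) + (hm None *+ q var_u + \sum_(i < d) hm (Some i) *+ q (var_p i)).
  by rewrite /hom (sum_counts hm cL).
have -> : q (var_xi (d := d)) = 0%N.
  apply/eqP; rewrite -leqn0; apply: (leq_trans (q'q _ _)); [by constructor 1|by rewrite q0].
have b2 o : (alpha + beta - (sdeg s (ko o))%:R) *+ q' (jo o) <= hm o *+ q (jo o).
  rewrite hmE; have [/[dup] do_ /dummyP/q'q h|nd] := boolP (dummy o).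
    by apply: ler_wnMn2l.
  rewrite mul0rn; have [->|h] := posnP (q' (jo o)); first by rewrite mulr0n.
  by case/negP: nd; apply/dummyP; exact: hd.
rewrite /mh /monomial_homogeneity q0 !mulr0n !add0r; apply: lerD.
  by have := b2 None; rewrite /= sdeg0 subr0 [alpha + _]addrC.
by apply: ler_sum => i _; have := b2 (Some i); rewrite /= sdeg_munit [alpha + _]addrC.
Qed.

Lemma hom_ge q L : M_F F q -> counts q L -> alpha <= hom q L.
Proof.
move=> Mq cL; have [kap kap0 [Dm gap]] := subcritical_gap.
have [q1 _ [nd|h]] := gap q L Mq cL; last by apply: le_trans h; rewrite lerDl ltW.
rewrite /hom big_seq big1 ?addr0 => [|y /nd]; last by rewrite hmE => /negPf ->.
case: (q _) q1 => [|[|//]] _; last by rewrite mulr1n.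
by rewrite mulr0n ltW.
Qed.

Lemma W_weight n t : W_ F n t -> alpha <= wt t.
Proof.
elim/ltn_ind: n t => n IH t /W_inv[m [q [L [mn Mq cL hL ->]]]].
apply: le_trans (hom_ge Mq cL) _; rewrite wt_tree /hom lerD2l !big_seq; apply: ler_sum => y /hL/pl_inv.
case=> [[k ->]|[u [Wu _] ->]]; first by rewrite wt_Xpow (le_trans (hm_le0 _)).
rewrite wt_II (le_trans (hm_le _))// lerD2r lerD2r; exact: IH mn _ Wu.
Qed.

Lemma pl_weight o n x : pl (ko o) n x -> hm o <= wt x.
Proof.
case/pl_inv => [[k ->]|[u [Wu _] ->]]; first by rewrite wt_Xpow (le_trans (hm_le0 _)).
by rewrite wt_II (le_trans (hm_le _))// lerD2r lerD2r; exact: W_weight Wu.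
Qed.

Lemma tree_weight_ge m q L y : counts q L -> (forall y, y \in L -> pl (ko y.1) m y.2) -> y \in L ->
  hom q L - hm y.1 + wt y.2 <= wt (tree q L).
Proof.
move=> cL hL yL; rewrite wt_tree /hom (big_rem y)//= [in leRHS](big_rem y)//=.
have -> : forall a h r w : R, a + (h + r) - h + w = a + (w + r) by move=> a h r w; ring.
rewrite lerD2l lerD2l !big_seq; apply: ler_sum => z /mem_rem /hL; exact: pl_weight.
Qed.

Lemma hom_le q L y : y \in L -> hom q L <= hm y.1.
Proof.
move=> yL; rewrite /hom (big_rem y)//= addrCA -[leRHS]addr0 lerD2l -[leRHS]addr0; apply: lerD.
  by rewrite -[leRHS](mul0rn _ (q (var_xi (d := d)))) ler_wMn2r// ltW.
by apply: sumr_le0 => z _; exact: hm_le0.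
Qed.

(** The smoothing beta - |k| > 0 of the kernels in use comes from here. For a dummy factor, alpha <
    hom q L <= alpha + beta - |k| by subcriticality; otherwise alpha + beta - |k| > 0 > alpha. *)
Lemma ko_beta q L y : M_F F q -> counts q L -> y \in L -> (sdeg s (ko y.1))%:R < beta.
Proof.
move=> Mq cL yL; have [kap kap0 [Dm gap]] := subcritical_gap.
have [dy|] := boolP (dummy y.1); last first.
  by rewrite /dummy -ltNge subr_gt0 => h; apply: lt_le_trans h _; rewrite -[leRHS]add0r lerD2r ltW.
have [_ _ [nd|h]] := gap q L Mq cL; first by have := nd y yL; rewrite dy.
have := le_trans h (hom_le q yL); rewrite hmE dy; lra.
Qed.

Lemma nondummy_gap : exists2 rho : R, 0 < rho & forall o, ~~ dummy o -> rho <= alpha + beta - (sdeg s (ko o))%:R.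
Proof.
have [rho rho0 h] : exists2 rho : R, 0 < rho & forall i, i \in enum 'I_d -> ~~ dummy (Some i) ->
    rho <= alpha + beta - (sdeg s (ko (Some i)))%:R.
  elim: (enum 'I_d) => [|i e [rho rho0 h]]; first by exists 1.
  have [di|ndi] := boolP (dummy (Some i)).
    by exists rho => // j; rewrite inE => /predU1P[->|/h//]; rewrite di.
  move: (ndi); rewrite {1}/dummy -ltNge => h0.
  exists (Num.min rho (alpha + beta - (sdeg s (ko (Some i)))%:R)); first by rewrite lt_min rho0.
  move=> j; rewrite inE => /predU1P[->|/h hj] nd; rewrite ge_min ?lexx ?orbT//.
  by rewrite hj.
have [dn|ndn] := boolP (dummy None).
  by exists rho => // -[i|]; [apply: h; rewrite mem_enum|rewrite dn].
move: (ndn); rewrite {1}/dummy -ltNge => h0.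
exists (Num.min rho (alpha + beta - (sdeg s (ko None))%:R)); first by rewrite lt_min rho0.
by move=> [i|] nd; rewrite ge_min ?lexx ?orbT// h// mem_enum.
Qed.

(** Relative to wt u, the planting adds beta - |k| and the rest of the product at least hom q L - hm
    y.1. For a dummy factor the total is hom q L - alpha, bounded below by subcriticality. Otherwise
    hm y.1 = 0 and the total is at least alpha + beta - |k|, which is positive and takes finitely
    many values. *)
Lemma tree_gain : exists2 kap : R, 0 < kap & forall m q L, M_F F q -> counts q L ->
  (forall y, y \in L -> pl (ko y.1) m y.2) -> forall y u, y \in L -> y.2 = II (ko y.1) u ->
  wt u + kap <= wt (tree q L).
Proof.
have [kap kap0 [Dm gap]] := subcritical_gap; have [rho rho0 hrho] := nondummy_gap.
exists (Num.min kap rho) => [|m q L Mq cL hL y u yL yu]; first by rewrite lt_min kap0.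
apply: le_trans (tree_weight_ge cL hL yL); rewrite yu wt_II hmE.
have k1 : Num.min kap rho <= kap by rewrite ge_min lexx.
have k2 : Num.min kap rho <= rho by rewrite ge_min lexx orbT.
have ha := hom_ge Mq cL; have [dy|nd] := boolP (dummy y.1); last by have := hrho _ nd; lra.
have [_ _ [h|h]] := gap q L Mq cL; first by have := h y yL; rewrite dy.
by lra.
Qed.

Lemma inn_Xpow t u : is_Xpow t -> ~ inn u t.
Proof.
elim/(@expr_ind d): t => [_|_|i _|t1 t2 h1 h2 /is_Xpow_emul[/h1 n1 /h2 n2]|k t _ /II_notXpow//].
- by rewrite inn_pi.
- by rewrite inn_pi.
- by rewrite inn_pi.
- by rewrite inn_emul; tauto.
Qed.

Lemma inn_tree u q L : inn u (tree q L) -> exists2 y, y \in L & inn u y.2.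
Proof.
apply: (eprod_ind (P := fun t => inn u t -> exists2 y, y \in L & inn u y.2)).
- by rewrite inn_pi.
- by rewrite inn_pi.
- by move=> t1 t2 h1 h2 /inn_emul[/h1|/h2].
- by move=> y yL h; exists y.
Qed.

Lemma inn_W n t u : W_ F n t -> inn u t -> (exists m, W_ F m u) /\ wt u < wt t.
Proof.
have [kap kap0 gain] := tree_gain.
elim/ltn_ind: n t => n IH t /W_inv[m [q [L [mn Mq cL hL ->]]]] /inn_tree[y yL iy].
have [/inn_Xpow/(_ iy)//|[w [Ww nw] yw]] := pl_inv (hL y yL).
have h := gain m q L Mq cL hL y w yL yw; move: iy; rewrite yw inn_II => -[->|iw].
  by split; [exists m|lra].
by have [h1 h2] := IH m mn w Ww iw; split => //; lra.
Qed.

Lemma fac_W n t k u : W_ F n t -> fac k u t -> (exists m, W_ F m u) /\ (sdeg s k)%:R < beta.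
Proof.
move=> /W_inv[m [q [L [mn Mq cL hL ->]]]].
have : forall y, y \in L -> fac k u y.2 -> (exists m, W_ F m u) /\ (sdeg s k)%:R < beta.
  move=> y yL fy; have [/inn_Xpow/(_ (fac_inn fy))//|[w [Ww nw] yw]] := pl_inv (hL y yL).
  move: fy; rewrite yw fac_II => -[-> ->]; split; first by exists m.
  exact: ko_beta Mq cL yL.
apply: (eprod_ind (P := fun t => fac k u t -> (exists m, W_ F m u) /\ (sdeg s k)%:R < beta)).
- by move/fac_one.
- by move/fac_Xi.
- by move=> t1 t2 h1 h2 /fac_emul[/h1|/h2].
Qed.

Lemma cop_Xpow_left k : lspan [set p | is_Xpow p.1] (Delta (Xpow k) : Hsp2 R d).
Proof.
suff h t : is_Xpow t -> lspan [set p | is_Xpow t -> is_Xpow p.1] (Delta t : Hsp2 R d).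
  by apply: lspanS (h _ _) => [p|]; [apply; exists k|exists k].
move: t; apply: (cop_span s_gt0 (P := fun t => [set p | is_Xpow t -> is_Xpow p.1])) => //.
- by move=> t u /is_Xpow_emul.
- by move=> l t /II_notXpow.
- by move=> i /=.
- by move=> i _ /=; exact: is_Xpow_one.
- by move=> t u p q xt xu h1 h2 _ /=; apply/is_Xpow_emul; split; [exact: h1|exact: h2].
Qed.

Lemma cop_II_left (D : set (expr d)) k u : lspan [set p | D p.1] (Delta u : Hsp2 R d) ->
  lspan [set p | is_Xpow p.1 \/ exists2 w, D w /\ ~ is_Xpow w & p.1 = II k w] (Delta (II k u)).
Proof.
move=> hu; rewrite (cop_II s_gt0 k (leqnn _)); apply: lspanD.
  apply: lspan_lext => p cp; rewrite /Iop; case: asboolP => nx; first by rewrite tens0l; exact: lspan0.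
  rewrite tens_bas; apply: lspan_bas; right; exists p.1 => //; split => //; exact: hu cp.
apply: lspan_sum => l _; apply: lspan_sum => m _.
have := @lspan_tens R _ _ is_Xpow setT (Ex l) (Ex m * Jop s alpha beta (k + l + m) u).
move=> h; apply: lspanS (h _ (fun _ _ => I)) => [p [xp _]|]; first by left.
by apply: lspanZ; apply: lspan_bas; exists l.
Qed.

(** Left components keep the shape of the tree: each factor becomes one of the same kind, a power of
    X or a planted tree of the same stage, and [counts] depends on the kinds alone. *)
Lemma W_cop n t : W_ F n t -> lspan [set p | W_ F n p.1] (Delta t : Hsp2 R d).
Proof.
elim/ltn_ind: n t => n IH t /W_inv[m [q [L [mn Mq cL hL ->]]]].
have hy y : y \in L -> lspan [set p | pl (ko y.1) m p.1] (Delta y.2 : Hsp2 R d).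
  move=> yL; have := hL y yL; move: y.2 => x; case: m mn {hL} => [//|m] mn.
  case=> [[k ->]|[u [Wu nu] <-]]; first by apply: lspanS (@cop_Xpow_left k) => p xp; left.
  apply: lspanS (cop_II_left (IH _ mn u Wu)) => p [xp|[w [Ww nw] pw]]; first by left.
  by right; exists w.
have : lspan [set p : expr d * expr d | exists L', [/\ map fst L' = map fst L,
    forall y, y \in L' -> pl (ko y.1) m y.2 & p.1 = tree q L']] (Delta (tree q L) : Hsp2 R d).
  rewrite /tree; elim: (q _) => [|a ih] /=; last first.
    rewrite cop_emul cop_Xi -bas_one tens_bas.
    apply: (lspanM (B := [set p | p.1 = Xi]) _ _ ih); last exact: lspan_bas.
    by move=> [p1 p2] [r1 r2] /= -> [L' [h1 h2 ->]]; exists L'.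
  rewrite /eprod; elim: L hy {hL cL} => [|y L ihL] hy.
    rewrite big_nil cop_one; apply: lspan_one; exists [::]; split => //.
    by rewrite /eprod big_nil.
  rewrite big_cons cop_emul.
  apply: (lspanM (B := [set p | pl (ko y.1) m p.1]) _ (hy y (mem_head _ _)) (ihL _)); last first.
    by move=> z zL; apply: hy; rewrite inE zL orbT.
  move=> [p1 p2] [r1 r2] /= h0 [L' [h1 h2 ->]]; exists ((y.1, p1) :: L'); split.
  - by rewrite /= h1.
  - by move=> z; rewrite inE => /predU1P[->//|/h2].
  - by rewrite big_cons.
move=> h; apply: lspanS h => p [L' [h1 h2 e0]]; rewrite /= e0; apply: (W_mono mn); apply: W_intro => // o.
have e L1 : count (fun y : fct => y.1 == o) L1 = count (pred1 o) (map fst L1) by rewrite count_map.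
by rewrite e h1 -e cL.
Qed.

End Trees.

Lemma mcoeff_lext (R : realType) (K L : choiceType) (f : K -> malg L R) (a : malg K R) l :
  mcoeff l (lext f a) = lextR (fun k => mcoeff l (f k)) a.
Proof. by rewrite /lext raddf_sum; apply: eq_bigr => k _ /=; rewrite mcoeffZ. Qed.

Lemma mcoeff_Gm (R : realType) (d : nat) (s : 'I_d -> nat) (alpha beta : R) g t u :
  mcoeff u (Gm s alpha beta g t) = lextR (fun p => g p.2 * (p.1 == u)%:R) (coproduct s alpha beta t).
Proof. by rewrite mcoeff_lext; apply: eq_bigr => p _; rewrite mcoeffZ mcoeff_bas. Qed.

Lemma lextR_Gm (R : realType) (d : nat) (s : 'I_d -> nat) (alpha beta : R) (F : expr d -> R) g t :
  lextR F (Gm s alpha beta g t) = lextR (fun p => F p.1 * g p.2) (coproduct s alpha beta t).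
Proof.
rewrite /Gm lextR_lext; apply: eq_lextR => p _; by rewrite lextRZ lextR_bas mulrC.
Qed.

#[local] Opaque Gm lext.

(** * Admissible models in base-point free form *)

Section Series.
Context {R : realType}.
Implicit Types (a b : nat -> R).

Lemma seriesB_cvg a b (la lb : R) : series a @ \oo --> la -> series b @ \oo --> lb ->
  series (fun m => a m - b m) @ \oo --> la - lb.
Proof.
move=> ha hb; have -> : series (fun m => a m - b m) = fun n => series a n - series b n.
  by apply/funext => n; rewrite /series /= sumrB.
exact: cvgB.
Qed.

Lemma seriesZ_cvg a (la c : R) : series a @ \oo --> la -> series (fun m => c * a m) @ \oo --> c * la.
Proof.
move=> ha; have -> : series (fun m => c * a m) = fun n => c * series a n.
  by apply/funext => n; rewrite /series /= mulr_sumr.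
by apply: cvgM => //; exact: cvg_cst.
Qed.

Lemma series_sum_cvg (I : eqType) (q : seq I) (a : I -> nat -> R) (la : I -> R) :
  (forall i, i \in q -> series (a i) @ \oo --> la i) ->
  series (fun m => \sum_(i <- q) a i m) @ \oo --> \sum_(i <- q) la i.
Proof.
elim: q => [|i q ih] hq.
  rewrite big_nil (_ : series _ = fun=> 0); first exact: cvg_cst.
  by apply/funext => n; rewrite /series /= big1// => m _; rewrite big_nil.
rewrite big_cons (_ : series _ = fun n => series (a i) n + series (fun m => \sum_(i <- q) a i m) n).
  apply: cvgD; first by apply: hq; rewrite inE eqxx.
  by apply: ih => j jq; apply: hq; rewrite inE jq orbT.
by apply/funext => n; rewrite /series /= -big_split; apply: eq_bigr => m _; rewrite big_cons.
Qed.

End Series.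

Section GoodModels.
Context {R : realType} {d : nat} (s : 'I_d -> nat) (alpha beta r : R).
Hypothesis s_gt0 : forall i, (0 < s i)%N.
Context (K : nat -> 'rV[R]_d -> R) (N : nat).
Local Notation V := 'rV[R]_d.
Local Notation test := (V -> R).
Implicit Types (t u : expr d) (k l q p : mindex d) (x y z : V) (phi psi : test).
Local Notation wt := (weight s alpha beta).
Local Notation Delta := (coproduct s alpha beta).
Local Notation Alg := (Alg s alpha beta).
Local Notation pos_J := (pos_J s alpha beta).
Local Notation nb := (nb s alpha beta).
Local Notation Gm := (Gm s alpha beta).
Local Notation H := (Hsp R d).
Local Notation sbox := (@sbox R d s).
Local Notation kk := (kk K).
Local Notation S := (stot s).
Hypothesis sK : forall m, smooth (K m).
Hypothesis supK : forall m, supported_in (sbox 0 (lam m)) (K m).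
Hypothesis bK : forall k : mindex d, exists C : R, forall m x,
  `|Dpart k (K m) x| <= C * 2 `^ ((S%:R - beta + (sdeg s k)%:R) * m%:R).
Hypothesis annK : forall m x (q : seq (R * mindex d)),
  (forall w, w \in q -> (sdeg s w.2)%:R <= r) ->
  integral_rV (fun y => K m (x - y) * \sum_(w <- q) w.1 * monomial w.2 y) = 0.

(* Bs is stable under the coproduct, whose right components only involve the
   trees of C. *)
Record closed (Bs C : set (expr d)) : Prop := Closed {
  cl_fin : exists e : seq (expr d), uniq e /\ forall t, t \in e <-> Bs t;
  cl_C : C `<=` Bs;
  cl_formal : forall t, Bs t -> formal t;
  cl_cop : forall t, Bs t -> lspan (Bs `*` Alg [set u | C u /\ wt u < wt t]) (Delta t);
  cl_ni : forall t, C t -> lspan [set p | is_Xpow p.1 \/ forall n : nat, wt p.1 + beta <> n%:R] (Delta t);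
  cl_pol : forall p, Bs (Xpow p) -> (sdeg s p)%:R <= r
}.

Definition fc (Pi : V -> expr d -> test -> R) x k t : R :=
  - limn (series (fun n => Pi x t (kk k n x))).

Definition Fx Pi x : expr d -> R := charE (- x) (fc Pi x).

(* bP is the base-point free version of Pi: Pi_x = bP o F_x. *)
Record good (Pi : V -> expr d -> test -> R) (bP : expr d -> test -> R) (Bs : set (expr d)) : Prop := Good {
  gd_lin : forall t, Bs t -> Tlin (bP t);
  gd_rep : forall x t phi, Bs t -> test_function phi ->
    Pi x t phi = lextR (fun u => bP u phi) (Gm (Fx Pi x) t);
  gd_pol : forall p phi, Bs (Xpow p) -> test_function phi ->
    bP (Xpow p) phi = integral_rV (fun y => monomial p y * phi y);
  gd_ser : forall k t phi, Bs t -> Bs (II k t) -> test_function phi ->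
    series (fun n => integral_rV (fun y => phi y * bP t (kk k n y))) @ \oo --> bP (II k t) phi;
  gd_bd : forall t rad, Bs t -> exists2 A : R, 0 <= A & forall x, sbox 0 rad x ->
    Tb s N x rad A (wt t) (Pi x t)
}.

(** Weights are real numbers; the well-founded measure is the number of lighter trees in the finite
    set Bs. *)
Lemma weight_ind (Bs : set (expr d)) (P : expr d -> Prop) :
  (exists e : seq (expr d), uniq e /\ forall t, t \in e <-> Bs t) ->
  (forall t, Bs t -> (forall u, Bs u -> wt u < wt t -> P u) -> P t) -> forall t, Bs t -> P t.
Proof.
move=> [e [_ eB]] ih t; pose m t := count (fun u => wt u < wt t) e.
have [n] := ubnP (m t); elim: n t => // n IH t; rewrite ltnS => tn Bt.
apply: ih => // u Bu ut; apply: IH => //; apply: leq_trans tn.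
have ue : u \in e by apply/eB.
have h v : wt v < wt u -> wt v < wt t by move=> h; exact: lt_trans ut.
rewrite /m; clear -ue ut h; elim: e ue => // v e IHe; rewrite inE => /predU1P[<-|/IHe h2] /=.
  rewrite ltxx ut add0n add1n ltnS; exact: sub_count.
rewrite -addnS leq_add//; have := h v; case: (wt v < wt u) => // /(_ isT) ->; exact: leqnn.
Qed.

Lemma bP_shift (bP : expr d -> test -> R) (Bs : set (expr d)) x c k phi :
  (forall p, Bs (Xpow p) -> bP (Xpow p) phi = integral_rV (fun y => monomial p y * phi y)) ->
  lspan Bs (Gm (charE (- x) c) (Xpow k)) -> test_function phi ->
  lextR (fun u => bP u phi) (Gm (charE (- x) c) (Xpow k)) =
  integral_rV (fun y => monomial k (y - x) * phi y).
Proof.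
move=> hP aB tp; set a := Gm _ _ in aB *.
have aX : lspan is_Xpow a by exact: Gm_Xpow_span.
(* Evaluation of X at y is a character, and it sends the image of X^k to (y - x)^k. *)
have E y : monomial k (y - x) = lextR (charE y (fun _ _ => 0)) a.
  rewrite /a Gm_Xpow lextRE; pose Y := fun i => bas (Xvar i) + ((- x) ord0 i)%:A : H.
  have hY i : lext (V := R^o) (charE y (fun _ _ => 0)) (Y i) = (y - x) ord0 i.
    by rewrite /Y linearD linearZ /= -[X in _ *: lext _ X]bas_one !lext_bas charE_X charE_one !mxE /GRing.scale /= mulr1.
  have h1 : lext (V := R^o) (charE y (fun _ _ => 0)) (1 : H) = 1.
    by rewrite -bas_one lext_bas charE_one.
  have hM := @lextM R (expr d) (R^o : comAlgType R) (charE y (fun _ _ => 0)) _ _ (charE_emul y _).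
  have hM' (f g : H) : lext (V := R^o) (charE y (fun _ _ => 0)) (f * g) =
     (lext (V := R^o) (charE y (fun _ _ => 0)) f : R) * lext (V := R^o) (charE y (fun _ _ => 0)) g.
    exact: hM.
  rewrite /monomial; elim/big_rec2: _ => [|i w b _ ->]; first by rewrite h1.
  rewrite hM' -hY; congr (_ * _); elim: (k i) => [|n ih]; first by rewrite !expr0 h1.
  by rewrite !exprS hM' ih.
have [r0 [b [r00 L]]] := test_loc s_gt0 0 tp.
have ck p : cpt (fun y : V => monomial p y * phi y).
  have [sp sup _] := L.
  apply: (@smooth_cpt _ _ _ 0 (fun i => r0 ^+ s i)).
  - by apply: smoothM => //; exact: smooth_monomial.
  - by move=> i; rewrite exprn_ge0// ltW.
  - by move=> y; rewrite mulf_eq0 negb_or => /andP[_ /sup].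
rewrite (_ : (fun y => monomial k (y - x) * phi y) =
    fun y => \sum_(u <- msupp a) mcoeff u a * (charE y (fun _ _ => 0) u * phi y)); last first.
  by apply/funext => y; rewrite E /lextR mulr_suml; apply: eq_bigr => u _; rewrite mulrA.
rewrite /lextR.
have h (e : seq (expr d)) : (forall u, u \in e -> mcoeff u a != 0) ->
    cpt (fun y => \sum_(u <- e) mcoeff u a * (charE y (fun _ _ => 0) u * phi y)) /\
    \sum_(u <- e) mcoeff u a * bP u phi =
    integral_rV (fun y => \sum_(u <- e) mcoeff u a * (charE y (fun _ _ => 0) u * phi y)).
  elim: e => [|u e ih] he.
    rewrite big_nil; have -> : (fun y : V => \sum_(u <- [::]) mcoeff u a * (charE y (fun _ _ => 0) u * phi y)) = fun=> 0.
      by apply/funext => y; rewrite big_nil.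
    by rewrite integral0; split=> //; exact: cpt0.
  have [v ve|ih1 ih2] := ih; first by apply: he; rewrite inE ve orbT.
  have ua : mcoeff u a != 0 by apply: he; rewrite inE eqxx.
  have [p up] := aX _ ua; have Bu := aB _ ua.
  have Eu : (fun y => charE y (fun _ _ => 0) u * phi y) = fun y => monomial p y * phi y.
    by apply/funext => y; rewrite up charE_Xpow.
  have -> : (fun y => \sum_(u0 <- u :: e) mcoeff u0 a * (charE y (fun _ _ => 0) u0 * phi y)) =
    fun y => mcoeff u a * (monomial p y * phi y) + \sum_(u <- e) mcoeff u a * (charE y (fun _ _ => 0) u * phi y).
    by apply/funext => y; rewrite big_cons up charE_Xpow.
  split; first by apply: cpt_lin => //; exact: ck.
  rewrite big_cons integral_lin//.
  by rewrite ih2 {2}up hP// -up.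
by apply: (h _ _).2 => u; rewrite mem_msupp.
Qed.

Section Consequences.
Context (Pi : V -> expr d -> test -> R) (bP : expr d -> test -> R) (Bs C : set (expr d)).
Hypothesis clB : closed Bs C.
Hypothesis gdB : good Pi bP Bs.

Lemma cop_Bs t : Bs t -> lspan [set p | Bs p.1] (Delta t).
Proof. by move=> /(cl_cop clB); apply: lspanS => p []. Qed.

Lemma Gm_Bs g t : Bs t -> lspan Bs (Gm g t).
Proof. by move=> Bt; apply: Gm_span; exact: cop_Bs. Qed.

Lemma Pi_Tlin x t : Bs t -> Tlin (Pi x t).
Proof.
move=> Bt c phi psi tp tq; have tpq : test_function (fun x => c * phi x + psi x).
  by apply: testD => //; exact: testZ.
rewrite !(gd_rep gdB)//; transitivity (lextR (fun u => c * bP u phi + bP u psi) (Gm (Fx Pi x) t)).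
  by apply: eq_lextR => u /(Gm_Bs Bt) Bu; exact: (gd_lin gdB).
by rewrite lextRE (lext_linear (V := R^o)).
Qed.

Lemma Pi_Xpow x k phi : Bs (Xpow k) -> test_function phi ->
  Pi x (Xpow k) phi = integral_rV (fun y => monomial k (y - x) * phi y).
Proof.
move=> Bk tp; rewrite (gd_rep gdB)//; apply: (bP_shift (Bs := Bs)) => // [p Bp|].
  exact: (gd_pol gdB).
exact: Gm_Bs.
Qed.

(** The analytic counterpart of the convention I_k (X^l) = 0. *)
Lemma Pi_Xpow_kk x k m y p : Bs (Xpow p) -> Pi x (Xpow p) (kk k m y) = 0.
Proof.
move=> Bp; rewrite Pi_Xpow//; last exact: (test_kk sK supK).
exact: (@kernel_annihilates R d s (K m) (lam m) r (sK m) (lam_ge0 m) (supK (m:=m)) (annK m) k p x y (cl_pol clB Bp)).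
Qed.

Lemma bP_Xpow_kk k m y p : Bs (Xpow p) -> bP (Xpow p) (kk k m y) = 0.
Proof.
move=> Bp; rewrite (gd_pol gdB)//; last exact: (test_kk sK supK).
have := @kernel_annihilates R d s (K m) (lam m) r (sK m) (lam_ge0 m) (supK (m:=m)) (annK m) k p 0 y (cl_pol clB Bp).
by under eq_fun do rewrite subr0.
Qed.

Lemma fc_bound k t rad : Bs t -> pos_J k t -> exists2 D : R, 0 <= D & forall x, sbox 0 rad x ->
  series (fun n => Pi x t (kk k n x)) @ \oo --> - fc Pi x k t /\ `|fc Pi x k t| <= D.
Proof.
move=> Bt /pos_JP[p _].
have [A A0 AT] := gd_bd gdB (`|rad| + 1) Bt.
have [C1 C10 h1] := kk_pair sK supK bK N k.
have [G G0 GP] := geo_bound p.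
set w := wt t + beta - (sdeg s k)%:R in p GP h1 *.
exists (C1 * A * 2 `^ w * G); first nneg.
move=> x xr; have x1 : sbox 0 (`|rad| + 1) x.
  move=> i; apply: (le_trans (xr i)); rewrite -[leLHS]ger0_norm; last exact: le_trans (xr i).
  by rewrite normrX; apply: lerXn2r; rewrite ?nnegrE ?addr_ge0// lerDl.
have T1 : Tb s N x 1 A (wt t) (Pi x t) by apply: Tb_le (AT x x1) => //; rewrite lerDr.
have B M : \sum_(n < M) `|Pi x t (kk k n x)| <= C1 * A * 2 `^ w * G.
  apply: (GP (fun n => Pi x t (kk k n x)) _ 2) => //; first nneg.
    by move=> m h; have := le_trans h (lam_le1 m); lra.
  move=> m _; apply: (le_trans (h1 _ _ _ _ m T1)); rewrite -/w -[X in _ <= X]mulrA.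
  by rewrite -pw_ratio// lam_gt0.
by have [c1 c2] := series_bound (u := fun n => Pi x t (kk k n x)) B; rewrite /fc opprK normrN.
Qed.

Lemma fc_cvg x k t : Bs t -> pos_J k t ->
  series (fun n => Pi x t (kk k n x)) @ \oo --> - fc Pi x k t.
Proof.
move=> Bt pt; have [r0 _ r0x] := in_sbox0 s_gt0 x.
by have [D _ h] := fc_bound r0 Bt pt; exact: (h x r0x).1.
Qed.

Lemma Fx_one x : Fx Pi x m1 = 1. Proof. exact: charE_one. Qed.

(** The coefficients of the character of F_x^-1 o F_y; the translation parts match since -x + (x -
    y) = -y. *)
Definition Gc x y := comp s alpha beta (x - y) (fc Pi x) (fc Pi y).
Definition G x y : expr d -> R := charE (x - y) (Gc x y).

Lemma G_one x y : G x y m1 = 1. Proof. exact: charE_one. Qed.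

Lemma G_spec x y t : formal t -> lext (Gm (Fx Pi x)) (Gm (G x y) t) = Gm (Fx Pi y) t.
Proof.
move=> ft; rewrite /G /Fx (comp_spec _ _ s_gt0 _ _ _ _ ft).
have -> : - x + (x - y) = - y by rewrite addrA addNr sub0r.
reflexivity.
Qed.

Lemma Pi_G x y t phi : Bs t -> test_function phi ->
  Pi y t phi = lextR (fun u => Pi x u phi) (Gm (G x y) t).
Proof.
move=> Bt tp; rewrite (gd_rep gdB y Bt tp) -(G_spec x y (cl_formal clB Bt)) lextR_lext.
by apply: eq_lextR => u /(Gm_Bs Bt) Bu; rewrite (gd_rep gdB).
Qed.

Lemma G_xx x t : formal t -> Gm (G x x) t = bas t.
Proof.
move=> ft; apply/eqP; rewrite -subr_eq0; apply/eqP/(Gm_inj (alpha := alpha) (beta := beta) s_gt0 (Fx_one x)).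
  by apply: lspanB; [exact: Gm_formal|exact: lspan_bas].
by rewrite linearB /= lext_bas G_spec// subrr.
Qed.

Lemma snorm_eq0 x y : ~~ (0 < snorm s (x - y)) -> x = y.
Proof.
move=> h; have h0 : snorm s (x - y) <= 0 by rewrite leNgt.
apply/rowP => i; have := @snorm_coord _ _ _ s_gt0 _ _ i h0; rewrite expr0n gtn_eqF ?s_gt0//= !mxE.
by rewrite normr_le0 subr_eq0 => /eqP.
Qed.

Definition Gbound t rad := exists2 D : R, 0 <= D & forall x y u, sbox 0 rad x -> sbox 0 rad y ->
  0 < snorm s (x - y) ->
  `|mcoeff u (Gm (G x y) t)| <= D * snorm s (x - y) `^ (wt t - wt u).

(** By the formula for [comp] this coefficient is minus the sum over m of the Taylor remainders of
    K_m from x to y, tested against the Pi_x u and weighted by the coefficients of Gamma_xy t. Those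
    weights are bounded by [Gbound t], and [gamma_core] does the rest. *)
Lemma Gc_bound t k rad : 0 <= rad -> C t -> pos_J k t -> Gbound t rad ->
  exists2 D : R, 0 <= D & forall x y, sbox 0 rad x -> sbox 0 rad y -> 0 < snorm s (x - y) ->
  `|Gc x y k t| <= D * snorm s (x - y) `^ (wt t + beta - (sdeg s k)%:R).
Proof.
move=> rad0 Ct pt [D D0 hD]; have Bt := cl_C clB Ct; have ft := cl_formal clB Bt.
have [e [ue eB]] := cl_fin clB.
have [/pos_JP[w0 nXt]] := (pt, pt); set w := _ - _ in w0 *.
move=> _.
have ni x y u : mcoeff u (Gm (G x y) t) != 0 -> is_Xpow u \/ forall n : nat, wt u + beta <> n%:R.
  have : lspan [set u | is_Xpow u \/ forall n : nat, wt u + beta <> n%:R] (Gm (G x y) t).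
    by apply: Gm_span; exact: (cl_ni clB).
  by move=> h /h.
(* Powers of X drop out because K annihilates them. For the remaining trees in Gamma_xy t, [cl_ni]
   makes [om u] differ from every natural number. *)
pose ok u := ~~ `[< is_Xpow u >] && `[< forall n : nat, wt u + beta <> n%:R >].
pose rr := [seq u <- e | ok u].
pose om u := wt u + beta - (sdeg s k)%:R.
(* The Taylor order is chosen so that |j| < Nn u exactly when J_(k + j) u has positive weight
   ([posN]): the Taylor terms are those present in [Jbar]. *)
pose Nn u := if om u < 0 then 0%N else (Num.truncn (om u)).+1.
have rrB u : u \in rr -> Bs u by rewrite mem_filter => /andP[_ /eB].
have rrX u : u \in rr -> ~ is_Xpow u by rewrite mem_filter => /andP[/andP[/asboolPn]].
have rrn u : u \in rr -> forall n : nat, om u <> n%:R.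
  rewrite mem_filter => /andP[/andP[_ /asboolP h] _] n; rewrite /om => /eqP.
  by rewrite subr_eq -natrD => /eqP; exact: h.
have N1 u : u \in rr -> om u < (Nn u)%:R.
  by move=> _; rewrite /Nn; case: ifP => // _; exact: truncnS_gt.
have N2 u : u \in rr -> (0 < Nn u)%N -> (Nn u)%:R - 1 < om u.
  move=> ur; rewrite /Nn; case: ltP => // h _; have h1 : (Num.truncn (om u))%:R <= om u by rewrite truncn_le.
  rewrite -addn1 natrD addrK lt_neqAle h1 andbT.
  by apply/eqP => e1; apply: (rrn u ur (Num.truncn (om u))).
have [Cc Cc0 hc] := gamma_core s_gt0 sK supK bK N N1 N2 w0.
have [A A0 AT] : exists2 A : R, 0 <= A & forall u, u \in rr -> forall x, sbox 0 rad x -> Tb s N x 2 A (wt u) (Pi x u).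
  have : {subset rr <= Bs} by move=> u /rrB; rewrite in_setE.
  elim: rr {rrB rrX rrn N1 N2 hc} => [|u rr ih] sub; first by exists 0.
  have [A A0 hA] : exists2 A : R, 0 <= A & forall u, u \in rr -> forall x, sbox 0 rad x -> Tb s N x 2 A (wt u) (Pi x u).
    by apply: ih => v vr; apply: sub; rewrite inE vr orbT.
  have Bu : Bs u by have := sub u; rewrite inE eqxx in_setE; apply.
  have [A' A'0 hA'] := gd_bd gdB (rad + 2) Bu.
  exists (A + A'); first exact: addr_ge0.
  move=> v; rewrite inE => /predU1P[->|vr] x x0; last first.
    by apply: Tb_le (hA v vr x x0) => //; rewrite lerDl.
  apply: Tb_le (hA' x _) => //; [by rewrite lerDr|by rewrite lerDr|].
  by apply: sbox_mono x0 => //; rewrite lerDl.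
have [A2 A20 A2T] := gd_bd gdB (rad + 2) Bt.
exists (Cc * (D + 1) * (A + A2)); first nneg.
move=> x y x0 y0 r0; set rho := snorm s (x - y) in r0 *.
pose c u := mcoeff u (Gm (G x y) t).
have Tl u : Bs u -> Tlin (Pi x u) by exact: Pi_Tlin.
(* [gamma_core] asks every T u to be linear, whence the default 0 outside Bs. *)
pose T u := if `[< Bs u >] then Pi x u else fun=> 0.
have TE u : Bs u -> T u = Pi x u by rewrite /T => Bu; rewrite asboolT.
have Tlin_T u : Tlin (T u).
  by rewrite /T; case: asboolP => [/Tl//|_] ? ? ? _ _; rewrite mulr0 addr0.
have cB u : c u != 0 -> Bs u by move=> /(Gm_Bs Bt).
have c_rr u : c u != 0 -> ~ is_Xpow u -> u \in rr.
  move=> cu nX; rewrite mem_filter /ok; apply/andP; split; last exact/eB/cB.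
  apply/andP; split; first exact/asboolPn.
  by apply/asboolP; case: (ni _ _ _ cu).
have sumrr (F : expr d -> R) : (forall u, c u != 0 -> is_Xpow u -> F u = 0) ->
    lextR F (Gm (G x y) t) = \sum_(u <- rr) c u * F u.
  move=> hF; rewrite /lextR; apply: (@big_supp_eq (expr d) R (enum_fset (msupp (Gm (G x y) t))) rr (fun u => c u * F u)).
  - exact: msupp_uniq.
  - by rewrite filter_uniq.
  - by move=> u; rewrite mem_msupp negbK => /eqP h; rewrite /c h mul0r.
  - move=> u urr; have [->|cu] := eqVneq (c u) 0; first by rewrite mul0r.
    have [xu|nxu] := pselect (is_Xpow u); first by rewrite hF ?mulr0.
    by move: urr; rewrite c_rr.
have TT m : Pi y t (kk k m y) = \sum_(u <- rr) c u * T u (kk k m y).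
  rewrite (Pi_G x)//; last exact: (test_kk sK supK).
  rewrite sumrr; last by move=> u cu [p up]; rewrite up Pi_Xpow_kk// -up; exact: cB.
  by rewrite !big_seq; apply: eq_bigr => u /rrB Bu; rewrite TE.
have yx : sbox x rho y by exact: sbox_snorm.
have cD u : u \in rr -> `|c u| <= D * rho `^ (wt t - wt u) by move=> _; exact: hD.
have TbT u : u \in rr -> Tb s N x 2 (A + A2) (wt u) (T u).
  by move=> ur; rewrite (TE _ (rrB _ ur)); apply: Tb_le (AT u ur x x0) => //; rewrite lerDl.
have TbT0 : Tb s N y 2 (A + A2) (wt t) (Pi y t).
  apply: Tb_le (A2T y _) => //; [by rewrite lerDr|by rewrite lerDr|].
  by apply: sbox_mono y0 => //; rewrite lerDl.
have AA : 0 <= A + A2 by exact: addr_ge0.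
have sb := hc c T (Pi y t) x y rho D (A + A2) Tlin_T TT r0 AA D0 yx cD TbT TbT0.
have [cv bd] := series_bound (u := fun m => \sum_(u <- rr) c u * T u (kr s K (Nn u) k m x y)) sb.
have -> : Cc * (D + 1) * (A + A2) * rho `^ w = Cc * (D + 1) * (A + A2) * rho `^ (wt t + beta - (sdeg s k)%:R) by [].
apply: le_trans bd; suff E : Gc x y k t = - limn (series (fun m => \sum_(u <- rr) c u * T u (kr s K (Nn u) k m x y))).
  by rewrite E normrN lexx.
rewrite /Gc compE// -/(Gc x y) -/(G x y); apply/eqP; rewrite -subr_eq0 opprK; apply/eqP.
have posN u j : u \in rr -> (j \in midx s (Nn u)) = pos_J (k + j) u.
  move=> ur; rewrite mem_midx//; apply/idP/pos_JP.
    rewrite /Nn; case: ltP => // h jN; split; last exact: rrX.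
    rewrite sdegD natrD opprD addrA -/(om u) subr_gt0 lt_neqAle; apply/andP; split.
      by apply/eqP => e1; apply: (rrn u ur (sdeg s j)).
    apply: (@le_trans _ _ (Num.truncn (om u))%:R); last by rewrite truncn_le.
    by rewrite ler_nat -ltnS.
  move=> [h _]; move: h; rewrite sdegD natrD opprD addrA -/(om u) subr_gt0 => h.
  rewrite /Nn ifF; last by apply/negbTE; rewrite -leNgt; exact: le_trans (ltW h).
  by rewrite -(ltr_nat R); apply: lt_trans h (truncnS_gt _).
have L1 : series (fun m => \sum_(u <- rr) c u * T u (kr s K (Nn u) k m x y)) @ \oo -->
    - fc Pi y k t - \sum_(u <- rr) c u * \sum_(j <- midx s (Nn u)) ev (y - x) j * - fc Pi x (k + j) u.
  have E1 : (fun m => \sum_(u <- rr) c u * T u (kr s K (Nn u) k m x y)) =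
      fun m => Pi y t (kk k m y) - \sum_(u <- rr) c u * \sum_(j <- midx s (Nn u)) ev (y - x) j * T u (kk (k + j) m x).
    apply/funext => m; rewrite TT -sumrB; apply: eq_bigr => u _.
    by rewrite (T_kr sK supK)// mulrBr.
  rewrite E1; apply: seriesB_cvg; first exact: fc_cvg.
  apply: series_sum_cvg => u ur; apply: seriesZ_cvg; apply: series_sum_cvg => j jN; apply: seriesZ_cvg.
  rewrite (TE _ (rrB _ ur)); apply: fc_cvg; [exact: rrB|by rewrite -posN].
rewrite (cvg_lim _ L1)//.
have -> : shiftS s (nb t) (- (x - y)) (Jbar s alpha beta (fc Pi x) (Gm (G x y) t)) k =
    \sum_(u <- rr) c u * \sum_(j <- midx s (Nn u)) ev (y - x) j * fc Pi x (k + j) u.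
  rewrite opprB /shiftS /Jbar.
  transitivity (\sum_(m <- midx s (nb t)) \sum_(u <- rr) c u * (ev (y - x) m * Jc s alpha beta (fc Pi x) (k + m) u)).
    apply: eq_bigr => m _; rewrite sumrr; last first.
      by move=> u _ xu; rewrite /Jc ifF//; apply: negbTE; apply/pos_JP => -[_ /(_ xu)].
    by rewrite mulr_sumr; apply: eq_bigr => u _; ring.
  rewrite exchange_big !big_seq; apply: eq_bigr => u ur /=; rewrite -mulr_sumr.
  have [->|cu] := eqVneq (c u) 0; first by rewrite !mul0r.
  congr (_ * _); transitivity (\sum_(j <- midx s (Nn u)) ev (y - x) j * Jc s alpha beta (fc Pi x) (k + j) u).
    apply: big_supp_eq; rewrite ?midx_uniq// => m mN.
      have ut : wt u <= wt t by exact: (Gm_le s_gt0 (G_one x y) ft cu).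
      rewrite (Jc_vanish (fc Pi x) (nb_le ut)) ?mulr0// sdegD.
      by move: mN; rewrite mem_midx// -leqNgt => h; rewrite (leq_trans h)// leq_addl.
    by rewrite /Jc -posN// (negPf mN) mulr0.
  by rewrite !big_seq; apply: eq_bigr => j jN; rewrite /Jc -posN// jN.
have -> : \sum_(u <- rr) c u * (\sum_(j <- midx s (Nn u)) ev (y - x) j * - fc Pi x (k + j) u) =
    - \sum_(u <- rr) c u * \sum_(j <- midx s (Nn u)) ev (y - x) j * fc Pi x (k + j) u.
  rewrite -sumrN; apply: eq_bigr => u _; rewrite -mulrN -sumrN; congr (_ * _).
  by apply: eq_bigr => j _; rewrite mulrN.
by ring.
Qed.

(** Bounds for a character multiply along products while the weights add, and Delta preserves the
    total weight; so it is enough to bound the J-coefficients of the trees in D. The tree t itself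
    need not belong to Bs, which [extend_other] uses. *)
Lemma Gm_bound_step t (D : set (expr d)) rad : 0 <= rad -> D `<=` C ->
  lspan [set p | Alg D p.2] (Delta t) -> (forall u, D u -> Gbound u rad) -> Gbound t rad.
Proof.
move=> rad0 DC Bt IH.
pose P t' A := forall x y, sbox 0 rad x -> sbox 0 rad y -> 0 < snorm s (x - y) ->
  `|G x y t'| <= A * snorm s (x - y) `^ wt t'.
have hP t' : Alg D t' -> exists2 A : R, 0 <= A & P t' A.
  move: t'; apply: alg_ind.
  - by exists 1 => // x y _ _ _; rewrite G_one wt_one powRr0 normr1 mulr1.
  - move=> i; exists 1 => // x y _ _ r0; rewrite /G charE_X wt_X mul1r powR_mulrn ?snorm_ge0//.
    exact: (@snorm_coord _ _ _ s_gt0 _ _ i (lexx _)).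
  - move=> u v _ _ [A A0 hA] [A' A'0 hA']; exists (A * A'); first exact: mulr_ge0.
    move=> x y x0 y0 r0; rewrite /G charE_emul wt_emul normrM powRD; last by apply/implyP => _; rewrite gt_eqF.
    rewrite mulrACA; apply: ler_pM => //; [exact: hA|exact: hA'].
  - move=> k u Du pu; have [A A0 hA] := Gc_bound rad0 (DC u Du) pu (IH u Du).
    by exists A => // x y x0 y0 r0; rewrite /G charE_II wt_II; exact: hA.
pose Q (v : expr d * expr d) B := mcoeff v (Delta t) != 0 -> P v.2 B.
have [v|v B B' BB' h cp x y x0 y0 r0|A A0 hA] := @cst_sum R _ (enum_fset (msupp (Delta t))) Q.
- have [cp|cp] := boolP (mcoeff v (Delta t) != 0); last by exists 0; rewrite // /Q (negPf cp).
  have /hP[B B0 hB] := Bt _ cp; by exists B.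
- apply: (le_trans (h cp x y x0 y0 r0)).
  by rewrite ler_wpM2r// powR_ge0.
have wp (p : expr d * expr d) : mcoeff p (Delta t) != 0 -> wt p.1 + wt p.2 = wt t by exact: cop_weight.
exists (\sum_(p <- enum_fset (msupp (Delta t))) `|mcoeff p (Delta t)| * A); first by apply: sumr_ge0 => p _; apply: mulr_ge0.
move=> x y u x0 y0 r0; set rho := snorm s (x - y) in r0 *.
rewrite mcoeff_Gm /lextR (le_trans (ler_norm_sum _ _ _))// mulr_suml.
rewrite !big_seq; apply: ler_sum => p pe; have cp : mcoeff p (Delta t) != 0 by rewrite -mem_msupp.
rewrite normrM -mulrA ler_wpM2l// normrM.
have [<-|_] := eqVneq p.1 u; last by rewrite normr0 mulr0; apply: mulr_ge0; rewrite ?powR_ge0.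
rewrite normr1 mulr1 (_ : wt t - wt p.1 = wt p.2); last by rewrite -(wp p cp) addrC addKr.
exact: (hA p pe cp).
Qed.

Lemma Gm_bound t rad : 0 <= rad -> Bs t -> Gbound t rad.
Proof.
move=> rad0; move: t; apply: (weight_ind (cl_fin clB)) => t Bt IH.
apply: (@Gm_bound_step t [set u | C u /\ wt u < wt t]) => // [u []//|p /(cl_cop clB Bt)[]//|u [Cu ut]].
exact: IH (cl_C clB Cu) ut.
Qed.

End Consequences.

End GoodModels.

(** * From the base-point free form to admissible models *)

Section GoodIsAdmissible.
Context {R : realType} {d : nat} (s : 'I_d -> nat) (alpha beta r : R).
Hypothesis s_gt0 : forall i, (0 < s i)%N.
Context (K : nat -> 'rV[R]_d -> R) (N : nat).
Local Notation V := 'rV[R]_d.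
Local Notation test := (V -> R).
Implicit Types (t u : expr d) (k l q p : mindex d) (x y z : V) (phi psi : test).
Local Notation wt := (weight s alpha beta).
Local Notation Delta := (coproduct s alpha beta).
Local Notation Alg := (Alg s alpha beta).
Local Notation pos_J := (pos_J s alpha beta).
Local Notation nb := (nb s alpha beta).
Local Notation Gm := (Gm s alpha beta).
Local Notation comp := (comp s alpha beta).
Local Notation Jc := (Jc s alpha beta).
Local Notation H := (Hsp R d).
Local Notation sbox := (@sbox R d s).
Local Notation kk := (kk K).
Local Notation fc := (fc K).
Local Notation Fx := (Fx K).
Local Notation G := (G s alpha beta K).
Local Notation good := (good s alpha beta K N).
Local Notation closed := (closed s alpha beta r).
Local Notation S := (stot s).
Hypothesis sK : forall m, smooth (K m).
Hypothesis supK : forall m, supported_in (sbox 0 (lam m)) (K m).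
Hypothesis bK : forall k : mindex d, exists C : R, forall m x,
  `|Dpart k (K m) x| <= C * 2 `^ ((S%:R - beta + (sdeg s k)%:R) * m%:R).
Hypothesis annK : forall m x (q : seq (R * mindex d)),
  (forall w, w \in q -> (sdeg s w.2)%:R <= r) ->
  integral_rV (fun y => K m (x - y) * \sum_(w <- q) w.1 * monomial w.2 y) = 0.

Lemma Tb_weaken x rad (A a a' : R) T : 0 <= A -> a' <= a -> Tb s N x rad A a T ->
  exists2 A' : R, 0 <= A' & Tb s N x rad A' a' T.
Proof.
move=> A0 aa h; exists (A * `|rad| `^ (a - a')); first exact: mulr_ge0 (powR_ge0 _ _).
move=> dl b phi d0 dr L; apply: (le_trans (h _ _ _ d0 dr L)).
have b0 := loc_ge0 d0 L.
have -> : A * b * dl `^ a = A * b * (dl `^ (a - a') * dl `^ a') by rewrite -pwD// subrK.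
have -> : A * `|rad| `^ (a - a') * b * dl `^ a' = A * b * (`|rad| `^ (a - a') * dl `^ a') by ring.
apply: ler_wpM2l; first exact: mulr_ge0.
apply: ler_wpM2r; first exact: powR_ge0.
by apply: ge0_ler_powR; rewrite ?nnegrE ?subr_ge0 ?normr_ge0 ?(ltW d0)// (le_trans dr)// ler_norm.
Qed.

Lemma all_Tb_lext x a (I : choiceType) (T : I -> test -> R) (c : malg I R) :
  (forall i, mcoeff i c != 0 -> all_Tb s N x a (T i)) -> all_Tb s N x a (fun phi => lextR (T^~ phi) c).
Proof.
move=> hT rad.
have [|i B B' BB' h ci dl b phi d0 dr L|A A0 hA] :=
  @cst_sum R _ (enum_fset (msupp c)) (fun i A => mcoeff i c != 0 -> Tb s N x rad A a (T i)).
- move=> i; have [ci|ci] := boolP (mcoeff i c != 0); last by exists 0.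
  have [A hA] := hT i ci rad; exists `|A|; first exact: normr_ge0.
  by move=> _; apply: Tb_le hA => //; exact: ler_norm.
- apply: (le_trans (h ci _ _ _ d0 dr L)); rewrite ler_wpM2r ?powR_ge0// ler_wpM2r//.
  exact: loc_ge0 d0 L.
exists (\sum_(i <- enum_fset (msupp c)) `|mcoeff i c| * A) => dl b phi d0 dr L.
rewrite /lextR (le_trans (ler_norm_sum _ _ _))// !mulr_suml !big_seq; apply: ler_sum => i ic.
have ci : mcoeff i c != 0 by rewrite -mem_msupp.
by rewrite normrM -!mulrA ler_wpM2l// mulrA; exact: hA.
Qed.

Lemma Tb_ext x rad A a T T' : (forall phi, test_function phi -> T phi = T' phi) ->
  Tb s N x rad A a T -> Tb s N x rad A a T'.
Proof. by move=> e h dl b phi d0 dr L; rewrite -e; [exact: h|exact: loc_test L]. Qed.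

Lemma Tlin_lext (I : choiceType) (T : I -> test -> R) (c : malg I R) :
  (forall i, mcoeff i c != 0 -> Tlin (T i)) -> Tlin (fun phi => lextR (T^~ phi) c).
Proof.
move=> h b phi psi tp tq; transitivity (lextR (fun i => b * T i phi + T i psi) c).
  by apply: eq_lextR => i /h; exact.
by rewrite lextRE (lext_linear (V := R^o)).
Qed.

(* No cancellation: the first component X^l occurs in Delta (I_k t) only
   through the Taylor terms. *)
Lemma mcoeff_cop_II k l t : pos_J (k + l) t ->
  mcoeff (Xpow l, II (k + l) t) (Delta (II k t)) = (mfact l)%:R^-1.
Proof.
move=> pt; rewrite (cop_II s_gt0 k (leqnn _)) mcoeffD mcoeff_lext [X in X + _]big1 ?add0r; last first.
  move=> v _; rewrite /Iop; case: ifP => _; first by rewrite tens0l mcoeff0 mulr0.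
  rewrite tens_bas mcoeff_bas; case: eqVneq => [[e _]|_]; last by rewrite mulr0.
  by case: (@II_notXpow _ k v.1); rewrite e; exists l.
rewrite raddf_sum /= -[RHS](_ : \sum_(l' <- midx s (nb t)) (l' == l)%:R * (mfact l)%:R^-1 = _); last first.
  have ln : l \in midx s (nb t).
    rewrite mem_midx//; apply: leq_ltn_trans (pos_J_nb pt); rewrite sdegD; exact: leq_addl.
  rewrite (bigD1_seq l)//= ?eqxx ?mul1r ?midx_uniq// big1 ?addr0// => l' /negPf->.
  by rewrite mul0r.
apply: eq_bigr => l' _; rewrite raddf_sum /=.
have E m : mcoeff (Xpow l, II (k + l) t) (tens (Ex l') (Ex m * Jop s alpha beta (k + l' + m) t)) =
    ((l' == l) && (m == 0))%:R * (mfact l)%:R^-1 :> R.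
  rewrite Jop_if; case: ifP => [pm|npm]; last first.
    rewrite mulr0 tens0r mcoeff0; case: andP => [[/eqP e1 /eqP e2]|]; last by rewrite mul0r.
    by move: npm; rewrite e1 e2 addr0 pt.
  rewrite /Ex -scalerAl bas_mul tensZ tens_bas mcoeffZ mcoeff_bas.
  have [/andP[/eqP-> /eqP->]|ne] := boolP ((l' == l) && (m == 0)).
    rewrite addr0 Xpow0 mul1m eqxx mulr1 mul1r.
    suff -> : mfact (0 : mindex d) = 1%N by rewrite invr1 mulr1.
    by rewrite /mfact big1// => i _; rewrite midx0 fact0.
  rewrite mul0r; case: eqP => [[e1 e2]|]; last by rewrite mulr0.
  case/negP: ne.
  have f1 : fac (k + l' + m) t (II (k + l) t) by rewrite -e2; apply/fac_emul; right; apply/fac_II.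
  have [e3 _] := (fac_II _ _ _ _).1 f1.
  have [w w1 w2] : exists2 w, w = Xpow m :> expr d & sdeg s m = 0%N.
    exists (Xpow m) => //; have := congr1 wt e2.
    rewrite wt_emul !wt_II wt_Xpow e3 => /eqP; rewrite -subr_eq0 addrK => /eqP.
    by move/eqP; rewrite pnatr_eq0 => /eqP.
  have m0 : m = 0.
    apply/ffunP => i; rewrite midx0; apply/eqP; move/eqP: w2; rewrite /sdeg sum_nat_eq0 => /forallP/(_ i).
    by rewrite implyTb muln_eq0 gtn_eqF ?s_gt0.
  rewrite m0 eqxx andbT; apply/eqP/ffunP => i; have := congr1 (fun f : mindex d => f i) e3.
  by rewrite m0 addr0 !midxD => /addnI.
have [ll|ll] := eqVneq l' l; last first.
  by rewrite mul0r big1// => m _; rewrite E (negPf ll) mul0r.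
rewrite mul1r (eq_bigr (fun m : mindex d => (m == 0)%:R * (mfact l)%:R^-1)); last by move=> m _; rewrite E ll eqxx.
rewrite (bigD1_seq 0)//= ?eqxx ?mul1r ?midx_uniq//; last first.
  by rewrite mem_midx// /sdeg big1// => i _; rewrite midx0 muln0.
by rewrite big1 ?addr0// => m /negPf->; rewrite mul0r.
Qed.

Section Fixed.
Context (Bs C : set (expr d)).
Hypothesis clB : closed Bs C.

(** By [mcoeff_cop_II] the pair formed by X^l and J_(k + l) t does occur in Delta (I_k t), and
    closedness applies to it. *)
Lemma cl_II k l t : Bs (II k t) -> pos_J (k + l) t -> C t /\ Bs (Xpow l).
Proof.
move=> Bt pt; have : mcoeff (Xpow l, II (k + l) t) (Delta (II k t)) != 0 :> R.
  by rewrite mcoeff_cop_II// invr_eq0 pnatr_eq0 -lt0n /mfact prodn_gt0// => i; exact: fact_gt0.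
by move=> /(cl_cop clB Bt)[B1 /Alg_II[[]]].
Qed.

(** In the image of I_k t, the tree I_k u comes from u alone, so its coefficient is that of u in the
    image of t. *)
Lemma Gm_II_Bs v c k t u : Bs (II k t) -> mcoeff u (Gm (charE v c) t) != 0 -> ~ is_Xpow u -> Bs (II k u).
Proof.
move=> Bt cu nu; suff : mcoeff (II k u) (Gm (charE v c) (II k t)) != 0 by move/(Gm_Bs clB Bt).
rewrite (Gm_II s_gt0 v c k (leqnn _)) mcoeffD [X in _ + X]raddf_sum [X in _ + X]big1 ?addr0 /=; last first.
  move=> l _; rewrite /Ex !mcoeffZ mcoeff_bas; case: eqP => [e|]; last by rewrite !mulr0.
  by case: (@II_notXpow _ k u); rewrite -e; exists l.
rewrite mcoeff_lext /lextR (bigD1_seq u) ?msupp_uniq ?mem_msupp//= big1 ?addr0; last first.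
  move=> w wu; rewrite /Iop; case: ifP => _; first by rewrite mcoeff0 mulr0.
  rewrite mcoeff_bas; case: eqP => [/II_inj[_ e]|]; last by rewrite mulr0.
  by rewrite e eqxx in wu.
by rewrite /Iop asboolF// mcoeff_bas eqxx mulr1.
Qed.

End Fixed.

Section Fixed2.
Context (Bs C : set (expr d)).
Hypothesis clB : closed Bs C.

Section WithPi.
Context (Pi : V -> expr d -> test -> R) (bP : expr d -> test -> R).
Hypothesis gdB : good Pi bP Bs.

(** The character of F_x^-1: [comp] with target coefficients 0 and total translation -x + x = 0,
    which is the identity by [Gm_id]. *)
Definition Finv x : expr d -> R := charE x (comp x (fc Pi x) (fun _ _ => 0)).

Lemma Finv_spec x t : formal t -> lext (Gm (Fx Pi x)) (Gm (Finv x) t) = bas t.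
Proof.
move=> ft; rewrite /Finv /Fx (comp_spec _ _ s_gt0 _ _ _ _ ft) addNr.
exact: Gm_id.
Qed.

Lemma bPE x t phi : Bs t -> test_function phi ->
  bP t phi = lextR (fun u => Pi x u phi) (Gm (Finv x) t).
Proof.
move=> Bt tp; rewrite -[LHS](lextR_bas (fun u => bP u phi)) -(Finv_spec x (cl_formal clB Bt)) lextR_lext.
by apply: eq_lextR => u /(Gm_Bs clB Bt) Bu; rewrite (gd_rep gdB).
Qed.

Lemma Pi_all_Tb x t : Bs t -> all_Tb s N x (wt t) (Pi x t).
Proof.
move=> Bt rad; have [r0 r00 r0x] := in_sbox0 s_gt0 x.
have [A A0 AT] := gd_bd gdB (Num.max r0 rad) Bt.
exists A; apply: Tb_le (AT x _) => //; first by rewrite le_max lexx orbT.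
by apply: sbox_mono r0x; [exact: ltW|rewrite le_max lexx].
Qed.

(** By [bPE], bP t is a combination of functionals Pi_x u with u in Bs, at any x; the least weight
    in Bs is an order valid for all of them. *)
Lemma bP_all_Tb : exists a, forall t x, Bs t -> all_Tb s N x a (bP t).
Proof.
have [e [_ eB]] := cl_fin clB; have [a ha] : exists a, forall t, t \in e -> a <= wt t.
  elim: e {eB} => [|t e [a ha]]; first by exists 0.
  exists (Num.min a (wt t)) => u; rewrite inE => /predU1P[->|/ha h]; first by rewrite ge_min lexx orbT.
  by rewrite ge_min h.
exists a => t x Bt rad.
have [u cu rad'|A hA] := @all_Tb_lext x a _ (fun u => Pi x u) (Gm (Finv x) t) _ rad.
  have Bu := Gm_Bs clB Bt cu; have [A hA] := Pi_all_Tb x Bu rad'.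
  have hA' : Tb s N x rad' `|A| (wt u) (Pi x u) by apply: Tb_le hA => //; exact: ler_norm.
  have au : a <= wt u by apply: ha; apply/eB.
  by have [A' _ h] := Tb_weaken (normr_ge0 A) au hA'; exists A'; exact: h.
by exists A; apply: Tb_ext hA => phi tp; rewrite -bPE.
Qed.

Lemma bP_cpt t k m phi : Bs t -> test_function phi -> cpt (fun y => phi y * bP t (kk k m y)).
Proof.
move=> Bt tp; have [a ha] := bP_all_Tb; have [r0 [b [r00 L]]] := test_loc s_gt0 N tp.
exact: (Vk_cpt s_gt0 sK supK _ _ (gd_lin gdB Bt) (ha t 0 Bt) r00 L).
Qed.

(* The larger set Bs' and its functionals bP' allow for a tree I_k(t) on which
   Pi is not yet defined. *)
Lemma good_ser_ext (Bs' C' : set (expr d)) (bP' : expr d -> test -> R) x k t phi :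
  closed Bs' C' -> Bs t -> Bs' (II k t) -> test_function phi ->
  (forall p, Bs' (Xpow p) -> bP' (Xpow p) phi = integral_rV (fun y => monomial p y * phi y)) ->
  (forall u, Bs u -> Bs' (II k u) ->
    series (fun n => integral_rV (fun y => phi y * bP u (kk k n y))) @ \oo --> bP' (II k u) phi) ->
  series (fun n => integral_rV (fun y => phi y * Pi x t (kk k n y))) @ \oo -->
  lextR (fun u => bP' u phi) (Gm (Fx Pi x) (II k t)) -
    \sum_(l <- midx s (nb t)) Jc (fc Pi x) (k + l) t * moment x l phi.
Proof.
move=> clB' Bt BIt tp pol' ser'; pose c u := mcoeff u (Gm (Fx Pi x) t).
pose e := [seq u <- enum_fset (msupp (Gm (Fx Pi x) t)) | ~~ `[< is_Xpow u >]].
have eP u : u \in e -> [/\ c u != 0, Bs u & ~ is_Xpow u].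
  by rewrite mem_filter mem_msupp => /andP[/asboolPn nu cu]; split => //; exact: (Gm_Bs clB Bt cu).
have lE (F : expr d -> R) : (forall u, Bs u -> is_Xpow u -> F u = 0) ->
    lextR F (Gm (Fx Pi x) t) = \sum_(u <- e) c u * F u.
  move=> hF; rewrite /lextR [RHS]big_filter [RHS]big_mkcond !big_seq; apply: eq_bigr => u ur /=.
  case: asboolP => //= xu; rewrite hF ?mulr0//; rewrite mem_msupp in ur; exact: (Gm_Bs clB Bt ur).
have -> : (fun n => integral_rV (fun y => phi y * Pi x t (kk k n y))) =
    fun n => \sum_(u <- e) c u * integral_rV (fun y => phi y * bP u (kk k n y)).
  apply/funext => n; transitivity (integral_rV (fun y => \sum_(u <- e) c u * (phi y * bP u (kk k n y)))).
    congr integral_rV; apply/funext => y; rewrite (gd_rep gdB x Bt (test_kk sK supK k n y)) lE.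
      by rewrite mulr_sumr; apply: eq_bigr => u _; ring.
    by move=> u Bu [p up]; rewrite up (bP_Xpow_kk sK supK annK clB gdB)// -up.
  have h (e' : seq (expr d)) : {subset e' <= e} ->
      cpt (fun y => \sum_(u <- e') c u * (phi y * bP u (kk k n y))) /\
      integral_rV (fun y => \sum_(u <- e') c u * (phi y * bP u (kk k n y))) =
      \sum_(u <- e') c u * integral_rV (fun y => phi y * bP u (kk k n y)).
    elim: e' => [|u e' ih] sub.
      have -> : (fun y => \sum_(u <- [::]) c u * (phi y * bP u (kk k n y))) = fun=> 0.
        by apply/funext => y; rewrite big_nil.
      by rewrite big_nil integral0; split => //; exact: cpt0.
    have [v ve|c1 e1] := ih; first by apply: sub; rewrite inE ve orbT.
    have [_ Bu _] : [/\ c u != 0, Bs u & ~ is_Xpow u] by apply: eP; apply: sub; rewrite inE eqxx.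
    have c2 := bP_cpt k n Bu tp.
    have -> : (fun y => \sum_(u0 <- u :: e') c u0 * (phi y * bP u0 (kk k n y))) =
      fun y => c u * (phi y * bP u (kk k n y)) + \sum_(u <- e') c u * (phi y * bP u (kk k n y)).
      by apply/funext => y; rewrite big_cons.
    by rewrite big_cons integral_lin// e1; split => //; exact: cpt_lin.
  exact: (h e (fun _ => id)).2.
rewrite (_ : lextR _ _ - _ = \sum_(u <- e) c u * bP' (II k u) phi); last first.
  rewrite (Gm_II s_gt0 _ _ _ (leqnn _)) -/(Fx Pi x) lextRD lextR_lext.
  rewrite (lE (fun u => lextR (fun v => bP' v phi) (Iop k u))); last first.
    by move=> u _ xu; rewrite /Iop asboolT// lextR0.
  rewrite [X in _ + lextR _ X - _](eq_bigr (fun l => shiftS s (nb t) (- x) (fun m => Jc (fc Pi x) (k + m) t) l *: Ex l)); last first.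
    by move=> l _; congr (_ *: _); apply: eq_bigr => m _; rewrite addrA.
  rewrite -(Gm_Ex alpha beta s_gt0 (- x) (fc Pi x) (vanish_add k (Jc_vanish (fc Pi x) (leqnn (nb t))))).
  rewrite lextR_lext lextR_sum [X in _ + X - _](_ : _ = \sum_(l <- midx s (nb t)) Jc (fc Pi x) (k + l) t * moment x l phi).
    rewrite addrK !big_seq; apply: eq_bigr => u /eP[_ _ nu].
    by rewrite /Iop asboolF// lextR_bas.
  apply: eq_bigr => l _; rewrite lextRZ /Ex lextRZ lextR_bas.
  rewrite {1 2}/Jc; case: ifP => [pl|]; last by rewrite !mul0r.
  have [_ Bl] := cl_II clB' BIt pl; congr (_ * _).
  rewrite (bP_shift s_gt0 pol' (Gm_Bs clB' Bl) tp).
  rewrite /moment -integralZ.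
    by congr integral_rV; apply/funext => y; rewrite mulrA.
  have [r0 [b [r00 L]]] := test_loc s_gt0 0 tp.
  have h := moment_cpt x l r00 L.
  have -> : (fun y => monomial l (y - x) * phi y) = fun y => (mfact l)%:R * ((mfact l)%:R^-1 * monomial l (y - x) * phi y).
    apply/funext => y; rewrite !mulrA mulfV ?mul1r// pnatr_eq0 -lt0n /mfact prodn_gt0// => i; exact: fact_gt0.
  exact: cptZ.
apply: series_sum_cvg => u /eP[cu Bu nu]; apply: seriesZ_cvg.
by apply: ser' => //; exact: (Gm_II_Bs clB' BIt cu nu).
Qed.

Lemma good_ser x k t phi : Bs t -> Bs (II k t) -> test_function phi ->
  series (fun n => integral_rV (fun y => phi y * Pi x t (kk k n y))) @ \oo -->
  Pi x (II k t) phi - \sum_(l <- midx s (nb t)) Jc (fc Pi x) (k + l) t * moment x l phi.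
Proof.
move=> Bt BIt tp; rewrite (gd_rep gdB x BIt tp).
exact: (good_ser_ext clB Bt BIt tp (fun p Bp => gd_pol gdB Bp tp) (fun u Bu BIu => gd_ser gdB Bu BIu tp)).
Qed.

Variables (P : set (expr d)) (f : V -> expr d -> R).
Hypothesis multP : forall x, multiplicative_on P (f x).
Hypothesis algP : Alg C `<=` P.
Hypothesis fX : forall x i, f x (Xvar i) = - x ord0 i.
Hypothesis fII : forall x k t, C t -> pos_J k t -> f x (II k t) = fc Pi x k t.

Lemma f_charE x t : Alg C t -> f x t = Fx Pi x t.
Proof.
move=> At; rewrite (mult_char (s := s) (alpha := alpha) (beta := beta) algP (multP x) At).
rewrite (_ : \row_i _ = - x); last by apply/rowP => i; rewrite !mxE fX.
by apply: (eq_charE (s := s) (alpha := alpha) (beta := beta) (C := C)) At => k u; exact: fII.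
Qed.

Lemma cop_C t : Bs t -> lspan (Bs `*` Alg C) (Delta t).
Proof.
by move=> /(cl_cop clB); apply: lspanS => u [B1 A2]; split => //; apply: AlgS A2 => v [].
Qed.

Lemma Gm_f x t : Bs t -> Gm (f x) t = Gm (Fx Pi x) t.
Proof. by move=> Bt; apply: eq_Gm (cop_C Bt) _ => u /f_charE. Qed.

Lemma lspan_formal (a : H) : lspan Bs a -> lspan formal a.
Proof. by apply: lspanS => u; exact: cl_formal clB u. Qed.

Lemma lspan_Gm (g : expr d -> R) (a : H) : lspan Bs a -> lspan Bs (lext (Gm g) a).
Proof. by move=> ha; apply: lspan_lext => u cu; exact: (@Gm_Bs _ _ _ _ _ _ _ _ clB g u (ha u cu)). Qed.

Lemma Gamma_of_f x (a : H) : lspan Bs a -> Gamma_of s alpha beta (f x) a = lext (Gm (Fx Pi x)) a.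
Proof. by move=> ha; rewrite Gamma_ofE; apply: eq_lext => u /ha; exact: Gm_f. Qed.

Lemma lext_Gm2 (g g' h : expr d -> R) (a : H) : lspan Bs a ->
  (forall u, Bs u -> lext (Gm g) (Gm g' u) = Gm h u) -> lext (Gm g) (lext (Gm g') a) = lext (Gm h) a.
Proof.
move=> ha e; transitivity (lext (fun u => lext (Gm g) (Gm g' u)) a); first exact: lext_lext.
by apply: eq_lext => u cu; exact: e (ha _ cu).
Qed.

Lemma G_lext x y (a : H) : lspan Bs a ->
  lext (Gm (Fx Pi x)) (lext (Gm (G Pi x y)) a) = lext (Gm (Fx Pi y)) a.
Proof.
by move=> ha; apply: lext_Gm2 ha _ => u Bu; exact: (@G_spec _ _ s alpha beta s_gt0 K Pi x y u (cl_formal clB Bu)).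
Qed.

(** F_x is unitriangular, hence injective on the span of Bs, so its partial inverse is evaluated by
    exhibiting a preimage of F_y a. *)
Lemma Gamma_fromE x y (a : H) : lspan Bs a ->
  Gamma_from s alpha beta Bs f x y a = lext (Gm (G Pi x y)) a.
Proof.
move=> ha; rewrite /Gamma_from /=.
have -> : Gamma_of s alpha beta (f y) a = Gamma_of s alpha beta (f x) (lext (Gm (G Pi x y)) a).
  apply: (etrans (Gamma_of_f y ha)); symmetry.
  exact: (etrans (Gamma_of_f x (@lspan_Gm (G Pi x y) a ha)) (G_lext x y ha)).
have inj : {in lspan Bs &, injective (Gamma_of s alpha beta (f x))}.
  move=> b c; rewrite !in_setE => hb hc; rewrite (Gamma_of_f x hb) (Gamma_of_f x hc) => e.
  apply/eqP; rewrite -subr_eq0; apply/eqP; apply: (Gm_inj (alpha := alpha) (beta := beta) s_gt0 (Fx_one K Pi x)).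
    by apply: lspan_formal; exact: lspanB.
  by rewrite linearB /= e subrr.
by rewrite pinvKV// in_setE; exact: lspan_Gm.
Qed.

Lemma G_comp x y z (a : H) : lspan Bs a ->
  lext (Gm (G Pi x y)) (lext (Gm (G Pi y z)) a) = lext (Gm (G Pi x z)) a.
Proof.
move=> ha; apply/eqP; rewrite -subr_eq0; apply/eqP; apply: (Gm_inj (alpha := alpha) (beta := beta) s_gt0 (Fx_one K Pi x)).
  by apply: lspan_formal; apply: lspanB; apply: lspan_Gm => //; exact: lspan_Gm.
have e := etrans (G_lext x y (@lspan_Gm (G Pi y z) a ha)) (G_lext y z ha).
apply: (etrans (linearB (lext (Gm (Fx Pi x))) _ _)); apply/eqP; rewrite subr_eq0; apply/eqP.
exact: (etrans e (esym (G_lext x z ha))).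
Qed.

Lemma unif_bounds rad : 0 <= rad -> exists2 A : R, 0 <= A & forall t, Bs t ->
  (forall x, sbox 0 rad x -> Tb s N x rad A (wt t) (Pi x t)) /\
  (forall x y u, sbox 0 rad x -> sbox 0 rad y -> 0 < snorm s (x - y) ->
    `|mcoeff u (Gm (G Pi x y) t)| <= A * snorm s (x - y) `^ (wt t - wt u)).
Proof.
move=> rad0; have [e [_ eB]] := cl_fin clB.
pose Q t A := Bs t ->
  (forall x, sbox 0 rad x -> Tb s N x rad A (wt t) (Pi x t)) /\
  (forall x y u, sbox 0 rad x -> sbox 0 rad y -> 0 < snorm s (x - y) ->
    `|mcoeff u (Gm (G Pi x y) t)| <= A * snorm s (x - y) `^ (wt t - wt u)).
have [t|t A A' AA h Bt|A A0 hA] := @cst_sum R _ e Q.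
- have [Bt|nB] := pselect (Bs t); last by exists 0.
  have [A A0 hA] := gd_bd gdB rad Bt.
  have [D D0 hD] := Gm_bound s_gt0 sK supK bK annK clB gdB rad0 Bt.
  exists (A + D) => [|_]; first exact: addr_ge0.
  split=> [x x0|x y u x0 y0 r0]; first by apply: Tb_le (hA x x0) => //; rewrite lerDl.
  by apply: (le_trans (hD x y u x0 y0 r0)); rewrite ler_wpM2r ?powR_ge0// lerDr.
- have [h1 h2] := h Bt; split=> [x x0|x y u x0 y0 r0]; first by apply: Tb_le (h1 x x0).
  by apply: (le_trans (h2 x y u x0 y0 r0)); rewrite ler_wpM2r ?powR_ge0.
by exists A => // t Bt; apply: hA => //; apply/eB.
Qed.

Lemma hnorm_homogeneous (l : R) (a : H) : homogeneous s alpha beta l a ->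
  hnorm s alpha beta l a = \sum_(t <- enum_fset (msupp a)) `|mcoeff t a|.
Proof.
move=> ha; rewrite /hnorm big_mkcond !big_seq; apply: eq_bigr => t.
by rewrite mem_msupp => /ha->; rewrite eqxx.
Qed.

Lemma good_model T : is_test_order s alpha beta T N ->
  is_model s alpha beta T Bs P Pi (Gamma_from s alpha beta Bs f).
Proof.
move=> TN; split.
- move=> x t Bt; exact: distribution_of_Tb (Pi_Tlin clB gdB x Bt) (Pi_all_Tb x Bt).
- move=> x y; exists (G Pi x y); first exact: char_mult.
  by move=> a ha; rewrite Gamma_fromE// Gamma_ofE.
- split=> [x a ha|x y z a ha].
    rewrite Gamma_fromE// -[RHS]lext_id; apply: eq_lext => u /ha Bu.
    by rewrite (G_xx alpha beta s_gt0)//; exact: cl_formal clB _ Bu.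
  rewrite (Gamma_fromE y z ha) (Gamma_fromE x z ha) (Gamma_fromE x y (@lspan_Gm _ a ha)).
  exact: G_comp.
- move=> x y a phi ha tp; rewrite /Pi_lin (Gamma_fromE x y ha) lextR_lext; apply: eq_lextR => u /ha Bu.
  exact: (Pi_G s_gt0 clB gdB).
exists N => // gamma A gamma0 cA.
have [rad rad1 Arad] := compact_sbox s_gt0 cA.
have rad0 : 0 <= rad by apply: le_trans rad1.
have [D D0 hD] := unif_bounds rad0.
have [e [ue eB]] := cl_fin clB.
exists (D + (size e)%:R * D) => x y l a Ax Ay _ ha la.
have x0 := Arad _ Ax; have y0 := Arad _ Ay.
rewrite (hnorm_homogeneous la).
have na0 : 0 <= \sum_(t <- enum_fset (msupp a)) `|mcoeff t a| by exact: sumr_ge0.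
split=> [dl phi d0 d1 up|m ml].
  apply: (@le_trans _ _ (\sum_(t <- enum_fset (msupp a)) `|mcoeff t a| * (D * dl `^ l))).
    rewrite /Pi_lin /lextR (le_trans (ler_norm_sum _ _ _))// !big_seq; apply: ler_sum => t.
    rewrite mem_msupp => ca; rewrite normrM ler_wpM2l// -(la t ca).
    have := (hD t (ha t ca)).1 x x0 dl 1 _ d0 (le_trans d1 rad1) (loc_rescale s_gt0 x d0 up).
    by rewrite mulr1.
  rewrite -mulr_suml mulrA [X in X * _]mulrC ler_wpM2r ?powR_ge0// ler_wpM2r// lerDl.
  exact: mulr_ge0.
rewrite (Gamma_fromE x y ha); set rho := snorm s (x - y).
(* For x = y the operator is the identity, and an element homogeneous of degree l has no component
   of degree m < l. *)
have [r0|r0] := boolP (0 < rho); last first.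
  rewrite (snorm_eq0 s_gt0 r0) (_ : lext _ a = a); last first.
    rewrite -[RHS]lext_id; apply: eq_lext => u /ha Bu.
    by rewrite (G_xx alpha beta s_gt0)//; exact: cl_formal clB _ Bu.
  rewrite /hnorm big_mkcond big_seq big1; last first.
    move=> t; rewrite mem_msupp => /la ->; rewrite ifF//; apply/negbTE.
    by rewrite gt_eqF.
  by apply: mulr_ge0; rewrite ?powR_ge0 ?mulr_ge0 ?addr_ge0 ?mulr_ge0.
rewrite /hnorm; set b := lext _ a.
have hb : lspan Bs b by exact: lspan_Gm.
have -> : \sum_(t <- enum_fset (msupp b) | wt t == m) `|mcoeff t b| = \sum_(t <- e | wt t == m) `|mcoeff t b|.
  rewrite big_mkcond [RHS]big_mkcond; apply: big_supp_eq; rewrite ?msupp_uniq// => t.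
    by rewrite mem_msupp negbK => /eqP->; rewrite normr0; case: ifP.
  move=> te; have [->|cb] := eqVneq (mcoeff t b) 0; first by rewrite normr0; case: ifP.
  by case/negP: te; apply/eB; exact: hb.
apply: (@le_trans _ _ (\sum_(t <- e) \sum_(u <- enum_fset (msupp a)) `|mcoeff u a| * (D * rho `^ (l - m)))).
  rewrite big_mkcond; apply: ler_sum => t _; case: eqP => [tm|_]; last first.
    by apply: sumr_ge0 => u _; rewrite !mulr_ge0 ?powR_ge0.
  rewrite /b mcoeff_lext /lextR (le_trans (ler_norm_sum _ _ _))// !big_seq; apply: ler_sum => u.
  rewrite mem_msupp => ca; rewrite normrM ler_wpM2l// -(la u ca) -tm.
  exact: (hD u (ha u ca)).2.
rewrite big_const_seq count_predT iter_addr_0 -mulr_suml.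
set Q := \sum_(_ <- _) _ in na0 *.
have -> : Q * (D * rho `^ (l - m)) *+ size e = (size e)%:R * D * Q * rho `^ (l - m) by rewrite -[_ *+ size e]mulr_natl; ring.
by rewrite ler_wpM2r ?powR_ge0// ler_wpM2r// lerDr.
Qed.

Lemma good_admissible T : is_test_order s alpha beta T N ->
  (forall x k t, Bs t -> P (II k t) -> pos_J k t /\ f x (II k t) = fc Pi x k t) ->
  admissible_with s alpha beta T Bs P K Pi (Gamma_from s alpha beta Bs f) f.
Proof.
move=> TN hP; split; first exact: good_model.
- by split.
- split=> // x k t Bt PI; have [pt ->] := hP x k t Bt PI.
  exact: (fc_cvg s_gt0 sK supK bK gdB).
- by move=> x k phi Bk tp; exact: (Pi_Xpow s_gt0 clB gdB).
move=> x k t phi Bt BI tp; have := @good_ser x k t phi Bt BI tp; congr (_ --> _).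
congr (_ - _).
rewrite [RHS](@fsbigE _ _ _ _ _ (midx s (nb t))) ?midx_uniq//; last first.
  move=> l _ ln; rewrite Jop_if ifF ?lextR0 ?mul0r//; apply: contraNF ln => pl.
  by rewrite mem_midx//; apply: leq_ltn_trans (pos_J_nb pl); rewrite sdegD; exact: leq_addl.
rewrite [RHS](eq_bigl xpredT); last by move=> l; rewrite in_setT.
apply: eq_bigr => l _; rewrite /moment /Jc Jop_if; case: ifP => pl; last by rewrite lextR0 !mul0r.
by rewrite lextR_bas fII//; exact: (cl_II clB BI pl).1.
Qed.

End WithPi.
End Fixed2.
End GoodIsAdmissible.

(** * Recovering the base-point free form from a model *)

Section AdmissibleIsGood.
Context {R : realType} {d : nat} (s : 'I_d -> nat) (alpha beta r : R).
Hypothesis s_gt0 : forall i, (0 < s i)%N.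
Context (K : nat -> 'rV[R]_d -> R) (N : nat).
Local Notation V := 'rV[R]_d.
Local Notation test := (V -> R).
Implicit Types (t u : expr d) (k l q p : mindex d) (x y z : V) (phi psi : test).
Local Notation wt := (weight s alpha beta).
Local Notation Alg := (Alg s alpha beta).
Local Notation pos_J := (pos_J s alpha beta).
Local Notation nb := (nb s alpha beta).
Local Notation Gm := (Gm s alpha beta).
Local Notation comp := (comp s alpha beta).
Local Notation Jc := (Jc s alpha beta).
Local Notation H := (Hsp R d).
Local Notation sbox := (@sbox R d s).
Local Notation kk := (kk K).
Local Notation fc := (fc K).
Local Notation Fx := (Fx K).
Local Notation G := (G s alpha beta K).
Local Notation good := (good s alpha beta K N).
Local Notation closed := (closed s alpha beta r).
Local Notation S := (stot s).
Hypothesis sK : forall m, smooth (K m).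
Hypothesis supK : forall m, supported_in (sbox 0 (lam m)) (K m).
Hypothesis bK : forall k : mindex d, exists C : R, forall m x,
  `|Dpart k (K m) x| <= C * 2 `^ ((S%:R - beta + (sdeg s k)%:R) * m%:R).
Hypothesis annK : forall m x (q : seq (R * mindex d)),
  (forall w, w \in q -> (sdeg s w.2)%:R <= r) ->
  integral_rV (fun y => K m (x - y) * \sum_(w <- q) w.1 * monomial w.2 y) = 0.

Lemma integral_lextR (I : choiceType) (a : malg I R) (F : I -> V -> R) :
  (forall i, mcoeff i a != 0 -> cpt (F i)) ->
  integral_rV (fun y => lextR (F^~ y) a) = lextR (fun i => integral_rV (F i)) a.
Proof.
move=> hF; have h (e : seq I) : (forall i, i \in e -> mcoeff i a != 0) ->
    cpt (fun y => \sum_(i <- e) mcoeff i a * F i y) /\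
    integral_rV (fun y => \sum_(i <- e) mcoeff i a * F i y) = \sum_(i <- e) mcoeff i a * integral_rV (F i).
  elim: e => [|i e ih] he.
    have -> : (fun y => \sum_(i <- [::]) mcoeff i a * F i y) = fun=> 0 by apply/funext => y; rewrite big_nil.
    by rewrite big_nil integral0; split => //; exact: cpt0.
  have [j je|c1 e1] := ih; first by apply: he; rewrite inE je orbT.
  have ci : cpt (F i) by apply: hF; apply: he; rewrite inE eqxx.
  have -> : (fun y => \sum_(j <- i :: e) mcoeff j a * F j y) =
    fun y => mcoeff i a * F i y + \sum_(j <- e) mcoeff j a * F j y by apply/funext => y; rewrite big_cons.
  by rewrite big_cons integral_lin// e1; split => //; exact: cpt_lin.
by apply: (h _ _).2 => i; rewrite mem_msupp.
Qed.

Lemma series_lextR (I : choiceType) (a : malg I R) (F : nat -> I -> R) (L : I -> R) :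
  (forall i, mcoeff i a != 0 -> series (F^~ i) @ \oo --> L i) ->
  series (fun n => lextR (F n) a) @ \oo --> lextR L a.
Proof.
move=> hF; rewrite /lextR; apply: series_sum_cvg => i; rewrite mem_msupp => ca.
by apply: seriesZ_cvg; exact: hF.
Qed.

Lemma lextRMr (I : choiceType) (F : I -> R) (a : malg I R) c : lextR (fun i => F i * c) a = lextR F a * c.
Proof. by rewrite /lextR mulr_suml; apply: eq_bigr => i _; rewrite mulrA. Qed.

Lemma lextRMl (I : choiceType) (F : I -> R) (a : malg I R) c : lextR (fun i => c * F i) a = c * lextR F a.
Proof. by rewrite /lextR mulr_sumr; apply: eq_bigr => i _; rewrite mulrCA. Qed.

Lemma lextR_sumf (I : choiceType) (J : Type) (q : seq J) (F : J -> I -> R) (a : malg I R) :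
  lextR (fun i => \sum_(j <- q) F j i) a = \sum_(j <- q) lextR (F j) a.
Proof.
by rewrite /lextR exchange_big; apply: eq_bigr => i _; rewrite mulr_sumr.
Qed.

Lemma lextRBf (I : choiceType) (F G : I -> R) (a : malg I R) :
  lextR (fun i => F i - G i) a = lextR F a - lextR G a.
Proof. by rewrite /lextR -sumrB; apply: eq_bigr => i _; rewrite mulrBr. Qed.

Lemma moment_mon x l phi : test_function phi ->
  moment x l phi = (mfact l)%:R^-1 * integral_rV (fun y => monomial l (y - x) * phi y).
Proof.
move=> tp; have [r0 [b [r00 L]]] := test_loc s_gt0 0 tp.
have h := moment_cpt x l r00 L; rewrite /moment -integralZ.
  by congr integral_rV; apply/funext => y; rewrite mulrA.
have -> : (fun y => monomial l (y - x) * phi y) = fun y => (mfact l)%:R * ((mfact l)%:R^-1 * monomial l (y - x) * phi y).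
  apply/funext => y; rewrite !mulrA mulfV ?mul1r// pnatr_eq0 -lt0n /mfact prodn_gt0// => i; exact: fact_gt0.
exact: cptZ.
Qed.

Lemma Vk_lextR (I : choiceType) (a : malg I R) (T : I -> test -> R) k n phi :
  (forall i, mcoeff i a != 0 -> cpt (fun y => phi y * T i (kk k n y))) ->
  integral_rV (fun y => phi y * lextR (fun i => T i (kk k n y)) a) =
  lextR (fun i => integral_rV (fun y => phi y * T i (kk k n y))) a.
Proof.
move=> hT; rewrite -integral_lextR//; congr integral_rV; apply/funext => y.
by rewrite lextRMl.
Qed.

Lemma compact_sbox0 (rad : R) : compact (sbox 0 rad).
Proof.
have := @rV_compact R d (fun i => `[- (rad ^+ s i), rad ^+ s i]%classic) (fun i => @segment_compact R _ _).
congr compact; apply/seteqP; split=> x /= h i; have := h i; rewrite /= ?in_itv/= mxE ?subr0 ler_norml.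
  by [].
by [].
Qed.

Lemma snorm_sbox0 x y (rad : R) : 0 <= rad -> sbox 0 rad x -> sbox 0 rad y ->
  snorm s (x - y) <= d%:R * (2 * rad).
Proof.
move=> rad0 x0 y0; apply: (snorm_box s_gt0); first exact: mulr_ge0.
move=> i; rewrite !mxE; have := x0 i; have := y0 i; rewrite mxE !subr0 => hy hx.
apply: (le_trans (ler_normB _ _)); apply: (le_trans (lerD hx hy)).
have := exprD_super (s_gt0 i) rad0 rad0; by rewrite (_ : rad + rad = 2 * rad)//; ring.
Qed.

Section FromModel.
Context (Bs C T P : set (expr d)) (Pi : V -> expr d -> test -> R) (Gam : V -> V -> H -> H)
  (f : V -> expr d -> R).
Hypothesis clB : closed Bs C.
Hypothesis algP : Alg C `<=` P.
Hypothesis TN : is_test_order s alpha beta T N.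
Hypothesis adm : admissible_with s alpha beta T Bs P K Pi Gam f.

Let multP x : multiplicative_on P (f x).
Proof. by case: adm => _ [h _] _ _ _; exact: h. Qed.

Let fX x i : f x (Xvar i) = - x ord0 i.
Proof. by case: adm => _ _ [h _] _ _; exact: h. Qed.

Lemma model_fII x k t : Bs t -> P (II k t) -> f x (II k t) = fc Pi x k t.
Proof.
move=> Bt Pt; case: adm => _ _ [_ h] _ _; have c := h x k t Bt Pt.
by rewrite /fc -[LHS]opprK; congr (- _); symmetry; exact: cvg_lim c.
Qed.

Let fII x k t : C t -> pos_J k t -> f x (II k t) = fc Pi x k t.
Proof.
by move=> Ct pt; apply: model_fII; [exact: cl_C clB _ Ct|apply: algP; apply/Alg_II].
Qed.

(** In an admissible model Gamma is a function of Pi: the characters are given by [fc], hence so is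
    F_x^-1 o F_y. Uniqueness thus reduces to that of Pi. *)
Lemma model_Gam x y (a : H) : lspan Bs a -> Gam x y a = lext (Gm (G Pi x y)) a.
Proof.
move=> ha; case: adm => _ [_ h] _ _ _; rewrite (h x y a ha).
exact: (Gamma_fromE s_gt0 clB multP algP fX fII).
Qed.

Lemma model_PiG x y t phi : Bs t -> test_function phi ->
  Pi y t phi = lextR (fun u => Pi x u phi) (Gm (G Pi x y) t).
Proof.
move=> Bt tp; case: adm => -[_ _ _ h _] _ _ _ _.
have := h x y (bas t) phi (lspan_bas Bt) tp.
by rewrite /Pi_lin lextR_bas (model_Gam x y (lspan_bas Bt)) lext_bas.
Qed.

Lemma model_Tlin x t : Bs t -> Tlin (Pi x t).
Proof. by move=> Bt; case: adm => -[h _ _ _ _] _ _ _ _; exact: distribution_Tlin (h x t Bt). Qed.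

Let del0 : R := d.+1%:R^-1.

Lemma model_unit rad gamma : 0 < gamma -> exists2 D : R, 0 <= D & forall x y t, Bs t -> wt t < gamma ->
  sbox 0 rad x -> sbox 0 rad y ->
  [/\ Tb s N x del0 (D * d.+1%:R `^ wt t) (wt t) (Pi x t) &
  forall u, wt u < wt t -> `|mcoeff u (Gm (G Pi x y) t)| <= D * snorm s (x - y) `^ (wt t - wt u)].
Proof.
move=> gamma0; case: (adm) => -[_ _ _ _ [n [n1 n2] h]] _ _ _ _.
have nN : n = N.
  by case: TN => N1 N2; apply/eqP; rewrite eqn_leq n2//= N2.
rewrite {}nN in h; have [D hD] := h gamma _ gamma0 (@compact_sbox0 rad).
exists (`|D| * d.+1%:R ^+ (S + N * S)) => [|x y t Bt tg x0 y0]; first by rewrite mulr_ge0// exprn_ge0.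
have ht : homogeneous s alpha beta (wt t) (bas t : H).
  by move=> u; rewrite mcoeff_bas; have [->//|_] := eqVneq t u; rewrite eqxx.
have nt : hnorm s alpha beta (wt t) (bas t : H) = 1.
  rewrite (hnorm_homogeneous ht) -(lextR_bas (fun _ => 1 : R) t) /lextR; apply: eq_bigr => u _.
  by rewrite mulr1 mcoeff_bas ger0_norm.
have [h1 h2] := hD x y (wt t) (bas t) x0 y0 tg (lspan_bas Bt) ht; rewrite nt mulr1 in h1 h2.
split=> [|u ut].
  apply: (Tb_of_unit s_gt0 (model_Tlin x Bt) (normr_ge0 D)) => dl phi d0 d1 up.
  have := h1 dl phi d0 d1 up; rewrite /Pi_lin lextR_bas => h3; apply: (le_trans h3).
  by rewrite ler_wpM2r ?powR_ge0// ler_norm.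
have := h2 (wt u) ut; rewrite (model_Gam x y (lspan_bas Bt)) lext_bas => h3.
apply: le_trans (le_trans h3 _).
  rewrite /hnorm; have [->|cu] := eqVneq (mcoeff u (Gm (G Pi x y) t)) 0.
    by rewrite normr0 sumr_ge0.
  rewrite big_mkcond (bigD1_seq u) ?msupp_uniq ?mem_msupp//= eqxx lerDl.
  by apply: sumr_ge0 => v _; case: ifP.
rewrite ler_wpM2r ?powR_ge0// (le_trans (ler_norm _))// ler_peMr// exprn_ege1//.
by rewrite ler1n.
Qed.

(** The model controls Pi_x t at scales up to del0 only. Beyond, the test function is cut into
    pieces of scale del0 at nearby points z, and Pi_y t = Pi_z Gamma_zy t is bounded at z by the
    model again. The points z lie within 2 * rad of y, whence the box of radius 3 * rad. *)
Lemma model_bd t rad : Bs t -> exists2 A : R, 0 <= A & forall x, sbox 0 rad x ->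
  Tb s N x rad A (wt t) (Pi x t).
Proof.
move=> Bt; have [rad0|rad0] := lerP rad 0.
  by exists 0 => // x _ dl b phi d0 dr; have := lt_le_trans d0 (le_trans dr rad0); rewrite ltxx.
wlog rad1 : rad rad0 / 1 <= rad.
  move=> W; have m1' : 1 <= Num.max 1 rad by rewrite le_max lexx.
  have [A A0 hA] := W (Num.max 1 rad) (lt_le_trans ltr01 m1') m1'.
  exists A => // x xr; apply: Tb_le (hA x _) => //; first by rewrite le_max lexx orbT.
  by apply: sbox_mono xr; [exact: ltW|rewrite le_max lexx orbT].
have r0 : 0 <= rad := ltW rad0.
have [e [ue eB]] := cl_fin clB; have ft := cl_formal clB Bt.
have del00 : 0 < del0 by rewrite invr_gt0.
have del01 : del0 <= 1 by rewrite invf_le1// ler1n.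
have gamma0 : 0 < `|wt t| + 1 by rewrite ltr_wpDl.
have tg : wt t < `|wt t| + 1 by apply: le_lt_trans (ler_norm _) _; rewrite ltrDl.
have [D D0 hD] := model_unit (3 * rad) gamma0.
pose E := \sum_(u <- e) (d%:R * (2 * (3 * rad))) `^ (wt t - wt u).
have E0 : 0 <= E by apply: sumr_ge0 => u _; exact: powR_ge0.
(* For lighter u this is the bound of the model on Gamma; for the others unitriangularity leaves
   only the coefficient 1 of t. *)
have cb y z u : sbox 0 (3 * rad) y -> sbox 0 (3 * rad) z -> Bs u ->
    `|mcoeff u (Gm (G Pi z y) t)| <= D * E + 1.
  move=> y0 z0 Bu; have [ut|tu] := ltP (wt u) (wt t).
    have [_ h] := hD z y t Bt tg z0 y0; apply: (le_trans (h u ut)).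
    rewrite -[leLHS]addr0; apply: lerD => //; rewrite ler_wpM2l//.
    apply: (@le_trans _ _ ((d%:R * (2 * (3 * rad))) `^ (wt t - wt u))).
      apply: ge0_ler_powR; rewrite ?nnegrE ?subr_ge0 ?(ltW ut) ?snorm_ge0 ?mulr_ge0//.
      by apply: snorm_sbox0 => //; rewrite mulr_ge0.
    have ue' : u \in e by apply/eB.
    by rewrite /E (bigD1_seq u)//= lerDl; apply: sumr_ge0 => v _; exact: powR_ge0.
  have := @Gm_lower _ _ s alpha beta s_gt0 _ t (G_one s alpha beta K Pi z y) ft u.
  rewrite mcoeffB; case: eqVneq => [/eqP|_ /(_ isT) /=]; last by move=> /lt_le_trans/(_ tu); rewrite ltxx.
  rewrite subr_eq0 => /eqP -> _; rewrite mcoeff_bas; apply: (@le_trans _ _ 1).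
    by case: eqP => _; rewrite ?normr1 ?normr0.
  by rewrite lerDr mulr_ge0.
pose Q := (size e)%:R * (D * E + 1) * D.
have Q0 : 0 <= Q by rewrite !mulr_ge0// addr_ge0// mulr_ge0.
have hQ y z psi b' : sbox 0 rad y -> sbox y (2 * rad) z -> loc s N z del0 b' psi -> `|Pi y t psi| <= Q * b'.
  move=> y0 yz L; have tp := loc_test L; have b0 := loc_ge0 del00 L.
  have y3 : sbox 0 (3 * rad) y by apply: sbox_mono y0 => //; lra.
  have z3 : sbox 0 (3 * rad) z.
    have := sbox_trans s_gt0 r0 (mulr_ge0 (ler0n _ 2) r0) y0 yz.
    by rewrite (_ : rad + 2 * rad = 3 * rad)//; ring.
  rewrite (model_PiG z y Bt tp) /lextR (le_trans (ler_norm_sum _ _ _))//.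
  apply: (@le_trans _ _ (\sum_(u <- enum_fset (msupp (Gm (G Pi z y) t))) (D * E + 1) * (D * b'))).
    rewrite !big_seq; apply: ler_sum => u; rewrite mem_msupp => cu.
    have Bu := Gm_Bs clB Bt cu.
    have ut : wt u <= wt t by exact: (Gm_le s_gt0 (G_one s alpha beta K Pi z y) ft cu).
    rewrite normrM; apply: ler_pM => //; first exact: cb.
    have [h _] := hD z y u Bu (le_lt_trans ut tg) z3 y3.
    apply: (le_trans (h _ _ _ del00 (lexx _) L)); rewrite -!mulrA ler_wpM2l// mulrCA.
    by rewrite /del0 pwV// mulfV ?mulr1// gt_eqF// powR_gt0.
  rewrite big_const_seq count_predT iter_addr_0 -[_ *+ _]mulr_natl /Q -!mulrA.
  rewrite ler_wpM2r ?mulr_ge0 ?addr_ge0 ?mulr_ge0// ler_nat.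
  apply: uniq_leq_size; first exact: msupp_uniq.
  by move=> u; rewrite mem_msupp => cu; apply/eB; exact: (Gm_Bs clB Bt cu).
have [A A0 hA] := scale_up s_gt0 N del00 (le_trans del01 rad1).
set w := wt t in hD *.
(* For del0 < dl <= rad the power dl^-w is at most rad^-w or del0^-w, according to the sign of w;
   the sum covers both cases. *)
exists (D * d.+1%:R `^ w + A * Q * (del0 `^ (- w) + rad `^ (- w))).
  apply: addr_ge0; first exact: mulr_ge0 D0 (powR_ge0 _ _).
  by apply: mulr_ge0; [exact: mulr_ge0|apply: addr_ge0; exact: powR_ge0].
move=> x x0 dl b phi d0 dr L; have b0 := loc_ge0 d0 L; have dw := powR_ge0 dl w.
rewrite mulrDl mulrDl; have [dd|dd] := lerP dl del0.
  have x3 : sbox 0 (3 * rad) x by apply: sbox_mono x0 => //; lra.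
  have [h _] := hD x x t Bt tg x3 x3; apply: (le_trans (h _ _ _ d0 dd L)); rewrite lerDl.
  apply: mulr_ge0 => //; apply: mulr_ge0 => //.
  by apply: mulr_ge0; [exact: mulr_ge0|apply: addr_ge0; exact: powR_ge0].
apply: (@le_trans _ _ (A * Q * b)).
  apply: (hA _ _ x dl _ _ (model_Tlin x Bt) Q0 (ltW dd) dr _ L) => z psi b'.
  exact: hQ.
apply: (@le_trans _ _ (A * Q * (del0 `^ (- w) + rad `^ (- w)) * b * dl `^ w)); last first.
  by rewrite lerDr !mulr_ge0 ?powR_ge0.
have -> : A * Q * (del0 `^ (- w) + rad `^ (- w)) * b * dl `^ w =
  A * Q * b * ((del0 `^ (- w) + rad `^ (- w)) * dl `^ w) by ring.
rewrite -[leLHS]mulr1; apply: ler_wpM2l; first by apply: mulr_ge0 => //; apply: mulr_ge0.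
apply: (@le_trans _ _ (dl `^ (- w) * dl `^ w)); first by rewrite -pwD// addNr powRr0.
rewrite ler_wpM2r//; have [w0|w0] := lerP w 0.
  rewrite -[leLHS]add0r lerD ?powR_ge0// ge0_ler_powR ?nnegrE ?oppr_ge0//; exact: ltW.
rewrite -[leLHS]addr0 lerD ?powR_ge0// !pwN lef_pV2 ?posrE ?powR_gt0//.
by rewrite ge0_ler_powR ?nnegrE ?(ltW w0) ?(ltW d0) ?(ltW del00)// ltW.
Qed.

Lemma model_all_Tb x t : Bs t -> all_Tb s N x (wt t) (Pi x t).
Proof.
move=> Bt rad; have [r1 r10 r1x] := in_sbox0 s_gt0 x.
have [A _ hA] := model_bd (Num.max r1 rad) Bt.
exists A; apply: Tb_le (hA x _) => //; first by rewrite le_max lexx orbT.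
by apply: sbox_mono r1x; [exact: ltW|rewrite le_max lexx].
Qed.

Lemma model_cpt t k n phi : Bs t -> test_function phi -> cpt (fun y => phi y * Pi 0 t (kk k n y)).
Proof.
move=> Bt tp; have [r0 [b [r00 L]]] := test_loc s_gt0 N tp.
exact: (Vk_cpt s_gt0 sK supK _ _ (model_Tlin 0 Bt) (model_all_Tb 0 Bt) r00 L).
Qed.

(** Pi_0 o F_0^-1. The choice of base point is immaterial, since F_0^-1 o F_x is Gamma_0x by
    [Finv_G]. *)
Definition bPm t phi := lextR (fun u => Pi 0 u phi) (Gm (Finv s alpha beta K Pi 0) t).

Lemma Finv_G x t : formal t -> lext (Gm (Finv s alpha beta K Pi 0)) (Gm (Fx Pi x) t) = Gm (G Pi 0 x) t.
Proof.
move=> ft; apply/eqP; rewrite -subr_eq0; apply/eqP.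
apply: (Gm_inj (alpha := alpha) (beta := beta) s_gt0 (Fx_one K Pi 0)).
  apply: lspanB; last exact: Gm_formal.
  apply: lspan_lext => u cu.
  exact: (@Gm_formal _ _ s alpha beta s_gt0 _ u (@Gm_formal _ _ s alpha beta s_gt0 _ t ft u cu)).
apply: (etrans (linearB (lext (Gm (Fx Pi 0))) _ _)); apply/eqP; rewrite subr_eq0; apply/eqP.
apply: (etrans (lext_lext _ _ _)); apply: etrans (esym (@G_spec _ _ s alpha beta s_gt0 K Pi 0 x t ft)).
apply: etrans (lext_id _); apply: eq_lext => u cu; refine (@Finv_spec _ _ s alpha beta s_gt0 K Pi 0 u _).
exact: (@Gm_formal _ _ s alpha beta s_gt0 _ t ft u cu).
Qed.

(** For a planted tree, the convolution identity of admissibility at the base point 0 is summed over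
    the trees u of F_0^-1 t. The Taylor terms it carries are exactly the polynomial part of F_0^-1
    (I_k t). *)
Lemma model_good : good Pi bPm Bs.
Proof.
have pol p phi : Bs (Xpow p) -> test_function phi -> Pi 0 (Xpow p) phi = integral_rV (fun y => monomial p y * phi y).
  move=> Bp tp; case: adm => _ _ _ h _; rewrite (h 0 p phi Bp tp).
  by congr integral_rV; apply/funext => y; rewrite subr0.
have rep x t phi : Bs t -> test_function phi -> Pi x t phi = lextR (fun u => bPm u phi) (Gm (Fx Pi x) t).
  move=> Bt tp; rewrite (model_PiG 0 x Bt tp) -(Finv_G x (cl_formal clB Bt)) lextR_lext.
  reflexivity.
have X0 p : Gm (Fx Pi 0) (Xpow p) = bas (Xpow p).
  rewrite /Fx oppr0 Gm_Xpow bas_Xpow; apply: eq_bigr => i _.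
  by rewrite mxE scale0r addr0.
split=> //.
- by move=> t Bt; apply: Tlin_lext => u cu; apply: model_Tlin; exact: (Gm_Bs clB Bt cu).
- by move=> p phi Bp tp; rewrite -(pol p phi Bp tp) (rep 0 _ _ Bp tp) X0 lextR_bas.
- move=> k t phi Bt BIt tp; set g := Finv s alpha beta K Pi 0; have ft := cl_formal clB Bt.
  have [_ nt] := (formal_II k t).1 (cl_formal clB BIt).
  pose L u := lextR (fun v => Pi 0 v phi) (Iop k u) - \sum_(l <- midx s (nb t)) Jc (fc Pi 0) (k + l) u * moment 0 l phi.
  have -> : bPm (II k t) phi = lextR L (Gm g t).
    rewrite /bPm /g {1}/Finv (Gm_II s_gt0 _ _ _ (leqnn _)) -/(Finv s alpha beta K Pi 0) -/g lextRD lextR_lext.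
    rewrite [RHS](_ : _ = lextR (fun u => lextR (fun v => Pi 0 v phi) (Iop k u)) (Gm g t) -
       \sum_(l <- midx s (nb t)) lextR (fun u => Jc (fc Pi 0) (k + l) u) (Gm g t) * moment 0 l phi); last first.
      by rewrite /L lextRBf lextR_sumf; congr (_ - _); apply: eq_bigr => l _; rewrite lextRMr.
    congr (_ + _); rewrite lextR_sum -sumrN; apply: eq_bigr => l _.
    rewrite lextRZ (shiftS0 s_gt0)//; last exact: Jc_vanish.
    have [pt|npt] := boolP (pos_J (k + l) t).
      have [_ Bl] := cl_II s_gt0 clB BIt pt.
      rewrite /Ex lextRZ lextR_bas (pol l phi Bl tp) Jc_comp compE// oppr0.
      have V := @Jbar_vanish R d s alpha beta (fc Pi 0) _ t _ (leqnn _) (Gm_le s_gt0 (charE_one 0 (comp 0 (fc Pi 0) (fun _ _ => 0))) ft).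
      rewrite (shiftS0 s_gt0 _ V) sub0r mulNr moment_mon//; congr (- (_ * (_ * integral_rV _))).
      by apply/funext => y; rewrite subr0.
    rewrite {1}/Jc (negPf npt) mul0r (_ : lextR _ _ = 0) ?mul0r ?oppr0//.
    rewrite /lextR big_seq big1// => u; rewrite mem_msupp => cu; rewrite /Jc ifF ?mulr0//.
    apply: contraNF npt => /pos_JP[h _]; apply/pos_JP; split => //; apply: lt_le_trans h _.
    rewrite lerD2r lerD2r; exact: (Gm_le s_gt0 (charE_one _ _) ft cu).
  have -> : (fun n => integral_rV (fun y => phi y * bPm t (kk k n y))) =
      fun n => lextR (fun u => integral_rV (fun y => phi y * Pi 0 u (kk k n y))) (Gm g t).
    apply/funext => n; rewrite -Vk_lextR// => u cu; apply: model_cpt => //; exact: (Gm_Bs clB Bt cu).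
  apply: series_lextR => u cu; have Bu := Gm_Bs clB Bt cu.
  have [xu|nu] := pselect (is_Xpow u).
    rewrite /L /Iop asboolT// lextR0 big1 ?subr0; last first.
      by move=> l _; rewrite /Jc ifF ?mul0r//; apply: negbTE; apply/pos_JP => -[].
    rewrite (_ : (fun n => _) = fun=> 0); last first.
      apply/funext => n; rewrite (_ : (fun y => _) = fun=> 0) ?integral0//; apply/funext => y.
      case: xu => p up; rewrite up (pol _ _ _ (test_kk sK supK k n y)) -?up//.
      have := @kernel_annihilates R d s (K n) (lam n) r (sK n) (lam_ge0 n) (supK (m:=n)) (annK n) k p 0 y.
      under eq_fun do rewrite subr0.
      by move->; rewrite ?mulr0//; apply: (cl_pol clB); rewrite -up.
    rewrite (_ : series _ = fun=> 0); first exact: cvg_cst.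
    by apply/funext => n; rewrite /series /= big1.
  have BIu := Gm_II_Bs s_gt0 clB BIt cu nu.
  case: (adm) => _ _ _ _ h; have := h 0 k u phi Bu BIu tp; congr (_ --> _).
  rewrite /L {1}/Iop asboolF// lextR_bas; congr (_ - _).
  have ut : wt u <= wt t by exact: (Gm_le s_gt0 (charE_one _ _) ft cu).
  rewrite [LHS](@fsbigE _ _ _ _ _ (midx s (nb t))) ?midx_uniq//; last first.
    move=> l _ ln; rewrite Jop_if ifF ?lextR0 ?mul0r//; apply: contraNF ln => pl.
    rewrite mem_midx//; apply: leq_trans (nb_le ut); apply: leq_ltn_trans (pos_J_nb pl).
    by rewrite sdegD; exact: leq_addl.
  rewrite [LHS](eq_bigl xpredT); last by move=> l; rewrite in_setT.
  apply: eq_bigr => l _; rewrite /moment /Jc Jop_if; case: ifP => pl; last by rewrite lextR0 !mul0r.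
  by rewrite lextR_bas fII//; exact: (cl_II s_gt0 clB BIu pl).1.
- exact: model_bd.
Qed.

End FromModel.
End AdmissibleIsGood.

(** * The renormalised model *)

Section RenormalisedModel.
Context {R : realType} {d : nat} (s : 'I_d -> nat) (alpha beta r : R).
Hypothesis s_gt0 : forall i, (0 < s i)%N.
Context (K : nat -> 'rV[R]_d -> R) (N : nat).
Local Notation V := 'rV[R]_d.
Local Notation test := (V -> R).
Implicit Types (t u : expr d) (k l q p : mindex d) (x y z : V) (phi psi : test).
Local Notation wt := (weight s alpha beta).
Local Notation Delta := (coproduct s alpha beta).
Local Notation Alg := (Alg s alpha beta).
Local Notation pos_J := (pos_J s alpha beta).
Local Notation Gm := (Gm s alpha beta).
Local Notation H := (Hsp R d).
Local Notation sbox := (@sbox R d s).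
Local Notation kk := (kk K).
Local Notation fc := (fc K).
Local Notation Fx := (Fx K).
Local Notation good := (good s alpha beta K N).
Local Notation closed := (closed s alpha beta r).
Local Notation S := (stot s).
Hypothesis sK : forall m, smooth (K m).
Hypothesis supK : forall m, supported_in (sbox 0 (lam m)) (K m).
Hypothesis bK : forall k : mindex d, exists C : R, forall m x,
  `|Dpart k (K m) x| <= C * 2 `^ ((S%:R - beta + (sdeg s k)%:R) * m%:R).
Hypothesis annK : forall m x (q : seq (R * mindex d)),
  (forall w, w \in q -> (sdeg s w.2)%:R <= r) ->
  integral_rV (fun y => K m (x - y) * \sum_(w <- q) w.1 * monomial w.2 y) = 0.

(** The map (I (x) mult)(Delta (x) I) is unitriangular for the weight of the left component. *)
Lemma comul_mul_inj (a : Hsp2 R d) : lspan [set v | formal v.1] a -> comul_mul Delta a = 0 -> a = 0.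
Proof.
apply: (unitriangular_inj (w := fun v : expr d * expr d => wt v.1)) => v fv.
set F := fun q : expr d * expr d => bas (q.1, emul q.2 v.2) : Hsp2 R d.
have e : lext F (tens (bas v.1) 1) = bas v.
  by rewrite -[X in tens _ X]bas_one tens_bas lext_bas /F /= emul1 -surjective_pairing.
suff h : lspan [set l | wt l.1 < wt v.1] (lext F (Delta v.1 - tens (bas v.1) 1)).
  by move: h; rewrite linearB /= e.
apply: lspan_lext => q cq; apply: lspan_bas; exact: (cop_lower s_gt0 fv cq).
Qed.

(** By induction on the weight: (M (x) hat M) Delta t involves hat M only on J_k u with u lighter
    than t, which Delta^M u determines, and [comul_mul_inj] recovers Delta^M t from the identity. *)
Lemma DM_unique (F0 Fstar C0 : set (expr d)) (M : expr d -> H) DM DM' hM hM' :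
  closed F0 C0 -> C0 `<=` Fstar -> is_DeltaM s alpha beta Fstar F0 M DM hM ->
  is_DeltaM s alpha beta Fstar F0 M DM' hM' -> forall t, F0 t -> DM t = DM' t.
Proof.
move=> clF CS [[h1 _] h2 h3 h4 h5] [[h1' _] h2' h3' h4' h5'].
apply: (weight_ind (s := s) (alpha := alpha) (beta := beta) (cl_fin clF)) => t Ft IH; apply/eqP; rewrite -subr_eq0; apply/eqP.
apply: comul_mul_inj.
  by apply: lspanB; [apply: lspanS (h1 t Ft)|apply: lspanS (h1' t Ft)] => v [F1 _]; exact: cl_formal clF _ F1.
suff e : comul_mul Delta (DM t) = comul_mul Delta (DM' t).
  by apply: (etrans (linearB (lext _) _ _)); apply/eqP; rewrite subr_eq0; apply/eqP.
apply: (etrans (h3 t Ft)); apply: etrans (esym (h3' t Ft)); apply: eq_lext => v cv.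
congr (tens _ _); have [_ A2] := cl_cop clF Ft cv.
have alg u : Alg [set u | C0 u /\ wt u < wt t] u -> Alg Fstar u by apply: AlgS => w [/CS].
move: v.2 A2 => {cv v}; apply: (alg_ind (s := s) (alpha := alpha) (beta := beta)) => [|i|u w Au Aw e1 e2|k u [Cu ut] pu].
- by rewrite -Xpow0 h5 h5'.
- by rewrite -Xpow_unit h5 h5'.
- by rewrite (h4 _ _ (alg _ Au) (alg _ Aw)) (h4' _ _ (alg _ Au) (alg _ Aw)) e1 e2.
- have J0 : Jop s alpha beta k u != 0.
    by rewrite Jop_if pu; apply/eqP => /(congr1 (mcoeff (II k u))); rewrite mcoeff_bas eqxx mcoeff0 => /eqP; rewrite oner_eq0.
  have := h2 k u (CS _ Cu) J0; have := h2' k u (CS _ Cu) J0.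
  rewrite Jop_if pu !lext_bas => -> ->; rewrite IH//; exact: cl_C clF _ Cu.
Qed.

Section Renorm.
Context (Bs C F0 Fstar C0 P : set (expr d)) (Pi : V -> expr d -> test -> R) (bP : expr d -> test -> R).
Context (f : V -> expr d -> R) (M : expr d -> H) (DM : expr d -> Hsp2 R d) (hM : expr d -> H).
Hypothesis clB : closed Bs C.
Hypothesis clF : closed F0 C0.
Hypothesis gdB : good Pi bP Bs.
Hypothesis C0star : C0 `<=` Fstar.
Hypothesis starF : Fstar `<=` F0.
Hypothesis F0B : F0 `<=` Bs.
Hypothesis multP : forall x, multiplicative_on P (f x).
Hypothesis algP : Alg Bs `<=` P.
Hypothesis fX : forall x i, f x (Xvar i) = - x ord0 i.
Hypothesis fII : forall x k t, Bs t -> pos_J k t -> f x (II k t) = fc Pi x k t.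
Hypothesis MI : commutes_with_I F0 M.
Hypothesis MX : forall k, F0 (Xpow k) -> M (Xpow k) = bas (Xpow k).
Hypothesis MD : is_DeltaM s alpha beta Fstar F0 M DM hM.
Hypothesis DMtri : upper_triangular s alpha beta Fstar F0 DM.

Local Notation PiM := (Pi_renorm DM Pi f).
Local Notation fM := (f_renorm hM f).

Let starB : Fstar `<=` Bs. Proof. by move=> t /starF/F0B. Qed.
Let algS t : Alg Fstar t -> P t. Proof. by move=> h; apply: algP; exact: AlgS starB _ h. Qed.
Let hMspan t : Alg Fstar t -> lspan (Alg Fstar) (hM t).
Proof. by case: MD => -[_ h] _ _ _ _; exact: h. Qed.

Lemma fM_mult x : multiplicative_on (Alg Fstar) (fM x).
Proof.
case: MD => _ _ _ hmul hX; split.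
  by rewrite /f_renorm -Xpow0 hX lextR_bas Xpow0; exact: (multP x).1.
move=> t u At Au; rewrite /f_renorm hmul// lextRM_on// => k l ck cl.
by apply: (multP x).2; apply: algS; [exact: hMspan At _ ck|exact: hMspan Au _ cl].
Qed.

Lemma fM_X x i : fM x (Xvar i) = - x ord0 i.
Proof. by case: MD => _ _ _ _ hX; rewrite /f_renorm -Xpow_unit hX lextR_bas Xpow_unit. Qed.

Lemma DM_supp t v : F0 t -> mcoeff v (DM t) != 0 -> [/\ F0 v.1, Alg Fstar v.2 & wt t <= wt v.1].
Proof.
move=> Ft cv; case: MD => -[h _] _ _ _ _; have [F1 A2] := h t Ft v cv; split => //.
have [e|ne] := eqVneq v (t, m1); first by rewrite e.
have := DMtri Ft (k := v); rewrite mcoeffB -[X in tens _ X]bas_one tens_bas mcoeff_bas [_ == v]eq_sym (negPf ne) subr0.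
by move=> /(_ cv)[[_ /ltW]].
Qed.

(** Apply f_x to hat M J_k = mult (J_k (x) I) Delta^M. By triangularity the left components of
    Delta^M t weigh at least wt t, so none of their J_k is cut off for lack of weight and f_x may be
    replaced by its formula; powers of X contribute 0 on both sides. *)
Lemma fM_II x k t : Fstar t -> pos_J k t -> fM x (II k t) = fc PiM x k t.
Proof.
move=> St pt; have Ft := starF St; case: MD => _ h _ _ _.
have J0 : Jop s alpha beta k t != 0.
  by rewrite Jop_if pt; apply/eqP => /(congr1 (mcoeff (II k t))); rewrite mcoeff_bas eqxx mcoeff0 => /eqP; rewrite oner_eq0.
have := h k t St J0; rewrite Jop_if pt lext_bas /f_renorm => ->.
rewrite lextR_lext /fc -[LHS]opprK; congr (- _); symmetry; apply: cvg_lim => //.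
rewrite -mulN1r -lextRMl; apply: series_lextR => v cv.
have [F1 A2 tv] := DM_supp Ft cv.
have [xv|nv] := pselect (is_Xpow v.1).
  rewrite Jop_if ifF; last by apply: negbTE; apply/pos_JP => -[].
  rewrite mul0r lextR0 mulr0 (_ : series _ = fun=> 0); first exact: cvg_cst.
  apply/funext => n; rewrite /series /= big1// => m _.
  by case: xv => p up; rewrite up (Pi_Xpow_kk s_gt0 sK supK annK clB gdB) ?mul0r// -up; exact: F0B.
have pv : pos_J k v.1.
  apply/pos_JP; split => //; move/pos_JP: pt => [h1 _]; apply: lt_le_trans h1 _.
  by rewrite lerD2r lerD2r.
have Bv := F0B F1.
rewrite Jop_if pv bas_mul lextR_bas (multP x).2; last 2 first.
- by apply: algP; apply/Alg_II.
- exact: algS.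
rewrite (fII x Bv pv) mulrA mulN1r.
have -> : (fun n => Pi x v.1 (kk k n x) * f x v.2) = fun n => f x v.2 * Pi x v.1 (kk k n x).
  by apply/funext => n; rewrite mulrC.
by rewrite mulrC; apply: seriesZ_cvg; exact: (fc_cvg s_gt0 sK supK bK gdB).
Qed.

Lemma fM_charE x t : Alg Fstar t -> fM x t = Fx PiM x t.
Proof.
move=> At; rewrite (mult_char (s := s) (alpha := alpha) (beta := beta) (fun _ => id) (fM_mult x) At).
rewrite (_ : \row_i _ = - x); last by apply/rowP => i; rewrite !mxE fM_X.
by apply: (eq_charE (s := s) (alpha := alpha) (beta := beta) (C := Fstar)) At => k u; exact: fM_II.
Qed.

Definition bPM t phi := lextR (fun u => bP u phi) (M t).

Let Mspan t : F0 t -> lspan F0 (M t). Proof. by case: MI => h _; exact: h. Qed.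

(** Both sides of the defining identity of Delta^M are tested against bP (x) f_x. On the left,
    multiplicativity of f_x and Pi_x = bP o F_x produce (Pi_x (x) f_x) Delta^M; on the right, f_x o
    hat M is f^M_x. *)
Lemma PiM_rep x t phi : F0 t -> test_function phi ->
  PiM x t phi = lextR (fun u => bPM u phi) (Gm (Fx PiM x) t).
Proof.
move=> Ft tp; pose Phi (v : expr d * expr d) := bP v.1 phi * f x v.2.
have cl u : Alg C u -> P u by move=> h; apply: algP; exact: AlgS (cl_C clB) _ h.
transitivity (lextR Phi (comul_mul Delta (DM t))).
  rewrite /Pi_renorm /comul_mul lextR_lext; apply: eq_lextR => v cv.
  have [F1 A2 _] := DM_supp Ft cv; have B1 := F0B F1.
  rewrite (gd_rep gdB x B1 tp) lextR_lext.
  rewrite -(Gm_f clB multP cl fX _ x B1); last by move=> y k u /(cl_C clB); exact: fII.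
  rewrite lextR_Gm -lextRMr; apply: eq_lextR => w cw; rewrite lextR_bas /Phi/= (multP x).2 ?mulrA//; last exact: algS.
  by have [_ A3] := cl_cop clB B1 cw; apply: cl; apply: AlgS A3 => u [].
case: MD => _ _ h _ _; rewrite h// /tmap lextR_lext lextR_Gm; apply: eq_lextR => v cv.
have [F1 A2] := cl_cop clF Ft cv.
rewrite -fM_charE; last by apply: AlgS A2 => u [/C0star].
rewrite tensE lextR_lext /bPM /f_renorm -lextRMr; apply: eq_lextR => u cu.
rewrite lextR_lext -lextRMl; apply: eq_lextR => w cw; by rewrite lextR_bas.
Qed.

Lemma f_bound rad t : Alg Fstar t -> exists2 A : R, 0 <= A & forall x, sbox 0 rad x -> `|f x t| <= A.
Proof.
move: t; apply: alg_ind.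
- by exists 1 => // x _; rewrite (multP x).1 normr1.
- move=> i; exists `|rad ^+ s i| => // x /(_ i); rewrite mxE subr0 fX normrN => h.
  exact: le_trans h (ler_norm _).
- move=> t u At Au [A A0 hA] [D D0 hD]; exists (A * D); first exact: mulr_ge0.
  move=> x x0; rewrite (multP x).2 ?normrM; [|exact: algS|exact: algS].
  by apply: ler_pM => //; [exact: hA|exact: hD].
- move=> k t St pt; have Bt := starB St.
  have [D D0 hD] := fc_bound sK supK bK gdB rad Bt pt.
  by exists D => // x x0; rewrite fII//; exact: (hD x x0).2.
Qed.

Lemma PiM_good : good PiM bPM F0.
Proof.
split.
- by move=> t Ft; apply: Tlin_lext => u cu; apply: (gd_lin gdB); apply: F0B; exact: Mspan Ft _ cu.
- exact: PiM_rep.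
- by move=> p phi Fp tp; rewrite /bPM MX// lextR_bas (gd_pol gdB)//; exact: F0B.
- move=> k t phi Ft FIt tp; rewrite /bPM; case: MI => _ /(_ k t Ft FIt) e.
  rewrite e lextR_lext.
  have -> : (fun n => integral_rV (fun y => phi y * lextR (fun u => bP u (kk k n y)) (M t))) =
      fun n => lextR (fun u => integral_rV (fun y => phi y * bP u (kk k n y))) (M t).
    apply/funext => n; rewrite -Vk_lextR// => u cu.
    by apply: (bP_cpt s_gt0 sK supK clB gdB) => //; apply: F0B; exact: Mspan Ft _ cu.
  apply: series_lextR => u cu; have Fu := Mspan Ft cu.
  have [[p up]|nu] := pselect (is_Xpow u).
    rewrite /Iop asboolT; last by exists p.
    rewrite lextR0 (_ : series _ = fun=> 0); first exact: cvg_cst.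
    apply/funext => n; rewrite /series /= big1// => m _.
    rewrite (_ : (fun y => _) = fun=> 0) ?integral0//; apply/funext => y.
    by rewrite up (bP_Xpow_kk sK supK annK clB gdB) ?mulr0// -up; exact: F0B.
  rewrite /Iop asboolF// lextR_bas; apply: (gd_ser gdB) => //; first exact: F0B.
  (* I_k u lies in F0 because it occurs in M (I_k t) = I_k (M t): its coefficient there is that of u
     in M t, as no other tree is mapped to I_k u. *)
  apply: F0B; suff : mcoeff (II k u) (M (II k t)) != 0 by exact: Mspan FIt _.
  rewrite e mcoeff_lext /lextR (bigD1_seq u) ?msupp_uniq ?mem_msupp//= big1 ?addr0; last first.
    move=> w wu; rewrite /Iop; case: ifP => _; first by rewrite mcoeff0 mulr0.
    rewrite mcoeff_bas; case: eqP => [/II_inj[_ e']|]; last by rewrite mulr0.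
    by rewrite e' eqxx in wu.
  by rewrite /Iop asboolF// mcoeff_bas eqxx mulr1.
- move=> t rad Ft.
  pose Q (v : expr d * expr d) A := mcoeff v (DM t) != 0 ->
    forall x, sbox 0 rad x -> Tb s N x rad A (wt t) (fun phi => Pi x v.1 phi * f x v.2).
  have [v|v A A' AA h cv x x0|A A0 hA] := @cst_sum R _ (enum_fset (msupp (DM t))) Q.
  + have [cv|cv] := boolP (mcoeff v (DM t) != 0); last by exists 0; rewrite // /Q (negPf cv).
    have [F1 A2 tv] := DM_supp Ft cv; have B1 := F0B F1.
    have [A A0 hA] := gd_bd gdB rad B1; have [D D0 hD] := f_bound rad A2.
    exists (A * `|rad| `^ (wt v.1 - wt t) * D); first by rewrite !mulr_ge0 ?powR_ge0.
    move=> _ x x0 dl b phi d0 dr L; have b0 := loc_ge0 d0 L.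
    rewrite normrM; apply: (@le_trans _ _ (A * b * dl `^ wt v.1 * D)).
      by apply: ler_pM => //; [exact: hA|exact: hD].
    have -> : A * b * dl `^ wt v.1 * D = A * b * D * (dl `^ (wt v.1 - wt t) * dl `^ wt t).
      by rewrite -pwD// subrK; ring.
    have -> : A * `|rad| `^ (wt v.1 - wt t) * D * b * dl `^ wt t =
      A * b * D * (`|rad| `^ (wt v.1 - wt t) * dl `^ wt t) by ring.
    apply: ler_wpM2l; first by rewrite !mulr_ge0.
    apply: ler_wpM2r; first exact: powR_ge0.
    by apply: ge0_ler_powR; rewrite ?nnegrE ?subr_ge0 ?normr_ge0 ?(ltW d0)// (le_trans dr)// ler_norm.
  + exact: Tb_le (h cv x x0).
  exists (\sum_(v <- enum_fset (msupp (DM t))) `|mcoeff v (DM t)| * A).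
    by apply: sumr_ge0 => v _; exact: mulr_ge0.
  move=> x x0 dl b phi d0 dr L; rewrite /Pi_renorm /lextR (le_trans (ler_norm_sum _ _ _))//.
  rewrite !mulr_suml !big_seq; apply: ler_sum => v ve; have cv : mcoeff v (DM t) != 0 by rewrite -mem_msupp.
  by rewrite normrM -!mulrA ler_wpM2l// mulrA; exact: hA.
Qed.

End Renorm.
End RenormalisedModel.

(** * Extension and uniqueness *)

Section OneTree.
Context {R : realType} {d : nat} (s : 'I_d -> nat) (alpha beta r : R).
Hypothesis s_gt0 : forall i, (0 < s i)%N.
Context (K : nat -> 'rV[R]_d -> R) (N : nat).
Local Notation V := 'rV[R]_d.
Local Notation test := (V -> R).
Implicit Types (t u : expr d) (k l q p : mindex d) (x y z : V) (phi psi : test).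
Local Notation wt := (weight s alpha beta).
Local Notation Alg := (Alg s alpha beta).
Local Notation pos_J := (pos_J s alpha beta).
Local Notation Gm := (Gm s alpha beta).
Local Notation Jc := (Jc s alpha beta).
Local Notation H := (Hsp R d).
Local Notation sbox := (@sbox R d s).
Local Notation kk := (kk K).
Local Notation fc := (fc K).
Local Notation Fx := (Fx K).
Local Notation G := (G s alpha beta K).
Local Notation good := (good s alpha beta K N).
Local Notation closed := (closed s alpha beta r).
Local Notation S := (stot s).
Hypothesis sK : forall m, smooth (K m).
Hypothesis supK : forall m, supported_in (sbox 0 (lam m)) (K m).
Hypothesis bK : forall k : mindex d, exists C : R, forall m x,
  `|Dpart k (K m) x| <= C * 2 `^ ((S%:R - beta + (sdeg s k)%:R) * m%:R).
Hypothesis annK : forall m x (q : seq (R * mindex d)),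
  (forall w, w \in q -> (sdeg s w.2)%:R <= r) ->
  integral_rV (fun y => K m (x - y) * \sum_(w <- q) w.1 * monomial w.2 y) = 0.

Section Extend.
Context (B C : set (expr d)).
Hypothesis clB : closed B C.
Hypothesis hII : forall k t, B (II k t) -> C t /\ (sdeg s k)%:R < beta.
Hypothesis niB : forall t, B t -> ~ is_Xpow t -> forall n : nat, wt t <> n%:R.
Context (Bs : set (expr d)) (t : expr d) (Pi : V -> expr d -> test -> R) (bP : expr d -> test -> R).
Hypothesis clS : closed Bs (C `&` Bs).
Hypothesis gdS : good Pi bP Bs.
Hypothesis BsB : Bs `<=` B.
Hypothesis Bt : B t.
Hypothesis nBt : ~ Bs t.
Hypothesis tmin : forall u, B u -> wt u < wt t -> Bs u.
Hypothesis t0 : 0 < wt t.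

Let ft : formal t := cl_formal clB Bt.

(* t is a lightest tree of B on which Pi is not yet defined. *)
Definition ext : set (expr d) := [set u | Bs u \/ u = t].

Let extB : ext `<=` B. Proof. by move=> u [/BsB|->]. Qed.

Lemma lower_Bs g : g m1 = 1 -> lspan [set u | Bs u /\ wt u < wt t] (Gm g t - bas t).
Proof.
move=> g1 u cu; have ut : wt u < wt t := Gm_lower s_gt0 g1 ft cu; split => //.
apply: tmin => //; apply: (Gm_Bs clB (g := g) Bt); move: cu; rewrite mcoeffB mcoeff_bas.
have [tu|_] := eqVneq t u; last by rewrite subr0.
by move: ut; rewrite tu ltxx.
Qed.

Lemma closed_ext : closed ext (C `&` ext).
Proof.
split.
- have [e [ue eB]] := cl_fin clS; exists (t :: e); split.
    by rewrite /= ue andbT; apply/negP => /eB.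
  move=> u; rewrite inE; split=> [/predU1P[->|/eB]|[/eB->|->]]; [by right|by left|by rewrite orbT|by rewrite eqxx].
- by move=> u [].
- by move=> u /extB; exact: cl_formal clB _.
- move=> u [Bu|->].
    apply: lspanS (cl_cop clS Bu) => v [v1 v2]; split; first by left.
    by apply: AlgS v2 => w [[Cw Bw] wu]; split => //; split => //; left.
  move=> v cv; have [v1 v2] := cl_cop clB Bt cv.
  split; last first.
    apply: AlgS v2 => w [Cw wt']; split => //; split => //; left.
    by apply: tmin => //; exact: cl_C clB _ Cw.
  have [->|ne] := eqVneq v (t, m1); first by right.
  left; apply: tmin => //; apply: (cop_lower s_gt0 ft (k := v)).
  by rewrite mcoeffB -[X in tens _ X]bas_one tens_bas mcoeff_bas [_ == v]eq_sym (negPf ne) subr0.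
- by move=> u [Cu _]; exact: cl_ni clB _ Cu.
- by move=> p /extB; exact: cl_pol clB _.
Qed.

(** Adding t creates no convolution condition with t as argument: I_k t is heavier than t, and if it
    were in Bs then [cl_II] would put t in Bs. *)
Lemma ext_noII k : ~ ext (II k t).
Proof.
move=> h; have [Ct kb] := hII (extB h); case: h => [BI|e]; last first.
  by have := congr1 wt e; rewrite wt_II => e'; lra.
have [_ nt] := (formal_II k t).1 (cl_formal clS BI).
apply: nBt; have [|[_ h] _] := @cl_II R d s alpha beta r s_gt0 Bs _ clS k 0 t BI; last exact: h.
by rewrite addr0; apply/pos_JP; split => //; rewrite -addrA addr_gt0// subr_gt0.
Qed.

Section WithT.
Variable T : test -> R.

Definition bPe u : test -> R := if u == t then T else bP u.
(** Only bP t = T is free: the trees of F_x t other than t are lighter, so their contribution is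
    already determined. *)
Definition Pie x u phi : R :=
  if u == t then T phi + lextR (fun v => bP v phi) (Gm (Fx Pi x) t - bas t) else Pi x u phi.

Let neqt u : Bs u -> (u == t) = false.
Proof. by move=> Bu; apply/eqP => e; apply: nBt; rewrite -e. Qed.

Lemma Pie_old x u : Bs u -> Pie x u = Pi x u.
Proof. by move=> Bu; apply/funext => phi; rewrite /Pie neqt. Qed.

Lemma bPe_old u : Bs u -> bPe u = bP u.
Proof. by move=> Bu; rewrite /bPe neqt. Qed.

Lemma bPe_t : bPe t = T. Proof. by rewrite /bPe eqxx. Qed.

Lemma Fx_ext x u : ext u -> Gm (Fx Pie x) u = Gm (Fx Pi x) u.
Proof.
have E (D : set (expr d)) : D `<=` Bs -> forall t', Alg D t' -> Fx Pie x t' = Fx Pi x t'.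
  move=> DB t'; apply: eq_charE => k w /DB Bw _.
  by rewrite /fc Pie_old.
case=> [Bu|->].
  apply: eq_Gm (cl_cop clS Bu) _; apply: E => w [[]//].
apply: eq_Gm (cl_cop clB Bt) _; apply: E => w [Cw wt']; apply: tmin => //; exact: cl_C clB _ Cw.
Qed.

Lemma lextR_bPe x phi : lextR (fun u => bPe u phi) (Gm (Fx Pi x) t) =
  T phi + lextR (fun v => bP v phi) (Gm (Fx Pi x) t - bas t).
Proof.
rewrite -[in LHS](subrK (bas t) (Gm (Fx Pi x) t)) lextRD lextR_bas bPe_t addrC; congr (_ + _).
by apply: eq_lextR => u /(lower_Bs (Fx_one K Pi x))[Bu _]; rewrite bPe_old.
Qed.

Hypothesis Tl : Tlin T.
Hypothesis TX : forall p phi, t = Xpow p -> test_function phi ->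
  T phi = integral_rV (fun y => monomial p y * phi y).
Hypothesis TI : forall k u phi, t = II k u -> Bs u -> test_function phi ->
  series (fun n => integral_rV (fun y => phi y * bP u (kk k n y))) @ \oo --> T phi.
Hypothesis Tbd : forall rad, exists2 A : R, 0 <= A & forall x, sbox 0 rad x ->
  Tb s N x rad A (wt t) (fun phi => T phi + lextR (fun v => bP v phi) (Gm (Fx Pi x) t - bas t)).

Lemma ext_good : good Pie bPe ext.
Proof.
split.
- by move=> u [Bu|->]; [rewrite bPe_old//; exact: (gd_lin gdS)|rewrite bPe_t].
- move=> x u phi eu tp; rewrite Fx_ext//; case: eu => [Bu|->].
    rewrite Pie_old// (gd_rep gdS)//; apply: eq_lextR => v /(Gm_Bs clS Bu) Bv.
    by rewrite bPe_old.
  by rewrite lextR_bPe /Pie eqxx.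
- move=> p phi [Bp|e] tp; first by rewrite bPe_old//; exact: (gd_pol gdS).
  by rewrite e bPe_t; exact: TX.
- move=> k u phi eu eI tp; case: eu => [Bu|e]; last by move: eI; rewrite e => /ext_noII.
  rewrite bPe_old//; case: eI => [BI|e]; first by rewrite bPe_old//; exact: (gd_ser gdS).
  by rewrite e bPe_t; exact: TI.
- move=> u rad [Bu|->].
    have [A A0 hA] := gd_bd gdS rad Bu; exists A => // x x0.
    by rewrite Pie_old//; exact: hA.
  have [A A0 hA] := Tbd rad; exists A => // x x0 dl b phi d0 dr L.
  by rewrite /Pie eqxx; exact: hA.
Qed.

End WithT.

Lemma test_mon_cpt p phi : test_function phi -> cpt (fun y : V => monomial p y * phi y).
Proof.
move=> tp; have [r0 [b [r00 [sp sup _]]]] := test_loc s_gt0 0 tp.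
apply: (@smooth_cpt _ _ _ 0 (fun i => r0 ^+ s i)).
- by apply: smoothM => //; exact: smooth_monomial.
- by move=> i; rewrite exprn_ge0// ltW.
- by move=> y; rewrite mulf_eq0 negb_or => /andP[_ /sup].
Qed.

Lemma extend_Xpow p : t = Xpow p -> exists Pi' bP', good Pi' bP' ext /\ forall x u, Bs u -> Pi' x u = Pi x u.
Proof.
move=> tX; pose T phi : R := integral_rV (fun y : V => monomial p y * phi y).
exists (Pie T), (bPe T); split; last by move=> x u; exact: Pie_old.
have TX q phi : t = Xpow q -> test_function phi -> T phi = integral_rV (fun y => monomial q y * phi y).
  move=> tq _; rewrite /T; congr integral_rV; apply/funext => y; congr (_ * _).
  by rewrite -(charE_Xpow y (fun _ _ => 0) p) -(charE_Xpow y (fun _ _ => 0) q) -tX -tq.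
apply: ext_good => //.
- move=> c phi psi tp tq; rewrite /T -integral_lin; [|exact: test_mon_cpt..].
  by congr integral_rV; apply/funext => y; ring.
- by move=> k u phi e; case: (@II_notXpow _ k u); exists p; rewrite -e.
- move=> rad; exists (2 ^+ d * (mfact p)%:R); first by rewrite mulr_ge0.
  move=> x x0 dl b phi d0 dr L; have tp := loc_test L; rewrite -lextR_bPe tX.
  rewrite (bP_shift s_gt0 (Bs := ext)) ?wt_Xpow//; last 2 first.
  + move=> q [Bq|e]; first by rewrite bPe_old//; exact: (gd_pol gdS).
    by rewrite e bPe_t; exact: TX (esym e) tp.
  + by rewrite -tX; apply: (Gm_Bs closed_ext); right.
  have := moment_bound p d0 L; rewrite (moment_mon s_gt0)// normrM powR_mulrn ?(ltW d0)//.
  have f0 : 0 < (mfact p)%:R :> R by rewrite ltr0n /mfact prodn_gt0// => i; exact: fact_gt0.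
  rewrite ger0_norm ?invr_ge0 ?ler0n// ler_pdivrMl// => h; apply: (le_trans h).
  by rewrite le_eqVlt; apply/orP; left; apply/eqP; ring.
Qed.

(** bP t is forced to be the sum over m of the integrals of phi y * bP u (kk k m y). It converges
    because, at the base point 0, the series for Pi_0 u minus its Taylor part does by [schauder],
    the Taylor part does since only J's of positive weight occur, and the lower trees of F_0 u are
    handled by [gd_ser]. The same Schauder bound at every x gives the order wt t. *)
Lemma extend_II k u : t = II k u -> exists Pi' bP', good Pi' bP' ext /\ forall x v, Bs v -> Pi' x v = Pi x v.
Proof.
move=> tI; have [Cu kb] : C u /\ (sdeg s k)%:R < beta by apply: hII; rewrite -tI.
have [_ nu] : formal u /\ ~ is_Xpow u by apply/(formal_II k); rewrite -tI.
have wE : wt t = wt u + beta - (sdeg s k)%:R by rewrite tI wt_II.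
have Bu : Bs u by apply: tmin; [exact: cl_C clB _ Cu|rewrite wE; lra].
have nXt : ~ is_Xpow t by rewrite tI; exact: II_notXpow.
have n0 := niB Bt nXt; have w0 : 0 < wt t := t0; set w := wt t in wE n0 w0 *.
(* As w is positive and not an integer, the indices with |j| < N0 are those for which J_(k + j) u
   has positive weight. *)
pose N0 := (Num.truncn w).+1.
have N1 : wt u + beta - (sdeg s k)%:R < N0%:R by rewrite -wE; exact: truncnS_gt.
have tw : (Num.truncn w)%:R <= w by rewrite truncn_le ltW.
have N2 : N0%:R - 1 < wt u + beta - (sdeg s k)%:R.
  rewrite -wE /N0 -addn1 natrD addrK lt_neqAle tw andbT.
  by apply/eqP => e1; apply: (n0 (Num.truncn w)).
have pN j : (j \in midx s N0) = pos_J (k + j) u.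
  rewrite mem_midx// /N0 ltnS; apply/idP/pos_JP => [jN|[h _]].
    split=> //; rewrite sdegD natrD opprD addrA -wE subr_gt0 lt_neqAle; apply/andP; split.
      by apply/eqP => e1; apply: (n0 (sdeg s j)).
    by apply: le_trans tw; rewrite ler_nat.
  move: h; rewrite sdegD natrD opprD addrA -wE subr_gt0 => h.
  by rewrite -ltnS -(ltr_nat R); apply: lt_trans h (truncnS_gt _).
have [Cs Cs0 hS] := schauder s_gt0 sK supK bK N kb N1 N2.
pose Dn x phi n := Vk K k n (Pi x u) phi - Pk s K N0 k n x (Pi x u) phi.
have PkL x phi : series (fun n => Pk s K N0 k n x (Pi x u) phi) @ \oo -->
    \sum_(j <- midx s N0) - fc Pi x (k + j) u * moment x j phi.
  apply: series_sum_cvg => j jN; rewrite mulrC.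
  rewrite (_ : (fun n => _) = fun n => moment x j phi * Pi x u (kk (k + j) n x)); last first.
    by apply/funext => n; rewrite mulrC.
  by apply: seriesZ_cvg; apply: (fc_cvg s_gt0 sK supK bK gdS) => //; rewrite -pN.
have DB rad : exists2 A : R, 0 <= A & forall x dl b phi, sbox 0 rad x -> 0 < dl -> dl <= rad ->
    loc s N x dl b phi -> forall m, \sum_(n < m) `|Dn x phi n| <= A * b * dl `^ w.
  have [A A0 hA] := gd_bd gdS (2 * rad + 2) Bu; exists (Cs * A); first exact: mulr_ge0.
  move=> x dl b phi x0 d0 dr L; rewrite wE; have rad0 := lt_le_trans d0 dr.
  have x2 : sbox 0 (2 * rad + 2) x by apply: sbox_mono x0; [exact: ltW|lra].
  exact: hS (Pi_Tlin clS gdS x Bu) (Pi_all_Tb s_gt0 gdS x Bu) A0 (hA x x2) d0 dr L.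
have cvb v : Bs v -> ext (II k v) -> II k v <> t -> forall phi, test_function phi ->
    series (fun n => integral_rV (fun y => phi y * bP v (kk k n y))) @ \oo --> bP (II k v) phi.
  by move=> Bv [BI|//] _ phi tp; exact: (gd_ser gdS).
pose ser phi := series (fun n => integral_rV (fun y => phi y * bP u (kk k n y))).
have cvser phi : test_function phi -> cvgn (ser phi).
  move=> tp; have [r0 [b [r00 L]]] := test_loc s_gt0 N tp.
  have [A A0 hA] := DB r0; have s0 : sbox 0 r0 0 by exact: sbox_refl (ltW r00).
  have [c1 _] := series_bound (u := Dn 0 phi) (hA _ _ _ _ s0 r00 (lexx _) L).
  pose a : H := Gm (Fx Pi 0) u - bas u.
  have fu := cl_formal clS Bu.
  have aP v : mcoeff v a != 0 -> [/\ Bs v, wt v < wt u & mcoeff v (Gm (Fx Pi 0) u) != 0].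
    move=> cv; have vu : wt v < wt u := Gm_lower s_gt0 (Fx_one K Pi 0) fu cv.
    have cG : mcoeff v (Gm (Fx Pi 0) u) != 0.
      move: cv; rewrite mcoeffB mcoeff_bas; have [e|_] := eqVneq u v; last by rewrite subr0.
      by move: vu; rewrite e ltxx.
    by split => //; exact: (Gm_Bs clS Bu cG).
  have c2 : series (fun n => lextR (fun v => integral_rV (fun y => phi y * bP v (kk k n y))) a) @ \oo -->
      lextR (fun v => if `[< is_Xpow v >] then 0 else bP (II k v) phi) a.
    apply: series_lextR => v /aP[Bv vu cG]; case: asboolP => [[p vp]|nv].
      rewrite (_ : series _ = fun=> 0); first exact: cvg_cst.
      apply/funext => n; rewrite /series /= big1// => m _.
      rewrite (_ : (fun y => _) = fun=> 0) ?integral0//; apply/funext => y.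
      by rewrite vp (bP_Xpow_kk sK supK annK clS gdS) ?mulr0// -vp.
    apply: cvb => //; last by rewrite tI => /II_inj[_ e]; move: vu; rewrite e ltxx.
    by apply: (Gm_II_Bs s_gt0 closed_ext _ cG nv); rewrite -tI; right.
  have E : (fun n => integral_rV (fun y => phi y * bP u (kk k n y))) = fun n =>
      (Dn 0 phi n + Pk s K N0 k n 0 (Pi 0 u) phi) -
      lextR (fun v => integral_rV (fun y => phi y * bP v (kk k n y))) a.
    apply/funext => n; rewrite /Dn subrK /Vk.
    rewrite (_ : (fun y => phi y * Pi 0 u (kk k n y)) = fun y => phi y * lextR (fun v => bP v (kk k n y)) (Gm (Fx Pi 0) u)); last first.
      by apply/funext => y; rewrite (gd_rep gdS 0 Bu (test_kk sK supK k n y)).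
    rewrite Vk_lextR; last first.
      by move=> v cv; apply: (bP_cpt s_gt0 sK supK clS gdS) => //; exact: (Gm_Bs clS Bu cv).
    by rewrite /a lextRB lextR_bas opprB addrC subrK.
  rewrite /ser E; apply: (cvgP (limn (series (Dn 0 phi)) + _ - _)).
  apply: seriesB_cvg; last exact: c2.
  rewrite (_ : series _ = fun n => series (Dn 0 phi) n + series (fun n => Pk s K N0 k n 0 (Pi 0 u) phi) n).
    by apply: cvgD; [exact: c1|exact: PkL].
  by apply/funext => n; rewrite /series /= big_split.
pose T phi : R := limn (ser phi).
exists (Pie T), (bPe T); split; last by move=> x v; exact: Pie_old.
have TI k' v phi : t = II k' v -> Bs v -> test_function phi ->
    series (fun n => integral_rV (fun y => phi y * bP v (kk k' n y))) @ \oo --> T phi.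
  by rewrite tI => /II_inj[<- <-] _ tp; exact: cvser.
apply: ext_good => //.
- move=> c phi psi tp tq; have tpq : test_function (fun x => c * phi x + psi x).
    by apply: testD => //; exact: testZ.
  apply: cvg_lim => //; rewrite /ser.
  rewrite (_ : series _ = fun n => c * ser phi n + ser psi n).
    by apply: cvgD; [apply: cvgM; [exact: cvg_cst|exact: cvser]|exact: cvser].
  apply/funext => n; rewrite /ser /series /= mulr_sumr -big_split; apply: eq_bigr => m _ /=.
  rewrite -integral_lin; [|exact: (bP_cpt s_gt0 sK supK clS gdS)..].
  by congr integral_rV; apply/funext => y; ring.
- by move=> p phi e; case: nXt; exists p.
move=> rad; have [A A0 hA] := DB rad; exists A => // x x0 dl b phi d0 dr L; have tp := loc_test L.
have [c1 c2] := series_bound (u := Dn x phi) (hA _ _ _ _ x0 d0 dr L).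
rewrite -/w; apply: le_trans c2; rewrite -lextR_bPe le_eqVlt; apply/orP; left; apply/eqP; congr `|_|.
symmetry; apply: cvg_lim => //.
have h := @good_ser_ext R d s alpha beta r s_gt0 K N sK supK annK Bs _ clS Pi bP gdS ext _ (bPe T) x k u phi
  closed_ext Bu.
have {}h := h ltac:(by rewrite -tI; right) tp.
have h1 p : ext (Xpow p) -> bPe T (Xpow p) phi = integral_rV (fun y => monomial p y * phi y).
  case=> [Bp|e]; first by rewrite bPe_old//; exact: (gd_pol gdS).
  by case: nXt; exists p.
have h2 v : Bs v -> ext (II k v) ->
    series (fun n => integral_rV (fun y => phi y * bP v (kk k n y))) @ \oo --> bPe T (II k v) phi.
  move=> Bv eI; have [e|ne] := eqVneq (II k v) t.
    by rewrite e bPe_t; exact: TI (esym e) Bv tp.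
  by rewrite /bPe (negPf ne); apply: cvb => //; apply/eqP.
have := seriesB_cvg (h h1 h2) (PkL x phi); congr (_ --> _).
rewrite -tI -addrA -opprD -[RHS]subr0; congr (_ - _); apply/eqP; rewrite addr_eq0 -sumrN; apply/eqP.
rewrite (_ : \sum_(j <- midx s N0) _ = \sum_(j <- midx s N0) Jc (fc Pi x) (k + j) u * moment x j phi); last first.
  by rewrite !big_seq; apply: eq_bigr => j jN; rewrite mulNr opprK /Jc -pN jN.
apply: big_supp_eq; rewrite ?midx_uniq// => j jn; rewrite /Jc ifF ?mul0r//.
  apply: contraNF jn => pl; rewrite mem_midx//; apply: leq_ltn_trans (pos_J_nb pl).
  by rewrite sdegD; exact: leq_addl.
by rewrite -pN (negPf jn).
Qed.

(* For a product of positive weight, bP t is the reconstruction of the germ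
   y |-> - bP (F_y t - t), which is coherent with exponent wt t. *)
Lemma extend_other : ~ is_Xpow t -> (forall k u, t <> II k u) ->
  exists Pi' bP', good Pi' bP' ext /\ forall x v, Bs v -> Pi' x v = Pi x v.
Proof.
move=> nX nI; have [e [ue eB]] := cl_fin clS.
pose Z z phi : R := - lextR (fun v => bP v phi) (Gm (Fx Pi z) t - bas t).
have Zl z : Tlin (Z z).
  move=> c phi psi tp tq; rewrite /Z (Tlin_lext (T := bP) _ c tp tq) ?opprD ?mulrN//.
  by move=> v /(lower_Bs (Fx_one K Pi z))[Bv _]; exact: (gd_lin gdS).
(* Coherence of the germ: its increment from y to z is Pi_y applied to the part of Gamma_yz t below
   t, so a term u brings |y - z|^(wt t - wt u) delta^(wt u), of total order wt t. *)
have ZB y z phi : test_function phi -> Z z phi - Z y phi = - lextR (fun v => Pi y v phi) (Gm (G Pi y z) t - bas t).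
  move=> tp; have -> : lextR (fun v => Pi y v phi) (Gm (G Pi y z) t - bas t) =
      lextR (fun v => bP v phi) (lext (Gm (Fx Pi y)) (Gm (G Pi y z) t - bas t)).
    rewrite lextR_lext; apply: eq_lextR => v /(lower_Bs (G_one s alpha beta K Pi y z))[Bv _].
    exact: (gd_rep gdS).
  have -> : lext (Gm (Fx Pi y)) (Gm (G Pi y z) t - bas t) = Gm (Fx Pi z) t - Gm (Fx Pi y) t.
    apply: (etrans (linearB (lext (Gm (Fx Pi y))) _ _)).
    by congr (_ - _); [exact: (@G_spec _ _ s alpha beta s_gt0 K Pi y z t ft)|exact: lext_bas].
  have aux (a1 b1 c1 : R) : c1 - a1 - (c1 - b1) = - (a1 - b1) by ring.
  have ZE w : Z w phi = lextR (fun v => bP v phi) (bas t) - lextR (fun v => bP v phi) (Gm (Fx Pi w) t).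
    by rewrite /Z (lextRB (fun v => bP v phi) (Gm (Fx Pi w) t) (bas t)) opprB.
  rewrite (ZE z) (ZE y) (lextRB (fun v => bP v phi) (Gm (Fx Pi z) t) (Gm (Fx Pi y) t)).
  exact: (aux _ _ _).
have Zb rad : exists2 D : R, 0 <= D & forall y z dl b phi, sbox 0 rad y -> 0 < dl -> dl <= rad ->
    sbox y (4 * dl) z -> loc s N y dl b phi -> `|Z z phi - Z y phi| <= D * b * dl `^ wt t.
  have [rad0|rad0] := lerP rad 0.
    by exists 0 => // y z dl b phi _ d0 dr; have := lt_le_trans d0 (le_trans dr rad0); rewrite ltxx.
  have r5 : 0 <= 5 * rad by rewrite mulr_ge0// ltW.
  have [A A0 hA] := unif_bounds s_gt0 sK supK bK annK clS gdS r5.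
  (* t is not in Bs, where [Gm_bound] lives; but the right components of Delta t only involve
     lighter trees, which are. The radius 5 * rad contains the points within 4 * dl of y. *)
  have [D D0 hD] : Gbound s alpha beta K Pi t (5 * rad).
    apply: (Gm_bound_step s_gt0 sK supK bK annK clS gdS (D := C `&` Bs)) => //.
      move=> v cv; have [_ v2] := cl_cop clB Bt cv; apply: AlgS v2 => w [Cw wt']; split => //.
      by apply: tmin => //; exact: cl_C clB _ Cw.
    by move=> u [_ Bu]; apply: (Gm_bound s_gt0 sK supK bK annK clS gdS).
  pose E u := D * A * (d%:R * 4) `^ (wt t - wt u).
  have E0 u : 0 <= E u by rewrite mulr_ge0 ?mulr_ge0 ?powR_ge0.
  exists (\sum_(u <- e) E u) => [|y z dl b phi y0 d0 dr yz L]; first exact: sumr_ge0.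
  have tp := loc_test L; have b0 := loc_ge0 d0 L.
  have y5 : sbox 0 (5 * rad) y by apply: sbox_mono y0; [exact: ltW|lra].
  have z5 : sbox 0 (5 * rad) z.
    have d4 : 0 <= 4 * dl by rewrite mulr_ge0 // ltW.
    have := sbox_trans s_gt0 (ltW rad0) d4 y0 yz; apply: sbox_mono; lra.
  have [r0|r0] := boolP (0 < snorm s (y - z)); last first.
    by rewrite (snorm_eq0 s_gt0 r0) subrr normr0 mulr_ge0 ?powR_ge0// mulr_ge0// sumr_ge0.
  have rz : snorm s (y - z) <= d%:R * (4 * dl).
    apply: (snorm_box s_gt0) => [|i]; first by rewrite mulr_ge0// ltW.
    by have := yz i; rewrite !mxE distrC.
  rewrite ZB// normrN /lextR; set a := _ - _.
  rewrite (_ : \sum_(u <- _) _ = \sum_(u <- e) mcoeff u a * Pi y u phi); last first.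
    apply: big_supp_eq; rewrite ?msupp_uniq// => u; rewrite ?mem_msupp.
      by rewrite negbK => /eqP->; rewrite mul0r.
    move=> ue'; have [->|cu] := eqVneq (mcoeff u a) 0; first by rewrite mul0r.
    by case/negP: ue'; apply/eB; have [] := lower_Bs (G_one s alpha beta K Pi y z) cu.
  rewrite (le_trans (ler_norm_sum _ _ _))// !mulr_suml; apply: ler_sum => u _; rewrite normrM.
  have [->|cu] := eqVneq (mcoeff u a) 0; first by rewrite normr0 mul0r mulr_ge0 ?powR_ge0// mulr_ge0.
  have [Bu ut] := lower_Bs (G_one s alpha beta K Pi y z) cu.
  have c1 : `|mcoeff u a| <= D * (d%:R * (4 * dl)) `^ (wt t - wt u).
    rewrite /a mcoeffB mcoeff_bas; have [tu|_] := eqVneq t u; first by move: ut; rewrite tu ltxx.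
    rewrite subr0; apply: (le_trans (hD _ _ _ y5 z5 r0)); rewrite ler_wpM2l//.
    by apply: ge0_ler_powR; rewrite ?nnegrE ?subr_ge0 ?(ltW ut) ?snorm_ge0// !mulr_ge0// ltW.
  have c2 := (hA u Bu).1 y y5 dl b phi d0 (le_trans dr _) L.
  have {}c2 := c2 ltac:(lra).
  apply: (le_trans (ler_pM (normr_ge0 _) (normr_ge0 _) c1 c2)).
  rewrite le_eqVlt; apply/orP; left; apply/eqP; rewrite /E mulrA (@powRM _ (d%:R * 4) dl) ?mulr_ge0 ?(ltW d0)//.
  have -> : dl `^ wt t = dl `^ (wt t - wt u) * dl `^ wt u by rewrite -pwD// subrK.
  by ring.
have [T Tl TP] := reconstruction s_gt0 t0 Zl Zb.
exists (Pie T), (bPe T); split; last by move=> x v; exact: Pie_old.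
apply: ext_good => //.
- by move=> p phi e'; case: nX; exists p.
- by move=> k u phi /nI.
- move=> rad; have [A A0 hA] := TP rad; exists A => // x x0 dl b phi d0 dr L.
  by have := hA x dl b phi x0 d0 dr L; rewrite /Z opprK.
Qed.

Lemma extend_one : exists Pi' bP', good Pi' bP' ext /\ forall x v, Bs v -> Pi' x v = Pi x v.
Proof.
have [[p tX]|nX] := pselect (is_Xpow t); first exact: extend_Xpow tX.
have [[k [u tI]]|nI] := pselect (exists k u, t = II k u); first exact: extend_II tI.
by apply: extend_other => // k u e; apply: nI; exists k, u.
Qed.

End Extend.
End OneTree.

Section AllTrees.
Context {R : realType} {d : nat} (s : 'I_d -> nat) (alpha beta r : R).
Hypothesis s_gt0 : forall i, (0 < s i)%N.
Context (K : nat -> 'rV[R]_d -> R) (N : nat).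
Local Notation V := 'rV[R]_d.
Local Notation test := (V -> R).
Implicit Types (t u : expr d) (k l q p : mindex d) (x y z : V) (phi psi : test).
Local Notation wt := (weight s alpha beta).
Local Notation Gm := (Gm s alpha beta).
Local Notation H := (Hsp R d).
Local Notation sbox := (@sbox R d s).
Local Notation fc := (fc K).
Local Notation Fx := (Fx K).
Local Notation G := (G s alpha beta K).
Local Notation good := (good s alpha beta K N).
Local Notation closed := (closed s alpha beta r).
Local Notation S := (stot s).
Hypothesis sK : forall m, smooth (K m).
Hypothesis supK : forall m, supported_in (sbox 0 (lam m)) (K m).
Hypothesis bK : forall k : mindex d, exists C : R, forall m x,
  `|Dpart k (K m) x| <= C * 2 `^ ((S%:R - beta + (sdeg s k)%:R) * m%:R).
Hypothesis annK : forall m x (q : seq (R * mindex d)),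
  (forall w, w \in q -> (sdeg s w.2)%:R <= r) ->
  integral_rV (fun y => K m (x - y) * \sum_(w <- q) w.1 * monomial w.2 y) = 0.

(** Induction on the number of missing trees, adding each time one below which nothing is missing.
    Missing trees have positive weight, as [extend_one] requires. *)
Lemma extend_all (B C Bs : set (expr d)) Pi bP : closed B C ->
  (forall k t, B (II k t) -> C t /\ (sdeg s k)%:R < beta) ->
  (forall t, B t -> ~ is_Xpow t -> forall n : nat, wt t <> n%:R) ->
  closed Bs (C `&` Bs) -> good Pi bP Bs -> Bs `<=` B -> (forall t, B t -> wt t <= 0 -> Bs t) ->
  exists Pi' bP', good Pi' bP' B /\ forall x u, Bs u -> Pi' x u = Pi x u.
Proof.
move=> clB hII niB; have [e [ue eB]] := cl_fin clB.
have [n] := ubnP (count (fun u => ~~ `[< Bs u >]) e).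
elim: n Bs Pi bP => // n IH Bs Pi bP; rewrite ltnS => cn clS gdS BsB low.
have [[t [Bt tmin nBt]]|all] := pselect (exists t, [/\ B t, forall u, B u -> wt u < wt t -> Bs u & ~ Bs t]).
  have t0 : 0 < wt t by rewrite ltNge; apply/negP => /(low t Bt).
  have [Pi1 [bP1 [gd1 e1]]] := extend_one s_gt0 sK supK bK annK clB hII niB clS gdS BsB Bt nBt tmin t0.
  have [|||u Bu u0|Pi' [bP' [gd' e']]] := IH (ext Bs t) Pi1 bP1 _ _ gd1.
  - apply: leq_trans cn; have te : t \in e by apply/eB.
    move: te nBt; clear; elim: e => // u e ihe; rewrite inE => /predU1P[<-|/ihe h] nBt /=.
      rewrite asboolT; last by right.
      rewrite asboolF// add0n add1n ltnS; apply: sub_count => v /asboolPn h.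
      by apply/asboolPn => Bv; apply: h; left.
    have {}h := h nBt; rewrite -addnS leq_add//; have [Bu|nBu] := pselect (Bs u); first by rewrite asboolT //; left.
    by rewrite [in X in (_ <= X)%N]asboolF//; case: (asbool _).
  - exact: (closed_ext s_gt0 clB clS BsB Bt nBt tmin).
  - by move=> u [/BsB|->].
  - by left; exact: low.
  by exists Pi', bP'; split => // x u Bu; rewrite e' ?e1//; left.
(* Without such a tree nothing is missing at all, by induction on the weight. *)
have e' : Bs = B.
  apply/seteqP; split=> // t; apply: (weight_ind (s := s) (alpha := alpha) (beta := beta) (cl_fin clB)) => u Bu IHu.
  by apply: contrapT => nBu; apply: all; exists u.
by rewrite -e'; exists Pi, bP.
Qed.

Lemma lower_span (B C : set (expr d)) g t : closed B C -> B t -> g m1 = 1 ->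
  lspan [set u | B u /\ wt u < wt t] (Gm g t - bas t).
Proof.
move=> clB Bt g1 u cu; have ut : wt u < wt t := Gm_lower s_gt0 g1 (cl_formal clB Bt) cu; split => //.
apply: (Gm_Bs clB (g := g) Bt); move: cu; rewrite mcoeffB mcoeff_bas.
have [tu|_] := eqVneq t u; last by rewrite subr0.
by move: ut; rewrite tu ltxx.
Qed.

Lemma Fx_agree (B C D : set (expr d)) Pi1 Pi2 x t : closed B C ->
  (forall u, C u -> wt u < wt t -> D u) ->
  (forall u phi, D u -> test_function phi -> Pi1 x u phi = Pi2 x u phi) ->
  B t -> Gm (Fx Pi1 x) t = Gm (Fx Pi2 x) t.
Proof.
move=> clB CD e Bt; apply: eq_Gm (cl_cop clB Bt) _ => v; apply: eq_charE => k u [Cu ut] _.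
rewrite /fc; congr (- limn (series _)); apply/funext => n; apply: e; first exact: CD.
exact: (test_kk sK supK).
Qed.

Lemma G_agree (B C : set (expr d)) Pi1 Pi2 x y (a : H) : closed B C ->
  (forall x u phi, B u -> test_function phi -> Pi1 x u phi = Pi2 x u phi) -> lspan B a ->
  lext (Gm (G Pi1 x y)) a = lext (Gm (G Pi2 x y)) a.
Proof.
move=> clB e ha.
have eF z b : lspan B b -> lext (Gm (Fx Pi1 z)) b = lext (Gm (Fx Pi2 z)) b.
  move=> hb; apply: eq_lext => u /hb; apply: (Fx_agree clB (D := B)) => //; last by move=> w phi; exact: e.
  by move=> w /(cl_C clB).
have hG Pi' : lspan B (lext (Gm (G Pi' x y)) a).
  by apply: lspan_lext => u cu; exact: (@Gm_Bs _ _ _ _ _ _ _ _ clB _ u (ha u cu)).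
have fB b : lspan B b -> lspan formal b by apply: lspanS => u; exact: cl_formal clB _.
have L Pi' : lext (Gm (Fx Pi' x)) (lext (Gm (G Pi' x y)) a) = lext (Gm (Fx Pi' y)) a.
  exact: (@G_lext _ _ s alpha beta r s_gt0 K B C clB Pi' x y a ha).
apply/eqP; rewrite -subr_eq0; apply/eqP; apply: (Gm_inj (alpha := alpha) (beta := beta) s_gt0 (Fx_one K Pi1 x)).
  by apply: fB; apply: lspanB; exact: hG.
apply: (etrans (linearB (lext (Gm (Fx Pi1 x))) _ _)); apply/eqP; rewrite subr_eq0; apply/eqP.
apply: (etrans (L Pi1)); symmetry; apply: (etrans (eF x _ (hG Pi2))); apply: (etrans (L Pi2)).
exact: esym (eF y a ha).
Qed.

(** By induction the lower part of F_x t contributes equally to both, so bP1 t - bP2 t = Pi1_x t -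
    Pi2_x t for every x. The left side does not depend on x and the right side has order wt t at x;
    for wt t > 0 it vanishes by [Tb_eq0]. Polynomials and planted trees are determined directly by
    their formulas. *)
Lemma good_unique (B C F0 : set (expr d)) Pi1 bP1 Pi2 bP2 : closed B C ->
  (forall k t, B (II k t) -> C t /\ (sdeg s k)%:R < beta) ->
  (forall t, B t -> wt t <= 0 -> F0 t) ->
  good Pi1 bP1 B -> good Pi2 bP2 B ->
  (forall x t phi, F0 t -> test_function phi -> Pi1 x t phi = Pi2 x t phi) ->
  forall t, B t -> forall x phi, test_function phi -> Pi1 x t phi = Pi2 x t phi.
Proof.
move=> clB hII low gd1 gd2 eF.
pose P t := (forall x phi, test_function phi -> Pi1 x t phi = Pi2 x t phi) /\
  (forall phi, test_function phi -> bP1 t phi = bP2 t phi).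
suff h t : B t -> P t by move=> t /h[].
move: t; apply: (weight_ind (s := s) (alpha := alpha) (beta := beta) (cl_fin clB)) => t Bt IH.
have eG x : Gm (Fx Pi1 x) t = Gm (Fx Pi2 x) t.
  apply: (Fx_agree clB (D := [set u | B u /\ wt u < wt t])) => //.
    by move=> u Cu ut; split => //; exact: cl_C clB _ Cu.
  by move=> u phi [Bu ut]; exact: (IH u Bu ut).1.
have D x phi : test_function phi -> bP1 t phi - bP2 t phi = Pi1 x t phi - Pi2 x t phi.
  move=> tp; rewrite (gd_rep gd1 x Bt tp) (gd_rep gd2 x Bt tp) -eG.
  set a := Gm (Fx Pi1 x) t.
  have e (bP : expr d -> test -> R) : lextR (fun u => bP u phi) a = bP t phi + lextR (fun u => bP u phi) (a - bas t).
    by rewrite -[in LHS](subrK (bas t) a) lextRD lextR_bas addrC.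
  have e2 : lextR (fun u => bP1 u phi) (a - bas t) = lextR (fun u => bP2 u phi) (a - bas t).
    apply: eq_lextR => u /(lower_span clB Bt (Fx_one K Pi1 x))[Bu ut].
    exact: (IH u Bu ut).2.
  by rewrite (e bP1) (e bP2) e2 opprD addrACA subrr addr0.
suff hb phi : test_function phi -> bP1 t phi = bP2 t phi.
  by split => // x phi tp; apply/eqP; rewrite -subr_eq0 -(D x phi tp) (hb phi tp) subrr.
move=> tp; have [F0t|nF0] := pselect (F0 t).
  by apply/eqP; rewrite -subr_eq0 (D 0 phi tp) (eF 0 t phi F0t tp) subrr.
have [[p tX]|nX] := pselect (is_Xpow t).
  by have Bp : B (Xpow p) by [rewrite -tX]; rewrite tX (gd_pol gd1 Bp tp) (gd_pol gd2 Bp tp).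
have [[k [u tI]]|nI] := pselect (exists k u, t = II k u).
  have [Cu kb] : C u /\ (sdeg s k)%:R < beta by apply: hII; rewrite -tI.
  have Bu := cl_C clB Cu.
  have ut : wt u < wt t by rewrite tI wt_II; lra.
  have BI : B (II k u) by rewrite -tI.
  have h1 := gd_ser gd1 Bu BI tp; have h2 := gd_ser gd2 Bu BI tp.
  rewrite tI -(cvg_lim _ h1)// -(cvg_lim _ h2)//; congr (limn (series _)); apply/funext => n.
  congr integral_rV; apply/funext => y; congr (_ * _); apply: (IH u Bu ut).2.
  exact: (test_kk sK supK).
have t0 : 0 < wt t by rewrite ltNge; apply/negP => /(low t Bt).
have Dl : Tlin (fun phi => bP1 t phi - bP2 t phi).
  move=> c phi1 phi2 t1 t2; rewrite (gd_lin gd1 Bt c t1 t2) (gd_lin gd2 Bt c t1 t2).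
  by move: (bP1 t phi1) (bP1 t phi2) (bP2 t phi1) (bP2 t phi2) => a1 a2 a3 a4; ring.
have [r0 [b [r00 L]]] := test_loc s_gt0 N tp.
apply/eqP; rewrite -subr_eq0; apply/eqP.
apply: (Tb_eq0 s_gt0 Dl t0 _ r00 L) => rad.
have [A1 A10 h1] := gd_bd gd1 rad Bt; have [A2 A20 h2] := gd_bd gd2 rad Bt.
exists (A1 + A2); first exact: addr_ge0.
move=> y dl b' psi y0 d0 dr L'; rewrite (D y psi (loc_test L')).
rewrite (le_trans (ler_normB _ _))// mulrDl mulrDl lerD//; [exact: h1|exact: h2].
Qed.

End AllTrees.

(** * Local finiteness *)

Section Finiteness.
Context {R : realType} {d : nat} (s : 'I_d -> nat) (alpha beta : R).
Local Notation jet := (1 + (d + 1))%N.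
Context (F : 'rV[R]_jet -> R).
Hypothesis s_gt0 : forall i, (0 < s i)%N.
Hypothesis beta0 : 0 < beta.
Hypothesis alpha0 : alpha < 0.
Hypothesis sF : smooth F.
Hypothesis affF : affine_in_xi F.
Hypothesis subF : locally_subcritical s alpha beta F.
Implicit Types (q : mindex jet) (t u x : expr d) (k l : mindex d) (o : option 'I_d).
Local Notation wt := (weight s alpha beta).
Local Notation Delta := (coproduct s alpha beta).
Local Notation Alg := (Alg s alpha beta).
Local Notation fct := (option 'I_d * expr d)%type.
Implicit Types (L : seq fct).
Local Notation ko := (@ko d).
Local Notation pl := (pl F).

Definition products (Y : seq (expr d)) n : seq (expr d) :=
  iter n (fun Z => Z ++ [seq emul y z | y <- Y, z <- Z]) [:: m1].

Lemma mem_products Y n (l : seq (expr d)) : (size l <= n)%N -> {subset l <= Y} ->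
  \big[emul/m1]_(y <- l) y \in products Y n.
Proof.
elim: n l => [|n ih] [|y l] //= sl lY; rewrite ?big_nil ?inE// mem_cat.
  by rewrite -(big_nil m1 emul predT id) ih.
by rewrite big_cons allpairs_f ?orbT// ?lY ?mem_head// ih// => z zl; rewrite lY// inE zl orbT.
Qed.

(* Only finitely many factors other than powers of X fit below a given weight,
   since those of nonpositive homogeneity are in bounded number. *)
Lemma tree_shape (e : seq (expr d)) (rho : R) : exists n, forall m q L, M_F F q -> counts q L ->
  (forall y, y \in L -> pl (ko y.1) m y.2) ->
  (forall y u, y \in L -> y.2 = II (ko y.1) u -> u \in e) -> wt (tree q L) <= rho ->
  tree q L \in [seq emul x y | x <- [seq Xpow k | k <- midx s n],
    y <- products (Xi :: [seq II (ko o) u | o <- enum {: option 'I_d}, u <- e]) n].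
Proof.
have [kap kap0 [Dm gap]] := subcritical_gap sF affF subF.
have [rh rh0 hrh] := @nondummy_gap R d s alpha beta.
(* All [hm o] are nonpositive, so adding C lifts each of them to at least rh. At most Dm factors
   need this, and every planted factor then counts for at least rh in the weight. *)
pose C := rh - \sum_o hm s alpha beta o.
have hC o : rh - C <= hm s alpha beta o.
  rewrite /C opprB addrCA subrr addr0 (bigD1 o)//= gerDl; apply: sumr_le0 => i _; exact: hm_le0.
have C0 : 0 <= C.
  rewrite subr_ge0; apply: (@le_trans _ _ 0); last exact: ltW.
  apply: sumr_le0 => i _; exact: hm_le0.
pose B := rho - alpha + C * Dm%:R.
(* The first bound is for the power of X, the second for the number of factors, with room for one
   factor Xi beside the planted trees. *)
exists (maxn (Num.truncn B).+1 (Num.truncn (B / rh)).+2) => m q L Mq cL hL he hw.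
have [q1 cD _] := gap q L Mq cL.
set Y := [seq II (ko o) u | o <- _, u <- e].
have [k [l [lY el hk]]] : exists k (l : seq (expr d)), [/\ {subset l <= Y}, eprod L = emul (Xpow k) (\big[emul/m1]_(y <- l) y) &
    (sdeg s k)%:R + rh * (size l)%:R <= \sum_(y <- L) wt y.2 + C * (count (fun y : fct => dummy s alpha beta y.1) L)%:R].
  elim: L hL he {cL hw cD} => [|y L ih] hL he.
    exists 0, [::]; rewrite /eprod !big_nil Xpow0 emul1 sdeg0 /= !mulr0 !addr0; split=> //.
  have [k [l [lY el hk]]] := ih (fun z zL => hL z ltac:(by rewrite inE zL orbT))
    (fun z u zL => he z u ltac:(by rewrite inE zL orbT)).
  rewrite /eprod !big_cons -/(eprod L) el /=.
  have [[k' yk]|[u [Wu nu] yu]] := pl_inv (hL y (mem_head _ _)).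
    exists (k' + k), l; split => //; first by rewrite yk XpowD emulA.
    rewrite yk wt_Xpow sdegD !natrD mulrDr -!addrA lerD2l (le_trans hk)// lerD2l lerDr.
    by rewrite mulr_ge0.
  exists k, (y.2 :: l); split.
  - move=> z; rewrite inE => /predU1P[->|/lY//]; rewrite yu.
    by apply: allpairs_f; [rewrite mem_enum|apply: he yu; exact: mem_head].
  - by rewrite big_cons emulA [emul y.2 _]emulC emulA.
  have hy : rh <= wt y.2 + C * (dummy s alpha beta y.1)%:R.
    have [dy|nd] := boolP (dummy _ _ _ _).
      by rewrite mulr1 -lerBlDr (le_trans (hC y.1))// (pl_weight alpha0 sF affF subF (hL _ (mem_head _ _))).
    rewrite mulr0 addr0 yu wt_II (le_trans (hrh _ nd))// lerD2r lerD2r.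
    by rewrite (W_weight alpha0 sF affF subF Wu).
  by rewrite /= -natr1 natrD; move: hk hy; lra.
have hB : (sdeg s k)%:R + rh * (size l)%:R <= B.
  apply: (le_trans hk); rewrite /B; apply: lerD; last by rewrite ler_wpM2l// ler_nat.
  rewrite lerBrDr addrC; apply: le_trans hw; rewrite wt_tree lerD2r.
  by case: (q _) q1 => [|[|//]] _; rewrite ?mulr0n ?mulr1n// ltW.
have lt_trunc (x : R) (n : nat) : n%:R <= x -> (n < (Num.truncn x).+1)%N.
  by move=> h; rewrite -(ltr_nat R); exact: le_lt_trans h (truncnS_gt _).
have kB : (sdeg s k < (Num.truncn B).+1)%N.
  by apply: lt_trunc; apply: le_trans hB; rewrite lerDl mulr_ge0// ltW.
have lB : (size l < (Num.truncn (B / rh)).+1)%N.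
  by apply: lt_trunc; rewrite ler_pdivlMr// mulrC (le_trans _ hB)// lerDr.
have -> : tree q L = emul (Xpow k) (\big[emul/m1]_(y <- nseq (q (var_xi (d := d))) Xi ++ l) y).
  by rewrite /tree el iter_emul big_cat /= big_nseq Monoid.mulmCA.
apply: allpairs_f; first by apply: map_f; rewrite mem_midx//; apply: leq_trans kB _; exact: leq_maxl.
apply: mem_products.
  by rewrite size_cat size_nseq leq_max; apply/orP; right; move: (leq_add q1 lB); rewrite addnS => /ltnW.
by move=> y; rewrite mem_cat inE => /orP[/nseqP[-> _]|/lY ->]; rewrite ?eqxx ?orbT.
Qed.

(** By [tree_gain] the trees planted inside one of weight at most rho weigh at most rho - kap, and
    no tree weighs less than alpha; so the induction is on the number of steps kap between alpha and
    rho. *)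
Lemma W_finite (rho : R) : exists e : seq (expr d), forall n t, W_ F n t -> wt t <= rho -> t \in e.
Proof.
have [kap kap0 gain] := tree_gain alpha0 sF affF subF.
have [N hN] : exists N : nat, rho < alpha + N%:R * kap.
  exists (Num.truncn ((rho - alpha) / kap)).+1; rewrite -ltrBlDl -ltr_pdivrMr//; exact: truncnS_gt.
elim: N rho hN => [|N ih] rho hN.
  exists [::] => n t Wt h; have := W_weight alpha0 sF affF subF Wt; move: hN; rewrite mul0r; lra.
have [e he] := ih (rho - kap) ltac:(move: hN; rewrite -natr1 mulrDl; lra).
have [n hn] := tree_shape e rho.
eexists=> m t /W_inv[m' [q [L [mm' Mq cL hL ->]]]] hw; apply: (hn _ _ _ Mq cL hL _ hw) => y u yL yu.
have [|[w [Ww _] yw]] := pl_inv (hL y yL); first by rewrite yu => /II_notXpow.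
have uw : u = w by move: yw; rewrite yu => /II_inj[].
apply: (he m') => //; first by rewrite uw.
have := gain _ _ _ Mq cL hL y u yL yu; move: hw; lra.
Qed.

(** * The trees of the regularity structure *)

Definition Wall : set (expr d) := [set t | exists n, W_ F n t].

Lemma F_FP t : F_F F t <-> [\/ Wall t, is_Xpow t | exists2 u, Wall u /\ ~ is_Xpow u & t = II 0 u].
Proof.
split=> [[n _ [Wt|]]|]; first by constructor 1; exists n.
  case: n => // n [xt|[u [Wu nu] <-]]; first by constructor 2.
  by constructor 3; exists u => //; split => //; exists n.+1.
case=> [[n Wt]|xt|[u [[n Wu] nu] ->]]; first by exists n => //; left.
- by exists 1%N => //; right; left.
- by exists n => //; right; case: n Wu => // n Wu; right; exists u.
Qed.

Lemma F_F_W t : Wall t -> F_F F t. Proof. by move=> h; apply/F_FP; constructor 1. Qed.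

Lemma F_F_II0 u : Wall u -> ~ is_Xpow u -> F_F F (II 0 u).
Proof. by move=> h n; apply/F_FP; constructor 3; exists u. Qed.

Lemma F_F_formal t : F_F F t -> formal t.
Proof.
case/F_FP=> [[n]|[k ->]|[u [[n Wu] nu] ->]]; first exact: W_formal.
- exact: formal_Xpow.
- by apply: formal_I => //; exact: W_formal Wu.
Qed.

Lemma F_F_inn t u : F_F F t -> inn u t -> Wall u /\ wt u < wt t.
Proof.
case/F_FP=> [[n Wt] /(inn_W alpha0 sF affF subF Wt)//|xt /(inn_Xpow xt)//|[w [[n Ww] nw] ->]].
rewrite inn_II wt_II sdeg0 subr0 => -[->|iu]; first by split; [exists n|rewrite ltrDl].
have [h1 h2] := inn_W alpha0 sF affF subF Ww iu.
by split => //; rewrite (lt_trans h2)// ltrDl.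
Qed.

Lemma F_F_II k u : F_F F (II k u) -> Wall u /\ (sdeg s k)%:R < beta.
Proof.
case/F_FP=> [[n Wt]|/II_notXpow//|[w [Ww nw] /II_inj[-> ->]]]; last by rewrite sdeg0.
by apply: (fac_W alpha0 sF affF subF Wt); apply/fac_II.
Qed.

Lemma F_F_cop t : F_F F t -> lspan [set p | F_F F p.1] (Delta t : Hsp2 R d).
Proof.
case/F_FP=> [[n Wt]|[k ->]|[u [[n Wu] nu] ->]].
- by apply: lspanS (@W_cop _ _ s alpha beta F s_gt0 n t Wt) => p Wp; apply: F_F_W; exists n.
- by apply: lspanS (@cop_Xpow_left R d s alpha beta s_gt0 k) => p xp; apply/F_FP; constructor 2.
- apply: lspanS (@cop_II_left R d s alpha beta s_gt0 (W_ F n) 0 u (@W_cop _ _ s alpha beta F s_gt0 n u Wu)) => p [xp|[w [Ww nw] e]].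
    by apply/F_FP; constructor 2.
  by rewrite /= e; apply: F_F_II0 => //; exists n.
Qed.

Lemma F_F_finite (rho : R) : exists e : seq (expr d), forall t, F_F F t -> wt t <= rho -> t \in e.
Proof.
have [e he] := W_finite rho; have [n hn] : exists n : nat, rho < n%:R.
  by exists (Num.truncn rho).+1; exact: truncnS_gt.
exists (e ++ [seq Xpow k | k <- midx s n] ++ [seq II 0 u | u <- e]) => t.
rewrite !mem_cat; case/F_FP=> [[m Wt] /(he _ _ Wt)->//|[k ->]|[u [[m Wu] nu] ->]].
  by rewrite wt_Xpow => h; rewrite map_f ?orbT// mem_midx// -(ltr_nat R) (le_lt_trans h).
rewrite wt_II sdeg0 subr0 => h; rewrite map_f ?orbT//.
by apply: (he _ _ Wu); apply: le_trans h; rewrite lerDl ltW.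
Qed.

Hypothesis niF : no_integer_weight s alpha beta F.
Variable r : R.
Local Notation B := (F_F_upto s alpha beta F r).

(* The right components of Delta t only involve trees occurring inside t. *)
Lemma closed_trees (Bs C D : set (expr d)) : Bs `<=` B -> C `<=` Bs -> C `<=` Wall ->
  (forall t, Bs t -> lspan (Bs `*` Alg D) (Delta t : Hsp2 R d)) -> D `&` Wall `<=` C -> closed s alpha beta r Bs C.
Proof.
move=> BB CB CW hD DC; split => //.
- have [e he] := F_F_finite r; exists (undup [seq t <- e | `[< Bs t >]]); split; first exact: undup_uniq.
  move=> t; rewrite mem_undup mem_filter; split=> [/andP[/asboolP//]|Bt].
  by have [Ft wr] := BB t Bt; rewrite he// andbT; apply/asboolP.
- by move=> t /BB[Ft _]; exact: F_F_formal.
- move=> t Bt p cp; have [Ft _] := BB t Bt.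
  have [B1 A1] := hD t Bt p cp; have [_ A2] := cop_right s_gt0 (F_F_formal Ft) cp.
  split => //; apply: (AlgS _ (AlgI A1 A2)) => u [Du iu].
  by have [Wu wu] := F_F_inn Ft iu; split => //; exact: DC.
- move=> t /CW[n Wt] p cp; have Wp := @W_cop _ _ s alpha beta F s_gt0 n t Wt p cp.
  have [xp|np] := pselect (is_Xpow p.1); [by left|right] => m.
  have := niF (F_F_II0 (ex_intro _ n Wp) np) (@II_notXpow _ _ _) (n := m).
  by rewrite wt_II sdeg0 subr0.
- by move=> p /BB[_]; rewrite wt_Xpow.
Qed.

(** Right components have nonnegative weight, so the left ones stay below r. *)
Lemma closed_upto : closed s alpha beta r B (B `&` Wall).
Proof.
apply: (closed_trees (D := B)) => [t|t []|t []|t [Ft tr] p cp|t] //.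
have := F_F_cop Ft cp; have := cop_weight s_gt0 cp; have [_ A2] := cop_right s_gt0 (F_F_formal Ft) cp.
move=> wp Fp; have AB : Alg B p.2.
  apply: (AlgS _ A2) => u iu; have [Wu wu] := F_F_inn Ft iu.
  by split; [exact: F_F_W|rewrite (le_trans (ltW wu))].
split => //; split => //; apply: le_trans tr; rewrite -wp lerDl.
by move: p.2 AB; apply: alg_ind => [|i|t1 t2 _ _ h1 h2|k u _ /pos_JP[/ltW h _]];
  rewrite ?wt_one ?wt_X ?wt_emul ?wt_II// addr_ge0.
Qed.

Section Sets.
Variables (Fstar F0 : set (expr d)).
Hypothesis rs : renorm_sets s alpha beta (F_F F) Fstar F0.
Hypothesis F0r : forall t, F0 t -> wt t <= r.

Lemma F0_upto : F0 `<=` B.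
Proof. by move=> t F0t; split; [case: rs => _ h _ _; exact: h|exact: F0r]. Qed.

Lemma closed_F0 : closed s alpha beta r F0 (Fstar `&` Wall).
Proof.
have [h1 h2 _ h4] := rs; apply: (closed_trees (D := Fstar)) => //; first exact: F0_upto.
by move=> t [/h1].
Qed.

(** F0 again, but with the second set cut out of that of the full structure: the form in which
    [extend_all] starts from F0. *)
Lemma closed_F0_upto : closed s alpha beta r F0 ((B `&` Wall) `&` F0).
Proof.
have [h1 h2 _ h4] := rs; apply: (closed_trees (D := Fstar)) => //; first exact: F0_upto.
- by move=> t [[]].
- by move=> t [/h1 F0t Wt]; split => //; split => //; exact: F0_upto.
Qed.
End Sets.
End Finiteness.

Theorem theorem8p44 (R : realType) (d : nat) (s : 'I_d -> nat)
    (alpha beta r : R) (F : 'rV[R]_(1 + (d + 1)) -> R)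
    (K : nat -> 'rV[R]_d -> R)
    (Fstar F0 : set (expr d))
    (M : expr d -> Hsp R d) (DM : expr d -> Hsp2 R d) (hM : expr d -> Hsp R d)
    (Pi : 'rV[R]_d -> expr d -> ('rV[R]_d -> R) -> R)
    (Gam : 'rV[R]_d -> 'rV[R]_d -> Hsp R d -> Hsp R d)
    (f : 'rV[R]_d -> expr d -> R) :
  is_scaling s -> 0 < beta -> alpha < 0 ->
  smooth F -> affine_in_xi F -> locally_subcritical s alpha beta F ->
  no_integer_weight s alpha beta F ->
  0 < r -> kernel_decomposition s beta r K ->
  renorm_sets s alpha beta (F_F F) Fstar F0 ->
  (forall t, F0 t -> weight s alpha beta t <= r) ->
  renorm_group s alpha beta Fstar F0 M ->
  is_DeltaM s alpha beta Fstar F0 M DM hM ->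
  admissible_with s alpha beta (F_F F) (F_F_upto s alpha beta F r)
    (F_F_plus s alpha beta F) K Pi Gam f ->
  let PiM := Pi_renorm DM Pi f in
  let fM := f_renorm hM f in
  let GamM := Gamma_from s alpha beta F0 fM in
  admissible s alpha beta (F_F F) F0 (Alg s alpha beta Fstar) K PiM GamM /\
  exists Pi' Gam',
    [/\ admissible s alpha beta (F_F F) (F_F_upto s alpha beta F r)
          (F_F_plus s alpha beta F) K Pi' Gam',
        model_agree F0 Pi' PiM Gam' GamM
      & forall Pi'' Gam'',
          admissible s alpha beta (F_F F) (F_F_upto s alpha beta F r)
            (F_F_plus s alpha beta F) K Pi'' Gam'' ->
          model_agree F0 Pi'' PiM Gam'' GamM ->
          model_agree (F_F_upto s alpha beta F r) Pi'' Pi' Gam'' Gam'].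
Proof.
move=> [s_gt0 _] beta0 alpha0 sF affF subF niF r0 [sK supK0 bK annK] rs F0r [MI [DM' [hM' [hDM' [MD' _ MX tri' _]]]]] MD adm.
have supK m : supported_in (@sbox R d s 0 (lam m)) (K m).
  move=> x /supK0 h i; rewrite mxE subr0; exact: (@snorm_coord _ _ _ s_gt0 _ _ i h).
set B := F_F_upto s alpha beta F r; set W := @Wall R d F.
have clB : closed s alpha beta r B (B `&` W) by exact: closed_upto.
have clF : closed s alpha beta r F0 (Fstar `&` W).
  exact: (closed_F0 s_gt0 beta0 alpha0 sF affF subF niF rs F0r).
have clFB : closed s alpha beta r F0 ((B `&` W) `&` F0).
  exact: (closed_F0_upto s_gt0 beta0 alpha0 sF affF subF niF rs F0r).
have F0B : F0 `<=` B by exact: (F0_upto rs F0r).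
have [starF F0F low0 _] := rs.
have BF : B `<=` F_F F by move=> t [].
have low t : B t -> weight s alpha beta t <= 0 -> F0 t by move=> /BF; exact: low0.
have hII k t : B (II k t) -> (B `&` W) t /\ (sdeg s k)%:R < beta.
  move=> [Ft wr]; have [Wt kb] := F_F_II beta0 alpha0 sF affF subF Ft.
  split=> //; split=> //; split; first exact: F_F_W.
  by apply: le_trans wr; rewrite wt_II -addrA lerDl subr_ge0 ltW.
have niB t : B t -> ~ is_Xpow t -> forall n : nat, weight s alpha beta t <> n%:R.
  by move=> /BF; exact: niF.
have algF : Alg s alpha beta B `<=` F_F_plus s alpha beta F by exact: AlgS.
have algC : Alg s alpha beta (B `&` W) `<=` F_F_plus s alpha beta F by apply: AlgS => t [/BF].
have FplusII k t : F_F_plus s alpha beta F (II k t) -> pos_J s alpha beta k t by move=> /(Alg_II s alpha beta)[].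
have [[_ _ _ _ [N TN _]] [multf _] [fX _] _ _] := adm.
have gd := model_good s_gt0 sK supK annK clB algC TN adm.
have fII x k t : B t -> pos_J s alpha beta k t -> f x (II k t) = fc K Pi x k t.
  move=> Bt pJ; apply: (model_fII adm) => //.
  by apply: algF; apply/Alg_II.
have starW : Fstar `&` W `<=` Fstar by move=> t [].
(* Membership of M in the group provides triangularity for some Delta^M; uniqueness transfers it to
   the given one. *)
have DMtri : upper_triangular s alpha beta Fstar F0 DM.
  by move=> t F0t; rewrite (DM_unique s_gt0 clF starW MD MD')//; exact: tri'.
move=> PiM fM GamM.
have gdM := (PiM_good s_gt0 sK supK bK annK clB clF gd starW starF F0B multf algF fX fII MI MX MD DMtri).
have fMm x : multiplicative_on (Alg s alpha beta Fstar) (fM x).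
  exact: (fM_mult starF F0B multf algF MD).
have fMX x i : fM x (Xvar i) = - x ord0 i.
  exact: (fM_X fX MD).
have fMII x k t : Fstar t -> pos_J s alpha beta k t -> fM x (II k t) = fc K PiM x k t.
  exact: (fM_II s_gt0 sK supK bK annK clB gd starF F0B multf algF fII MD DMtri).
have fMC x k t : (Fstar `&` W) t -> pos_J s alpha beta k t -> fM x (II k t) = fc K PiM x k t.
  by move=> [Ft _]; exact: fMII.
have admM : admissible_with s alpha beta (F_F F) F0 (Alg s alpha beta Fstar) K PiM GamM fM.
  apply: (good_admissible s_gt0 sK supK bK annK clF gdM) => //.
  - exact: AlgS.
  - by move=> x k t _ /Alg_II[Ft pJ]; split; [|exact: fMII].
split; first by exists fM.
have [Pi' [bP' [gd' agr]]] := extend_all s_gt0 sK supK bK annK clB hII niB clFB gdM F0B low.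
(* The characters of the extension are read off Pi' itself through [fc], so the formula for f'_x
   (J_k t) holds by construction. *)
pose f' x := Fx K Pi' x.
have f'II x k t : f' x (II k t) = fc K Pi' x k t by rewrite /f' /Fx charE_II.
pose Gam' := Gamma_from s alpha beta B f'.
have mult' x : multiplicative_on (F_F_plus s alpha beta F) (f' x) by exact: char_mult.
have f'X x i : f' x (Xvar i) = - x ord0 i by rewrite /f' /Fx charE_X mxE.
have adm' : admissible_with s alpha beta (F_F F) B (F_F_plus s alpha beta F) K Pi' Gam' f'.
  apply: (good_admissible s_gt0 sK supK bK annK clB gd') => //.
  by move=> x k t _ /FplusII.
exists Pi', Gam'; split.
- by exists f'.
- split=> [x t phi F0t _|x y a aF0]; first by rewrite agr.
  have aB := lspanS F0B aF0; rewrite /Gam' (Gamma_fromE s_gt0 clB mult' algC f'X (fun x k t _ _ => f'II x k t))//.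
  apply: etrans (esym (Gamma_fromE s_gt0 clF fMm (AlgS starW) fMX fMC x y aF0)).
  by apply: (G_agree s_gt0 sK supK x y clF _ aF0) => z u phi F0u _; rewrite agr.
move=> Pi2 Gam2 [f2 adm2] [agr2 _].
have [[_ _ _ _ [N2 TN2 _]] _ _ _ _] := adm2.
(* The order of the test functions is determined by the trees, so the two models are tested against
   the same class. *)
have N2E : N2 = N by apply/eqP; rewrite eqn_leq (TN.2 _ TN2.1) (TN2.2 _ TN.1).
rewrite N2E in TN2.
have gd2 := model_good s_gt0 sK supK annK clB algC TN2 adm2.
have e : forall t, B t -> forall x phi, test_function phi -> Pi2 x t phi = Pi' x t phi.
  apply: (good_unique s_gt0 sK supK clB hII low gd2 gd') => x t phi F0t tp.
  by rewrite agr// agr2.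
split=> [x t phi Bt|x y a aB]; first exact: e.
apply: (etrans (model_Gam s_gt0 clB algC adm2 x y aB)).
apply: etrans (esym (model_Gam s_gt0 clB algC adm' x y aB)).
apply: (G_agree s_gt0 sK supK x y clB _ aB) => z u phi Bu; exact: e.
Qed.
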